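(* Let $\ell\in2\mathbb{N}_0$, let $k\ge1$ and $0\le h<k$ be integers with $\gcd(h,k)=1$, and let $Z\in\mathbb{C}$ with $\mathrm{Re}(\frac1Z)\ge\frac k2$ and $|Z|\ll\frac1k$. Then \begin{multline*} \left[\frac{\partial^\ell}{\partial z^\ell} \mathcal{U}_1\left(z;\frac hk+\frac{iZ}{k}\right)\right]_{z=0} = \frac{(2\pi i)^\ell i^{\frac32}}{4\sqrt{6}k}\chi(M_{h,k})^{-1}\sum_{\nu=0}^{2k-1} (-1)^\nu e^{\frac{\pi i[-h]_k}{12k}(12\nu(\nu+1)+1)}\sum_{j=0}^{\frac\ell2} \binom{\ell}{2j}\sum_{\substack{a,b,c\ge0\\ a+b+c=j}} k^a\kappa(a,b,c)Z^{\frac12-a-2c}\\ \times \int_{-1}^1 C_{\ell-2j}\left(\frac{1}{2k}\left(\frac{x}{\sqrt{6}}-\nu-\frac12\right)\right) e^{\frac{\pi}{6kZ}(1-x^2)} dx + O\left(\log(k)|Z|^{\frac12-\ell}\right). \end{multline*}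
   Context: For $\tau=\tau_1+i\tau_2\in\mathbb{H}$, $z=z_1+iz_2$, $q=e^{2\pi i\tau}$, $\zeta=e^{2\pi iz}$, $(a;q)_\infty=\prod_{j\ge0}(1-aq^j)$. Define $\eta(\tau):=q^{\frac1{24}}(q;q)_\infty$, $\mathcal{C}^*(z;\tau):=q^{-\frac1{24}}\frac{(q;q)_\infty}{(\zeta q;q)_\infty(\zeta^{-1}q;q)_\infty}$, $\vartheta(z;\tau):=i\sum_{m\in\mathbb{Z}+\frac12}(-1)^{m-\frac12}q^{\frac{m^2}2}\zeta^m$, $\psi(z;\tau):=i\sum_{m\in\mathbb{Z}+\frac12}\mathrm{sgn}(m+\frac{z_2}{\tau_2})(-1)^{m-\frac12}q^{\frac{m^2}2}\zeta^m$, and $\mathcal{U}_1(z;\tau):=-\frac{i\mathcal{C}^*(z;\tau)}{2\eta(\tau)}(\vartheta(2z;\tau)+\psi(2z;\tau))$. $C_j(w):=\left(\frac{1}{2\pi i}\frac{\partial}{\partial w}\right)^j\cot(\pi w)$; $\kappa(a,b,c):=\frac{(2(a+b+c))!(-1)^{a+c}B_{2c}(\frac12)}{a!(2b+1)!(2c)!\pi^a4^{a+b}}$ with $B_\nu$ Bernoulli polynomials. $\chi$ is the eta multiplier: $\chi\begin{pmatrix}a&b\\c&d\end{pmatrix}:=\left(\frac{d}{|c|}\right)e^{\frac{\pi i}{12}((a+d)c-bd(c^2-1)-3c)}$ for $c$ odd, $\left(\frac cd\right)e^{\frac{\pi i}{12}(ac(1-d^2)+d(b-c+3)-3)}$ for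 $c$ even. $[-h]_k\in\{0,\dots,k-1\}$ satisfies $-h[-h]_k\equiv1\pmod k$; $M_{h,k}:=\begin{pmatrix}[-h]_k&-\frac{h[-h]_k+1}{k}\\ k&-h\end{pmatrix}$. Principal branches are used; the implied constants are uniform in $h,k,Z$ (depending on $\ell$ and the implied constant in $|Z|\ll\frac1k$).
   Formalization: For k=1 the factor log(k) in the error term, which would vanish and make the claim a false exact equality (e.g. ℓ=0, h=0, 1/Z=1.05), is replaced by the constant 1; for k≥2 the error term is as stated. *)

(* Defs.v *)
From HB Require Import structures.
From mathcomp Require Import all_boot all_order all_algebra.
From mathcomp Require Import complex.
From mathcomp Require Import all_classical all_reals all_analysis.

Set Implicit Arguments.
Unset Strict Implicit.
Unset Printing Implicit Defensive.

Import Order.TTheory GRing.Theory Num.Theory.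
Import numFieldNormedType.Exports.

Local Open Scope classical_set_scope.
Local Open Scope ring_scope.
Local Open Scope complex_scope.

Section ComplexFunctions.
Variable R : realType.
Local Notation C := R[i].
Implicit Types (z w s tau : C).

Definition iC : C := 0 +i* 1.

Definition ipi : C := iC * (pi : R)%:C.

Definition cabs z : R := complex.Re `|z|.

Definition cexp z : C :=
  (expR (complex.Re z))%:C * (cos (complex.Im z) +i* sin (complex.Im z)).

Definition ccos z : C := (cexp (iC * z) + cexp (- (iC * z))) / 2%:R.
Definition csin z : C := (cexp (iC * z) - cexp (- (iC * z))) / (2%:R * iC).
Definition ccot z : C := ccos z / csin z.

(* The principal argument, with values in ]-pi, pi] for z != 0. *)
Definition carg z : R :=
  let t := acos (complex.Re z / cabs z) in
  if complex.Im z < 0 then - t else t.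

Definition clog z : C := ln (cabs z) +i* carg z.

(* Principal branch of z ^ s, for z != 0. *)
Definition cpow z s : C := cexp (s * clog z).

(* With q = e2pi tau and zeta = e2pi z, the (fractional) powers q ^ r and
   zeta ^ m always mean e2pi (r * tau) and e2pi (m * z). *)
Definition e2pi w : C := cexp (2%:R * ipi * w).

(* The topology of the complex plane is found through the alias R[i]^o. *)
Definition qpoch (a q : C) : C :=
  lim ((fun n : nat => \prod_(j < n) (1 - a * q ^+ j) : C^o) @ \oo).

(* Sum over all the integers; it is only used for absolutely convergent
   families, for which the order of summation is irrelevant. *)
Definition sumZ (f : int -> C) : C :=
  lim ((fun N : nat =>
    \sum_(n < N) (f n%:Z + f (- n.+1%:Z)) : C^o) @ \oo).

Definition eta tau : C := e2pi (tau / 24%:R) * qpoch (e2pi tau) (e2pi tau).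

Definition Cstar z tau : C :=
  let q := e2pi tau in let zeta := e2pi z in
  e2pi (- (tau / 24%:R)) *
  (qpoch q q / (qpoch (zeta * q) q * qpoch (zeta^-1 * q) q)).

(* The sums over m in Z + 1/2 are indexed by n = m - 1/2. *)
Definition halfint (n : int) : R := n%:~R + 2%:R^-1.

Definition vartheta z tau : C :=
  iC * sumZ (fun n => let m := halfint n in
    (-1) ^ n * e2pi ((m ^+ 2 / 2%:R)%:C * tau) * e2pi (m%:C * z)).

Definition psi z tau : C :=
  iC * sumZ (fun n => let m := halfint n in
    (Num.sg (m + complex.Im z / complex.Im tau))%:C *
    (-1) ^ n * e2pi ((m ^+ 2 / 2%:R)%:C * tau) * e2pi (m%:C * z)).

Definition U1 z tau : C :=
  - (iC * Cstar z tau / (2%:R * eta tau)) *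
    (vartheta (2%:R * z) tau + psi (2%:R * z) tau).

Definition cderiv (n : nat) (f : C -> C) z : C :=
  ((f : C -> C^o)^`(n))%classic z.

Definition Ccot (j : nat) : C -> C :=
  iter j (fun (f : C -> C) w => (2%:R * ipi)^-1 * cderiv 1 f w)
       (fun w => ccot ((pi : R)%:C * w)).

Definition cint (a b : R) (f : R -> C) : C :=
  (\int[lebesgue_measure]_(x in `[a, b]) complex.Re (f x))%R +i*
  (\int[lebesgue_measure]_(x in `[a, b]) complex.Im (f x))%R.

(* Bernoulli polynomials. The recursion is the comparison of the coefficients
   of t ^ n.+1 in (exp t - 1) * (\sum_n B_n(x) t ^ n / n!) = t * exp (x t). *)
Fixpoint bernoulli_seq (n : nat) : seq {poly R} :=
  if n is m.+1 then
    let s := bernoulli_seq m in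
    rcons s ('X^m - (m.+1)%:R^-1 *: \sum_(i < m) 'C(m.+1, i)%:R *: s`_i)
  else [::].

Definition bernoulli_poly (n : nat) : {poly R} := (bernoulli_seq n.+1)`_n.

Lemma size_bernoulli_seq n : size (bernoulli_seq n) = n.
Proof. by elim: n => //= n IHn; rewrite size_rcons IHn. Qed.

Lemma nth_bernoulli_seq n i : (i < n)%N ->
  (bernoulli_seq n)`_i = bernoulli_poly i.
Proof.
elim: n => // n IHn; rewrite ltnS leq_eqVlt => /predU1P[->//|ltin].
by rewrite /= nth_rcons size_bernoulli_seq ltin IHn.
Qed.

Lemma bernoulli_polyE n :
  \sum_(i < n.+1) 'C(n.+1, i)%:R *: bernoulli_poly i = (n.+1)%:R *: 'X^n.
Proof.
rewrite big_ord_recr /= {2}/bernoulli_poly /= nth_rcons size_bernoulli_seq.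
rewrite ltnn eqxx binSn scalerBr scalerA mulfV ?pnatr_eq0// scale1r.
rewrite addrC -addrA -[RHS]addr0; congr (_ + _); apply/eqP.
rewrite addrC subr_eq0; apply/eqP.
by apply: eq_bigr => i _; rewrite nth_bernoulli_seq.
Qed.

Definition kappa (a b c : nat) : R :=
  ((2 * (a + b + c))`!)%:R * (-1) ^+ (a + c) *
    (bernoulli_poly (2 * c)).[2%:R^-1] /
  ((a`!)%:R * ((2 * b + 1)`!)%:R * ((2 * c)`!)%:R *
    pi ^+ a * 4%:R ^+ (a + b)).

End ComplexFunctions.

Arguments iC {R}.
Arguments ipi {R}.

Definition legendre (a : int) (p : nat) : int :=
  if (p %| a)%Z then 0
  else if [exists x : 'I_p, ((x : nat)%:Z ^+ 2 == a %[mod p])%Z] then 1 else -1.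

(* The symbol (a / n) for odd n: the Jacobi symbol for n > 0, extended to n < 0
   by (a / -1) = -1 if a < 0 and 1 otherwise (Kronecker's convention). *)
Definition jacobi (a n : int) : int :=
  (if (n < 0) && (a < 0) then -1 else 1) *
  \prod_(p <- primes `|n|%N) legendre a p ^+ logn p `|n|%N.

Definition mx2 (a b c d : int) : 'M[int]_2 :=
  \matrix_(i < 2, j < 2)
    if i == 0 then (if j == 0 then a else b) else (if j == 0 then c else d).

Definition chi (R : realType) (M : 'M[int]_2) : R[i] :=
  let a := M 0 0 in let b := M 0 1 in let c := M 1 0 in let d := M 1 1 in
  if odd `|c|%N then
    (jacobi d `|c|)%:~R *
    cexp (ipi / 12%:R *
          ((a + d) * c - b * d * (c ^+ 2 - 1) - 3%:R * c)%:~R)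
  else
    (jacobi c d)%:~R *
    cexp (ipi / 12%:R *
          (a * c * (1 - d ^+ 2) + d * (b - c + 3%:R) - 3%:R)%:~R).

(* [-h]_k *)
Definition neg_inv (h k : nat) : nat :=
  find (fun x : nat => (- h%:Z * x%:Z == 1 %[mod k])%Z) (iota 0 k).

Definition Mhk (h k : nat) : 'M[int]_2 :=
  mx2 (neg_inv h k)%:Z (- ((h * neg_inv h k + 1) %/ k)%N%:Z)
      k%:Z (- h%:Z).

(* log k in an error term: for k = 1, where the logarithm vanishes, it stands
   for the constant 1. *)
Definition errlog (R : realType) (k : nat) : R :=
  if k == 1%N then 1 else ln k%:R.

(* Main.v *)
(* Near z = 0 the product of U1 and of the triple product q-series of theta is
   an explicit partial theta function F. The modular transformation of theta
   (Poisson summation and finite Gauss sums) and that of eta (theta at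
   thirds, then Euclid's algorithm on (h, k) with quadratic reciprocity for the
   multiplier) turn this into an identity for U1 in terms of q' = e(tau'),
   |q'| <= 1/5, and of F. Comparing Taylor coefficients at 0, the inverse of
   sinh produces the Bernoulli numbers in kappa, and the factors depending on
   q' only contribute to the error. The Taylor coefficients of F are series of
   Gaussians twisted by a 2k-periodic character; taking Fourier transforms
   and summing geometric series, they become integrals over the real line of a
   derivative of a Gaussian against a finite sum of cotangents whose poles are
   shifted off the line. The segment |y| <= 1/sqrt 6 gives, after integrations
   by parts, the main term; the tails are O(log k) by a principal value
   estimate near each pole which is uniform in the shift. *)
Require Import Defs.
From HB Require Import structures.
From mathcomp Require Import all_boot all_order all_algebra.
From mathcomp Require Import complex.
From mathcomp Require Import all_classical all_reals all_analysis.
From mathcomp Require Import ring lra zify.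
From mathcomp Require fingroup cyclic finalg finfield pgroup sylow.

Set Implicit Arguments.
Unset Strict Implicit.
Unset Printing Implicit Defensive.

Import Order.TTheory GRing.Theory Num.Theory.
Import numFieldNormedType.Exports.

Local Open Scope classical_set_scope.
Local Open Scope ring_scope.
Local Open Scope complex_scope.

(** The cut at [|y| = 1 / sqrt 6] is forced by eta. With [Y = 1 / (k Z)], dividing by the factor
    [e(tau' / 12)] costs [exp (pi * Re Y / 6)], and the Gaussian [exp (- pi Y y^2)] has decayed by
    exactly this factor at [y^2 = 1 / 6]. A correction in q' gains [exp (- 2 pi * Re Y)], which
    outweighs the cost. Each derivative in z costs a factor of order [1 / |Z|]. The logarithm comes
    from the 2k cotangents: near one pole the others sum to O(k log k). The partial theta function
    has no parity, but after division by z all other factors are even; so even Taylor coefficients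
    are compared among themselves, and the line is reflected only against Gaussian derivatives of
    even order. On the real line the exponential series of the cotangents diverges. A shift [e > 0]
    makes it geometric, and bounds independent of [e] survive the limit [e -> 0]. The constant [c]
    of the finite Fourier transform is never evaluated, since it multiplies the partial theta
    function on both sides. No contour is moved: Gaussian integrals are deformed in a parameter, and
    improper integrals are limits over growing segments. *)

Ltac feed H :=
  match type of H with
  | ?A -> _ => let h := fresh in assert (h : A); [|specialize (H h); clear h]
  end.

Import ComplexField.Normc.

Local Notation Re := complex.Re.
Local Notation Im := complex.Im.

(** * The modulus as a real number, real and imaginary parts *)

Section Cabs.
Variable R : realType.
Local Notation C := R[i].
Implicit Types (z w : C) (x y : R).

Lemma cabsE z : cabs z = normc z.
Proof. by []. Qed.

Lemma cabs_sqrt z : cabs z = Num.sqrt (Re z ^+ 2 + Im z ^+ 2).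
Proof. by rewrite /cabs normc_def. Qed.

Lemma normC_cabs z : `|z| = (cabs z)%:C.
Proof. by []. Qed.

Lemma cabs_ge0 z : 0 <= cabs z.
Proof. by rewrite -ler0c -normC_cabs. Qed.

Lemma cabs0 : cabs (0 : C) = 0.
Proof. by rewrite cabsE normc0. Qed.

Lemma cabs1 : cabs (1 : C) = 1.
Proof. by rewrite cabsE normc1. Qed.

Lemma cabsM z w : cabs (z * w) = cabs z * cabs w.
Proof. exact: normcM. Qed.

Lemma cabsV z : cabs z^-1 = (cabs z)^-1.
Proof. exact: normcV. Qed.

Lemma cabsN z : cabs (- z) = cabs z.
Proof. exact: normcN. Qed.

Lemma cabsD z w : cabs (z + w) <= cabs z + cabs w.
Proof. exact: le_normcD. Qed.

Lemma cabsB z w : cabs (z - w) = cabs (w - z).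
Proof. by rewrite -cabsN opprB. Qed.

Lemma cabsX z n : cabs (z ^+ n) = cabs z ^+ n.
Proof. by elim: n => [|n IH]; rewrite ?expr0 ?cabs1// !exprS cabsM IH. Qed.

Lemma cabs_real x : cabs x%:C = `|x|.
Proof. by rewrite cabs_sqrt /= expr0n addr0 sqrtr_sqr. Qed.

Lemma cabs_nat n : cabs (n%:R : C) = n%:R.
Proof. by rewrite -(rmorph_nat (real_complex R)) cabs_real ger0_norm. Qed.

Lemma cabs_eq0 z : (cabs z == 0) = (z == 0).
Proof.
apply/eqP/eqP => [/eq0_normc //|->]; exact: cabs0.
Qed.

Lemma cabs_gt0 z : (0 < cabs z) = (z != 0).
Proof. by rewrite lt0r cabs_ge0 andbT cabs_eq0. Qed.

Lemma ge_Re_cabs z : `|Re z| <= cabs z.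
Proof. by rewrite -lecR; exact: normc_ge_Re. Qed.

Lemma ge_Im_cabs z : `|Im z| <= cabs z.
Proof.
case: z => a b; rewrite cabs_sqrt /= -sqrtr_sqr ler_wsqrtr//.
by rewrite lerDr sqr_ge0.
Qed.

Lemma cabs_le_ReIm z : cabs z <= `|Re z| + `|Im z|.
Proof.
rewrite {1}[z]complexE (le_trans (cabsD _ _))// cabsM !cabs_real.
by rewrite -[X in cabs X]/(0 +i* 1) cabs_sqrt /= expr0n expr1n add0r sqrtr1 mul1r.
Qed.

Lemma cabs_sum (I : Type) (r : seq I) (P : pred I) (F : I -> C) :
  cabs (\sum_(i <- r | P i) F i) <= \sum_(i <- r | P i) cabs (F i).
Proof.
elim/big_ind2: _ => [|a b c d h1 h2|//]; first by rewrite cabs0.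
by rewrite (le_trans (cabsD _ _))// lerD.
Qed.

Lemma cabs_prod (I : Type) (r : seq I) (P : pred I) (F : I -> C) :
  cabs (\prod_(i <- r | P i) F i) = \prod_(i <- r | P i) cabs (F i).
Proof. by apply: big_morph; [exact: cabsM|exact: cabs1]. Qed.

Lemma ler_cabsB z w : cabs z - cabs w <= cabs (z - w).
Proof. by rewrite lerBlDr -{1}(subrK w z) cabsD. Qed.

Lemma cabs_iC : cabs (iC : C) = 1.
Proof. by rewrite cabs_sqrt /= expr0n expr1n add0r sqrtr1. Qed.

Lemma iC_sqr : (iC : C) * iC = -1.
Proof. by rewrite -expr2 sqr_i. Qed.

Lemma cReM z w : Re (z * w) = Re z * Re w - Im z * Im w.
Proof. by case: z w => a b [c d]. Qed.
Lemma cImM z w : Im (z * w) = Re z * Im w + Im z * Re w.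
Proof. by case: z w => a b [c d]. Qed.
Lemma cReD z w : Re (z + w) = Re z + Re w.
Proof. by case: z w => a b [c d]. Qed.
Lemma cImD z w : Im (z + w) = Im z + Im w.
Proof. by case: z w => a b [c d]. Qed.
Lemma cReN z : Re (- z) = - Re z.
Proof. by case: z. Qed.
Lemma cImN z : Im (- z) = - Im z.
Proof. by case: z. Qed.
Lemma cRe_sum (I : Type) (r : seq I) (P : pred I) (F : I -> C) :
  Re (\sum_(i <- r | P i) F i) = \sum_(i <- r | P i) Re (F i).
Proof. by apply: (big_morph _ cReD). Qed.

Lemma cIm_sum (I : Type) (r : seq I) (P : pred I) (F : I -> C) :
  Im (\sum_(i <- r | P i) F i) = \sum_(i <- r | P i) Im (F i).
Proof. by apply: (big_morph _ cImD). Qed.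

Lemma complexP z w : Re z = Re w -> Im z = Im w -> z = w.
Proof. by case: z w => a b [c d] /= -> ->. Qed.

Lemma natC_neq0 k : (0 < k)%N -> (k%:R : C) != 0.
Proof. by rewrite pnatr_eq0 -lt0n. Qed.

Lemma natR_gt0 k : (0 < k)%N -> (0 : R) < k%:R.
Proof. by rewrite ltr0n. Qed.

Lemma piC_neq0 : ((pi : R)%:C : C) != 0.
Proof. by rewrite -cabs_gt0 cabs_real gtr0_norm ?pi_gt0. Qed.

Lemma Re_gt0_neq0 z : 0 < Re z -> z != 0.
Proof. by move=> rz; apply: contraTneq rz => ->; rewrite ltxx. Qed.

Lemma eq_ler x y : x = y -> x <= y.
Proof. by move=> ->. Qed.

End Cabs.

(** * Complex differentiation in slope form *)

Section Cdiff.
Variable R : realType.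
Local Notation C := R[i].
Implicit Types (f g : C -> C) (z w d : C).

(* Caratheodory's form of the derivative: composition, products and inverses
   become algebra on the continuous slope. *)
Definition ccont f z := forall e : R, 0 < e -> exists2 dl : R, 0 < dl &
  forall w, cabs (w - z) < dl -> cabs (f w - f z) <= e.
Definition cdiff f z d := exists g, [/\ ccont g z, g z = d &
  forall w, f w = f z + (w - z) * g w].

Lemma ccont_cst z d : ccont (fun=> d) z.
Proof. by move=> e e0; exists 1 => // w _; rewrite subrr cabs0 ltW. Qed.

Lemma ccont_id z : ccont id z.
Proof. by move=> e e0; exists e => // w /ltW. Qed.

Lemma ccontD f g z : ccont f z -> ccont g z -> ccont (fun w => f w + g w) z.
Proof.
move=> cf cg e e0; have e2 : 0 < e / 2 by rewrite divr_gt0.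
have [d d0 Hd] := cf _ e2; have [d' d'0 Hd'] := cg _ e2.
exists (Num.min d d') => [|w]; first by rewrite lt_min d0.
rewrite lt_min => /andP[/Hd h1 /Hd' h2].
rewrite opprD addrACA (le_trans (cabsD _ _))//; lra.
Qed.

Lemma ccontM f g z : ccont f z -> ccont g z -> ccont (fun w => f w * g w) z.
Proof.
move=> cf cg e e0.
pose M := cabs (f z) + cabs (g z) + 1.
have fz := cabs_ge0 (f z); have gz := cabs_ge0 (g z).
have M0 : 0 < M by rewrite /M; lra.
have e2 : 0 < Num.min 1 (e / (2 * M)) by rewrite lt_min ltr01 divr_gt0// mulr_gt0.
have [d d0 Hd] := cf _ e2; have [d' d'0 Hd'] := cg _ e2.
exists (Num.min d d') => [|w]; first by rewrite lt_min d0.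
rewrite lt_min => /andP[/Hd + /Hd'].
rewrite !le_min => /andP[_ h1] /andP[h2 h3].
rewrite (_ : _ - _ = (f w - f z) * g w + f z * (g w - g z)); last by ring.
rewrite (le_trans (cabsD _ _))// !cabsM.
have gw : cabs (g w) <= M.
  have := cabsD (g w - g z) (g z); rewrite subrK /M; lra.
have fM : cabs (f z) <= M by rewrite /M; lra.
have E : e = e / (2 * M) * M + M * (e / (2 * M)) by field; rewrite lt0r_neq0.
by rewrite E lerD// ler_pM// cabs_ge0.
Qed.

Lemma ccontN f z : ccont f z -> ccont (fun w => - f w) z.
Proof.
by move=> cf e /cf[d d0 H]; exists d => // w /H; rewrite -opprD cabsN.
Qed.

Lemma ccontV f z : f z != 0 -> ccont f z -> ccont (fun w => (f w)^-1) z.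
Proof.
rewrite -cabs_gt0 => f0 cf e e0.
have e2 : 0 < Num.min (cabs (f z) / 2) (e * (cabs (f z) ^+ 2 / 2)).
  by rewrite lt_min !(divr_gt0, mulr_gt0, exprn_gt0).
have [d d0 Hd] := cf _ e2; exists d => // w /Hd.
rewrite le_min => /andP[h1 h2].
have fw : cabs (f z) / 2 <= cabs (f w).
  have := cabsD (f w - f z) (- f w); rewrite addrAC subrr add0r !cabsN; lra.
have fw0 : 0 < cabs (f w) by lra.
have fwn : f w != 0 by rewrite -cabs_gt0.
have fzn : f z != 0 by rewrite -cabs_gt0.
rewrite (_ : _ - _ = - (f w - f z) * ((f w)^-1 * (f z)^-1)); last by field; rewrite fwn fzn.
rewrite !cabsM cabsN !cabsV mulrA -!mulrA -invfM ler_pdivrMr ?mulr_gt0//.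
rewrite (le_trans h2)// ler_pM2l//; nra.
Qed.

Lemma ccont_comp f g z : ccont f z -> ccont g (f z) -> ccont (fun w => g (f w)) z.
Proof.
move=> cf cg e /cg[d d0 Hd]; have d2 : 0 < d / 2 by rewrite divr_gt0.
have [d' d'0 Hd'] := cf _ d2; exists d' => // w /Hd' h; apply: Hd; lra.
Qed.

Lemma ccontP f z : ccont f z -> {for z, continuous (f : C^o -> C^o)}.
Proof.
move=> h A /nbhs_ballP[e e0 HA]; apply/nbhs_ballP.
move: e0; rewrite /= ltcE /= => /andP[/eqP e1 e0].
have e20 : 0 < Re e / 2 by rewrite divr_gt0.
have [dl dl0 H] := h _ e20.
exists dl%:C; first by rewrite /= ltcR.
move=> w; rewrite /ball /= normC_cabs ltcR cabsB => /H {}H.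
apply: HA; rewrite /ball /= normC_cabs cabsB ltcE /= e1 eqxx /=; lra.
Qed.

Lemma cdiff_ccont f z d : cdiff f z d -> ccont f z.
Proof.
move=> [g [gc _ E]]; rewrite (_ : f = fun w => f z + (w - z) * g w); last exact/funext.
apply: ccontD; first exact: ccont_cst.
apply: ccontM => //; apply: ccontD; [exact: ccont_id|exact: ccont_cst].
Qed.

Lemma cdiff_cst z d : cdiff (fun=> d) z 0.
Proof. by exists (fun=> 0); split=> [| |w]; [exact: ccont_cst| |rewrite mulr0 addr0]. Qed.
Lemma cdiff_id z : cdiff id z 1.
Proof. by exists (fun=> 1); split=> [| |w]; [exact: ccont_cst| |rewrite mulr1 addrC subrK]. Qed.
Lemma cdiffD f g z d e : cdiff f z d -> cdiff g z e -> cdiff (fun w => f w + g w) z (d + e).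
Proof.
move=> [f' [cf <- Ef]] [g' [cg <- Eg]]; exists (fun w => f' w + g' w).
split=> //; first exact: ccontD.
by move=> w; rewrite (Ef w) (Eg w); ring.
Qed.
Lemma cdiffM f g z d e : cdiff f z d -> cdiff g z e ->
  cdiff (fun w => f w * g w) z (d * g z + f z * e).
Proof.
move=> Df [g' [cg <- Eg]]; have cf := cdiff_ccont Df.
case: Df => f' [cf' <- Ef].
exists (fun w => f' w * g z + f w * g' w); split=> //.
  by apply: ccontD; apply: ccontM => //; exact: ccont_cst.
by move=> w; rewrite (Eg w) mulrDr {1}(Ef w); ring.
Qed.
Lemma cdiffZ f z d c : cdiff f z d -> cdiff (fun w => c * f w) z (c * d).
Proof. by move=> h; have := cdiffM (cdiff_cst z c) h; rewrite mul0r add0r. Qed.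
Lemma cdiffN f z d : cdiff f z d -> cdiff (fun w => - f w) z (- d).
Proof.
move=> /(cdiffZ (-1)); rewrite mulN1r; congr cdiff; apply/funext => w.
by rewrite mulN1r.
Qed.
Lemma cdiffB f g z d e : cdiff f z d -> cdiff g z e -> cdiff (fun w => f w - g w) z (d - e).
Proof. by move=> hf /cdiffN hg; exact: cdiffD. Qed.
Lemma cdiff_comp f g z d e : cdiff f z d -> cdiff g (f z) e -> cdiff (fun w => g (f w)) z (e * d).
Proof.
move=> Df [g' [cg <- Eg]]; have cf := cdiff_ccont Df.
case: Df => f' [cf' <- Ef].
exists (fun w => g' (f w) * f' w); split=> //.
  by apply: ccontM => //; exact: (ccont_comp cf cg).
by move=> w; rewrite (Eg (f w)) {1}(Ef w); ring.
Qed.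

(** From right to left the slope is the difference quotient, completed by [d] at [z]. This is the
    entrance for functions known through estimates, such as [cexp], parameter integrals and
    series. *)
Lemma cdiff_epsP f z d : cdiff f z d <-> forall e : R, 0 < e -> exists2 dl : R, 0 < dl &
  forall h, cabs h < dl -> cabs (f (z + h) - f z - d * h) <= e * cabs h.
Proof.
split=> [[g [cg <- E]] e e0|H].
  have [dl dl0 H] := cg _ e0; exists dl => // h hd.
  rewrite E (_ : _ - _ = (g (z + h) - g z) * h); last by ring.
  by rewrite cabsM ler_wpM2r ?cabs_ge0// H// addrAC subrr add0r.
exists (fun w => if w == z then d else (f w - f z) / (w - z)); split.
- move=> e e0; have [dl dl0 {}H] := H e e0; exists dl => // w hw.
  rewrite eqxx; have [_|wz] := eqVneq w z; first by rewrite subrr cabs0 ltW.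
  have := H (w - z) hw; rewrite [z + _]addrC subrK => hh.
  rewrite (_ : _ - d = (f w - f z - d * (w - z)) / (w - z)).
    by rewrite cabsM cabsV ler_pdivrMr// cabs_gt0 subr_eq0.
  by field; rewrite subr_eq0.
- by rewrite eqxx.
- move=> w; have [->|wz] := eqVneq w z; first by rewrite subrr mul0r addr0.
  by field; rewrite subr_eq0.
Qed.

Lemma cdiff_near f g z d (dl : R) : 0 < dl ->
  (forall w, cabs (w - z) < dl -> f w = g w) -> cdiff f z d -> cdiff g z d.
Proof.
move=> dl0 fg /cdiff_epsP H; apply/cdiff_epsP => e e0.
have [dl' dl'0 {}H] := H e e0; exists (Num.min dl dl'); first by rewrite lt_min dl0.
move=> h; rewrite lt_min => /andP[h1 h2].
rewrite -(fg (z + h)); last by rewrite addrAC subrr add0r.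
by rewrite -(fg z) ?subrr ?cabs0//; exact: H.
Qed.

Lemma cdiffV f z d : f z != 0 -> cdiff f z d -> cdiff (fun w => (f w)^-1) z (- d / f z ^+ 2).
Proof.
move=> f0 Df; have cf := cdiff_ccont Df.
have f0' : 0 < cabs (f z) by rewrite cabs_gt0.
have [dl dl0 Hdl] := cf (cabs (f z) / 2) ltac:(by rewrite divr_gt0).
have nz w : cabs (w - z) < dl -> f w != 0.
  move=> /Hdl; apply: contraPneq => ->; rewrite sub0r cabsN; apply/negP; rewrite -ltNge; lra.
case: (Df) => f' [cf' <- Ef].
pose h w := - f' w / (f z * f w).
(* [(f w)^-1] factors through the slope [h] only where [f] does not vanish, so the factored function
   is differentiated instead; the two agree near [z]. *)
apply: (@cdiff_near (fun w => (f z)^-1 + (w - z) * h w) _ _ _ dl) => //.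
  move=> w /nz fw; rewrite /h.
  have E : (w - z) * f' w = f w - f z by rewrite (Ef w) [f z + _]addrC addrK.
  rewrite !(mulNr, mulrN) mulrA E; field.
  by rewrite f0 fw.
exists h; split => //.
- apply: ccontM; first exact: ccontN.
  apply: ccontV; first by rewrite mulf_neq0.
  by apply: ccontM; [exact: ccont_cst|exact: (cdiff_ccont Df)].
- by move=> w; rewrite subrr mul0r addr0.
Qed.

(** The link with the derivative behind [cderiv], in which the theorem is stated. *)
Lemma cdiff_is_derive f z d : cdiff f z d -> is_derive (z : C^o) 1 (f : C^o -> C^o) d.
Proof.
move=> [g [cg <- E]].
have H : (h^-1 *: (f (h *: (1 : C^o) + z) - f z) : C^o) @[h --> (0 : C^o)^'] --> (g z : C^o).
  have : (g (h + z) : C^o) @[h --> (0 : C^o)^'] --> (g z : C^o).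
    apply: cvg_within_filter.
    have /ccontP : ccont (fun h => g (h + z)) 0.
      apply: (@ccont_comp (fun h => h + z)); last by rewrite add0r.
      by apply: ccontD; [exact: ccont_id|exact: ccont_cst].
    rewrite /prop_for /continuous_at.
    by have -> : g (0 + z) = g z by rewrite add0r.
  apply: cvg_trans; apply: near_eq_cvg.
  rewrite /dnbhs near_withinE; near=> h => h0.
  have -> : (h *: (1 : C^o) : C^o) = h by rewrite /GRing.scale /= mulr1.
  by rewrite E /GRing.scale /=; field.
split; first by apply/cvg_ex; exists (g z).
exact: cvg_lim H.
Unshelve. all: by end_near. Qed.

Lemma cdiff_derive1 f z d : cdiff f z d -> cderiv 1 f z = d.
Proof. by move=> /cdiff_is_derive [_ <-]; rewrite /cderiv derive1n1 derive1E. Qed.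

Lemma cdiff_sum n (F : 'I_n -> C -> C) (D : 'I_n -> C) z :
  (forall i, cdiff (F i) z (D i)) -> cdiff (fun w => \sum_i F i w) z (\sum_i D i).
Proof.
elim: n F D => [|n IH] F D H.
  rewrite big_ord0 (_ : (fun w => _) = fun=> 0); first exact: cdiff_cst.
  by apply/funext => w; rewrite big_ord0.
rewrite big_ord_recr (_ : (fun w => _) = fun w => \sum_(i < n) F (widen_ord (leqnSn n) i) w + F ord_max w).
  by apply: cdiffD => //; apply: IH.
by apply/funext => w; rewrite big_ord_recr.
Qed.

Lemma cdiffX n z : cdiff (fun w => w ^+ n) z (n%:R * z ^+ n.-1).
Proof.
elim: n => [|n IH].
  by rewrite mul0r; exact: cdiff_cst.
rewrite (_ : (fun w => _) = fun w => w * w ^+ n); last by apply/funext => w; rewrite exprS.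
have := cdiffM (cdiff_id z) IH; congr cdiff.
by rewrite mul1r mulrCA; case: n IH => [|n] _ /=; [ring|rewrite -exprS; ring].
Qed.

Lemma cdiff_poly (p : {poly C}) z : cdiff (fun w => p.[w]) z p^`().[z].
Proof.
elim/poly_ind: p => [|p c IH].
  rewrite deriv0 horner0 (_ : (fun w => _) = fun=> 0); first exact: cdiff_cst.
  by apply/funext => w; rewrite horner0.
rewrite (_ : (fun w => _) = fun w => p.[w] * w + c); last first.
  by apply/funext => w; rewrite !hornerE.
rewrite derivD derivC addr0 derivM derivX mulr1 !hornerE.
rewrite -[X in cdiff _ _ X]addr0; apply: cdiffD; last exact: cdiff_cst.
by have := cdiffM IH (cdiff_id z); rewrite mulr1.
Qed.

Lemma cdiff_lin (a b z : C) : cdiff (fun w => a * w + b) z a.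
Proof.
by have := cdiffD (cdiffZ a (cdiff_id z)) (cdiff_cst z b); rewrite mulr1 addr0.
Qed.

End Cdiff.

(** * Exponential and trigonometric functions *)

Section Cexp.
Variable R : realType.
Local Notation C := R[i].
Implicit Types (z w : C) (x y : R).

Lemma cexpD z w : cexp (z + w) = cexp z * cexp w.
Proof.
case: z w => a b [c d]; rewrite /cexp /= expRD cosD sinD.
by apply: complexP => /=; ring.
Qed.

Lemma Re_cexp z : Re (cexp z) = expR (Re z) * cos (Im z).
Proof. by rewrite /cexp /=; ring. Qed.

Lemma Im_cexp z : Im (cexp z) = expR (Re z) * sin (Im z).
Proof. by rewrite /cexp /=; ring. Qed.

Lemma cexp0 : cexp (0 : C) = 1.
Proof. by rewrite /cexp /= expR0 cos0 sin0; apply: complexP => /=; ring. Qed.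

Lemma cabs_cexp z : cabs (cexp z) = expR (Re z).
Proof.
rewrite /cexp cabsM cabs_real ger0_norm ?expR_ge0// cabs_sqrt /=.
by rewrite cos2Dsin2 sqrtr1 mulr1.
Qed.

Lemma cexp_neq0 z : cexp z != 0.
Proof. by rewrite -cabs_gt0 cabs_cexp expR_gt0. Qed.

Lemma cexpN z : cexp (- z) = (cexp z)^-1.
Proof.
apply: (mulfI (cexp_neq0 z)); rewrite -cexpD subrr cexp0 mulfV//; exact: cexp_neq0.
Qed.

Lemma cexpB z w : cexp (z - w) = cexp z / cexp w.
Proof. by rewrite cexpD cexpN. Qed.

Lemma cexpMn z n : cexp (n%:R * z) = cexp z ^+ n.
Proof.
elim: n => [|n IH]; first by rewrite mul0r cexp0 expr0.
by rewrite -natr1 mulrDl mul1r cexpD IH exprSr.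
Qed.

Lemma cexp_real x : cexp x%:C = (expR x)%:C.
Proof. by rewrite /cexp /= cos0 sin0; apply: complexP => /=; ring. Qed.

Lemma cexp_iR x : cexp (iC * x%:C) = cos x +i* sin x.
Proof.
have r : Re (iC * x%:C : C) = 0 by rewrite cReM /=; ring.
have i : Im (iC * x%:C : C) = x by rewrite cImM /=; ring.
by rewrite /cexp r i expR0 mul1r.
Qed.

Lemma cexp_ipi : cexp (ipi : C) = -1.
Proof. by rewrite cexp_iR cospi sinpi; apply: complexP => /=; ring. Qed.

Lemma cexp_ipi_half : cexp (ipi / 2 : C) = iC.
Proof.
have -> : (ipi / 2 : C) = iC * (pi / 2)%:C.
  by rewrite /ipi -mulrA rmorphM /= fmorphV rmorph_nat.
by rewrite cexp_iR cos_pihalf sin_pihalf.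
Qed.

Lemma cexp_ipi_int (n : int) : cexp (ipi * n%:~R : C) = (-1) ^ n.
Proof.
have H (m : nat) : cexp (ipi * m%:R : C) = (-1) ^+ m by rewrite mulrC cexpMn cexp_ipi.
case: n => m; first exact: H.
by rewrite NegzE mulrNz mulrN cexpN -pmulrn H.
Qed.

Lemma e2piD z w : e2pi (z + w) = e2pi z * e2pi w.
Proof. by rewrite /e2pi mulrDr cexpD. Qed.

Lemma e2pi_int (n : int) : e2pi (n%:~R : C) = 1.
Proof.
rewrite /e2pi (mulrC 2) -mulrA (_ : 2 * n%:~R = (2 * n)%:~R); last by rewrite intrM.
by rewrite cexp_ipi_int -exprz_exp (_ : (-1) ^ 2 = 1) ?exp1rz// -exprnP sqrrN expr1n.
Qed.

Lemma e2pi_shift z (n : int) : e2pi (z + n%:~R) = e2pi z.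
Proof. by rewrite e2piD e2pi_int mulr1. Qed.

Lemma Re_ipi z : Re (ipi * z) = - pi * Im z.
Proof. by rewrite /ipi; case: z => a b /=; ring. Qed.

Lemma cabs_e2pi z : cabs (e2pi z) = expR (- (2 * pi) * Im z).
Proof.
have -> : e2pi z = cexp (ipi * ((2 : R)%:C * z)).
  by rewrite /e2pi rmorph_nat; congr cexp; ring.
by rewrite cabs_cexp Re_ipi cImM /=; congr expR; ring.
Qed.

Lemma derive_eps (f : R -> R) x d : is_derive x 1 f d ->
  forall e : R, 0 < e -> exists2 dl : R, 0 < dl &
  forall h, `|h| < dl -> `|f (x + h) - f x - d * h| <= e * `|h|.
Proof.
move=> [dfx <-] e e0.
have H : h^-1 *: (f (h *: (1 : R) + x) - f x) @[h --> (0 : R)^'] --> 'D_1 f x by [].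
move/cvgrPdist_le : H => /(_ _ e0).
rewrite /dnbhs near_withinE => /nbhs_ballP[dl /= dl0 H].
exists dl => // h hd; have [->|h0] := eqVneq h 0.
  by rewrite addr0 subrr mulr0 subrr normr0 mulr0.
have := H h; rewrite /ball /= sub0r normrN => /(_ hd h0).
rewrite [h *: _]mulr1 /GRing.scale /= => {}H.
rewrite (_ : _ - _ = - ('D_1 f x - h^-1 * (f (h + x) - f x)) * h).
  by rewrite normrM normrN ler_wpM2r.
by rewrite (addrC x h); field.
Qed.

(** The real derivatives of [expR], [cos] and [sin] at 0 are enough; the functional equation of
    [cexp] carries the result to every point. *)
Lemma cdiff_cexp0 : cdiff (@cexp R) 0 1.
Proof.
apply/cdiff_epsP => e e0.
have [e' [e'0 e'1 e'e]] : exists e' : R, [/\ 0 < e', e' <= 1 & e' <= e / 10].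
  exists (Num.min (e / 10) 1); rewrite lt_min divr_gt0//= !ge_min lexx lexx orbT; by split.
have [d1 d10 H1] := derive_eps (is_derive_expR 0) e'0.
have [d2 d20 H2] := derive_eps (is_derive_cos 0) e'0.
have [d3 d30 H3] := derive_eps (is_derive_sin 0) e'0.
pose dl := Num.min (Num.min d1 (Num.min d2 d3)) e'.
exists dl; first by rewrite !lt_min d10 d20 d30.
move=> [a b]; rewrite !lt_min => /andP[/andP[h1 /andP[h2 h3]] h4].
have ha := ge_Re_cabs (a +i* b); have hb := ge_Im_cabs (a +i* b); rewrite /= in ha hb.
set h := a +i* b in h1 h2 h3 h4 ha hb *.
have {}H1 := H1 a (le_lt_trans ha h1).
have {}H2 := H2 b (le_lt_trans hb h2).
have {}H3 := H3 b (le_lt_trans hb h3).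
rewrite add0r expR0 mul1r in H1.
rewrite add0r cos0 sin0 oppr0 mul0r subr0 in H2.
rewrite add0r cos0 sin0 mul1r subr0 in H3.
rewrite add0r cexp0 mul1r.
pose u : C := cos b +i* sin b.
(* Each bracket is a remainder in one variable and [a * b] is of second order. Together they cost
   [6 * e' * cabs h], below the [10 * e' * cabs h] allotted by the choice of [e']. *)
have -> : cexp h - 1 - h = (expR a - 1 - a)%:C * u +
    ((1 + a)%:C * ((cos b - 1) +i* (sin b - b)) + (0 +i* (a * b))).
  by rewrite /cexp /u /h; apply: complexP => /=; ring.
have cu : cabs u = 1 by rewrite cabs_sqrt /= cos2Dsin2 sqrtr1.
have t1 : cabs ((expR a - 1 - a)%:C * u) <= e' * `|a| by rewrite cabsM cu mulr1 cabs_real.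
have t2 : cabs ((cos b - 1) +i* (sin b - b)) <= 2 * e' * `|b|.
  by rewrite (le_trans (cabs_le_ReIm _))//=; lra.
have h0 := cabs_ge0 h.
have t3 : cabs (0 +i* (a * b)) <= e' * cabs h.
  by rewrite (le_trans (cabs_le_ReIm _))//= normr0 add0r normrM ler_pM//; lra.
have a1 : cabs (1 + a)%:C <= 2.
  rewrite cabs_real (le_trans (ler_normD _ _))// normr1; lra.
rewrite (le_trans (cabsD _ _))// (le_trans (lerD t1 (cabsD _ _)))// cabsM.
have t4 : cabs (1 + a)%:C * cabs ((cos b - 1) +i* (sin b - b)) <= 2 * (2 * e' * `|b|).
  by rewrite ler_pM// cabs_ge0.
have t5 : e' * `|a| <= e' * cabs h by rewrite ler_wpM2l// ltW.
have t6 : e' * `|b| <= e' * cabs h by rewrite ler_wpM2l// ltW.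
have t7 : e' * cabs h <= e / 10 * cabs h by rewrite ler_wpM2r.
have t8 : 0 <= e * cabs h by rewrite mulr_ge0// ltW.
lra.
Qed.

Lemma cdiff_cexp z : cdiff (@cexp R) z (cexp z).
Proof.
have h : cdiff (fun w => 1 * w + - z) z 1 := cdiff_lin _ _ _.
have h0 : (fun w => 1 * w + - z) z = 0 by rewrite mul1r subrr.
have := cdiff_cexp0; rewrite -{1}h0 => /(cdiff_comp h) /(cdiffZ (cexp z)).
rewrite !mulr1; congr cdiff; apply/funext => w.
by rewrite mul1r -cexpD addrC subrK.
Qed.

Lemma cdiff_cexp_comp (f : C -> C) z d : cdiff f z d ->
  cdiff (fun w => cexp (f w)) z (cexp (f z) * d).
Proof. by move=> h; exact: (cdiff_comp h (cdiff_cexp _)). Qed.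

Lemma cdiff_cexpZ (a z : C) : cdiff (fun w => cexp (a * w)) z (cexp (a * z) * a).
Proof. by apply: cdiff_cexp_comp; have := cdiffZ a (cdiff_id z); rewrite mulr1. Qed.

Lemma csin2E z : csin z = (cexp (iC * z) - cexp (- (iC * z))) / (2 * iC).
Proof. by []. Qed.

Lemma iC_neq0 : (iC : C) != 0.
Proof. by rewrite -cabs_gt0 cabs_iC. Qed.

Lemma cdiff_csin z : cdiff (@csin R) z (ccos z).
Proof.
rewrite (_ : @csin R = fun w => (2 * iC)^-1 * (cexp (iC * w) - cexp (- iC * w))); last first.
  by apply/funext => w; rewrite /csin mulrC mulNr.
have := cdiffZ (2 * iC)^-1 (cdiffB (cdiff_cexpZ iC z) (cdiff_cexpZ (- iC) z)).
congr cdiff; rewrite /ccos mulNr; field; exact: iC_neq0.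
Qed.

Lemma cdiff_ccos z : cdiff (@ccos R) z (- csin z).
Proof.
rewrite (_ : @ccos R = fun w => (2)^-1 * (cexp (iC * w) + cexp (- iC * w))); last first.
  by apply/funext => w; rewrite /ccos mulrC mulNr.
have := cdiffZ (2)^-1 (cdiffD (cdiff_cexpZ iC z) (cdiff_cexpZ (- iC) z)).
have H : (iC * iC : C) = -1 := iC_sqr R.
congr cdiff; rewrite /csin mulNr.
apply: (mulIf iC_neq0); apply: (mulIf iC_neq0).
have i0 := iC_neq0; transitivity (2^-1 * (cexp (iC * z) - cexp (- (iC * z))) * (iC * iC) * iC : C); first by ring.
by rewrite H; field.
Qed.

Lemma cdiff_ccot z : csin z != 0 -> cdiff (@ccot R) z (- (1 + ccot z ^+ 2)).
Proof.
move=> s0; have := cdiffM (cdiff_ccos z) (cdiffV s0 (cdiff_csin z)).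
rewrite (_ : @ccot R = fun w => ccos w * (csin w)^-1)//.
by have -> : - (1 + ccot z ^+ 2) = - csin z / csin z + ccos z * (- ccos z / csin z ^+ 2)
  by rewrite /ccot; field.
Qed.

Lemma csinE x y : csin (x +i* y) = (sin x * (expR y + expR (- y)) / 2) +i* (cos x * (expR y - expR (- y)) / 2).
Proof.
have iV : (2 * iC : C)^-1 = 0 +i* (- (2^-1)).
  have i0 := iC_neq0.
  have n2 : (2 * iC : C) != 0 by rewrite mulf_neq0// pnatr_eq0.
  apply: (mulfI n2).
  rewrite mulfV//; apply: complexP; rewrite (cReM, cImM) /=; by field.
rewrite /csin iV /cexp /iC.
by apply: complexP; simpl; rewrite !(mul0r, mul1r, mulr0, addr0, add0r, sub0r, subr0, opprK, cosN, sinN); field.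
Qed.

Lemma ccosE x y : ccos (x +i* y) = (cos x * (expR y + expR (- y)) / 2) +i* (- (sin x * (expR y - expR (- y)) / 2)).
Proof.
have iV : (2 : C)^-1 = (2^-1)%:C by rewrite fmorphV rmorph_nat.
rewrite /ccos iV /cexp /iC.
by apply: complexP; simpl; rewrite !(mul0r, mul1r, mulr0, addr0, add0r, sub0r, subr0, opprK, cosN, sinN); field.
Qed.

Lemma expR_cosh_ge1 y : 1 <= (expR y + expR (- y)) / 2.
Proof.
rewrite expRN; have := expR_gt0 y; set e := expR y => e0.
have : 0 <= (e - 1) ^+ 2 / e by rewrite divr_ge0 ?sqr_ge0// ltW.
have -> : (e - 1) ^+ 2 / e = e + e^-1 - 2 by field; rewrite lt0r_neq0.
lra.
Qed.

(** The real part is [sin x * cosh y] with [cosh y >= 1]. The bound does not see the imaginary part,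
    which is what makes later estimates uniform in the shift off the line. *)
Lemma csin_ge_sin z : `|sin (Re z)| <= cabs (csin z).
Proof.
case: z => x y; apply: le_trans (ge_Re_cabs _); rewrite csinE /=.
have := expR_cosh_ge1 y; set c := (_ / 2) => c1.
rewrite -mulrA -/c normrM ler_peMr// ger0_norm//; lra.
Qed.

Lemma ccot_periodic z : ccot (z + (pi : R)%:C) = ccot z.
Proof.
have E : iC * (z + (pi : R)%:C) = iC * z + ipi by rewrite mulrDr.
rewrite /ccot /ccos /csin E opprD !cexpD !cexpN cexp_ipi invrN1.
have e0 := cexp_neq0 (iC * z); set e := cexp _ in e0 *.
have -> : e * -1 + e^-1 * -1 = - (e + e^-1) by ring.
have -> : e * -1 - e^-1 * -1 = - (e - e^-1) by ring.
by rewrite mulNr (mulNr (e - e^-1)) invrN mulrNN.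
Qed.

End Cexp.

Global Opaque cexp csin ccos ccot.

(** * Integrals of complex functions over real segments *)

Section Cint.
Variable R : realType.
Local Notation C := R[i].
Local Notation mu := (@lebesgue_measure R).
Implicit Types (F G : C -> C) (a b c x : R).

(** Continuity in a complex neighbourhood of each real point, not only along the segment: integrands
    stay functions of a complex variable, so that [cdiff] applies to them. *)
Definition segc a b F := forall x, a <= x <= b -> ccont F x%:C.

Notation integ a b F := (cint a b (fun x => F x%:C)).

Lemma segc_diff a b F f : (forall x, a <= x <= b -> cdiff F x%:C (f x)) -> segc a b F.
Proof. by move=> h x /h /cdiff_ccont. Qed.

Lemma segcW a b a' b' F : a <= a' -> b' <= b -> segc a b F -> segc a' b' F.
Proof.
by move=> h1 h2 h x /andP[h3 h4]; apply: h; rewrite (le_trans h1 h3) (le_trans h4 h2).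
Qed.

Lemma segcD a b F G : segc a b F -> segc a b G -> segc a b (fun z => F z + G z).
Proof. by move=> h1 h2 x hx; apply: ccontD; [exact: h1|exact: h2]. Qed.
Lemma segcM a b F G : segc a b F -> segc a b G -> segc a b (fun z => F z * G z).
Proof. by move=> h1 h2 x hx; apply: ccontM; [exact: h1|exact: h2]. Qed.
Lemma segc_cst a b d : segc a b (fun=> d).
Proof. by move=> x _; exact: ccont_cst. Qed.

Lemma segc_within_Re a b F : segc a b F ->
  {within `[a, b], continuous (fun x => Re (F x%:C))}.
Proof.
move=> h; apply: continuous_in_subspaceT => x; rewrite inE /= in_itv /= => hx.
apply/cvgrPdist_le => e e0; have [d d0 H] := h x hx e e0.
apply/nbhs_ballP; exists d => // y; rewrite /ball /= => yd.
rewrite -cReN -cReD (le_trans (ge_Re_cabs _))// cabsB H//.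
by rewrite -rmorphB cabs_real distrC.
Qed.

Lemma segc_within_Im a b F : segc a b F ->
  {within `[a, b], continuous (fun x => Im (F x%:C))}.
Proof.
move=> h; apply: continuous_in_subspaceT => x; rewrite inE /= in_itv /= => hx.
apply/cvgrPdist_le => e e0; have [d d0 H] := h x hx e e0.
apply/nbhs_ballP; exists d => // y; rewrite /ball /= => yd.
rewrite -cImN -cImD (le_trans (ge_Im_cabs _))// cabsB H//.
by rewrite -rmorphB cabs_real distrC.
Qed.

Lemma segc_int_Re a b F : segc a b F ->
  mu.-integrable `[a, b] (EFin \o (fun x => Re (F x%:C))).
Proof.
by move=> h; apply: continuous_compact_integrable; [exact: segment_compact|exact: segc_within_Re].
Qed.

Lemma segc_int_Im a b F : segc a b F ->
  mu.-integrable `[a, b] (EFin \o (fun x => Im (F x%:C))).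
Proof.
by move=> h; apply: continuous_compact_integrable; [exact: segment_compact|exact: segc_within_Im].
Qed.

Lemma eq_cint a b (f g : R -> C) : (forall x, a <= x <= b -> f x = g x) ->
  cint a b f = cint a b g.
Proof.
by move=> h; rewrite /cint; congr Complex; apply: eq_Rintegral => x;
  rewrite inE /= in_itv /= => /h ->.
Qed.

Lemma cintD a b F G : segc a b F -> segc a b G ->
  integ a b (fun z => F z + G z) = integ a b F + integ a b G.
Proof.
move=> hF hG; rewrite /cint; apply: complexP; rewrite /=.
  by rewrite -RintegralD//; [|exact: segc_int_Re|exact: segc_int_Re];
    apply: eq_Rintegral => x _; rewrite cReD.
by rewrite -RintegralD//; [|exact: segc_int_Im|exact: segc_int_Im];
  apply: eq_Rintegral => x _; rewrite cImD.
Qed.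

Lemma cintZ a b (d : C) F : segc a b F ->
  integ a b (fun z => d * F z) = d * integ a b F.
Proof.
move=> hF; case: d => d1 d2; rewrite /cint; apply: complexP; rewrite /=.
  transitivity (\int[mu]_(x in `[a, b]) (d1 * Re (F x%:C) - d2 * Im (F x%:C))).
    by apply: eq_Rintegral => x _; rewrite cReM.
  rewrite RintegralB//; last 2 first.
  - by apply: (@integrableZl _ _ _ mu `[a, b] _ d1 (EFin \o (fun x => Re (F x%:C)))) => //; exact: segc_int_Re.
  - by apply: (@integrableZl _ _ _ mu `[a, b] _ d2 (EFin \o (fun x => Im (F x%:C)))) => //; exact: segc_int_Im.
  by rewrite !RintegralZl//; [exact: segc_int_Im|exact: segc_int_Re].
transitivity (\int[mu]_(x in `[a, b]) (d1 * Im (F x%:C) + d2 * Re (F x%:C))).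
  by apply: eq_Rintegral => x _; rewrite cImM.
rewrite RintegralD//; last 2 first.
- by apply: (@integrableZl _ _ _ mu `[a, b] _ d1 (EFin \o (fun x => Im (F x%:C)))) => //; exact: segc_int_Im.
- by apply: (@integrableZl _ _ _ mu `[a, b] _ d2 (EFin \o (fun x => Re (F x%:C)))) => //; exact: segc_int_Re.
by rewrite !RintegralZl//; [exact: segc_int_Re|exact: segc_int_Im].
Qed.

Lemma cintB a b F G : segc a b F -> segc a b G ->
  integ a b (fun z => F z - G z) = integ a b F - integ a b G.
Proof.
move=> hF hG; have hG' : segc a b (fun z => -1 * G z) by apply: segcM => //; exact: segc_cst.
rewrite (@eq_cint _ _ _ (fun x => F x%:C + (fun z => -1 * G z) x%:C)).
  by rewrite (cintD hF hG') (cintZ _ hG) mulN1r.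
by move=> x _ /=; rewrite mulN1r.
Qed.

Lemma cint0 a b : cint a b (fun=> 0 : C) = 0.
Proof. by apply: complexP; rewrite /= Rintegral_cst// mul0r. Qed.

Lemma segc_sum a b n (F : 'I_n -> C -> C) : (forall i, segc a b (F i)) ->
  segc a b (fun z => \sum_i F i z).
Proof.
elim: n F => [|n IH] F hF.
  rewrite (_ : (fun z => _) = fun=> 0); first exact: segc_cst.
  by apply/funext => z; rewrite big_ord0.
rewrite (_ : (fun z => _) = fun z => \sum_(i < n) F (widen_ord (leqnSn n) i) z + F ord_max z).
  by apply: segcD => //; exact: IH.
by apply/funext => z; rewrite big_ord_recr.
Qed.

Lemma cint_sum a b n (F : 'I_n -> C -> C) : (forall i, segc a b (F i)) ->
  integ a b (fun z => \sum_i F i z) = \sum_i integ a b (F i).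
Proof.
elim: n F => [|n IH] F h.
  by rewrite big_ord0 -[RHS](cint0 a b); apply: eq_cint => x _; rewrite big_ord0.
rewrite big_ord_recr /= -(IH (fun i => F (widen_ord (leqnSn n) i)))//.
rewrite -(cintD (F := fun z => \sum_(i < n) F (widen_ord (leqnSn n) i) z) (G := F ord_max))//.
  by apply: eq_cint => x _; rewrite big_ord_recr.
by apply: segc_sum.
Qed.

Lemma cint_cat a b c F : a <= b -> b <= c -> segc a c F ->
  integ a c F = integ a b F + integ b c F.
Proof.
move=> ab bc h; have hab := segcW (lexx a) bc h; have hbc := segcW ab (lexx c) h.
suff H (f : R -> R) : mu.-integrable `[a, c] (EFin \o f) ->
    \int[mu]_(x in `[a, c]) f x = \int[mu]_(x in `[a, b]) f x + \int[mu]_(x in `[b, c]) f x.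
  by apply: complexP; rewrite /= H//; [exact: segc_int_Re|exact: segc_int_Im].
move=> fi; apply/eqP; rewrite addrC -subr_eq; apply/eqP.
rewrite Rintegral_itvB ?bnd_simp// Rintegral_itv_obnd_cbnd//.
by apply: integrableS fi => //; apply: subset_itvScc; rewrite ?bnd_simp.
Qed.

Lemma cintxx a (f : R -> C) : cint a a f = 0.
Proof. by apply: complexP; rewrite /= set_itv1 Rintegral_set1. Qed.

Lemma real_eps_derive (f : R -> R) x d :
  (forall e : R, 0 < e -> exists2 dl : R, 0 < dl &
    forall h, `|h| < dl -> `|f (x + h) - f x - d * h| <= e * `|h|) -> is_derive x 1 f d.
Proof.
move=> H.
have cv : h^-1 *: (f (h *: (1 : R) + x) - f x) @[h --> (0 : R)^'] --> d.
  apply/cvgrPdist_le => e e0; have [dl dl0 {}H] := H e e0.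
  rewrite /dnbhs near_withinE; apply/nbhs_ballP; exists dl => // h.
  rewrite /ball /= sub0r normrN => /H {}H h0.
  rewrite [h *: _]mulr1 /GRing.scale /= (addrC h x).
  rewrite -(ler_pM2r (_ : 0 < `|h|)) ?normr_gt0// -normrM (le_trans _ H)//.
  by rewrite -normrN le_eqVlt; apply/orP; left; apply/eqP; congr `|_|; field.
split; first by apply/cvg_ex; exists d.
exact: cvg_lim cv.
Qed.

Lemma cint_FTC a b F G : a <= b ->
  (forall x, a <= x <= b -> cdiff G x%:C (F x%:C)) -> segc a b F ->
  integ a b F = G b%:C - G a%:C.
Proof.
rewrite le_eqVlt => /predU1P[<- _ _|ab dG hF]; first by rewrite cintxx subrr.
have dRe x : a <= x <= b -> is_derive x 1 (fun x => Re (G x%:C)) (Re (F x%:C)).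
  move=> /dG /cdiff_epsP H; apply: real_eps_derive => e e0.
  have [d d0 {}H] := H e e0; exists d => // h hd.
  have := H h%:C; rewrite cabs_real => /(_ hd); apply: le_trans.
  apply: le_trans (ge_Re_cabs _); rewrite !cReD !cReN cReM /= mulr0 subr0 rmorphD//.
have dIm x : a <= x <= b -> is_derive x 1 (fun x => Im (G x%:C)) (Im (F x%:C)).
  move=> /dG /cdiff_epsP H; apply: real_eps_derive => e e0.
  have [d d0 {}H] := H e e0; exists d => // h hd.
  have := H h%:C; rewrite cabs_real => /(_ hd); apply: le_trans.
  apply: le_trans (ge_Im_cabs _); rewrite !cImD !cImN cImM /= mulr0 add0r rmorphD//.
have FTC (f g : R -> R) : {within `[a, b], continuous f} ->
    (forall x, a <= x <= b -> is_derive x 1 g (f x)) ->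
    \int[mu]_(x in `[a, b]) f x = g b - g a.
  move=> cf dg; rewrite /Rintegral (@continuous_FTC2 _ f g)//.
    split.
    - by move=> x; rewrite in_itv /= => /andP[/ltW ax /ltW xb]; have [] := dg x; rewrite ?ax.
    - apply: cvg_at_right_filter; apply: differentiable_continuous; apply/derivable1_diffP.
      by have [] := dg a ltac:(by rewrite lexx ltW).
    - apply: cvg_at_left_filter; apply: differentiable_continuous; apply/derivable1_diffP.
      by have [] := dg b ltac:(by rewrite lexx ltW).
  by move=> x; rewrite in_itv /= derive1E => /andP[/ltW ax /ltW xb]; have [] := dg x; rewrite ?ax.
apply: complexP.
  by rewrite /= (FTC _ _ (segc_within_Re hF) dRe) cReD cReN.
by rewrite /= (FTC _ _ (segc_within_Im hF) dIm) cImD cImN.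
Qed.

(* Rotating [F] by the phase of its integral reduces the bound to real parts. *)
Lemma cint_le_primitive a b F (P p : C -> C) : a <= b -> segc a b F ->
  (forall x, a <= x <= b -> cdiff P x%:C (p x%:C)) -> segc a b p ->
  (forall x, a <= x <= b -> cabs (F x%:C) <= Re (p x%:C)) ->
  cabs (integ a b F) <= Re (P b%:C) - Re (P a%:C).
Proof.
move=> ab hF dP hp le; rewrite -cReN -cReD -(cint_FTC ab dP hp).
set I := integ a b F.
have [I0|I0] := eqVneq I 0.
  rewrite I0 cabs0 /=; apply: Rintegral_ge0 => x; rewrite /= in_itv /= => /le.
  exact: le_trans (cabs_ge0 _).
have cI : 0 < cabs I by rewrite cabs_gt0.
pose u : C := (I^*%C) / (cabs I)%:C.
have uI : u * I = (cabs I)%:C.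
  rewrite /u mulrAC (mulrC _ I) -sqr_normc normC_cabs expr2 mulfK//.
  by rewrite -(rmorph0 (real_complex R)) (inj_eq (@complexI R)) lt0r_neq0.
have cu : cabs u = 1.
  apply: (mulIf (lt0r_neq0 cI)); rewrite -cabsM uI cabs_real mul1r ger0_norm//; exact: cabs_ge0.
have := cintZ u hF; rewrite -/I uI => /(congr1 (@Re R)) /= <-.
apply: le_Rintegral => //.
- by apply: (segc_int_Re (F := fun z => u * F z)); apply: segcM => //; exact: segc_cst.
- exact: segc_int_Re.
- move=> x; rewrite /= in_itv /= => /le; apply: le_trans.
  by apply: (le_trans (ler_norm _)); rewrite (le_trans (ge_Re_cabs _))// cabsM cu mul1r.
Qed.

Lemma cint_bound a b F (M : R) : a <= b -> segc a b F ->
  (forall x, a <= x <= b -> cabs (F x%:C) <= M) -> cabs (integ a b F) <= M * (b - a).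
Proof.
move=> ab hF le.
have := @cint_le_primitive a b F (fun z => M%:C * z) (fun=> M%:C) ab hF.
have -> : Re (M%:C * b%:C) - Re (M%:C * a%:C) = M * (b - a) by rewrite /=; ring.
apply => //; last exact: segc_cst.
by move=> x _; have := cdiffZ M%:C (cdiff_id x%:C); rewrite mulr1.
Qed.

Lemma cint_parts a b F G F' G' : a <= b ->
  (forall x, a <= x <= b -> cdiff F x%:C (F' x%:C)) ->
  (forall x, a <= x <= b -> cdiff G x%:C (G' x%:C)) -> segc a b F' -> segc a b G' ->
  integ a b (fun z => F z * G' z) = F b%:C * G b%:C - F a%:C * G a%:C - integ a b (fun z => F' z * G z).
Proof.
move=> ab dF dG cF cG.
have cF0 := segc_diff dF; have cG0 := segc_diff dG.
have := @cint_FTC a b (fun z => F' z * G z + F z * G' z) (fun z => F z * G z) ab.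
move=> <-; first last.
- by apply: segcD; exact: segcM.
- by move=> x hx; apply: cdiffM; [exact: dF|exact: dG].
rewrite (cintD (F := fun z => F' z * G z) (G := fun z => F z * G' z)); try exact: segcM.
by rewrite addrAC subrr add0r.
Qed.

(** For complex values there is no mean value equality; the bound comes from integrating the
    derivative. It replaces contour arguments whenever a parameter is deformed. *)
Lemma mvt_bound a b F F' (M : R) : a <= b ->
  (forall x, a <= x <= b -> cdiff F x%:C (F' x%:C)) -> segc a b F' ->
  (forall x, a <= x <= b -> cabs (F' x%:C) <= M) -> cabs (F b%:C - F a%:C) <= M * (b - a).
Proof. by move=> ab dF cF le; rewrite -(cint_FTC ab dF cF); exact: cint_bound. Qed.

Lemma cexp_sub1_le (w : C) : cabs (cexp w - 1) <= cabs w * expR (cabs w).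
Proof.
have := @mvt_bound 0 1 (fun z => cexp (w * z)) (fun z => cexp (w * z) * w) (cabs w * expR (cabs w)) ler01.
rewrite subr0 mulr1 mulr1 mulr0 cexp0; apply.
- by move=> x _; exact: cdiff_cexpZ.
- move=> x _; apply: ccontM; last exact: ccont_cst.
  exact: cdiff_ccont (cdiff_cexpZ _ _).
- move=> x /andP[x0 x1]; rewrite cabsM cabs_cexp mulrC ler_wpM2l ?cabs_ge0// ler_expR.
  rewrite cReM /= mulr0 subr0 (le_trans (ler_norm _))// normrM (ger0_norm x0).
  by rewrite -[leRHS]mulr1 ler_pM//; exact: ge_Re_cabs.
Qed.

Lemma cexp_sub1_sub_le (w : C) : cabs (cexp w - 1 - w) <= cabs w ^+ 2 * expR (cabs w).
Proof.
have := @mvt_bound 0 1 (fun z => cexp (w * z) - w * z) (fun z => cexp (w * z) * w - w) (cabs w ^+ 2 * expR (cabs w)) ler01.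
rewrite subr0 !mulr1 !mulr0 cexp0 subr0 addrAC; apply.
- move=> x _; apply: cdiffB; first exact: cdiff_cexpZ.
  by have := cdiffZ w (cdiff_id x%:C); rewrite mulr1.
- move=> x _; apply: ccontD; last exact: ccont_cst.
  by apply: ccontM; [exact: cdiff_ccont (cdiff_cexpZ _ _)|exact: ccont_cst].
- move=> x /andP[x0 x1]; rewrite -[X in _ - X]mul1r -mulrBl cabsM mulrC expr2 -mulrA ler_wpM2l ?cabs_ge0//.
  have wx : cabs (w * x%:C) <= cabs w by rewrite cabsM cabs_real ger0_norm// ler_piMr// cabs_ge0.
  rewrite (le_trans (cexp_sub1_le _))// ler_pM ?cabs_ge0 ?expR_ge0// ler_expR//.
Qed.

End Cint.

Notation integ a b F := (cint a b (fun x => F x%:C)).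

(** * Limits and absolutely convergent series *)

Section Series.
Variable R : realType.
Local Notation C := R[i].
Implicit Types (u v a b : nat -> C) (l : C).

Definition ccvg u l := forall e : R, 0 < e -> exists N, forall n, (N <= n)%N -> cabs (u n - l) <= e.

Lemma ccvg_lim u l : ccvg u l -> lim ((u : nat -> C^o) @ \oo) = l.
Proof.
move=> h; have H : (u : nat -> C^o) @ \oo --> (l : C^o).
  move=> A /nbhs_ballP[e e0 HA].
  move: e0; rewrite /= ltcE /= => /andP[/eqP e1 e0].
  have [N HN] := h (Re e / 2) ltac:(by rewrite divr_gt0).
  exists N => // n /= /HN {}HN; apply: HA; rewrite /ball /= normC_cabs cabsB ltcE /= e1 eqxx /=.
  lra.
exact: cvg_lim H.
Qed.

Lemma ccvg_uniq u l l' : ccvg u l -> ccvg u l' -> l = l'.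
Proof. by move=> /ccvg_lim <- /ccvg_lim <-. Qed.

Lemma ccvg_cst l : ccvg (fun=> l) l.
Proof. by move=> e e0; exists 0%N => n _; rewrite subrr cabs0 ltW. Qed.

Lemma ccvgD u v l l' : ccvg u l -> ccvg v l' -> ccvg (fun n => u n + v n) (l + l').
Proof.
move=> hu hv e e0; have e2 : 0 < e / 2 by rewrite divr_gt0.
have [N HN] := hu _ e2; have [M HM] := hv _ e2; exists (maxn N M) => n.
rewrite geq_max => /andP[/HN h1 /HM h2].
rewrite opprD addrACA (le_trans (cabsD _ _))//; lra.
Qed.

Lemma ccvg_le u l (v : nat -> R) (c : R) : 0 < c ->
  (forall e : R, 0 < e -> exists N, forall n, (N <= n)%N -> v n <= e) ->
  (forall n, cabs (u n - l) <= c * v n) -> ccvg u l.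
Proof.
move=> c0 hv le e e0; have [N HN] := hv (e / c) ltac:(by rewrite divr_gt0).
exists N => n /HN h; rewrite (le_trans (le n))// mulrC -ler_pdivlMr//.
Qed.

Lemma ccvgM u v l l' : ccvg u l -> ccvg v l' -> ccvg (fun n => u n * v n) (l * l').
Proof.
move=> hu hv e e0.
pose M := cabs l + cabs l' + 1.
have l0 := cabs_ge0 l; have l0' := cabs_ge0 l'.
have M0 : 0 < M by rewrite /M; lra.
have [e2 [e20 e21 e2e]] : exists e2 : R, [/\ 0 < e2, e2 <= 1 & e2 <= e / (2 * M)].
  exists (Num.min 1 (e / (2 * M))).
  by rewrite lt_min ltr01 divr_gt0 ?mulr_gt0//= !ge_min lexx lexx orbT.
have [N HN] := hu _ e20; have [N' HN'] := hv _ e20; exists (maxn N N') => n.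
rewrite geq_max => /andP[/HN h1 /HN' h2].
rewrite (_ : _ - _ = (u n - l) * v n + l * (v n - l')); last by ring.
rewrite (le_trans (cabsD _ _))// !cabsM.
have vn : cabs (v n) <= M.
  have := cabsD (v n - l') l'; rewrite subrK /M; lra.
have lM : cabs l <= M by rewrite /M; lra.
have E : e = e / (2 * M) * M + M * (e / (2 * M)) by field; rewrite lt0r_neq0.
by rewrite E lerD// ler_pM ?cabs_ge0// (le_trans _ e2e).
Qed.

Lemma ccvgZ c u l : ccvg u l -> ccvg (fun n => c * u n) (c * l).
Proof. by move=> h; apply: ccvgM => //; exact: ccvg_cst. Qed.

Lemma ccvgN u l : ccvg u l -> ccvg (fun n => - u n) (- l).
Proof. by move=> h e /h[N HN]; exists N => n /HN; rewrite -opprD cabsN. Qed.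

Lemma ccvgB u v l l' : ccvg u l -> ccvg v l' -> ccvg (fun n => u n - v n) (l - l').
Proof. by move=> hu /ccvgN; exact: ccvgD. Qed.

Lemma ccvgV u l : l != 0 -> ccvg u l -> ccvg (fun n => (u n)^-1) l^-1.
Proof.
move=> l0 hu e e0; have c : ccont (fun z : C => z^-1) l := ccontV l0 (@ccont_id _ l).
have [d d0 Hd] := c _ e0; have [N HN] := hu (d / 2) ltac:(by rewrite divr_gt0).
by exists N => n /HN h; apply: Hd; lra.
Qed.

Lemma ccvg_sub u l (f : nat -> nat) : (forall n, (n <= f n)%N) -> ccvg u l -> ccvg (u \o f) l.
Proof. by move=> hf h e /h[N HN]; exists N => n Nn; apply: HN; rewrite (leq_trans Nn). Qed.

Lemma ccvg_near u v l : (exists N, forall n, (N <= n)%N -> u n = v n) -> ccvg u l -> ccvg v l.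
Proof.
move=> [N HN] h e /h[M HM]; exists (maxn N M) => n.
by rewrite geq_max => /andP[/HN <-]; exact: HM.
Qed.

Lemma ccvg_bound u l (B : R) : (exists N, forall n, (N <= n)%N -> cabs (u n) <= B) ->
  ccvg u l -> cabs l <= B.
Proof.
move=> [M HM] h; apply/ler_addgt0Pr => e e0; have [N HN] := h e e0.
have hn := HN (maxn N M) (leq_maxl _ _); have hm := HM (maxn N M) (leq_maxr _ _).
have := cabsD (l - u (maxn N M)) (u (maxn N M)); rewrite subrK cabsB; lra.
Qed.

Lemma ccvg_sum n (F : 'I_n -> nat -> C) (L : 'I_n -> C) : (forall i, ccvg (F i) (L i)) ->
  ccvg (fun N => \sum_i F i N) (\sum_i L i).
Proof.
elim: n F L => [|n IH] F L h.
  rewrite big_ord0 (_ : (fun N => _) = fun=> 0); first exact: ccvg_cst.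
  by apply/funext => N; rewrite big_ord0.
rewrite big_ord_recr (_ : (fun N => _) = fun N => \sum_(i < n) F (widen_ord (leqnSn n) i) N + F ord_max N).
  by apply: ccvgD => //; apply: IH.
by apply/funext => N; rewrite big_ord_recr.
Qed.

Lemma ccvg_cont u l (f : C -> C) : ccont f l -> ccvg u l -> ccvg (fun n => f (u n)) (f l).
Proof.
move=> c hu e e0; have [d d0 Hd] := c _ e0.
have [N HN] := hu (d / 2) ltac:(by rewrite divr_gt0).
by exists N => n /HN h; apply: Hd; lra.
Qed.

(** Bounded partial sums, which for nonnegative terms amounts to convergence. *)
Definition rsummable (M : nat -> R) := exists B : R, forall N, \sum_(n < N) M n <= B.
Definition csummable a := rsummable (fun n => cabs (a n)).
Definition cser a : C := lim ((fun N : nat => \sum_(n < N) a n : C^o) @ \oo).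

Lemma rsummable_le (M M' : nat -> R) : (forall n, M n <= M' n) -> rsummable M' -> rsummable M.
Proof. by move=> le [B HB]; exists B => N; rewrite (le_trans _ (HB N))// ler_sum. Qed.

Lemma rsummableD (M M' : nat -> R) : rsummable M -> rsummable M' -> rsummable (fun n => M n + M' n).
Proof.
by move=> [B HB] [B' HB']; exists (B + B') => N; rewrite big_split lerD.
Qed.

Lemma rsummableZ (c : R) (M : nat -> R) : 0 <= c -> rsummable M -> rsummable (fun n => c * M n).
Proof. by move=> c0 [B HB]; exists (c * B) => N; rewrite -mulr_sumr ler_wpM2l. Qed.

Lemma rsummable_cvg (M : nat -> R) : (forall n, 0 <= M n) -> rsummable M ->
  exists s : R, forall e : R, 0 < e -> exists N, forall n, (N <= n)%N ->
    `|\sum_(i < n) M i - s| <= e.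
Proof.
move=> M0 [B HB]; pose u n := \sum_(i < n) M i.
have un : nondecreasing_seq u.
  apply/nondecreasing_seqP => n; by rewrite /u big_ord_recr lerDl.
have ub : has_ubound (range u) by exists B => _ [n _ <-]; exact: HB.
exists (sup (range u)) => e e0.
have /cvgrPdist_le /(_ _ e0)[N _ HN] := nondecreasing_cvgn un ub.
by exists N => n Nn; rewrite distrC; exact: (HN n Nn).
Qed.

Lemma rsummable_tail (M : nat -> R) : (forall n, 0 <= M n) -> rsummable M ->
  forall e : R, 0 < e -> exists N, forall n, \sum_(N <= i < n) M i <= e.
Proof.
move=> M0 sM e e0; have [s Hs] := rsummable_cvg M0 sM.
have [N HN] := Hs (e / 2) ltac:(by rewrite divr_gt0).
exists N => n; case: (leqP N n) => [Nn|nN]; last by rewrite big_geq ?ltW// ltnW.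
have h1 := HN _ (leqnn N); have h2 := HN _ Nn.
have : \sum_(i < n) M i = \sum_(i < N) M i + \sum_(N <= i < n) M i.
  by rewrite -!(big_mkord xpredT) -big_cat_nat.
move: h1 h2; rewrite !ler_norml => /andP[? ?] /andP[? ?]; lra.
Qed.

Lemma cser_eq a l : ccvg (fun N => \sum_(n < N) a n) l -> cser a = l.
Proof. exact: ccvg_lim. Qed.

Lemma cser_cvg a : csummable a -> ccvg (fun N => \sum_(n < N) a n) (cser a).
Proof.
move=> sa; suff [l hl] : exists l, ccvg (fun N => \sum_(n < N) a n) l by rewrite (cser_eq hl).
have part (f : C -> R) : (forall z, `|f z| <= cabs z) ->
    exists s : R, forall e : R, 0 < e -> exists N, forall n, (N <= n)%N ->
    `|\sum_(i < n) f (a i) - s| <= e.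
  move=> hf.
  have [||s Hs] := @rsummable_cvg (fun n => cabs (a n) + f (a n)).
  - by move=> n; have := hf (a n); rewrite ler_norml; lra.
  - apply: rsummableD => //; apply: rsummable_le sa => n.
    by rewrite (le_trans (ler_norm _)).
  have [s' Hs'] := @rsummable_cvg (fun n => cabs (a n)) (fun n => cabs_ge0 (a n)) sa.
  exists (s - s') => e e0; have e2 : 0 < e / 2 by rewrite divr_gt0.
  have [N HN] := Hs _ e2; have [N' HN'] := Hs' _ e2; exists (maxn N N') => n.
  rewrite geq_max => /andP[/HN h1 /HN' h2].
  have -> : \sum_(i < n) f (a i) = \sum_(i < n) (cabs (a i) + f (a i)) - \sum_(i < n) cabs (a i).
    by rewrite big_split addrAC subrr add0r.
  rewrite opprD addrACA (le_trans (ler_normD _ _))// -opprD normrN; lra.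
have [x Hx] := part _ (@ge_Re_cabs R); have [y Hy] := part _ (@ge_Im_cabs R).
exists (x +i* y) => e e0; have e2 : 0 < e / 2 by rewrite divr_gt0.
have [N HN] := Hx _ e2; have [N' HN'] := Hy _ e2; exists (maxn N N') => n.
rewrite geq_max => /andP[/HN h1 /HN' h2].
rewrite (le_trans (cabs_le_ReIm _))// cReD cImD cReN cImN cRe_sum cIm_sum /=; lra.
Qed.

Lemma csummable_le a (M : nat -> R) : (forall n, cabs (a n) <= M n) -> rsummable M -> csummable a.
Proof. exact: rsummable_le. Qed.

Lemma csummableD a b : csummable a -> csummable b -> csummable (fun n => a n + b n).
Proof. by move=> sa sb; apply: rsummable_le (rsummableD sa sb) => n; exact: cabsD. Qed.

Lemma csummableZ c a : csummable a -> csummable (fun n => c * a n).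
Proof.
by move=> sa; apply: rsummable_le (rsummableZ (cabs_ge0 c) sa) => n; rewrite cabsM.
Qed.

Lemma cserD a b : csummable a -> csummable b -> cser (fun n => a n + b n) = cser a + cser b.
Proof.
move=> sa sb; apply: cser_eq; rewrite (_ : (fun N => _) = fun N => \sum_(n < N) a n + \sum_(n < N) b n).
  by apply: ccvgD; exact: cser_cvg.
by apply/funext => N; rewrite big_split.
Qed.

Lemma cserZ c a : csummable a -> cser (fun n => c * a n) = c * cser a.
Proof.
move=> sa; apply: cser_eq; rewrite (_ : (fun N => _) = fun N => c * \sum_(n < N) a n).
  by apply: ccvgZ; exact: cser_cvg.
by apply/funext => N; rewrite mulr_sumr.
Qed.

Lemma eq_cser a b : a =1 b -> cser a = cser b.
Proof. by move=> /funext ->. Qed.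

Lemma cser_le a (B : R) : csummable a -> (forall N, \sum_(n < N) cabs (a n) <= B) -> cabs (cser a) <= B.
Proof.
move=> sa hB; apply: ccvg_bound (cser_cvg sa); exists 0%N => n _.
by rewrite (le_trans (cabs_sum _ _ _)).
Qed.

Lemma cser_recl a : csummable a -> cser a = a 0%N + cser (fun n => a n.+1).
Proof.
move=> sa; have h := cser_cvg sa.
apply/esym/(ccvg_uniq _ (ccvg_sub (f := S) (fun n => leqnSn n) h)).
rewrite (_ : _ \o _ = fun N => a 0%N + \sum_(n < N) a n.+1); last first.
  by apply/funext => N /=; rewrite big_ord_recl.
apply: ccvgD; first exact: ccvg_cst.
apply: cser_cvg; have [B HB] := sa; exists B => N.
rewrite (le_trans _ (HB N.+1))// big_ord_recl /= lerDr cabs_ge0//.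
Qed.

(** Beyond some [K] the tails of all the series are at most [e / 4] at once, by domination; on the
    first [K] terms only a finite sum passes to the limit. *)
Lemma tannery (a : nat -> nat -> C) b (M : nat -> R) :
  (forall N n, cabs (a N n) <= M n) -> rsummable M ->
  (forall n, ccvg (a^~ n) (b n)) -> ccvg (fun N => cser (a N)) (cser b).
Proof.
move=> le sM cv.
have M0 n : 0 <= M n := le_trans (cabs_ge0 _) (le 0%N n).
have leb n : cabs (b n) <= M n by apply: ccvg_bound (cv n); exists 0%N.
have sb : csummable b := csummable_le leb sM.
have sa N : csummable (a N) := csummable_le (le N) sM.
move=> e e0; have e4 : 0 < e / 4 by rewrite divr_gt0.
have [K HK] := rsummable_tail M0 sM e4.
have tail (f : nat -> C) : (forall n, cabs (f n) <= M n) -> csummable f ->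
    cabs (cser f - \sum_(n < K) f n) <= e / 4.
  move=> lef sf; have h := ccvgB (cser_cvg sf) (ccvg_cst (\sum_(n < K) f n)).
  apply: ccvg_bound h; exists K => n Kn.
  have -> : \sum_(i < n) f i - \sum_(i < K) f i = \sum_(K <= i < n) f i.
    by rewrite -!(big_mkord xpredT) (big_cat_nat (n := K))//= addrAC subrr add0r.
  rewrite (le_trans (cabs_sum _ _ _))// (le_trans _ (HK n))// ler_sum_nat//.
have h : ccvg (fun N => \sum_(n < K) a N n) (\sum_(n < K) b n).
  by apply: ccvg_sum => i; exact: cv.
have [N HN] := h _ e4; exists N => n /HN hn.
have t1 := tail _ (le n) (sa n); have t2 := tail _ leb sb.
rewrite (_ : _ - _ = (cser (a n) - \sum_(i < K) a n i) +
   ((\sum_(i < K) a n i - \sum_(i < K) b i) - (cser b - \sum_(i < K) b i))); last by ring.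
rewrite (le_trans (cabsD _ _))//.
have := cabsD (\sum_(i < K) a n i - \sum_(i < K) b i) (- (cser b - \sum_(i < K) b i)).
rewrite cabsN; lra.
Qed.

Lemma cser_fin a N : (forall n, (N <= n)%N -> a n = 0) -> cser a = \sum_(n < N) a n.
Proof.
move=> h; apply: cser_eq => e e0; exists N => n Nn.
rewrite -!(big_mkord xpredT) (big_cat_nat (n := N))//= addrAC subrr add0r.
rewrite big_nat_cond big1 ?cabs0 ?ltW// => i /andP[/andP[Ni _] _]; exact: h.
Qed.

Lemma geom_summable (r : R) : 0 <= r -> r < 1 -> rsummable (fun n => r ^+ n).
Proof.
move=> r0 r1; exists (1 - r)^-1 => N.
have r1' : 0 < 1 - r by lra.
rewrite -[leRHS]mul1r ler_pdivlMr// mulrC.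
have := subrX1 r N; have := exprn_ge0 N r0; lra.
Qed.

(** Half of the geometric decay is kept as [(Num.sqrt r) ^+ n]; the other half absorbs the power of
    [n], by the Taylor term of order [p + 1] of the exponential. *)
Lemma natX_geom_bound (r : R) p : 0 < r -> r < 1 ->
  exists2 B : R, 0 < B & forall n : nat, n.+1%:R ^+ p * r ^+ n <= B * (Num.sqrt r) ^+ n.
Proof.
move=> r0 r1.
have s0 : 0 < Num.sqrt r by rewrite sqrtr_gt0.
have s1 : Num.sqrt r < 1 by rewrite -sqrtr1 ltr_sqrt.
pose c := - ln (Num.sqrt r); have c0 : 0 < c by rewrite /c oppr_gt0 ln_lt0// s0.
have pc : 0 < (p.+1`!)%:R / c ^+ p.+1 by rewrite divr_gt0 ?exprn_gt0// ltr0n fact_gt0.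
exists ((p.+1`!)%:R / c ^+ p.+1 * expR c); first by rewrite mulr_gt0// expR_gt0.
move=> n; rewrite -{1}(sqr_sqrtr (ltW r0)) -exprM mulnC exprM expr2.
rewrite mulrA; apply: ler_wpM2r; first by rewrite exprn_ge0 ?ltW.
have -> : Num.sqrt r ^+ n = expR (- (c * n.+1%:R)) * expR c.
  rewrite -expRD -natr1 (_ : - _ + c = ln (Num.sqrt r) * n%:R); last by rewrite /c; ring.
  by rewrite expRM_natr lnK.
rewrite mulrA ler_wpM2r ?expR_ge0// expRN ler_pdivrMr ?expR_gt0//.
have h := @expR_ge1Dxn R (c * n.+1%:R) p (mulr_ge0 (ltW c0) (ler0n _ _)).
have h2 : (c * n.+1%:R) ^+ p.+1 / (p.+1`!)%:R <= expR (c * n.+1%:R) by rewrite (le_trans _ h)// lerDr.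
apply: le_trans (_ : p.+1`!%:R / c ^+ p.+1 * ((c * n.+1%:R) ^+ p.+1 / (p.+1`!)%:R) <= _); last first.
  by rewrite ler_wpM2l// ltW.
have -> : p.+1`!%:R / c ^+ p.+1 * ((c * n.+1%:R) ^+ p.+1 / (p.+1`!)%:R) = n.+1%:R ^+ p.+1.
  rewrite exprMn; field; rewrite pnatr_eq0 -lt0n fact_gt0 expf_neq0//; exact: lt0r_neq0.
by rewrite ler_weXn2l// ler1n.
Qed.

Lemma natX_geom_summable (r : R) p : 0 <= r -> r < 1 -> rsummable (fun n => n.+1%:R ^+ p * r ^+ n).
Proof.
rewrite le_eqVlt => /predU1P[<- _|r0 r1].
  exists 1 => -[|N]; first by rewrite big_ord0.
  rewrite big_ord_recl big1 ?addr0 ?expr1n ?mul1r// => i _.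
  by rewrite expr0n mulr0.
have [B B0 HB] := natX_geom_bound p r0 r1.
apply: rsummable_le HB _; apply: rsummableZ (ltW B0) _; apply: geom_summable.
  exact: sqrtr_ge0.
by rewrite -sqrtr1 ltr_sqrt.
Qed.

Lemma sumZE (f : int -> C) : sumZ f = cser (fun n => f n%:Z + f (- n.+1%:Z)).
Proof. by []. Qed.

Lemma exprn_cvg0 (r : R) : 0 <= r -> r < 1 -> forall e : R, 0 < e -> exists N, forall n, (N <= n)%N -> r ^+ n <= e.
Proof.
move=> r0 r1 e e0; have /cvgrPdist_le /(_ _ e0)[N _ HN] : (GRing.exp r : nat -> R) @ \oo --> (0 : R).
  by apply: cvg_expr; rewrite ger0_norm.
exists N => n /HN; rewrite sub0r normrN ger0_norm//; exact: exprn_ge0.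
Qed.

Lemma invn_cvg0 (e : R) : 0 < e -> exists N, forall n, (N <= n)%N -> n.+1%:R^-1 <= e.
Proof.
move=> e0; exists (Num.bound e^-1) => n Nn.
rewrite -[e]invrK lef_pV2 ?posrE ?invr_gt0 ?ltr0n//.
have := archi_boundP (ltW (_ : 0 < e^-1)); rewrite invr_gt0 => /(_ e0) /ltW h.
by rewrite (le_trans h)// ler_nat (leq_trans Nn).
Qed.

End Series.

(** * Principal argument, logarithm and square root *)

Section Branch.
Variable R : realType.
Local Notation C := R[i].
Implicit Types (z w : C).

Lemma cabs_sqr z : cabs z ^+ 2 = Re z ^+ 2 + Im z ^+ 2.
Proof. by rewrite cabs_sqrt sqr_sqrtr// addr_ge0 ?sqr_ge0. Qed.

Lemma carg_cos z : z != 0 -> cos (carg z) = Re z / cabs z.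
Proof.
rewrite -cabs_gt0 => z0.
have h : -1 <= Re z / cabs z <= 1.
  have := ge_Re_cabs z; rewrite ler_norml => /andP[h1 h2].
  by rewrite ler_pdivlMr// ler_pdivrMr// mul1r mulN1r h1 h2.
by rewrite /carg; case: ifP => _; rewrite ?cosN acosK.
Qed.

Lemma carg_sin z : z != 0 -> sin (carg z) = Im z / cabs z.
Proof.
rewrite -cabs_gt0 => z0.
have h : -1 <= Re z / cabs z <= 1.
  have := ge_Re_cabs z; rewrite ler_norml => /andP[h1 h2].
  by rewrite ler_pdivlMr// ler_pdivrMr// mul1r mulN1r h1 h2.
have E : 1 - (Re z / cabs z) ^+ 2 = (Im z / cabs z) ^+ 2.
  by rewrite !expr_div_n cabs_sqr; field; rewrite -cabs_sqr expf_neq0// lt0r_neq0.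
rewrite /carg; case: ifPn => hi; rewrite ?sinN sin_acos// E sqrtr_sqr normrM normfV (gtr0_norm z0).
  by rewrite ltr0_norm// mulNr opprK.
by rewrite ger0_norm// leNgt.
Qed.

Lemma carg_bound z : - pi <= carg z <= pi.
Proof.
have h : -1 <= Re z / cabs z <= 1.
  have [->|] := eqVneq z 0; first by rewrite /= mul0r; lra.
  rewrite -cabs_gt0 => z0.
  have := ge_Re_cabs z; rewrite ler_norml => /andP[h1 h2].
  by rewrite ler_pdivlMr// ler_pdivrMr// mul1r mulN1r h1 h2.
have a0 := acos_ge0 h; have a1 := acos_lepi h; have p0 := pi_ge0 R.
rewrite /carg; case: ifP => _; lra.
Qed.

Lemma cexp_clog z : z != 0 -> cexp (clog z) = z.
Proof.
move=> z0; have z0' : 0 < cabs z by rewrite cabs_gt0.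
apply: complexP; rewrite (Re_cexp, Im_cexp) /clog /= lnK ?posrE// (carg_cos, carg_sin)//;
  field; exact: lt0r_neq0.
Qed.

Definition csq z := cpow z 2^-1.

Lemma csq_sqr z : z != 0 -> csq z ^+ 2 = z.
Proof.
move=> z0; rewrite /csq /cpow -cexpMn -[RHS](cexp_clog z0); congr cexp.
by rewrite mulrA mulfV ?mul1r// pnatr_eq0.
Qed.

Lemma csq_neq0 z : csq z != 0.
Proof. exact: cexp_neq0. Qed.

Lemma invnat (n : nat) : (n%:R^-1 : C) = (n%:R^-1)%:C.
Proof. by rewrite fmorphV rmorph_nat. Qed.

Lemma Re_csq_ge0 z : z != 0 -> 0 <= Re (csq z).
Proof.
move=> z0; rewrite /csq /cpow invnat Re_cexp [Im _]cImM /=.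
rewrite !(mul0r, subr0, addr0).
have /andP[h1 h2] := carg_bound z.
rewrite mulr_ge0 ?expR_ge0// cos_ge0_pihalf//; lra.
Qed.

(** Identities between principal roots are proved through this: square both sides, then check the
    sign of one real part. *)
Lemma csq_unique z w : Re z > 0 -> z ^+ 2 = w -> csq w = z.
Proof.
move=> rz zw; have z0 := Re_gt0_neq0 rz.
have w0 : w != 0 by rewrite -zw expf_neq0.
have /eqP : (csq w) ^+ 2 = z ^+ 2 by rewrite csq_sqr.
rewrite eqf_sqr => /orP[/eqP//|/eqP e]; exfalso.
by have := Re_csq_ge0 w0; rewrite e cReN; lra.
Qed.

Lemma Re_csq_gt0 z : 0 < Re z -> 0 < Re (csq z).
Proof.
move=> rz; have z0 := Re_gt0_neq0 rz.
rewrite lt0r Re_csq_ge0// andbT; apply/negP => /eqP e.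
have := csq_sqr z0; case: (csq z) e => a b /= -> /(congr1 (@Re R)).
rewrite expr2 /= mul0r sub0r => e; have := sqr_ge0 b; rewrite expr2; lra.
Qed.

(** [(csq w - csq z) * (csq w + csq z) = w - z], and the second factor stays away from 0 because
    both roots have positive real part. The same identity yields the slope in [cdiff_csq]. *)
Lemma csq_ccont z : 0 < Re z -> ccont csq z.
Proof.
move=> rz e e0; have s0 := Re_csq_gt0 rz.
have z0 := Re_gt0_neq0 rz.
pose d := Num.min (Re z / 2) (e * Re (csq z)).
exists d; first by rewrite lt_min divr_gt0// mulr_gt0.
move=> w; rewrite lt_min => /andP[h1 h2].
have rw : 0 < Re w.
  have := le_lt_trans (ge_Re_cabs (w - z)) h1; rewrite cReD cReN ltr_norml; lra.
have w0 := Re_gt0_neq0 rw.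
have sw := Re_csq_gt0 rw.
have E : (csq w - csq z) * (csq w + csq z) = w - z by rewrite -subr_sqr !csq_sqr.
have P : Re (csq z) <= cabs (csq w + csq z).
  by rewrite (le_trans _ (ge_Re_cabs _))// (le_trans _ (ler_norm _))// cReD lerDr ltW.
have {}E : cabs (csq w - csq z) * cabs (csq w + csq z) = cabs (w - z) by rewrite -cabsM E.
rewrite -(ler_pM2r s0) (le_trans _ (ltW h2))// -E ler_wpM2l ?cabs_ge0//.
Qed.

Lemma cdiff_csq z : 0 < Re z -> cdiff csq z (2 * csq z)^-1.
Proof.
move=> rz; have z0 := Re_gt0_neq0 rz.
have s0 := csq_neq0 z; have n2 : (2 : C) != 0 by rewrite pnatr_eq0.
have Re2 w : 0 < Re w -> csq w + csq z != 0.
  move=> /Re_csq_gt0 rw; apply/negP => /eqP /(congr1 (@Re R)); rewrite cReD [RHS]/=.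
  have := Re_csq_gt0 rz; lra.
apply: (@cdiff_near _ (fun w => csq z + (w - z) * (csq w + csq z)^-1) _ _ _ (Re z)) => //.
  move=> w h; have rw : 0 < Re w.
    have := le_lt_trans (ge_Re_cabs (w - z)) h; rewrite cReD cReN ltr_norml; lra.
  have w0 := Re_gt0_neq0 rw.
  have E : (csq w - csq z) * (csq w + csq z) = w - z by rewrite -subr_sqr !csq_sqr.
  by rewrite -E mulfK ?Re2// addrC subrK.
exists (fun w => (csq w + csq z)^-1); split => //.
- apply: ccontV; first exact: Re2.
  by apply: ccontD; [exact: csq_ccont|exact: ccont_cst].
- by rewrite mulr_natl mulr2n.
- by move=> w; rewrite subrr mul0r addr0.
Qed.

Lemma cabs_csq z : z != 0 -> cabs (csq z) = Num.sqrt (cabs z).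
Proof.
move=> z0; rewrite -{2}(csq_sqr z0) cabsX sqrtr_sqr ger0_norm//; exact: cabs_ge0.
Qed.

Lemma cpow_half_sub z n : z != 0 -> cpow z (2^-1 - n%:R) = csq z / z ^+ n.
Proof. by move=> z0; rewrite /csq /cpow mulrBl cexpB cexpMn cexp_clog. Qed.

Lemma clog_iC : clog (iC : C) = ipi / 2.
Proof.
have -> : (ipi / 2 : C) = iC * (pi / 2)%:C.
  by rewrite /ipi -mulrA rmorphM /= fmorphV rmorph_nat.
rewrite /clog cabs_iC ln1 /carg /= mul0r ltNge ler01 /=.
by rewrite acos0; apply: complexP => /=; ring.
Qed.

End Branch.

Global Opaque csq cexp.

(** * Gaussian integrals with complex parameters *)

Section Gauss.
Variable R : realType.
Local Notation piC := ((pi : R)%:C).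
Local Notation C := R[i].
Implicit Types (Y b z w : C).

Lemma cint_opp (a b : R) (F : C -> C) : a <= b -> segc (- b) (- a) F ->
  integ (- b) (- a) F = integ a b (fun z => F (- z)).
Proof.
move=> ab hF; apply: complexP.
  rewrite /= /Rintegral integration_by_substitution_oppr//; last exact: segc_within_Re.
  by congr fine; apply: eq_integral => x _ /=; rewrite rmorphN.
rewrite /= /Rintegral integration_by_substitution_oppr//; last exact: segc_within_Im.
by congr fine; apply: eq_integral => x _ /=; rewrite rmorphN.
Qed.

(** The second-order remainder of [cexp] is uniform on the segment, which permits differentiation
    under the integral sign. *)
Lemma cdiff_integ_exp (a c : R) (p q : C -> C) (P : R) s : a <= c ->
  segc a c p -> segc a c q ->
  (forall x, a <= x <= c -> cabs (p x%:C) <= P) ->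
  (forall x, a <= x <= c -> cabs (q x%:C) <= P) ->
  cdiff (fun s => integ a c (fun z => cexp (s * p z) * q z)) s
    (integ a c (fun z => p z * (cexp (s * p z) * q z))).
Proof.
move=> ac cp cq hp hq; apply/cdiff_epsP => e e0.
have P0 : 0 <= P by rewrite (le_trans (cabs_ge0 (p a%:C)))// hp// lexx.
pose K := expR (cabs s * P) * P * (P ^+ 2 * expR P) * (c - a) + 1.
have K0 : 0 < K.
  rewrite ltr_wpDl// !mulr_ge0 ?expR_ge0 ?exprn_ge0//; lra.
have sE t : segc a c (fun z => cexp (t * p z) * q z).
  move=> x hx; apply: ccontM; last exact: cq.
  apply: (@ccont_comp _ (fun z => t * p z) (@cexp R)).
    by apply: ccontM; [exact: ccont_cst|exact: cp].
  exact: cdiff_ccont (cdiff_cexp _).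
exists (Num.min 1 (e / K)); first by rewrite lt_min ltr01 divr_gt0.
move=> h; rewrite lt_min => /andP[h1 /ltW h2].
have sD : segc a c (fun z => cexp ((s + h) * p z) * q z - cexp (s * p z) * q z).
  apply: segcD => //.
  by move=> x hx; apply: ccontN; exact: sE.
have sp : segc a c (fun z => p z * (cexp (s * p z) * q z)) by apply: segcM.
have shp : segc a c (fun z => h * (p z * (cexp (s * p z) * q z))).
  by apply: segcM => //; exact: segc_cst.
rewrite (mulrC _ h) -(cintZ h sp) -(cintB (sE (s + h)) (sE s)).
rewrite -(cintB sD shp).
have -> : e * cabs h = (e / K * K) * cabs h by rewrite divfK// lt0r_neq0.
have B x : a <= x <= c -> cabs (cexp ((s + h) * p x%:C) * q x%:C - cexp (s * p x%:C) * q x%:C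
    - h * (p x%:C * (cexp (s * p x%:C) * q x%:C))) <= expR (cabs s * P) * P * (P ^+ 2 * expR P) * cabs h ^+ 2.
  move=> hx; have hpx := hp x hx; have hqx := hq x hx.
  have -> : cexp ((s + h) * p x%:C) * q x%:C - cexp (s * p x%:C) * q x%:C
    - h * (p x%:C * (cexp (s * p x%:C) * q x%:C)) =
    cexp (s * p x%:C) * q x%:C * (cexp (h * p x%:C) - 1 - h * p x%:C).
    by rewrite mulrDl cexpD; ring.
  rewrite 2!cabsM -!mulrA; apply: ler_pM; rewrite ?cabs_ge0 ?mulr_ge0 ?cabs_ge0//.
    rewrite cabs_cexp ler_expR (le_trans (ler_norm _))// (le_trans (ge_Re_cabs _))//.
    by rewrite cabsM ler_wpM2l// cabs_ge0.
  apply: ler_pM; rewrite ?cabs_ge0//.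
  rewrite (le_trans (cexp_sub1_sub_le _))// cabsM exprMn.
  have ph : cabs h * cabs (p x%:C) <= P.
    by rewrite -[leRHS]mul1r; apply: ler_pM; rewrite ?cabs_ge0// ltW.
  have p2 : cabs (p x%:C) ^+ 2 <= P ^+ 2 by rewrite lerXn2r ?nnegrE ?cabs_ge0.
  have e2 : expR (cabs h * cabs (p x%:C)) <= expR P by rewrite ler_expR.
  have -> : P * (P * (expR P * cabs h ^+ 2)) = cabs h ^+ 2 * (P ^+ 2 * expR P) by ring.
  rewrite -mulrA ler_wpM2l ?exprn_ge0 ?cabs_ge0//.
  by apply: ler_pM; rewrite ?expR_ge0 ?exprn_ge0 ?cabs_ge0.
apply: (le_trans (@cint_bound _ a c (fun z => cexp ((s + h) * p z) * q z - cexp (s * p z) * q z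
    - h * (p z * (cexp (s * p z) * q z))) _ ac _ B)).
  by move=> x hx; apply: ccontD; [exact: sD|apply: ccontN; exact: shp].
have h0 := cabs_ge0 h.
have K1 : expR (cabs s * P) * P * (P ^+ 2 * expR P) * (c - a) <= K by rewrite /K lerDl.
apply: (@le_trans _ _ (K * cabs h ^+ 2)).
  by rewrite [leLHS]mulrAC ler_wpM2r ?exprn_ge0.
rewrite expr2 mulrA; apply: ler_wpM2r => //; rewrite mulrC.
by apply: ler_wpM2r => //; exact: ltW.
Qed.

Lemma cdiff_quad (al be z : C) :
  cdiff (fun w => cexp (al * w ^+ 2 + be * w)) z (cexp (al * z ^+ 2 + be * z) * (2 * al * z + be)).
Proof.
apply: cdiff_cexp_comp.
have := cdiffD (cdiffZ al (cdiffX 2 z)) (cdiffZ be (cdiff_id z)).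
by rewrite /= expr1 mulr1 (mulrCA al) mulrA.
Qed.

Lemma Re_realM (x : R) z : Re (x%:C * z) = x * Re z.
Proof. by rewrite cReM /= mul0r subr0. Qed.

Lemma real_gauss (e : R) : 0 < e -> exists L0, forall L : R, L0 <= L ->
  cabs (integ (- L) L (fun z => cexp (- z ^+ 2)) - (Num.sqrt pi)%:C) <= e.
Proof.
move=> e0.
have cE (x : R) : ccont (fun z : C => cexp (- z ^+ 2)) x%:C.
  by apply: cdiff_ccont; apply: cdiff_cexp_comp; apply: cdiffN; exact: cdiffX.
have E0 (L : R) : 0 <= L -> integ (- L) L (fun z => cexp (- z ^+ 2)) =
    (2 * gauss_integral_proof.integral0_gauss L)%:C.
  move=> L0.
  have H : integ 0 L (fun z => cexp (- z ^+ 2)) = (gauss_integral_proof.integral0_gauss L)%:C.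
    rewrite /gauss_integral_proof.integral0_gauss.
    have E (x : R) : cexp (- x%:C ^+ 2) = (gauss_fun x)%:C.
      by rewrite -rmorphXn -rmorphN cexp_real.
    rewrite (@eq_cint _ _ _ _ (fun x => (gauss_fun x)%:C)) => [|x _]; last exact: E.
    by apply: complexP => //=; rewrite Rintegral_cst// mul0r.
  rewrite (@cint_cat _ (- L) 0 L (fun z => cexp (- z ^+ 2))) ?oppr_le0//.
  have := @cint_opp 0 L (fun z => cexp (- z ^+ 2)) L0.
  rewrite oppr0 => ->; last by move=> x _; exact: cE.
  under eq_fun do rewrite sqrrN.
  by rewrite H -rmorphD; congr (_%:C); ring.
have cv : gauss_integral_proof.integral0_gauss (x : R) @[x --> +oo] --> Num.sqrt pi / 2.
  have : Num.sqrt (gauss_integral_proof.integral0_gauss (x : R) ^+ 2) @[x --> +oo]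
      --> Num.sqrt (pi / 4).
    apply: continuous_cvg => //; first exact: sqrt_continuous.
    exact: gauss_integral_proof.cvg_integral0_gauss_sqr.
  rewrite sqrtrM ?pi_ge0// sqrtrV// (_ : 4 = 2 ^+ 2); last by rewrite expr2 -natrM.
  rewrite sqrtr_sqr ger0_norm//.
  rewrite (_ : (fun _ => Num.sqrt _) = @gauss_integral_proof.integral0_gauss R)//.
  apply/funext => r; rewrite sqrtr_sqr ger0_norm//.
  exact: gauss_integral_proof.integral0_gauss_ge0.
have e2 : 0 < e / 2 by rewrite divr_gt0.
move/cvgrPdist_le : cv => /(_ _ e2)[M [Mr HM]].
exists (Num.max 0 (M + 1)) => L; rewrite ge_max => /andP[L0 ML].
rewrite E0// -rmorphB cabs_real.
have := HM L ltac:(lra); rewrite !ler_norml; lra.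
Qed.

Lemma segc_quad (al be : C) (a b : R) : segc a b (fun w => cexp (al * w ^+ 2 + be * w)).
Proof. by move=> x _; apply: cdiff_ccont (cdiff_quad _ _ _). Qed.

Lemma expRN_le (x : R) : 0 < x -> expR (- x) <= x^-1.
Proof.
move=> x0; rewrite expRN lef_pV2 ?posrE ?expR_gt0//.
by rewrite (le_trans _ (expR_ge1Dx x))// lerDr.
Qed.

(** [Y] is reached along the segment [Ys] from [1 / pi], where the integral is the real Gauss
    integral. The derivative of [csq (Ys s) * J s] in [s] consists of boundary terms only, and these
    vanish as [L] grows. *)
Lemma gauss0 Y (e : R) : 0 < Re Y -> 0 < e -> exists L0, forall L : R, L0 <= L ->
  cabs (csq Y * integ (- L) L (fun z => cexp (- (piC * Y) * z ^+ 2)) - 1) <= e.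
Proof.
move=> rY e0; have p0 := pi_gt0 R.
pose Y0 : C := (pi^-1)%:C; pose D := Y - Y0.
have pC0 := piC_neq0 R.
(* A lower bound for the real part of [Ys] along the whole deformation. *)
pose c := Num.min pi^-1 (Re Y).
have c0 : 0 < c by rewrite lt_min invr_gt0 p0.
have sc0 : 0 < Num.sqrt c by rewrite sqrtr_gt0.
have csY0 : csq Y0 = ((Num.sqrt pi)^-1)%:C.
  apply: csq_unique; first by rewrite /= invr_gt0 sqrtr_gt0.
  by rewrite -rmorphXn /= exprVn sqr_sqrtr// ltW.
have sp0 : 0 < Num.sqrt pi :> R by rewrite sqrtr_gt0.
have e1 : 0 < e / 2 * Num.sqrt pi by rewrite mulr_gt0 ?divr_gt0.
have [L1 HL1] := real_gauss e1.
pose B := (cabs D + 1) / (Num.sqrt c * pi * c).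
have B0 : 0 < B by rewrite divr_gt0 ?ltr_wpDl ?cabs_ge0// !mulr_gt0.
exists (Num.max (Num.max L1 1) (B / (e / 2))) => L; rewrite !ge_max => /andP[/andP[LL1 L1'] LB].
have L0 : 0 < L by lra.
pose Ys (s : C) := D * s + Y0.
have rYs (x : R) : 0 <= x <= 1 -> c <= Re (Ys x%:C).
  move=> /andP[x0 x1]; rewrite /Ys /D mulrC cReD Re_realM cReD cReN /=.
  have c1 : c <= pi^-1 by rewrite /c ge_min lexx.
  have c2 : c <= Re Y by rewrite /c ge_min lexx orbT.
  rewrite -[c]mul1r -{1}(subrK x 1) mulrDl.
  have -> : x * (Re Y - pi^-1) + pi^-1 = (1 - x) * pi^-1 + x * Re Y by ring.
  by rewrite lerD// ler_wpM2l//; lra.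
pose p z := - (piC * D) * z ^+ 2; pose q (z : C) := cexp (- z ^+ 2).
pose J s := integ (- L) L (fun z => cexp (s * p z) * q z).
have EE s z : cexp (s * p z) * q z = cexp (- (piC * Ys s) * z ^+ 2 + 0 * z).
  have E : piC * Ys s = piC * D * s + 1.
    by rewrite /Ys mulrDr /Y0 -rmorphM /= mulfV ?lt0r_neq0// mulrA.
  by rewrite /q -cexpD /p E; congr cexp; ring.
have sE s : segc (- L) L (fun z => cexp (s * p z) * q z).
  by rewrite (_ : (fun z => _) = fun z => cexp (- (piC * Ys s) * z ^+ 2 + 0 * z)); [exact: segc_quad|exact/funext].
have LN : - L <= L by lra.
have hpL (x : R) : - L <= x <= L -> cabs (p x%:C) <= cabs (piC * D) * L ^+ 2.
  move=> /andP[x0 x1].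
  have -> : cabs (p x%:C) = cabs (piC * D) * cabs x%:C ^+ 2.
    by rewrite /p (cabsM (- _)) cabsN cabsX.
  apply: ler_wpM2l; first exact: cabs_ge0.
  by rewrite lerXn2r ?nnegrE ?cabs_ge0 ?(ltW L0)// cabs_real ler_norml x0.
have hq (x : R) : cabs (q x%:C) <= 1.
  by rewrite /q cabs_cexp -rmorphXn -rmorphN /= -expR0 ler_expR oppr_le0 sqr_ge0.
have dJ s : cdiff J s (integ (- L) L (fun z => p z * (cexp (s * p z) * q z))).
  apply: (@cdiff_integ_exp _ _ _ _ (Num.max 1 (cabs (piC * D) * L ^+ 2))) => //.
  - move=> x _; apply: ccontM; [exact: ccont_cst|exact: cdiff_ccont (cdiffX _ _)].
  - by move=> x _; apply: cdiff_ccont; apply: cdiff_cexp_comp; apply: cdiffN; exact: cdiffX.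
  - by move=> x hx; rewrite le_max hpL// orbT.
  - by move=> x hx; rewrite le_max hq.
(* By parts, with the Gaussian against [z]: the derivative of the square root and that of the
   integral cancel up to the values at [L] and [- L]. *)
have IP s : D * J s + 2 * Ys s * integ (- L) L (fun z => p z * (cexp (s * p z) * q z)) =
    2 * L%:C * D * cexp (- (piC * Ys s) * L%:C ^+ 2).
  have H := @cint_parts _ (- L) L (fun z => cexp (s * p z) * q z) id
     (fun z => (cexp (s * p z) * q z) * (2 * - (piC * Ys s) * z)) (fun=> 1) LN.
  feed H.
    move=> x _; rewrite EE (_ : (fun z => _) = fun z => cexp (- (piC * Ys s) * z ^+ 2 + 0 * z)); last exact/funext.
    by have := cdiff_quad (- (piC * Ys s)) 0 x%:C; rewrite addr0.
  feed H; first by move=> x _; exact: cdiff_id.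
  feed H.
    by apply: segcM => // x _; apply: ccontM; [exact: ccont_cst|exact: ccont_id].
  feed H; first exact: segc_cst.
  have sG : segc (- L) L (fun z => p z * (cexp (s * p z) * q z)).
    by apply: segcM => // x _; apply: ccontM; [exact: ccont_cst|exact: cdiff_ccont (cdiffX _ _)].
  have -> : 2 * Ys s * integ (- L) L (fun z => p z * (cexp (s * p z) * q z)) =
     D * integ (- L) L (fun z => (cexp (s * p z) * q z) * (2 * - (piC * Ys s) * z) * z).
    rewrite -(cintZ _ sG).
    rewrite -(cintZ _ (F := fun z => (cexp (s * p z) * q z) * (2 * - (piC * Ys s) * z) * z)).
      by apply: eq_cint => x _; rewrite /p; ring.
    apply: segcM; last by move=> x _; exact: ccont_id.
    by apply: segcM => // x _; apply: ccontM; [exact: ccont_cst|exact: ccont_id].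
  have -> : J s = integ (- L) L (fun z => (cexp (s * p z) * q z) * 1).
    by apply: eq_cint => x _; rewrite mulr1.
  rewrite H (EE s L%:C) (EE s (- L)%:C) rmorphN sqrrN !mul0r !addr0.
  set X := cexp _; set I := cint _ _ _; ring.
pose F s := csq (Ys s) * J s.
pose F' s := D * (2 * csq (Ys s))^-1 * J s + csq (Ys s) * integ (- L) L (fun z => p z * (cexp (s * p z) * q z)).
have F'E (x : R) : 0 <= x <= 1 -> F' x%:C = L%:C * D * cexp (- (piC * Ys x%:C) * L%:C ^+ 2) / csq (Ys x%:C).
  move=> hx; have rx := rYs x hx; have Y_0 : Ys x%:C != 0.
    by apply: contraTneq rx => ->; rewrite /= -ltNge.
  have := IP x%:C; rewrite -{1}(csq_sqr Y_0) /F'; have := csq_neq0 (Ys x%:C).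
  set r := csq _ => r0.
  set I1 := J _; set I2 := cint _ _ _; set X := cexp _ => h.
  apply: (mulfI (mulf_neq0 (_ : (2 : C) != 0) r0)); first by rewrite pnatr_eq0.
  transitivity (D * I1 + 2 * r ^+ 2 * I2); first by field.
  by rewrite h; field.
have H := @mvt_bound R 0 1 F F' (B / L) ler01.
have {H} : cabs (F 1%:C - F 0%:C) <= B / L * (1 - 0).
  have dF (x : R) : 0 <= x <= 1 -> cdiff F x%:C (F' x%:C).
    move=> hx; have rx := lt_le_trans c0 (rYs x hx).
    rewrite /F' (mulrC D); apply: cdiffM => //.
    exact: (@cdiff_comp _ Ys (@csq R) x%:C _ _ (cdiff_lin D Y0 x%:C) (cdiff_csq rx)).
  apply: H => //.
  - move=> x hx.
    have cJ' : ccont (fun s => integ (- L) L (fun z => p z * (cexp (s * p z) * q z))) x%:C.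
      have {}dJ s : cdiff (fun s => integ (- L) L (fun z => cexp (s * p z) * (p z * q z))) s
         (integ (- L) L (fun z => p z * (cexp (s * p z) * (p z * q z)))).
        apply: (@cdiff_integ_exp (- L) L p (fun z => p z * q z) (cabs (piC * D) * L ^+ 2)) => //.
        - move=> y _; apply: ccontM; [exact: ccont_cst|exact: cdiff_ccont (cdiffX _ _)].
        - move=> y _; apply: ccontM.
            by apply: ccontM; [exact: ccont_cst|exact: cdiff_ccont (cdiffX _ _)].
          by apply: cdiff_ccont; apply: cdiff_cexp_comp; apply: cdiffN; exact: cdiffX.
        - move=> y hy; rewrite (cabsM (p _)) -[leRHS]mulr1.
          by apply: ler_pM; rewrite ?cabs_ge0 ?hpL.
      have := cdiff_ccont (dJ x%:C); congr (ccont _ _); apply/funext => s.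
      by apply: eq_cint => y _; ring.
    have rx := lt_le_trans c0 (rYs x hx).
    have cs : ccont (fun s => csq (Ys s)) x%:C.
      apply: ccont_comp; [exact: cdiff_ccont (cdiff_lin D Y0 x%:C)|exact: csq_ccont].
    apply: ccontD; last exact: ccontM.
    apply: ccontM; last exact: cdiff_ccont (dJ _).
    apply: ccontM; first exact: ccont_cst.
    apply: ccontV; first by rewrite mulf_neq0 ?csq_neq0// pnatr_eq0.
    by apply: ccontM; [exact: ccont_cst|].
  - move=> x hx; rewrite F'E// 3!cabsM cabsV cabs_cexp cabs_real gtr0_norm//.
    have rx := rYs x hx.
    have Y_0 : Ys x%:C != 0 by apply: contraTneq rx => ->; rewrite /= -ltNge.
    have h1 : expR (Re (- (pi%:C * Ys x%:C) * L%:C ^+ 2)) <= (pi * c * L ^+ 2)^-1.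
      apply: (le_trans _ (expRN_le _)); last by rewrite !mulr_gt0// exprn_gt0.
      have -> : - (piC * Ys x%:C) * L%:C ^+ 2 = (- (pi * L ^+ 2))%:C * Ys x%:C.
        by rewrite rmorphN rmorphM rmorphXn /=; ring.
      rewrite ler_expR Re_realM mulNr lerN2 (mulrAC pi c) ler_wpM2l//.
      by rewrite mulr_ge0 ?sqr_ge0// ltW.
    have h2 : (cabs (csq (Ys x%:C)))^-1 <= (Num.sqrt c)^-1.
      rewrite lef_pV2 ?posrE// ?cabs_gt0 ?csq_neq0// cabs_csq// ler_wsqrtr//.
      by rewrite (le_trans rx)// (le_trans (ler_norm _))// ge_Re_cabs.
    have D0 := cabs_ge0 D.
    apply: (@le_trans _ _ (L * (cabs D + 1) * (pi * c * L ^+ 2)^-1 * (Num.sqrt c)^-1)).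
      have L00 := ltW L0.
      apply: ler_pM; rewrite ?invr_ge0 ?cabs_ge0 ?mulr_ge0 ?expR_ge0 ?sqr_ge0//.
      apply: ler_pM; rewrite ?invr_ge0 ?cabs_ge0 ?mulr_ge0 ?expR_ge0//.
      by rewrite ler_pM2l// lerDl.
    rewrite /B le_eqVlt; apply/orP; left; apply/eqP.
    have := lt0r_neq0 p0; move: (pi : R) => P P0; field.
    by rewrite (lt0r_neq0 L0) (lt0r_neq0 c0) (lt0r_neq0 sc0) P0.
rewrite subr0 mulr1 /F /Ys mulr1 subrK mulr0 add0r csY0.
have -> : J 1 = integ (- L) L (fun z => cexp (- (piC * Y) * z ^+ 2)).
  by apply: eq_cint => x _; rewrite EE /Ys mulr1 subrK mul0r addr0.
have -> : J 0 = integ (- L) L (fun z => cexp (- z ^+ 2)).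
  by apply: eq_cint => x _; rewrite mul0r cexp0 mul1r.
set G := cint _ _ _; set G0 := cint _ _ _ => h1.
have h2 := HL1 L LL1.
have h3 : cabs (((Num.sqrt pi)^-1)%:C * G0 - 1) <= e / 2.
  have -> : ((Num.sqrt pi)^-1)%:C * G0 - 1 = ((Num.sqrt pi)^-1)%:C * (G0 - (Num.sqrt pi)%:C).
    rewrite mulrBr -rmorphM mulVf ?lt0r_neq0//.
  rewrite cabsM cabs_real gtr0_norm ?invr_gt0// mulrC ler_pdivrMr//.
have h4 : B / L <= e / 2 by rewrite ler_pdivrMr// mulrC -ler_pdivrMr// divr_gt0.
have := cabsD (csq Y * G - ((Num.sqrt pi)^-1)%:C * G0) (((Num.sqrt pi)^-1)%:C * G0 - 1).
rewrite addrA subrK; lra.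
Qed.

(** A second deformation, now of the linear coefficient [s * b] from 0 to [b]. Multiplied by
    [cexp (- be * s ^+ 2)], which completes the square, the integral again has a derivative made of
    boundary terms. *)
Lemma gauss_ft Y b (e : R) : 0 < Re Y -> 0 < e -> exists L0, forall L : R, L0 <= L ->
  cabs (csq Y * integ (- L) L (fun z => cexp (- (piC * Y) * z ^+ 2 + b * z))
     - cexp (b ^+ 2 / (4 * (piC * Y)))) <= e.
Proof.
move=> rY e0; have p0 := pi_gt0 R.
have pC0 := piC_neq0 R.
have Y_0 := Re_gt0_neq0 rY.
have n2 : (2 : C) != 0 by rewrite pnatr_eq0.
have n4 : (4 : C) != 0 by rewrite pnatr_eq0.
set A : C := piC * Y; have A0 : A != 0 by rewrite mulf_neq0.
have rA : 0 < Re A by rewrite Re_realM mulr_gt0.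
pose be := b ^+ 2 / (4 * A).
have ebe := cexp_neq0 be; have cbe : 0 < cabs (cexp be) by rewrite cabs_gt0.
have e1 : 0 < e / 2 / cabs (cexp be) by rewrite !divr_gt0.
have [L1 HL1] := gauss0 rY e1.
pose B := cabs (csq Y) * expR (cabs be) * (cabs b / cabs A) + 1.
have B0 : 0 < B by rewrite ltr_wpDl// !mulr_ge0 ?invr_ge0 ?cabs_ge0 ?expR_ge0.
(* [L >= (cabs b + 1) / Re A] makes both boundary values of the integrand at most [expR (- L)], for
   every [s] in [0, 1]. *)
exists (Num.max (Num.max L1 1) (Num.max ((cabs b + 1) / Re A) (B / (e / 2 / cabs (cexp be))))) => L.
rewrite !ge_max => /andP[/andP[LL1 L1'] /andP[LA LB]].
have L0 : 0 < L by lra.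
have LN : - L <= L by lra.
pose p z := b * z; pose q z := cexp (- A * z ^+ 2).
have EE s z : cexp (s * p z) * q z = cexp (- A * z ^+ 2 + (s * b) * z).
  by rewrite /q -cexpD /p; congr cexp; ring.
have sE s : segc (- L) L (fun z => cexp (s * p z) * q z).
  by rewrite (_ : (fun z => _) = fun z => cexp (- A * z ^+ 2 + (s * b) * z)); [exact: segc_quad|exact/funext].
have sp : segc (- L) L p by move=> x _; apply: ccontM; [exact: ccont_cst|exact: ccont_id].
pose M s := integ (- L) L (fun z => cexp (s * p z) * q z).
pose M' s := integ (- L) L (fun z => p z * (cexp (s * p z) * q z)).
have hp (x : R) : - L <= x <= L -> cabs (p x%:C) <= cabs b * L.
  by move=> /andP[x0 x1]; rewrite /p cabsM cabs_real ler_wpM2l ?cabs_ge0// ler_norml x0.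
have hq (x : R) : cabs (q x%:C) <= 1.
  rewrite /q cabs_cexp -expR0 ler_expR -rmorphXn mulrC Re_realM cReN.
  by rewrite mulrN oppr_le0 mulr_ge0 ?sqr_ge0// ltW.
have dM s : cdiff M s (M' s).
  apply: (@cdiff_integ_exp _ _ _ _ (Num.max 1 (cabs b * L))) => //.
  - by move=> x _; apply: cdiff_ccont; apply: cdiff_cexp_comp; apply: cdiffZ; exact: cdiffX.
  - by move=> x hx; rewrite le_max hp// orbT.
  - by move=> x hx; rewrite le_max hq.
pose W s := cexp (- A * L%:C ^+ 2 + (s * b) * L%:C) - cexp (- A * L%:C ^+ 2 - (s * b) * L%:C).
have M'E s : M' s = (s * b ^+ 2 * M s - b * W s) / (2 * A).
  have H := @cint_FTC _ (- L) L (fun z => (cexp (s * p z) * q z) * (2 * - A * z + s * b)) (fun z => cexp (s * p z) * q z) LN.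
  feed H.
    move=> x _; rewrite EE (_ : (fun z => _) = fun z => cexp (- A * z ^+ 2 + (s * b) * z)); last exact/funext.
    exact: cdiff_quad.
  feed H.
    apply: segcM => //; apply: segcD; last exact: segc_cst.
    by move=> x _; apply: ccontM; [exact: ccont_cst|exact: ccont_id].
  move: H; rewrite (EE s L%:C) (EE s (- L)%:C) rmorphN sqrrN (mulrN (s * b) L%:C) -/(W s).
  have -> : integ (- L) L (fun z => (cexp (s * p z) * q z) * (2 * - A * z + s * b)) =
     integ (- L) L (fun z => cexp (s * p z) * q z * (2 * - A * z)) + s * b * M s.
    rewrite -cintZ// -(cintD (F := fun z => cexp (s * p z) * q z * (2 * - A * z)) (G := fun z => s * b * (cexp (s * p z) * q z))).
    + by apply: eq_cint => x _; ring.
    + by apply: segcM => // x _; apply: ccontM; [exact: ccont_cst|exact: ccont_id].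
    + by apply: segcM => //; exact: segc_cst.
  move=> <-.
  have -> : M' s = - (b / (2 * A)) * integ (- L) L (fun z => cexp (s * p z) * q z * (2 * - A * z)).
    rewrite -(cintZ _ (F := fun z => cexp (s * p z) * q z * (2 * - A * z))).
      by apply: eq_cint => x _; rewrite /p; field; rewrite A0.
    by apply: segcM => // x _; apply: ccontM; [exact: ccont_cst|exact: ccont_id].
  by field; rewrite A0.
pose F s := csq Y * (cexp (- be * s ^+ 2) * M s).
pose F' s := - (csq Y * cexp (- be * s ^+ 2) * (b * W s / (2 * A))).
have dF s : cdiff F s (F' s).
  have d1 : cdiff (fun s => cexp (- be * s ^+ 2)) s (cexp (- be * s ^+ 2) * (- be * (2 * s))).
    by apply: cdiff_cexp_comp; apply: cdiffZ; have := cdiffX 2 s; rewrite /= expr1.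
  have := cdiffZ (csq Y) (cdiffM d1 (dM s)); rewrite M'E /F' /be; congr cdiff.
  by field; rewrite A0.
have cF' s : ccont F' s.
  have cq (al ga : C) : ccont (fun s : C => cexp (al + s * b * ga)) s.
    apply: (@ccont_comp _ (fun s : C => al + s * b * ga) (@cexp R)); last exact: cdiff_ccont (cdiff_cexp _).
    apply: ccontD; first exact: ccont_cst.
    apply: ccontM; last exact: ccont_cst.
    by apply: ccontM; [exact: ccont_id|exact: ccont_cst].
  apply: ccontN; apply: ccontM.
    apply: ccontM; first exact: ccont_cst.
    by apply: cdiff_ccont; apply: cdiff_cexp_comp; apply: cdiffZ; exact: cdiffX.
  apply: ccontM; last exact: ccont_cst.
  apply: ccontM; first exact: ccont_cst.
  apply: ccontD; first exact: cq.
  apply: ccontN; have := cq (- A * L%:C ^+ 2) (- L%:C); congr (ccont _ _).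
  by apply/funext => w; rewrite mulrN.
have H := @mvt_bound R 0 1 F F' (B / L) ler01.
have {H} : cabs (F 1%:C - F 0%:C) <= B / L * (1 - 0).
  apply: H => [x _|x _|x /andP[x0 x1]]; [exact: dF|exact: cF'|].
  rewrite /F' cabsN 4!cabsM cabsV cabsM cabs_nat.
  have h1 : cabs (cexp (- be * x%:C ^+ 2)) <= expR (cabs be).
    rewrite cabs_cexp ler_expR (le_trans (ler_norm _))// (le_trans (ge_Re_cabs _))//.
    by rewrite cabsM cabsN cabsX cabs_real ler_piMr ?cabs_ge0// ger0_norm// exprn_ile1.
  have hE (sg : C) : cabs sg = 1 -> cabs (cexp (- A * L%:C ^+ 2 + sg * (x%:C * b * L%:C))) <= L^-1.
    move=> sg1; rewrite cabs_cexp (le_trans _ (expRN_le L0))// ler_expR cReD -rmorphXn mulrC Re_realM cReN.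
    have h : Re (sg * (x%:C * b * L%:C)) <= cabs b * L.
      rewrite (le_trans (ler_norm _))// (le_trans (ge_Re_cabs _))// !cabsM sg1 mul1r !cabs_real.
      by rewrite (ger0_norm x0) (gtr0_norm L0) (ler_wpM2r (ltW L0))// ler_piMl// cabs_ge0.
    move: LA; rewrite ler_pdivrMr// => LA.
    have : (cabs b + 1) * L <= L * Re A * L by rewrite ler_wpM2r// ltW.
    lra.
  have h2 : cabs (W x%:C) <= 2 / L.
    rewrite /W (le_trans (cabsD _ _))// cabsN.
    have := hE 1 (cabs1 R); have := hE (-1); rewrite cabsN cabs1 mul1r mulN1r => /(_ erefl); lra.
  have bA : 0 <= cabs b / cabs A by rewrite divr_ge0// cabs_ge0.
  have cA : 0 < cabs A by rewrite cabs_gt0.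
  apply: (@le_trans _ _ (cabs (csq Y) * expR (cabs be) * (cabs b * (2 / L) / (2 * cabs A)))).
    rewrite ler_pM ?mulr_ge0 ?invr_ge0 ?mulr_ge0 ?cabs_ge0//.
      by rewrite ler_wpM2l ?cabs_ge0.
    by rewrite ler_wpM2r ?invr_ge0 ?mulr_ge0 ?cabs_ge0// ler_wpM2l ?cabs_ge0.
  apply: (@le_trans _ _ (cabs (csq Y) * expR (cabs be) * (cabs b / cabs A) / L)).
    apply: eq_ler; field.
    by rewrite !lt0r_neq0.
  by rewrite ler_wpM2r ?invr_ge0 ?ltW// /B ltrDl.
rewrite subr0 mulr1 /F expr1n mulr1 expr0n mulr0 cexp0 mul1r.
have -> : M 1 = integ (- L) L (fun z => cexp (- A * z ^+ 2 + b * z)).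
  by apply: eq_cint => x _; rewrite EE mul1r.
have -> : M 0 = integ (- L) L (fun z => cexp (- A * z ^+ 2)).
  by apply: eq_cint => x _; rewrite mul0r cexp0 mul1r.
set G := cint _ _ _; set G0 := cint _ _ _ => h1.
have h2 := HL1 L LL1; rewrite -/A -/G0 in h2.
rewrite -/be.
have h4 : B / L <= e / 2 / cabs (cexp be).
  by rewrite ler_pdivrMr// mulrC -ler_pdivrMr.
have := cabsD (csq Y * (cexp (- be) * G) - csq Y * G0) (csq Y * G0 - 1).
rewrite addrA subrK => h5.
have -> : csq Y * G - cexp be = cexp be * (csq Y * (cexp (- be) * G) - 1).
  by rewrite cexpN; field.
rewrite cabsM mulrC -ler_pdivlMr//; lra.
Qed.

End Gauss.

(** * Infinite products and the triple product *)

Section Products.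
Variable R : realType.
Local Notation C := R[i].
Implicit Types (u : nat -> C) (q z w : C).

(** From [N] on, [M * r ^+ n <= 1 / 2], so the terms decay like [2^-1 ^+ n]; the constant [c] pays
    for the finitely many earlier ones. *)
Lemma quad_summable (r M : R) p : 0 <= r -> r < 1 -> 0 <= M ->
  rsummable (fun n => n.+1%:R ^+ p * (M ^+ n * r ^+ (n * n))).
Proof.
move=> r0 r1 M0.
have h0 : 0 < (2 * (M + 1))^-1 by rewrite invr_gt0; lra.
have [N HN] := exprn_cvg0 r0 r1 h0.
have {}HN := HN N (leqnn N).
pose c := (2 * (M + 1)) ^+ N.
have c0 : 0 <= c by rewrite exprn_ge0//; lra.
have H n : M ^+ n * r ^+ (n * n) <= c * 2^-1 ^+ n.
  have [Nn|nN] := leqP N n.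
    apply: (@le_trans _ _ (2^-1 ^+ n)); last first.
      by rewrite ler_peMl ?exprn_ge0// exprn_ege1//; lra.
    rewrite exprM -exprMn lerXn2r ?nnegrE ?mulr_ge0 ?exprn_ge0//.
    have h : r ^+ n <= r ^+ N by rewrite ler_wiXn2l// ltW.
    have {}h := le_trans h HN.
    apply: (@le_trans _ _ ((M + 1) * (2 * (M + 1))^-1)).
      by rewrite ler_pM ?exprn_ge0//; lra.
    by apply: eq_ler; field; lra.
  have h1 : M ^+ n * r ^+ (n * n) <= (M + 1) ^+ N.
    rewrite -[leRHS]mulr1 ler_pM ?exprn_ge0//; last by rewrite exprn_ile1// ltW.
    apply: (@le_trans _ _ ((M + 1) ^+ n)); first by rewrite lerXn2r ?nnegrE//; lra.
    by rewrite ler_weXn2l ?(ltnW nN)//; lra.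
  apply: (le_trans h1); rewrite /c exprMn mulrAC -[leLHS]mul1r.
  rewrite ler_wpM2r ?exprn_ge0//; first lra.
  by rewrite exprVn ler_pdivlMr ?exprn_gt0// mul1r ler_weXn2l ?(ltnW nN)//; lra.
apply: rsummable_le (_ : forall n, _ <= c * (n.+1%:R ^+ p * 2^-1 ^+ n)) _.
  by move=> n; rewrite (mulrCA c) ler_wpM2l ?exprn_ge0.
by apply: rsummableZ => //; apply: natX_geom_summable; lra.
Qed.

Lemma prod_1D_le (v : nat -> R) n : (forall j, 0 <= v j) ->
  \prod_(j < n) (1 + v j) <= expR (\sum_(j < n) v j).
Proof.
move=> v0; rewrite expR_sum; apply: ler_prod => j _.
by rewrite expR_ge1Dx andbT addr_ge0.
Qed.

Lemma prod_1B_ge (v : nat -> R) J n : (forall j, 0 <= v j) ->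
  (forall m, \sum_(J <= j < m) v j <= 2^-1) ->
  1 - \sum_(J <= j < n) v j <= \prod_(J <= j < n) (1 - v j).
Proof.
move=> v0 hs; elim: n => [|n IH]; first by rewrite !big_geq ?subr0.
have [Jn|nJ] := leqP J n; last by rewrite !big_geq ?subr0.
rewrite !big_nat_recr//=.
have h1 : v n <= 2^-1.
  apply: le_trans (hs n.+1); rewrite big_nat_recr//= lerDr sumr_ge0//.
have s0 : 0 <= \sum_(J <= j < n) v j by rewrite sumr_ge0.
set S := \sum_(J <= j < n) v j in IH s0 *; set P := \prod_(J <= j < n) _ in IH *.
have := v0 n; have : (1 - S) * (1 - v n) <= P * (1 - v n) by rewrite ler_wpM2r//; lra.
nra.
Qed.

Lemma cprod_bound u (B : R) : (forall n, \sum_(j < n) cabs (u j) <= B) ->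
  forall n, cabs (\prod_(j < n) (1 + u j)) <= expR B.
Proof.
move=> hB n; rewrite cabs_prod.
apply: (@le_trans _ _ (\prod_(j < n) (1 + cabs (u j)))).
  apply: ler_prod => j _; rewrite cabs_ge0 /=.
  by rewrite (le_trans (cabsD _ _))// cabs1.
rewrite (le_trans (prod_1D_le n (fun j => cabs_ge0 (u j))))// ler_expR//.
Qed.

Lemma cprod_cvg u : csummable u -> exists p, ccvg (fun n => \prod_(j < n) (1 + u j)) p.
Proof.
move=> [B HB]; pose p n := \prod_(j < n) (1 + u j).
have sd : csummable (fun n => p n.+1 - p n).
  apply: rsummable_le (_ : forall n, _ <= expR B * cabs (u n)) _.
    move=> n; rewrite /p big_ord_recr /= -{2}[\prod_(j < n) _]mulr1 -mulrBr addrAC subrr add0r.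
    by rewrite (cabsM (\prod_(j < n) _)) ler_wpM2r ?cabs_ge0// cprod_bound.
  by apply: rsummableZ; [exact: expR_ge0|exists B].
exists (1 + cser (fun n => p n.+1 - p n)).
rewrite (_ : (fun n => _) = fun n => 1 + \sum_(j < n) (p j.+1 - p j)).
  by apply: ccvgD; [exact: ccvg_cst|exact: cser_cvg].
apply/funext => n; elim: n => [|n IH]; first by rewrite !big_ord0 addr0.
by rewrite [in RHS]big_ord_recr /= addrA -IH addrC subrK.
Qed.

(** Beyond [J] the tail of the sum is at most 1/2, so the remaining factors multiply to at least 1/2
    in modulus; the earlier partial products are finitely many nonzero numbers. *)
Lemma cprod_lower u : csummable u -> (forall j, 1 + u j != 0) ->
  exists2 m : R, 0 < m & forall n, m <= cabs (\prod_(j < n) (1 + u j)).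
Proof.
move=> su nz.
have h0 : 0 < 2^-1 :> R by rewrite invr_gt0.
have [J HJ] := rsummable_tail (fun j => cabs_ge0 (u j)) su h0.
have low n : (J <= n)%N -> cabs (\prod_(j < J) (1 + u j)) / 2 <= cabs (\prod_(j < n) (1 + u j)).
  pose v j := 1 + u j.
  have E k : \prod_(j < k) (1 + u j) = \prod_(0 <= j < k) v j by rewrite big_mkord.
  move=> Jn; rewrite !E [X in _ <= cabs X](big_cat_nat (n := J))//= (cabsM (\prod_(0 <= i < J) _)).
  rewrite ler_wpM2l ?cabs_ge0// cabs_prod.
  have h := prod_1B_ge n (fun j => cabs_ge0 (u j)) HJ.
  apply: (@le_trans _ _ (\prod_(J <= j < n) (1 - cabs (u j)))); first by have := HJ n; lra.
  rewrite big_nat_cond [leRHS]big_nat_cond; apply: ler_prod => j /andP[/andP[Jj jn] _].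
  have h1 : cabs (u j) <= 2^-1.
    apply: le_trans (HJ j.+1); rewrite big_nat_recr//= lerDr sumr_ge0// => i _; exact: cabs_ge0.
  apply/andP; split; first lra.
  have := cabsD (1 + u j) (- u j); rewrite addrK cabsN cabs1; lra.
have pos n : 0 < cabs (\prod_(j < n) (1 + u j)).
  by rewrite cabs_gt0; apply/prodf_neq0 => j _.
have [m m0 Hm] : exists2 m : R, 0 < m & forall n, (n <= J)%N -> m <= cabs (\prod_(j < n) (1 + u j)).
  elim: (J) => [|K [m m0 Hm]].
    by exists 1 => // n; rewrite leqn0 => /eqP ->; rewrite big_ord0 cabs1.
  exists (Num.min m (cabs (\prod_(j < K.+1) (1 + u j)))); first by rewrite lt_min m0 pos.
  move=> n; rewrite leq_eqVlt => /predU1P[->|]; first by rewrite ge_min lexx orbT.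
  by rewrite ltnS => /Hm h; rewrite ge_min h.
exists (Num.min m (cabs (\prod_(j < J) (1 + u j)) / 2)); first by rewrite lt_min m0 divr_gt0.
move=> n; have [/low h|/ltnW /Hm h] := leqP J n; rewrite ge_min h ?orbT//.
Qed.

Section Qpoch.
Variable q : C.
Hypothesis q1 : cabs q < 1.

Lemma geomZ_summable a : csummable (fun j => - (a * q ^+ j)).
Proof.
apply: rsummable_le (_ : forall j, _ <= cabs a * cabs q ^+ j) _.
  by move=> j; rewrite cabsN cabsM cabsX.
apply: rsummableZ; first exact: cabs_ge0.
by apply: geom_summable => //; exact: cabs_ge0.
Qed.

Lemma qpoch_cvg a : ccvg (fun n => \prod_(j < n) (1 - a * q ^+ j)) (qpoch a q).
Proof.
by have [p hp] := cprod_cvg (geomZ_summable a); rewrite /qpoch (ccvg_lim hp).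
Qed.

Lemma qpoch_neq0 a : (forall j, 1 - a * q ^+ j != 0) -> qpoch a q != 0.
Proof.
move=> nz; have [m m0 Hm] := cprod_lower (geomZ_summable a) nz.
rewrite -cabs_gt0 (lt_le_trans m0)//.
have h := qpoch_cvg a.
rewrite leNgt; apply/negP => lt; pose e := (m - cabs (qpoch a q)) / 2.
have [|N /(_ N (leqnn N))] := h e; first by rewrite /e; lra.
have := Hm N; have := cabsD (\prod_(j < N) (1 - a * q ^+ j) - qpoch a q) (qpoch a q).
rewrite subrK /e; lra.
Qed.

Lemma qX_neq1 j : 1 - q ^+ j.+1 != 0.
Proof.
rewrite subr_eq0 eq_sym; apply/negP => /eqP /(congr1 (@cabs R)).
rewrite cabsX cabs1 => h; have : cabs q ^+ j.+1 < 1 by rewrite exprn_ilt1// cabs_ge0.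
by rewrite h ltxx.
Qed.

Lemma qq_neq0 : qpoch q q != 0.
Proof. by apply: qpoch_neq0 => j; rewrite -exprS; exact: qX_neq1. Qed.

Definition qfac k := \prod_(j < k) (1 - q ^+ j.+1).

Lemma qfac_neq0 k : qfac k != 0.
Proof. by apply/prodf_neq0 => j _; exact: qX_neq1. Qed.

Lemma qfacS k : qfac k.+1 = qfac k * (1 - q ^+ k.+1).
Proof. by rewrite /qfac big_ord_recr. Qed.

Lemma qfac_cvg : ccvg qfac (qpoch q q).
Proof.
have := qpoch_cvg q; congr ccvg; apply/funext => n.
by apply: eq_bigr => j _; rewrite exprS.
Qed.

Lemma qfac_bounds : exists B : R, forall k, cabs (qfac k) <= B /\ cabs (qfac k)^-1 <= B.
Proof.
have nz j : 1 + - (q * q ^+ j) != 0 by rewrite -exprS; exact: qX_neq1.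
have E k : qfac k = \prod_(j < k) (1 + - (q * q ^+ j)) by apply: eq_bigr => j _; rewrite exprS.
have [m m0 Hm] := cprod_lower (geomZ_summable q) nz.
have [B HB] := geomZ_summable q.
exists (Num.max (expR B) m^-1) => k; have hb := @cprod_bound (fun j => - (q * q ^+ j)) B HB k; rewrite -E in hb.
rewrite !le_max hb; split=> //.
by rewrite E cabsV lef_pV2 ?posrE ?Hm ?orbT// -E cabs_gt0 qfac_neq0.
Qed.

(* 1/(q;q)_k, extended by zero to negative k so that [rfacS] holds throughout. *)
Definition rfac (k : int) := if k is Posz k' then (qfac k')^-1 else 0.

Lemma rfacS (k : int) : (1 - q ^ (k + 1)) * rfac (k + 1) = rfac k.
Proof.
case: k => [k|[|k]].
- rewrite -PoszD addn1 /= qfacS -exprnP; field.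
  by rewrite qfac_neq0 qX_neq1.
- by rewrite /= expr0z subrr mul0r.
- by rewrite NegzE -addn1 PoszD opprD subrK -NegzE /= mulr0.
Qed.

Variable w : C.
Hypothesis w0 : w != 0.

(** The Dirichlet kernel, [(w^(n + 1/2) - w^(- n - 1/2)) / (w^(1/2) - w^(-1/2))], in a form regular
    at [w = 1]. *)
Definition dker n : C := 1 + \sum_(i < n) (w ^+ i.+1 + w^-1 ^+ i.+1).

Lemma dker0 : dker 0 = 1. Proof. by rewrite /dker big_ord0 addr0. Qed.

Lemma dkerS n : dker n.+1 = dker n + (w ^+ n.+1 + w^-1 ^+ n.+1).
Proof. by rewrite /dker big_ord_recr /= addrA. Qed.

Lemma dker_mul0 : (w + w^-1) * dker 0 = dker 1 - dker 0.
Proof. by rewrite dkerS dker0 !expr1; ring. Qed.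

Lemma dker_mul n : (w + w^-1) * dker n.+1 = dker n.+2 + dker n.
Proof.
elim: n => [|n IH]; first by rewrite !dkerS dker0 !expr1; field.
rewrite [in LHS]dkerS mulrDr IH (dkerS n.+2) (dkerS n).
have wu : w * w^-1 = 1 by rewrite mulfV.
set u := w^-1 in wu *.
transitivity (dker n.+2 + dker n + (w ^+ n.+3 + u ^+ n.+3 + (w * u) * (w ^+ n.+1 + u ^+ n.+1))).
  by rewrite !exprS; ring.
by rewrite wu; ring.
Qed.

(** The value [- c 0] at index -1 reflects that [dker] extends to index -1 by [- dker 0], as
    [dker_mul0] shows. *)
Definition cprev (c : nat -> C) (n : nat) := if n is m.+1 then c m else - c 0%N.

Lemma dker_green (c : nat -> C) K :
  \sum_(n < K.+1) c n * ((w + w^-1) * dker n) =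
  \sum_(n < K.+1) (cprev c n + c n.+1) * dker n
   + c K * dker K.+1 - c K.+1 * dker K.
Proof.
elim: K => [|K IH]; first by rewrite !big_ord_recl !big_ord0 /= dker_mul0 /cprev; ring.
rewrite big_ord_recr [in RHS]big_ord_recr /= IH dker_mul; ring.
Qed.

(** [(-1)^n q^(n (n + 1) / 2)] times the Gaussian binomial coefficient of [2 N + 1] over [N - n]. *)
Definition jtc N n : C := (-1) ^+ n * q ^+ 'C(n.+1, 2) * qfac (2 * N).+1 *
  rfac (N%:Z - n%:Z) * rfac (N + n).+1%:Z.

Lemma jtc_eq0 N n : (N < n)%N -> jtc N n = 0.
Proof.
move=> Nn; rewrite /jtc (_ : N%:Z - n%:Z = Negz (n - N).-1) ?mulr0 ?mul0r//.
by rewrite NegzE; lia.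
Qed.

Lemma jtcS N n : q != 0 -> jtc N.+1 n = (1 + q ^+ N.+1 ^+ 2) * jtc N n
   - q ^+ N.+1 * (cprev (jtc N) n + jtc N n.+1).
Proof.
move=> q0.
pose r1 := rfac (N.+1%:Z - n%:Z); pose r2 := rfac (N + n).+2%:Z.
pose Q := q ^+ N.+1; pose a := q ^ (N.+1%:Z - n%:Z); pose b := q ^+ (N + n).+2.
have abE : a * b = Q ^+ 2 * q.
  rewrite /a /b /Q -exprM -exprSr -[q ^+ (N + n).+2]/(q ^ ((N + n).+2 : int)).
  by rewrite -expfzDr// -[RHS]/(q ^ ((N.+1 * 2).+1 : int)); congr (_ ^ _); lia.
have e1 : rfac (N%:Z - n%:Z) = (1 - a) * r1.
  by rewrite -rfacS /a /r1 (_ : N%:Z - n%:Z + 1 = N.+1%:Z - n%:Z)//; lia.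
have e2 : rfac (N + n).+1%:Z = (1 - b) * r2.
  by rewrite -rfacS -PoszD addn1.
have e3 : rfac (N%:Z - n.+1%:Z) = (1 - a / q) * ((1 - a) * r1).
  rewrite -e1 -rfacS (_ : N%:Z - n.+1%:Z + 1 = N%:Z - n%:Z); last by lia.
  congr ((1 - _) * _); rewrite /a -[q^-1]/(q ^ (-1 : int)) -expfzDr//; congr (_ ^ _); lia.
have e4 : (N + n.+1).+1 = (N + n).+2 by lia.
have f1 : qfac (2 * N.+1).+1 = qfac (2 * N).+1 * ((1 - Q ^+ 2) * (1 - Q ^+ 2 * q)).
  rewrite (_ : (2 * N.+1).+1 = (2 * N).+3); last by lia.
  have -> : Q ^+ 2 = q ^+ (2 * N).+2 by rewrite /Q -exprM; congr (_ ^+ _); lia.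
  by rewrite -exprSr 2!qfacS mulrA.
(* The recursion in [N] is a rational identity in [a], [b] and [q], with [Q ^+ 2] eliminated by
   [a * b = Q ^+ 2 * q]. *)
have key : (1 - Q ^+ 2) * (1 - Q ^+ 2 * q) = (1 + Q ^+ 2) * (1 - a) * (1 - b)
   + a * (1 - b / q) * (1 - b) + b * (1 - a / q) * (1 - a).
  have -> : b = Q ^+ 2 * q / a by rewrite -abE mulrAC mulfV ?mul1r// /a expfz_neq0.
  by field; rewrite q0 /a expfz_neq0.
have Qa : Q * q ^+ n.+1 = b by rewrite /Q /b -exprD; congr (q ^+ _); lia.
have Cn : q ^+ 'C(n.+2, 2) = q ^+ 'C(n.+1, 2) * q ^+ n.+1 by rewrite binS bin1 exprD mulrC.
have g1 : jtc N.+1 n = (-1) ^+ n * q ^+ 'C(n.+1, 2) * qfac (2 * N).+1 * (r1 * r2) *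
    ((1 - Q ^+ 2) * (1 - Q ^+ 2 * q)).
  by rewrite /jtc f1 (_ : (N.+1 + n).+1 = (N + n).+2) -/r1 -/r2; [ring|lia].
have g2 : Q * jtc N n.+1 = - ((-1) ^+ n * q ^+ 'C(n.+1, 2) * qfac (2 * N).+1 * (r1 * r2) *
    (b * (1 - a / q) * (1 - a))).
  by rewrite /jtc e3 e4 -/r2 Cn exprS -Qa; ring.
have g0 : jtc N n = (-1) ^+ n * q ^+ 'C(n.+1, 2) * qfac (2 * N).+1 * (r1 * r2) *
    ((1 - a) * (1 - b)).
  by rewrite /jtc e1 e2; ring.
have g3 : Q * cprev (jtc N) n =
   - ((-1) ^+ n * q ^+ 'C(n.+1, 2) * qfac (2 * N).+1 * (r1 * r2) * (a * (1 - b / q) * (1 - b))).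
  case: n @r1 @r2 @a @b abE e1 e2 e3 e4 key Qa Cn g1 g2 g0 => [|m] r1 r2 a b abE e1 e2 e3 e4 key Qa Cn g1 g2 g0.
    have aQ : a = Q by rewrite /a subr0.
    have bq : b / q = Q by rewrite /b addn0 exprSr mulfK.
    by rewrite mulrN g0 -aQ bq aQ; congr (- _); ring.
  have h1 : rfac (N%:Z - m%:Z) = r1 by rewrite /r1; congr rfac; lia.
  have h2 : rfac (N + m).+1%:Z = (1 - b / q) * ((1 - b) * r2).
    rewrite -e2 (_ : (N + m.+1).+1 = (N + m).+2); last by lia.
    rewrite -(rfacS (N + m).+1%:Z) -PoszD addn1; congr ((1 - _) * _).
    by rewrite /b -exprnP (_ : (N + m.+1).+2 = ((N + m).+2).+1) ?(exprSr _ (N + m).+2) ?mulfK// addnS.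
  have h3 : Q * q ^+ 'C(m.+1, 2) = a * q ^+ 'C(m.+2, 2).
    have -> : q ^+ 'C(m.+2, 2) = q ^+ 'C(m.+1, 2) * q ^+ m.+1 by rewrite binS bin1 exprD mulrC.
    suff <- : a * q ^+ m.+1 = Q by ring.
    rewrite /a /Q -[q ^+ m.+1]/(q ^ (m.+1 : int)) -expfzDr//.
    by rewrite -[RHS]/(q ^ (N.+1 : int)); congr (_ ^ _); lia.
  rewrite [cprev _ _]/= /jtc h1 h2.
  transitivity ((-1) ^+ m * (Q * q ^+ 'C(m.+1, 2)) * qfac (2 * N).+1 * (r1 * r2) * ((1 - b / q) * (1 - b))).
    by ring.
  by rewrite h3 exprS; ring.
rewrite mulrDr -/Q g1 g3 g2 g0 key; ring.
Qed.

(** The two new factors multiply to [1 + Q ^+ 2 - Q * (w + w^-1)] with [Q = q ^+ N.+1].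
    Multiplication by [w + w^-1] acts on coefficients through [dker_green], and [jtcS] is the
    resulting recursion. *)
Lemma finite_jtp N : q != 0 ->
  \prod_(j < N) ((1 - w * q ^+ j.+1) * (1 - w^-1 * q ^+ j.+1)) = \sum_(n < N.+1) jtc N n * dker n.
Proof.
move=> q0; elim: N => [|N IH].
  rewrite big_ord0 big_ord_recl big_ord0 dker0 /jtc /= /qfac !big_ord_recl !big_ord0 /=.
  by field; rewrite -[X in 1 - X]expr1 qX_neq1.
rewrite big_ord_recr /= IH.
have -> : \sum_(n < N.+1) jtc N n * dker n = \sum_(n < N.+2) jtc N n * dker n.
  by rewrite [RHS]big_ord_recr /= jtc_eq0// mul0r addr0.
have -> : (1 - w * q ^+ N.+1) * (1 - w^-1 * q ^+ N.+1) =
    (1 + q ^+ N.+1 ^+ 2) - q ^+ N.+1 * (w + w^-1) by field.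
rewrite mulrBr !mulr_suml.
have -> : \sum_(i < N.+2) jtc N i * dker i * (q ^+ N.+1 * (w + w^-1)) =
  q ^+ N.+1 * \sum_(i < N.+2) jtc N i * ((w + w^-1) * dker i).
  by rewrite mulr_sumr; apply: eq_bigr => i _; ring.
rewrite dker_green (jtc_eq0 (ltnSn N)) (jtc_eq0 (ltnW (ltnSn N.+1))) !mul0r subr0 addr0.
rewrite mulr_sumr -sumrB; apply: eq_bigr => i _.
by rewrite jtcS//; ring.
Qed.

Lemma jtc_cvg n : ccvg (fun N => jtc N n) ((-1) ^+ n * q ^+ 'C(n.+1, 2) / qpoch q q).
Proof.
have h := ccvgV qq_neq0 qfac_cvg.
have h1 : ccvg (fun N => qfac (2 * N).+1) (qpoch q q).
  by apply: (ccvg_sub (f := fun N => (2 * N).+1)) qfac_cvg => N; lia.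
have h2 : ccvg (fun N => rfac (N + n).+1%:Z) (qpoch q q)^-1.
  by apply: (ccvg_sub (f := fun N => (N + n).+1)) h => N; lia.
have h3 : ccvg (fun N => rfac (N%:Z - n%:Z)) (qpoch q q)^-1.
  move=> e /h[N HN]; exists (N + n)%N => m mN.
  rewrite (_ : m%:Z - n%:Z = (m - n)%N%:Z); last by lia.
  by apply: HN; lia.
have := ccvgM (ccvgM (ccvgZ ((-1) ^+ n * q ^+ 'C(n.+1, 2)) h1) h3) h2.
have E : forall c p : C, p != 0 -> c * p / p / p = c / p by move=> c p p0; field.
by rewrite E ?qq_neq0.
Qed.

Lemma dker_bound n : cabs (dker n) <= 2 * (n.+1%:R * (cabs w + cabs w^-1 + 1) ^+ n).
Proof.
set M := _ + 1; have M1 : 1 <= M by rewrite /M lerDr addr_ge0 ?cabs_ge0.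
have wM : cabs w <= M by rewrite /M -addrA lerDl addr_ge0 ?cabs_ge0.
have wM' : cabs w^-1 <= M by rewrite /M -addrA addrCA lerDl addr_ge0 ?cabs_ge0.
elim: n => [|n IH]; first by rewrite dker0 cabs1 expr0; lra.
rewrite dkerS (le_trans (cabsD _ _))//.
have h : cabs (w ^+ n.+1 + w^-1 ^+ n.+1) <= 2 * M ^+ n.+1.
  rewrite (le_trans (cabsD _ _))// !cabsX mulr_natl mulr2n lerD// lerXn2r ?nnegrE ?cabs_ge0//; lra.
have h2 : M ^+ n <= M ^+ n.+1 by rewrite ler_weXn2l.
have h3 : 2 * (n.+1%:R * M ^+ n) <= 2 * (n.+1%:R * M ^+ n.+1) by rewrite !ler_wpM2l.
have -> : 2 * (n.+2%:R * M ^+ n.+1) = 2 * (n.+1%:R * M ^+ n.+1) + 2 * M ^+ n.+1.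
  by rewrite -(natr1 n.+1); ring.
lra.
Qed.

Lemma jac_summable : csummable (fun n => (-1) ^+ n * q ^+ 'C(n.+1, 2) * dker n).
Proof.
pose r := Num.sqrt (cabs q).
have r0 : 0 <= r := sqrtr_ge0 _.
have r1 : r < 1 by rewrite -sqrtr1 ltr_sqrt.
pose M := cabs w + cabs w^-1 + 1.
apply: rsummable_le (_ : forall n, _ <= 2 * (n.+1%:R ^+ 1 * (M ^+ n * r ^+ (n * n)))) _; last first.
  apply: rsummableZ => //; apply: quad_summable => //.
  by rewrite /M !addr_ge0 ?cabs_ge0.
move=> n; rewrite cabsM cabsM !cabsX cabsN cabs1 expr1n mul1r mulrC.
rewrite (le_trans (ler_wpM2r _ (dker_bound n))) ?exprn_ge0 ?cabs_ge0// -/M expr1.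
rewrite -!mulrA !ler_wpM2l// ?exprn_ge0 ?/M ?addr_ge0 ?cabs_ge0//.
rewrite -(sqr_sqrtr (cabs_ge0 q)) -/r -exprM; apply: ler_wiXn2l => //; first exact: ltW.
have -> : (2 * 'C(n.+1, 2) = n.+1 * n)%N.
  by rewrite bin2 /= mul2n -[RHS]odd_double_half oddM /=; case: (odd n).
by rewrite mulSn leq_addl.
Qed.

(* The Jacobi triple product in a form without the apparent zero at w = 1. *)
Lemma jacobi_triple : q != 0 ->
  qpoch q q * (qpoch (w * q) q * qpoch (w^-1 * q) q) =
  cser (fun n => (-1) ^+ n * q ^+ 'C(n.+1, 2) * dker n).
Proof.
move=> q0.
have [B HB] := qfac_bounds.
have B0 : 0 <= B by have [h _] := HB 0%N; rewrite (le_trans (cabs_ge0 _) h).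
have rB k : cabs (rfac k) <= B.
  by case: k => k /=; [have [] := HB k|rewrite cabs0].
have H1 : ccvg (fun N => cser (fun n => jtc N n * dker n))
    (cser (fun n => (-1) ^+ n * q ^+ 'C(n.+1, 2) / qpoch q q * dker n)).
  apply: (@tannery _ _ _ (fun n => B ^+ 3 * cabs ((-1) ^+ n * q ^+ 'C(n.+1, 2) * dker n))).
  - move=> N n; rewrite /jtc.
    rewrite (_ : (-1) ^+ n * q ^+ 'C(n.+1, 2) * qfac (2 * N).+1 * rfac (N%:Z - n%:Z) * rfac (N + n).+1%:Z * dker n =
       (qfac (2 * N).+1 * rfac (N%:Z - n%:Z) * rfac (N + n).+1%:Z) * ((-1) ^+ n * q ^+ 'C(n.+1, 2) * dker n)); last by ring.
    rewrite cabsM ler_wpM2r ?cabs_ge0// cabsM cabsM 2!exprS expr1 mulrA.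
    have [h _] := HB (2 * N).+1.
    by rewrite !ler_pM ?mulr_ge0 ?cabs_ge0.
  - by apply: rsummableZ; [exact: exprn_ge0|exact: jac_summable].
  - by move=> n; apply: ccvgM; [exact: jtc_cvg|exact: ccvg_cst].
have H2 : ccvg (fun N => cser (fun n => jtc N n * dker n)) (qpoch (w * q) q * qpoch (w^-1 * q) q).
  have := ccvgM (qpoch_cvg (w * q)) (qpoch_cvg (w^-1 * q)); congr ccvg; apply/funext => N.
  rewrite (@cser_fin _ _ N.+1); last by move=> n /jtc_eq0 ->; rewrite mul0r.
  rewrite -finite_jtp// -big_split; apply: eq_bigr => j _.
  by rewrite /= exprS !mulrA.
rewrite (ccvg_uniq H2 H1) -cserZ.
  by apply: eq_cser => n; field; exact: qq_neq0.
rewrite (_ : (fun n => _) = fun n => (qpoch q q)^-1 * ((-1) ^+ n * q ^+ 'C(n.+1, 2) * dker n)).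
  by apply: csummableZ; exact: jac_summable.
by apply/funext => n; ring.
Qed.

End Qpoch.
End Products.

(** * Poisson summation for Gaussians by Fejer means *)

Section Poisson.
Variable R : realType.
Local Notation C := R[i].
Implicit Types (f g : int -> C) (W y z w : C) (x : R).

Definition psumZ f N : C := \sum_(n < N) (f n%:Z + f (- n.+1%:Z)).

Lemma psumZS f N : psumZ f N.+1 = psumZ f N + (f N%:Z + f (- N.+1%:Z)).
Proof. by rewrite /psumZ big_ord_recr. Qed.

Definition summableZ f := csummable (fun n => f n%:Z) /\ csummable (fun n => f (- n.+1%:Z)).

Lemma sumZ_cvg f : summableZ f -> ccvg (psumZ f) (sumZ f).
Proof. by move=> [h1 h2]; rewrite sumZE; apply: cser_cvg; exact: csummableD. Qed.

Lemma csummable_cvg0 (a : nat -> C) : csummable a -> ccvg a 0.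
Proof.
move=> h; have h1 := cser_cvg h; have h2 := ccvg_sub (f := S) (fun n => leqnSn n) h1.
have := ccvgB h2 h1; rewrite subrr; congr ccvg; apply/funext => n /=.
by rewrite big_ord_recr /= addrAC subrr add0r.
Qed.

Lemma cesaro (T : nat -> C) l : T 0%N = 0 -> ccvg (fun n => T n.+1 - T n) l ->
  ccvg (fun n => T n.+1 / n.+1%:R) l.
Proof.
move=> T0 h e e0; have [N HN] := h _ (divr_gt0 e0 (ltr0n _ 2)).
pose M := cabs (T N - N%:R * l).
have [N' HN'] := invn_cvg0 (e := e / 2 / (M + 1)) ltac:(by rewrite !divr_gt0// ltr_wpDl// cabs_ge0).
exists (maxn N N') => n; rewrite geq_max => /andP[Nn N'n].
have H m : (N <= m)%N -> cabs (T m - m%:R * l) <= M + (m - N)%:R * (e / 2).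
  elim: m => [|m IH]; first by rewrite leqn0 => /eqP N0; rewrite sub0n (mul0r (e / 2)) addr0 /M N0.
  rewrite leq_eqVlt => /predU1P[<-|]; first by rewrite subnn mul0r addr0.
  rewrite ltnS => Nm; rewrite subSn//.
  have -> : T m.+1 - m.+1%:R * l = (T m - m%:R * l) + (T m.+1 - T m - l) by rewrite -natr1; ring.
  rewrite (le_trans (cabsD _ _))// -(natr1 (m - N)) mulrDl mul1r addrA lerD// ?IH//; exact: HN.
have n0 : (0 : R) < n.+1%:R by rewrite ltr0n.
have -> : T n.+1 / n.+1%:R - l = (n.+1%:R)^-1 * (T n.+1 - n.+1%:R * l).
  by field; rewrite addrC natr1 pnatr_eq0.
rewrite cabsM cabsV cabs_nat.
have h1 := H n.+1 (leqW Nn); have h2 := HN' n N'n.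
have M0 : 0 <= M := cabs_ge0 _.
have h3 : ((n.+1 - N)%:R : R) <= n.+1%:R by rewrite ler_nat leq_subr.
have i0 : (0 : R) < n.+1%:R^-1 by rewrite invr_gt0.
rewrite ler_pdivlMr in h2; last by rewrite ltr_wpDl.
apply: le_trans (ler_wpM2l (ltW i0) h1) _.
have h4 : (n.+1 - N)%:R * (e / 2) <= n.+1%:R * (e / 2) by rewrite ler_wpM2r//; lra.
have h5 : n.+1%:R^-1 * (n.+1%:R * (e / 2)) = e / 2 by rewrite mulKf// gt_eqF.
have := ler_wpM2l (ltW i0) h4; rewrite h5; move: h2 i0; move: (n.+1%:R^-1 : R) ((n.+1 - N)%:R * (e / 2)) => i X h2 i0 h6.
rewrite mulrDr; rewrite mulrDr mulr1 in h2; lra.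
Qed.

(* The Fejer means of the partial sums, written as a double sum. *)
Lemma fejer_cvg f : summableZ f ->
  ccvg (fun N => (\sum_(a < N.+1) \sum_(b < N.+1) f (a%:Z - b%:Z)) / N.+1%:R) (sumZ f).
Proof.
move=> hf; apply: (cesaro (T := fun N => \sum_(a < N) \sum_(b < N) f (a%:Z - b%:Z))).
  by rewrite big_ord0.
have := ccvgD (sumZ_cvg hf) (csummable_cvg0 hf.1); rewrite addr0.
congr ccvg; apply/funext => N.
rewrite [in RHS]big_ord_recr /=.
under [X in X + _ - _]eq_bigr do rewrite big_ord_recr /=.
rewrite [in RHS]big_split /=.
transitivity (\sum_(b < N.+1) f (N%:Z - b%:Z) + \sum_(a < N) f (a%:Z - N%:Z)); last by ring.
have -> : \sum_(b < N.+1) f (N%:Z - b%:Z) = \sum_(i < N) f i%:Z + f N%:Z.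
  rewrite (reindex_inj rev_ord_inj) big_ord_recr /= subnn subr0; congr (_ + _).
  by apply: eq_bigr => i _; congr f; rewrite /=; have := ltn_ord i; lia.
have -> : \sum_(a < N) f (a%:Z - N%:Z) = \sum_(i < N) f (- i.+1%:Z).
  rewrite (reindex_inj rev_ord_inj); apply: eq_bigr => i _ /=.
  by congr f; have := ltn_ord i; lia.
by rewrite /psumZ big_split /= addrAC.
Qed.

Definition fourier (n : int) z := e2pi (n%:~R * z).

Lemma fourierD m n z : fourier (m + n) z = fourier m z * fourier n z.
Proof. by rewrite /fourier rmorphD mulrDl e2piD. Qed.

Lemma fourierX (n : nat) z : fourier n%:Z z = e2pi z ^+ n.
Proof. by rewrite /fourier /e2pi -cexpMn; congr cexp; rewrite -pmulrn; ring. Qed.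

Lemma fourierN n z : fourier (- n) z = (fourier n z)^-1.
Proof. by rewrite /fourier /e2pi -cexpN; congr cexp; rewrite rmorphN; ring. Qed.

Lemma fourier_per n z (j : int) : fourier n (z + j%:~R) = fourier n z.
Proof. by rewrite /fourier mulrDr -intrM e2pi_shift. Qed.

Lemma cdiff_fourier n z : cdiff (fourier n) z (fourier n z * (2 * ipi * n%:~R)).
Proof.
rewrite /fourier /e2pi (_ : (fun z => _) = fun z : C => cexp ((2 * ipi * n%:~R) * z)).
  by rewrite (mulrA (2 * ipi)); exact: cdiff_cexpZ.
by apply/funext => w; rewrite mulrA.
Qed.

Lemma ipi_neq0 : (ipi : C) != 0.
Proof.
rewrite /ipi mulf_neq0 ?iC_neq0// -cabs_gt0 cabs_real normr_gt0 gt_eqF//; exact: pi_gt0.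
Qed.

Lemma segc_fourier n (a b : R) : segc a b (fourier n).
Proof. by apply: segc_diff => x _; exact: cdiff_fourier. Qed.

Lemma integ_fourier n : integ (- 2^-1) 2^-1 (fourier n) = (n == 0)%:R.
Proof.
have h : - 2^-1 <= 2^-1 :> R by lra.
have [->|n0] := eqVneq n 0.
  have := @cint_FTC R (- 2^-1) 2^-1 (fun=> 1) id h.
  move=> H; feed H; first by move=> x _; exact: cdiff_id.
  feed H; first exact: segc_cst.
  move: H.
  rewrite (_ : cint _ _ _ = integ (- 2^-1) 2^-1 (fourier 0)).
    by move=> ->; rewrite -rmorphB /= (_ : 2^-1 - - 2^-1 = 1)//; lra.
  by apply: eq_cint => x _; rewrite /fourier mul0r -(mulr0z 1) e2pi_int.
pose c : C := 2 * ipi * n%:~R.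
have c0 : c != 0 by rewrite mulf_neq0 ?(mulf_neq0 _ ipi_neq0) ?pnatr_eq0 ?intr_eq0.
have := @cint_FTC R (- 2^-1) 2^-1 (fourier n) (fun z => c^-1 * fourier n z) h.
move=> H; feed H.
  move=> x _; have := cdiffZ c^-1 (cdiff_fourier n x%:C); congr cdiff.
  by rewrite mulrCA mulVf// mulr1.
feed H; first exact: segc_fourier.
rewrite H. have -> : (2^-1)%:C = (- 2^-1)%:C + (1%:Z)%:~R :> C.
  by rewrite -(rmorph1 (@real_complex R)) -rmorphD; congr _%:C; lra.
by rewrite fourier_per subrr.
Qed.

(** On the real line this is [|sum_a e(a z)|^2 / (N + 1)], expanded so that integration against it
    produces the Fejer means of [fejer_cvg]. *)
Definition fejer N z : C := (\sum_(a < N.+1) \sum_(b < N.+1) fourier (a%:Z - b%:Z) z) / N.+1%:R.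

Lemma integ_sum2 (a b : R) n m (F : 'I_n -> 'I_m -> C -> C) : (forall i j, segc a b (F i j)) ->
  integ a b (fun z => \sum_i \sum_j F i j z) = \sum_i \sum_j integ a b (F i j).
Proof.
move=> h; rewrite (cint_sum (F := fun i z => \sum_j F i j z)).
  by apply: eq_bigr => i _; rewrite cint_sum.
by move=> i; apply: segc_sum.
Qed.

(** With [y cos y <= sin y] at [y = x / 2], duplication gives [sin x >= x * cos (x / 2) ^ 2], and
    [cos (x / 2) ^ 2 >= 1 / 2] because [cos x >= 0]. *)
Lemma sin_ge_half x : 0 <= x <= pi / 2 -> x / 2 <= sin x.
Proof.
move=> /andP[x0 x1].
have h (y : R) : is_derive y 1 (fun x : R => sin x - x * cos x) (y * sin y).
  by apply: is_derive_eq; rewrite /GRing.scale /=; ring.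
have H : forall y : R, 0 <= y <= pi -> y * cos y <= sin y.
  move=> y /andP[y0 y1].
  have := @ger0_derive1_ndecr R (fun x : R => sin x - x * cos x) 0 y.
  move=> H; rewrite -subr_ge0 -[leLHS](_ : sin 0 - 0 * cos 0 = 0); last by rewrite sin0 mul0r subr0.
  apply: H => //.
  - move=> z; rewrite in_itv /= => /andP[z0 z1]; have [_ hz] := h z; rewrite derive1E hz.
    by rewrite mulr_ge0 ?(ltW z0)// sin_ge0_pi// (ltW z0) (le_trans (ltW z1)).
  - apply: continuous_subspaceT => z; apply: differentiable_continuous.
    by apply/derivable1_diffP; have [] := h z.
have h1 : 0 <= x / 2 <= pi by apply/andP; lra.
have h2 := H _ h1.
have c0 : 0 <= cos (x / 2) by apply: cos_ge0_pihalf; have := pi_gt0 R; lra.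
have E : sin x = 2 * cos (x / 2) * sin (x / 2).
  by rewrite {1}(_ : x = (x / 2) *+ 2) ?sin_mulr2n//; [rewrite !mulr2n; ring|rewrite mulr2n; field].
have E2 : cos x = 2 * cos (x / 2) ^+ 2 - 1.
  by rewrite {1}(_ : x = (x / 2) *+ 2) ?cos_mulr2n ?mulr2n//; [ring|field].
have c1 : 0 <= cos x by apply: cos_ge0_pihalf; have := pi_gt0 R; lra.
rewrite E; nra.
Qed.

Lemma e2pi_sub1 z : e2pi z - 1 = (2 * iC) * cexp (ipi * z) * csin ((pi : R)%:C * z).
Proof.
have e : ipi * z = iC * ((pi : R)%:C * z) by rewrite mulrA.
rewrite csin2E /e2pi -(mulrA 2 ipi) cexpMn e cexpN.
have := cexp_neq0 (iC * ((pi : R)%:C * z)); move: (cexp _) => w w0.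
by field; rewrite iC_neq0 w0.
Qed.

Lemma unit_sub1_ge (t : R) : `|t| <= 2^-1 -> `|t| <= cabs (e2pi t%:C - 1).
Proof.
move=> t1.
have e1 : cabs (cexp (ipi * t%:C)) = 1.
  by rewrite cabs_cexp Re_ipi /= mulr0 expR0.
rewrite e2pi_sub1 3!cabsM e1 cabs_iC cabs_nat !mulr1.
have h : `|sin (pi * t)| <= cabs (csin ((pi : R)%:C * t%:C)).
  by have := csin_ge_sin ((pi : R)%:C * t%:C); rewrite -rmorphM.
have h1 : pi * `|t| / 2 <= sin (pi * `|t|).
  by apply: sin_ge_half; rewrite mulr_ge0 ?pi_ge0// ler_wpM2l ?pi_ge0.
have h2 : sin (pi * `|t|) <= `|sin (pi * t)|.
  by case: (ger0P t) => _; [exact: ler_norm|rewrite mulrN sinN; rewrite -normrN ler_norm].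
have := pi_ge2 R; have := normr_ge0 t; nra.
Qed.

Lemma integ_fejer N : integ (- 2^-1) 2^-1 (fejer N) = 1.
Proof.
have E : integ (- 2^-1) 2^-1 (fejer N) = cint (- 2^-1) 2^-1 (fun x => (N.+1%:R)^-1 *
    (\sum_(a < N.+1) \sum_(b < N.+1) fourier (a%:Z - b%:Z) x%:C)).
  by apply: eq_cint => x _; rewrite mulrC.
rewrite E (cintZ _ (F := fun z => \sum_(a < N.+1) \sum_(b < N.+1) fourier (a%:Z - b%:Z) z)); last first.
  by apply: segc_sum => i; apply: segc_sum => j; exact: segc_fourier.
rewrite (integ_sum2 (F := fun (a b : 'I_N.+1) => fourier (a%:Z - b%:Z))); last first.
  by move=> *; exact: segc_fourier.
rewrite (eq_bigr (fun=> 1)); first by rewrite sumr_const card_ord mulVf// pnatr_eq0.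
move=> i _; rewrite (bigD1 i)//= integ_fourier subrr eqxx big1 ?addr0// => j ji.
rewrite integ_fourier subr_eq0; case: eqP => // -[/ord_inj e]; by rewrite e eqxx in ji.
Qed.

Lemma fejerN N z : fejer N (- z) = fejer N z.
Proof.
rewrite /fejer; congr (_ / _); rewrite exchange_big; apply: eq_bigr => i _; apply: eq_bigr => j _.
by rewrite /fourier; congr e2pi; rewrite !rmorphB /=; ring.
Qed.

(** Each geometric sum of [u] has modulus at most [2 / |u - 1|], and [|u - 1| >= |t|]. *)
Lemma fejer_bound N (t : R) : `|t| <= 2^-1 -> t ^+ 2 * cabs (fejer N t%:C) <= 4 / N.+1%:R.
Proof.
move=> t1; pose u : C := e2pi t%:C.
have u1 : cabs u = 1 by rewrite cabs_e2pi /= mulr0 expR0.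
have u0 : u != 0 by rewrite -cabs_gt0 u1.
have geo (v : C) : cabs v = 1 -> cabs (v - 1) * cabs (\sum_(a < N.+1) v ^+ a) <= 2.
  move=> v1; rewrite -cabsM mulrC.
  rewrite (_ : _ * _ = v ^+ N.+1 - 1); last by rewrite subrX1 mulrC.
  by rewrite (le_trans (cabsD _ _))// cabsX cabsN v1 expr1n cabs1.
have E : fejer N t%:C = (\sum_(a < N.+1) u ^+ a) * (\sum_(b < N.+1) u^-1 ^+ b) / N.+1%:R.
  rewrite /fejer; congr (_ / _); rewrite mulr_suml; apply: eq_bigr => i _.
  rewrite mulr_sumr; apply: eq_bigr => j _.
  by rewrite fourierD fourierN !fourierX exprVn.
have h1 := geo u u1; have h2 := geo u^-1; rewrite cabsV u1 invr1 in h2; have {}h2 := h2 erefl.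
have uV : cabs (u^-1 - 1) = cabs (u - 1).
  have -> : u^-1 - 1 = u^-1 * (1 - u) by field.
  by rewrite cabsM cabsV u1 invr1 mul1r cabsB.
have ut := unit_sub1_ge t1; rewrite -/u in ut; rewrite uV in h2.
rewrite E 2!cabsM cabsV cabs_nat mulrA ler_wpM2r ?invr_ge0//.
move: h1 h2 ut; set A := cabs (\sum_(a < _) u ^+ a); set B := cabs (\sum_(a < _) u^-1 ^+ a).
move=> h1 h2 ut.
have A0 : 0 <= A := cabs_ge0 _; have B0 : 0 <= B := cabs_ge0 _.
have a1 : `|t| * A <= 2 by apply: le_trans h1; rewrite ler_wpM2r.
have a2 : `|t| * B <= 2 by apply: le_trans h2; rewrite ler_wpM2r.
rewrite -(real_normK (num_real t)).
have -> : `|t| ^+ 2 * (A * B) = (`|t| * A) * (`|t| * B) by ring.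
have -> : 4 = 2 * 2 :> R by ring.
by rewrite ler_pM ?mulr_ge0.
Qed.

Lemma cint_affine (a b u v : R) (F : C -> C) : a <= b -> 0 < u -> segc (u * a + v) (u * b + v) F ->
  integ (u * a + v) (u * b + v) F = u%:C * integ a b (fun z => F (u%:C * z + v%:C)).
Proof.
move=> ab u0 hF; pose f x := u * x + v.
have df x : is_derive x 1 f u.
  by rewrite /f; apply: is_derive_eq; rewrite /GRing.scale /= mulr1 addr0.
have f' : f^`()%classic = cst u by apply/funext => x; rewrite derive1E; have [_ ->] := df x.
have cf : continuous f.
  by move=> x; apply: differentiable_continuous; apply/derivable1_diffP; have [] := df x.
have hF' : segc a b (fun z => F (u%:C * z + v%:C)).
  move=> x /andP[xa xb]; apply: (@ccont_comp _ (fun z => u%:C * z + v%:C) F).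
    by apply: ccontD; [apply: ccontM; [exact: ccont_cst|exact: ccont_id]|exact: ccont_cst].
  rewrite -rmorphM -rmorphD; apply: hF; rewrite !lerD2r !(ler_pM2l u0) xa//.
have S (g : R -> R) : {within `[f a, f b], continuous g} ->
    lebesgue_measure.-integrable `[a, b] (EFin \o (g \o f)) ->
    \int[lebesgue_measure]_(x in `[f a, f b]) g x = u * \int[lebesgue_measure]_(x in `[a, b]) g (f x).
  move=> cg ig; rewrite /Rintegral (@integration_by_substitution_increasing _ f g a b)//; last first.
  - split; [by move=> x _; have [] := df x|exact: cvg_at_right_filter (cf a)|exact: cvg_at_left_filter (cf b)].
  - by rewrite f'; exact: is_cvg_cst.
  - by rewrite f'; exact: is_cvg_cst.
  - by rewrite f' => x _; exact: cst_continuous.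
  - by move=> x y _ _ xy; rewrite /f ltrD2r ltr_pM2l.
  rewrite f' -/(Rintegral _ _ _) -RintegralZl//.
    by congr fine; apply: eq_integral => x _ /=; rewrite mulrC.
have E x : (f x)%:C = u%:C * x%:C + v%:C :> C by rewrite /f rmorphD rmorphM.
apply: complexP.
  rewrite Re_realM /= S; first by congr (_ * _); apply: eq_Rintegral => x _; rewrite -E.
    exact: segc_within_Re.
  by have := segc_int_Re hF'; congr (_.-integrable _ _); apply/funext => x /=; rewrite E.
rewrite cImM /= mul0r addr0 S; first by congr (_ * _); apply: eq_Rintegral => x _; rewrite -E.
  exact: segc_within_Im.
by have := segc_int_Im hF'; congr (_.-integrable _ _); apply/funext => x /=; rewrite E.
Qed.

Lemma gauss_summable (c d : R) p : 0 < c ->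
  rsummable (fun n => n.+1%:R ^+ p * expR (d * n%:R - c * n%:R ^+ 2)).
Proof.
move=> c0; have := @quad_summable R (expR (- c)) (expR d) p (expR_ge0 _).
have c1 : expR (- c) < 1 by rewrite -expR0 ltr_expR oppr_lt0.
move=> /(_ c1 (expR_ge0 _)); congr rsummable; apply/funext => n.
by rewrite -(expRM_natl _ d) -(expRM_natl _ (- c)) -expRD (_ : d * n%:R - c * n%:R ^+ 2 = n%:R * d + (n * n)%:R * - c)//; rewrite natrM; ring.
Qed.

Lemma gaussZ_summable (f : int -> C) (K c d : R) : 0 <= K -> 0 < c ->
  (forall n : int, cabs (f n) <= K * expR (d * `|n|%N%:R - c * `|n|%N%:R ^+ 2)) -> summableZ f.
Proof.
move=> K0 c0 h; split; apply: rsummable_le (fun n => h _) _.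
  by apply: rsummableZ => //; have := gauss_summable d 0 c0; congr rsummable; apply/funext => n; rewrite mul1r.
apply: (@rsummable_le _ _ (fun n => K * expR (`|d| + c) * (n.+1%:R ^+ 0 * expR ((`|d| + 0) * n%:R - c * n%:R ^+ 2)))).
  move=> n; rewrite abszN absz_nat -mulrA ler_wpM2l// mul1r -expRD ler_expR -natr1.
  have := ler_norm d; have n0 : 0 <= n%:R :> R by rewrite ler0n.
  by have := c0; nra.
by apply: rsummableZ; [rewrite mulr_ge0 ?expR_ge0|exact: gauss_summable].
Qed.

Section Formula.
Variables (W y : C).
Hypothesis rW : 0 < Re W.

Let phi z := cexp (- ((pi : R)%:C * W) * (y + z) ^+ 2).
(** [coef (- n)] is [csq W] times the integral over the line of [phi] against [fourier n]
    ([integ_coef_cvg]). *)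
Let coef (n : int) := cexp (- ((pi : R)%:C / W) * n%:~R ^+ 2 + 2 * ipi * n%:~R * y).

Lemma Re_inv_gt0 (w : C) : 0 < Re w -> 0 < Re w^-1.
Proof.
case: w => a b /= a0; rewrite divr_gt0// ltr_wpDr ?sqr_ge0// exprn_gt0//.
Qed.

Lemma intr_sqr_abs (n : int) : (n%:~R ^+ 2 : R) = `|n|%N%:R ^+ 2.
Proof. by case: n => n //; rewrite NegzE abszN rmorphN sqrrN. Qed.

Lemma cabs_int (n : int) : cabs (n%:~R : C) = `|n|%N%:R.
Proof. by case: n => n; rewrite ?NegzE ?abszN ?rmorphN ?cabsN /= ?cabs_nat// cabs_nat. Qed.

Lemma Re_intr2 (w : C) (n : int) : Re (w * n%:~R ^+ 2) = Re w * `|n|%N%:R ^+ 2.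
Proof. by rewrite -intr_sqr_abs -(rmorph_int (@real_complex R)) -rmorphXn mulrC Re_realM mulrC. Qed.

Lemma coef_summable : summableZ coef.
Proof.
have c0 : 0 < pi * Re W^-1 by rewrite mulr_gt0 ?pi_gt0 ?Re_inv_gt0.
apply: (gaussZ_summable (K := 1) (d := cabs (2 * ipi * y)) ler01 c0) => n.
rewrite mul1r /coef cabs_cexp ler_expR cReD Re_intr2 cReN Re_realM mulNr addrC lerD2r.
rewrite (le_trans (ler_norm _))// (le_trans (ge_Re_cabs _))// mulrAC -cabs_int -(cabsM (2 * ipi * y) n%:~R)//.
Qed.

Let P := cabs ((pi : R)%:C * W).
Let P0 : 0 <= P. Proof. exact: cabs_ge0. Qed.

Lemma cabs_phi (j : int) : cabs (phi j%:~R) <=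
  expR (P * cabs y ^+ 2) * expR (2 * P * cabs y * `|j|%N%:R - pi * Re W * `|j|%N%:R ^+ 2).
Proof.
rewrite /phi cabs_cexp -expRD ler_expR.
have -> : - ((pi : R)%:C * W) * (y + j%:~R) ^+ 2 = - ((pi : R)%:C * W) * j%:~R ^+ 2 +
   - (((pi : R)%:C * W) * (y ^+ 2)) - 2 * ((pi : R)%:C * W) * y * j%:~R by ring.
rewrite 2!cReD Re_intr2 cReN (Re_realM pi) mulNr.
have h1 := le_trans (ler_norm _) (ge_Re_cabs (- (((pi : R)%:C * W) * (y ^+ 2)))).
have h2 := le_trans (ler_norm _) (ge_Re_cabs (- (2 * ((pi : R)%:C * W) * y * j%:~R))).
rewrite cabsN (cabsM _ (y ^+ 2)) cabsX -/P in h1.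
rewrite cabsN (cabsM _ j%:~R) (cabsM _ y) (cabsM 2) cabs_int cabs_nat -/P in h2.
lra.
Qed.

Let M (j : int) := cabs (phi j%:~R) * ((2 + 2 * P) * expR P) * expR (6 * P * (cabs y + `|j|%N%:R)).

Let M_ge0 j : 0 <= M j.
Proof. by rewrite /M !mulr_ge0 ?expR_ge0 ?cabs_ge0// addr_ge0// mulr_ge0. Qed.

Lemma M_summable : rsummable (fun n => M n%:Z + M (- n.+1%:Z)).
Proof.
pose K := expR (P * cabs y ^+ 2) * ((2 + 2 * P) * expR P) * expR (6 * P * cabs y).
have K0 : 0 <= K by rewrite !mulr_ge0 ?expR_ge0 ?addr_ge0 ?mulr_ge0.
have c0 : 0 < pi * Re W by rewrite mulr_gt0 ?pi_gt0.
pose MC j := (M j)%:C.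
have [] := @gaussZ_summable MC K (pi * Re W) (2 * P * cabs y + 6 * P) K0 c0.
  move=> n; rewrite /MC cabs_real ger0_norm ?mulr_ge0 ?expR_ge0 ?cabs_ge0 ?addr_ge0 ?mulr_ge0//.
  rewrite /M (le_trans (ler_wpM2r _ (ler_wpM2r _ (cabs_phi n))))// ?mulr_ge0 ?expR_ge0 ?addr_ge0 ?mulr_ge0//.
  rewrite /K le_eqVlt; apply/orP; left; apply/eqP.
  have -> : (2 * P * cabs y + 6 * P) * `|n|%N%:R - pi * Re W * `|n|%N%:R ^+ 2 =
    (2 * P * cabs y * `|n|%N%:R - pi * Re W * `|n|%N%:R ^+ 2) + 6 * P * `|n|%N%:R by ring.
  rewrite (mulrDr (6 * P)) (expRD (6 * P * cabs y)) (expRD (2 * P * cabs y * `|n|%N%:R - _)); ring.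
rewrite /csummable => h1 h2; apply: rsummable_le (rsummableD h1 h2) => n.
by rewrite /MC !cabs_real lerD// ler_norm.
Qed.

(** The order [t ^+ 2] is what the bound [4 / ((N + 1) t^2)] for the Fejer kernel can absorb; this
    is why a symmetric second difference is taken. *)
Lemma phi_diff2 (j : int) (t : R) : `|t| <= 2^-1 ->
  cabs (phi (t%:C + j%:~R) + phi (- t%:C + j%:~R) - 2 * phi j%:~R) <= t ^+ 2 * M j.
Proof.
move=> t1; pose w := 2 * ((pi : R)%:C * W) * (y + j%:~R) * t%:C.
pose be := ((pi : R)%:C * W) * t%:C ^+ 2.
have -> : phi (t%:C + j%:~R) + phi (- t%:C + j%:~R) - 2 * phi j%:~R =
   phi j%:~R * (cexp (- be) * ((cexp w - 1 - w) + (cexp (- w) - 1 - - w)) + 2 * (cexp (- be) - 1)).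
  have -> : phi (t%:C + j%:~R) = phi j%:~R * cexp (- be) * cexp (- w).
    by rewrite /phi -!cexpD; congr cexp; rewrite /be /w; ring.
  have -> : phi (- t%:C + j%:~R) = phi j%:~R * cexp (- be) * cexp w.
    by rewrite /phi -!cexpD; congr cexp; rewrite /be /w; ring.
  move: (phi _) (cexp (- be)) (cexp w) (cexp (- w)) => a b c d; ring.
rewrite cabsM /M -(mulrA (cabs _)) (mulrCA (t ^+ 2)) ler_wpM2l ?cabs_ge0//.
set al := 6 * P * _.
have tt : `|t| ^+ 2 = t ^+ 2 by rewrite real_normK ?num_real.
have t0 : 0 <= `|t| by [].
have wE : cabs w <= al / 3 * `|t|.
  rewrite /w cabsM cabs_real ler_wpM2r// cabsM cabsM cabs_nat -/P /al.
  have -> : 6 * P * (cabs y + `|j|%:R) / 3 = 2 * P * (cabs y + `|j|%:R) by field.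
  by rewrite ler_wpM2l ?mulr_ge0// -(cabs_int j) cabsD.
have al0 : 0 <= al / 3 by rewrite divr_ge0// !mulr_ge0// addr_ge0 ?cabs_ge0.
have e3 : al / 3 <= expR (al / 3) by rewrite (le_trans _ (expR_ge1Dx _))// lerDr.
have w1 : cabs w <= al / 3 by rewrite (le_trans wE)// ler_piMr//; lra.
have w2 : cabs w ^+ 2 * expR (cabs w) <= t ^+ 2 * expR al.
  apply: (@le_trans _ _ ((al / 3 * `|t|) ^+ 2 * expR (al / 3))).
    by apply: ler_pM; rewrite ?sqr_ge0 ?expR_ge0 ?ler_expR// lerXn2r ?nnegrE ?cabs_ge0 ?(mulr_ge0 al0 t0).
  rewrite exprMn tt mulrAC mulrC ler_wpM2l ?sqr_ge0//.
  have -> : expR al = expR (al / 3) ^+ 2 * expR (al / 3).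
    by rewrite -expRM_natl -expRD; congr expR; field.
  by rewrite ler_wpM2r ?expR_ge0// lerXn2r ?nnegrE ?expR_ge0.
have b1 : cabs be = P * t ^+ 2 by rewrite /be cabsM cabsX cabs_real tt.
have t2 : t ^+ 2 <= 1 by rewrite -tt expr_le1//; lra.
have bP : cabs be <= P by rewrite b1 ler_piMr.
have h1 : cabs (cexp (- be)) <= expR P.
  by rewrite cabs_cexp ler_expR (le_trans (ler_norm _))// (le_trans (ge_Re_cabs _))// cabsN.
have h2 : cabs (cexp (- be) - 1) <= P * t ^+ 2 * expR P.
  rewrite (le_trans (cexp_sub1_le _))// cabsN -b1 ler_wpM2l ?cabs_ge0// ler_expR//.
have h3 := cexp_sub1_sub_le w; have h4 := cexp_sub1_sub_le (- w); rewrite cabsN in h4.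
have h5 : cabs (cexp w - 1 - w + (cexp (- w) - 1 - - w)) <= 2 * (t ^+ 2 * expR al).
  by rewrite (le_trans (cabsD _ _))//; lra.
have al1 : 1 <= expR al by rewrite -expR0 ler_expR; lra.
rewrite (le_trans (cabsD _ _))// 2!cabsM cabs_nat.
have h6 : cabs (cexp (- be)) * cabs (cexp w - 1 - w + (cexp (- w) - 1 - - w)) <= expR P * (2 * (t ^+ 2 * expR al)).
  by rewrite ler_pM ?cabs_ge0.
have h7 : P * t ^+ 2 * expR P <= P * t ^+ 2 * expR P * expR al.
  by rewrite ler_peMr// (mulr_ge0 (mulr_ge0 P0 (sqr_ge0 t)) (expR_ge0 P)).
lra.
Qed.

Lemma cdiff_phi z : cdiff phi z (phi z * (- ((pi : R)%:C * W) * (2 * (y + z)))).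
Proof.
apply: cdiff_cexp_comp; apply: cdiffZ.
have h : cdiff (fun z => 1 * z + y) z 1 := cdiff_lin _ _ _.
rewrite (_ : (fun z => (y + z) ^+ 2) = fun z => (1 * z + y) * (1 * z + y)).
  by have := cdiffM h h; congr cdiff; rewrite !mul1r !mulr1; ring.
by apply/funext => v; ring.
Qed.

Lemma segc_fejer N (a b : R) : segc a b (fejer N).
Proof.
apply: segcM; last exact: segc_cst.
by apply: segc_sum => i; apply: segc_sum => j; exact: segc_fourier.
Qed.

Lemma fejer_per N z (j : int) : fejer N (z + j%:~R) = fejer N z.
Proof. by rewrite /fejer; congr (_ / _); do 2 (apply: eq_bigr => ? _); rewrite fourier_per. Qed.

Let cell N (j : int) := integ (j%:~R - 2^-1) (j%:~R + 2^-1) (fun z => phi z * fejer N z).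

Lemma cell_approx N (j : int) : cabs (cell N j - phi j%:~R) <= 4 / N.+1%:R * M j.
Proof.
have h12 : - 2^-1 <= 2^-1 :> R by lra.
have sphi (a b : R) (u v : C) : segc a b (fun z => phi (u * z + v)).
  move=> x _; apply: (@ccont_comp _ (fun z => u * z + v) phi); last exact: cdiff_ccont (cdiff_phi _).
  by apply: ccontD; [apply: ccontM; [exact: ccont_cst|exact: ccont_id]|exact: ccont_cst].
pose f1 z := phi (1 * z + j%:~R) * fejer N z.
pose f2 z := phi (-1 * z + j%:~R) * fejer N z.
have s1 : segc (- 2^-1) 2^-1 f1 by apply: segcM; [exact: sphi|exact: segc_fejer].
have s2 : segc (- 2^-1) 2^-1 f2 by apply: segcM; [exact: sphi|exact: segc_fejer].
have e1 : cell N j = integ (- 2^-1) 2^-1 f1.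
  have := @cint_affine (- 2^-1) 2^-1 1 j%:~R (fun z => phi z * fejer N z) h12 ltr01.
  rewrite /cell (mul1r (- 2^-1)) (mul1r 2^-1) (addrC (- 2^-1)) (addrC 2^-1) => ->.
    by rewrite (rmorph1 (@real_complex R)) mul1r; apply: eq_cint => x _; rewrite /f1 rmorph_int mul1r fejer_per.
  apply: segcM; last exact: segc_fejer.
  by move=> x _; exact: cdiff_ccont (cdiff_phi _).
have e2 : integ (- 2^-1) 2^-1 f1 = integ (- 2^-1) 2^-1 f2.
  have := @cint_opp R (- 2^-1) 2^-1 f1 h12; rewrite opprK => /(_ s1) ->.
  by apply: eq_cint => x _; rewrite /f1 /f2 fejerN mul1r mulN1r.
(* The kernel is even, so averaging the cell over [x] and [- x] produces the second difference of
   [phi] at [j]. *)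
have e3 : 2 * (cell N j - phi j%:~R) = integ (- 2^-1) 2^-1 (fun z => (f1 z + f2 z) - 2 * phi j%:~R * fejer N z).
  have sf : segc (- 2^-1) 2^-1 (fejer N)  by exact: segc_fejer.
  rewrite (cintB (F := fun z => f1 z + f2 z) (G := fun z => 2 * phi j%:~R * fejer N z)); first last.
  - by apply: segcM => //; exact: segc_cst.
  - exact: segcD.
  rewrite (cintD (F := f1) (G := f2))// -e2 -e1 (cintZ _ sf) integ_fejer; ring.
have h : cabs (2 * (cell N j - phi j%:~R)) <= 4 / N.+1%:R * M j * (2^-1 - - 2^-1).
  rewrite e3; apply: (@cint_bound R (- 2^-1) 2^-1 (fun z => (f1 z + f2 z) - 2 * phi j%:~R * fejer N z)) => //.
    rewrite (_ : (fun z => _) = fun z => (f1 z + f2 z) + (- (2 * phi j%:~R)) * fejer N z).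
      by apply: segcD; [exact: segcD|apply: segcM; [exact: segc_cst|exact: segc_fejer]].
    by apply/funext => z; rewrite mulNr.
  move=> x hx; have x2 : `|x| <= 2^-1 by rewrite ler_norml.
  have -> : f1 x%:C + f2 x%:C - 2 * phi j%:~R * fejer N x%:C =
     (phi (x%:C + j%:~R) + phi (- x%:C + j%:~R) - 2 * phi j%:~R) * fejer N x%:C.
    by rewrite /f1 /f2 mul1r mulN1r; ring.
  rewrite cabsM; apply: (le_trans (ler_wpM2r (cabs_ge0 _) (phi_diff2 j x2))).
  by rewrite mulrAC (ler_wpM2r (M_ge0 j))// fejer_bound.
rewrite cabsM cabs_nat in h; have := cabs_ge0 (cell N j - phi j%:~R).
have M0 : 0 <= 4 / N.+1%:R * M j.
  by rewrite (mulr_ge0 _ (M_ge0 j))// divr_ge0.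
move: h M0; move: (4 / _ * _) (cabs _) => X Y h X0 Y0; lra.
Qed.

Lemma phi_summable : summableZ (fun j => phi j%:~R).
Proof.
have c0 : 0 < pi * Re W by rewrite mulr_gt0 ?pi_gt0.
exact: gaussZ_summable (expR_ge0 _) c0 cabs_phi.
Qed.

Lemma integ_cells N J : integ (- (J%:R + 2^-1)) (J%:R + 2^-1) (fun z => phi z * fejer N z) =
  psumZ (cell N) J + cell N J.
Proof.
have sF (a b : R) : segc a b (fun z => phi z * fejer N z).
  by apply: segcM; [move=> x _; exact: cdiff_ccont (cdiff_phi _)|exact: segc_fejer].
elim: J => [|J IH].
  by rewrite /psumZ big_ord0 add0r /cell add0r sub0r add0r.
rewrite psumZS; have J0 : 0 <= J%:R :> R by [].
rewrite -natr1 (@cint_cat _ _ (- (J%:R + 2^-1)) _ (fun z => phi z * fejer N z)); [|lra|lra|exact: sF].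
rewrite (@cint_cat _ (- (J%:R + 2^-1)) (J%:R + 2^-1) _ (fun z => phi z * fejer N z)) ?IH; [|lra|lra|exact: sF].
have -> : cell N (- J.+1%:Z) = integ (- (J%:R + 1 + 2^-1)) (- (J%:R + 2^-1)) (fun z => phi z * fejer N z).
  have E1 : (- J.+1%:Z)%:~R - 2^-1 = - (J%:R + 1 + 2^-1) :> R by rewrite mulrNz -pmulrn -natr1; field.
  have E2 : (- J.+1%:Z)%:~R + 2^-1 = - (J%:R + 2^-1) :> R by rewrite mulrNz -pmulrn -natr1; field.
  by rewrite /cell E1 E2.
have -> : cell N J.+1%:Z = integ (J%:R + 2^-1) (J%:R + 1 + 2^-1) (fun z => phi z * fejer N z).
  have E1 : J.+1%:Z%:~R - 2^-1 = J%:R + 2^-1 :> R by rewrite -pmulrn -natr1; field.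
  have E2 : J.+1%:Z%:~R + 2^-1 = J%:R + 1 + 2^-1 :> R by rewrite -pmulrn -(natr1 J).
  by rewrite /cell E1 E2.
set A := cint (- (J%:R + 1 + 2^-1)) _ _; set B := cint (J%:R + 2^-1) _ _.
by move: A B (psumZ _ _) (cell N J) => A B c d; ring.
Qed.

Lemma integ_coef_cvg (n : int) : ccvg (fun J : nat => csq W *
   integ (- (J%:R + 2^-1)) (J%:R + 2^-1) (fun z => phi z * fourier n z)) (coef (- n)).
Proof.
move=> e e0.
pose K := cexp (- ((pi : R)%:C * W) * y ^+ 2).
have K0 : 0 < cabs K by rewrite cabs_gt0 cexp_neq0.
have W0 := Re_gt0_neq0 rW.
have pC0 := piC_neq0 R.
pose b := - (2 * ((pi : R)%:C * W) * y) + 2 * ipi * n%:~R.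
have [L0 HL] := gauss_ft b rW (divr_gt0 e0 K0).
have [N HN] : exists N : nat, L0 <= N%:R.
  by exists (Num.bound `|L0|); rewrite (le_trans (ler_norm _))// ltW// archi_boundP.
exists N => J NJ; have hL : L0 <= J%:R + 2^-1.
  by rewrite (le_trans HN)// (@le_trans _ _ J%:R) ?ler_nat// lerDl; lra.
have := HL _ hL; rewrite ler_pdivlMr// mulrC -cabsM mulrBr mulrCA.
set I := cint _ _ _ => h.
have -> : cint (- (J%:R + 2^-1)) (J%:R + 2^-1) (fun x => phi x%:C * fourier n x%:C) = K * I.
  have sI : segc (- (J%:R + 2^-1)) (J%:R + 2^-1) (fun z => cexp (- ((pi : R)%:C * W) * z ^+ 2 + b * z)) by exact: segc_quad.
  rewrite /I -(cintZ _ sI); apply: eq_cint => x _.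
  by rewrite /phi /fourier /e2pi /K -!cexpD; congr cexp; rewrite /b; ring.
apply: le_trans h; apply: eq_ler; congr (cabs (_ - _)).
rewrite /coef /K -cexpD; congr cexp; rewrite mulrNz sqrrN /b /ipi.
move: (n%:~R : C) ((pi : R)%:C : C) pC0 => m p p0.
transitivity (- (p * W) * y ^+ 2 + ((- (2 * (p * W) * y)) ^+ 2 -
   8 * p ^+ 2 * iC * W * y * m + 4 * p ^+ 2 * m ^+ 2 * (iC * iC)) / (4 * (p * W))).
  by rewrite iC_sqr; field; rewrite p0 W0.
by field; rewrite p0 W0.
Qed.

(** The [N]-th Fejer mean of [coef] is [csq W] times the integral of [phi] against the kernel. Cell
    by cell this is [phi] at an integer up to [4 / (N + 1) * M j]; summability of [M] lets [N]
    grow. *)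
Lemma poisson_formula : sumZ coef = csq W * sumZ (fun j => phi j%:~R).
Proof.
have H1 (N : nat) : ccvg (fun J => csq W * (psumZ (cell N) J + cell N J))
   ((\sum_(a < N.+1) \sum_(b < N.+1) coef (b%:Z - a%:Z)) / N.+1%:R).
  have : ccvg (fun J : nat => \sum_(a < N.+1) \sum_(b < N.+1) csq W *
      integ (- (J%:R + 2^-1)) (J%:R + 2^-1) (fun z => phi z * fourier (a%:Z - b%:Z) z))
      (\sum_(a < N.+1) \sum_(b < N.+1) coef (b%:Z - a%:Z)).
    apply: ccvg_sum => a; apply: ccvg_sum => b.
    by have := integ_coef_cvg (a%:Z - b%:Z); rewrite opprB.
  move=> /ccvgM /(_ (ccvg_cst N.+1%:R^-1)); congr ccvg; apply/funext => J.
  rewrite -integ_cells.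
  have sF n : segc (- (J%:R + 2^-1)) (J%:R + 2^-1) (fun z => phi z * fourier n z).
    by apply: segcM; [move=> x _; exact: cdiff_ccont (cdiff_phi _)|exact: segc_fourier].
  have -> : integ (- (J%:R + 2^-1)) (J%:R + 2^-1) (fun z => phi z * fejer N z) =
     N.+1%:R^-1 * integ (- (J%:R + 2^-1)) (J%:R + 2^-1) (fun z =>
       \sum_(a < N.+1) \sum_(b < N.+1) phi z * fourier (a%:Z - b%:Z) z).
    rewrite -(cintZ _ (F := fun z => \sum_(a < N.+1) \sum_(b < N.+1) phi z * fourier (a%:Z - b%:Z) z)).
      apply: eq_cint => x _; rewrite /fejer mulrA mulrC; congr (_ * _).
      by rewrite mulr_sumr; apply: eq_bigr => a _; rewrite mulr_sumr.
    by apply: segc_sum => a; apply: segc_sum => b.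
  rewrite (integ_sum2 (F := fun a b z => phi z * fourier (a%:Z - b%:Z) z))//.
  rewrite mulrC mulrCA; congr (_ * _); rewrite mulr_sumr; apply: eq_bigr => a _.
  by rewrite mulr_sumr.
have [B HB] := M_summable.
have B0 : 0 <= B by have := HB 0%N; rewrite big_ord0.
have H2 (N : nat) : cabs ((\sum_(a < N.+1) \sum_(b < N.+1) coef (b%:Z - a%:Z)) / N.+1%:R -
    csq W * sumZ (fun j => phi j%:~R)) <= cabs (csq W) * (8 * B) * N.+1%:R^-1.
  have h3 : ccvg (fun J => csq W * (psumZ (fun j => phi j%:~R) J + phi J%:~R)) (csq W * sumZ (fun j => phi j%:~R)).
    apply: ccvgZ; have := ccvgD (sumZ_cvg phi_summable) (csummable_cvg0 phi_summable.1).
    by rewrite addr0.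
  apply: ccvg_bound (ccvgB (H1 N) h3); exists 0%N => J _.
  rewrite -mulrBr cabsM -mulrA ler_wpM2l ?cabs_ge0//.
  have M0 := M_ge0.
  have -> : psumZ (cell N) J + cell N J%:Z - (psumZ (fun j => phi j%:~R) J + phi J%:~R) =
      \sum_(j < J) ((cell N j%:Z - phi j%:~R) + (cell N (- j.+1%:Z) - phi (- j.+1%:Z)%:~R)) + (cell N J - phi J%:~R).
    rewrite opprD addrACA; congr (_ + _); rewrite /psumZ -sumrB; apply: eq_bigr => j _; ring.
  rewrite (le_trans (cabsD _ _))//.
  apply: (@le_trans _ _ (4 / N.+1%:R * (\sum_(j < J) (M j%:Z + M (- j.+1%:Z)) + M J%:Z))).
    rewrite mulrDr lerD ?cell_approx// mulr_sumr (le_trans (cabs_sum _ _ _))// ler_sum// => j _.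
    by rewrite (le_trans (cabsD _ _))// mulrDr lerD// cell_approx.
  have h4 := HB J; have h5 := HB J.+1; rewrite big_ord_recr /= in h5.
  have h6 : 0 <= \sum_(j < J) (M j%:Z + M (- j.+1%:Z)) by rewrite sumr_ge0// => j _; rewrite addr_ge0.
  have -> : 8 * B / N.+1%:R = 4 / N.+1%:R * (2 * B) by ring.
  rewrite ler_wpM2l ?divr_ge0//; have := M0 (- J.+1%:Z); lra.
have H3 : ccvg (fun N : nat => (\sum_(a < N.+1) \sum_(b < N.+1) coef (b%:Z - a%:Z)) / N.+1%:R) (sumZ coef).
  have := fejer_cvg coef_summable; congr ccvg; apply/funext => N; congr (_ / _).
  by rewrite exchange_big.
apply: ccvg_uniq H3 _; pose c := cabs (csq W) * (8 * B) + 1.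
have c0 : 0 < c by rewrite ltr_wpDl// !mulr_ge0 ?cabs_ge0.
apply: (@ccvg_le _ _ _ (fun N => N.+1%:R^-1) c) => //; first exact: invn_cvg0.
by move=> N; rewrite (le_trans (H2 N))// ler_wpM2r ?invr_ge0// lerDl.
Qed.

End Formula.
End Poisson.

(** * Theta series at rational points and their transformation *)

Section Theta.
Variable R : realType.
Local Notation piC := ((pi : R)%:C).
Local Notation C := R[i].
Implicit Types (W y z w tau Z : C) (n : int).

Lemma sumZ_scale (c : C) (f : int -> C) : summableZ f -> sumZ (fun n => c * f n) = c * sumZ f.
Proof.
move=> [h1 h2]; rewrite !sumZE -cserZ; last exact: csummableD.
by apply: eq_cser => n; rewrite mulrDr.
Qed.

Lemma eq_sumZ (f g : int -> C) : f =1 g -> sumZ f = sumZ g.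
Proof. by move=> h; rewrite !sumZE; apply: eq_cser => n; rewrite !h. Qed.

Lemma halfintE n : (halfint R n)%:C = n%:~R + 2^-1 :> C.
Proof. by rewrite /halfint rmorphD rmorph_int fmorphV rmorph_nat. Qed.

Lemma signzN n : (-1) ^ (- n) = (-1) ^ n :> C.
Proof.
case: n => n; first by rewrite -exprnN -exprVn invrN1.
by rewrite NegzE opprK -[RHS]exprnN -exprVn invrN1.
Qed.

Lemma signz_ipi n : (-1) ^ n = cexp (ipi * n%:~R) :> C.
Proof. by rewrite cexp_ipi_int. Qed.

Lemma summableZM (c : C) (f : int -> C) : summableZ f -> summableZ (fun n => c * f n).
Proof. by move=> [h1 h2]; split; exact: csummableZ. Qed.

(** Moving [y] to [y + i / (2 W)] turns the formula over the integers into the one over the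
    half-integers; the imaginary shift leaves the sign [(-1) ^ n] on the dual side. *)
Lemma poisson_half W y : 0 < Re W ->
  let F n := cexp (- (piC / W) * (halfint R n)%:C ^+ 2 + 2 * ipi * (halfint R n)%:C * y) in
  let G n := (-1) ^ n * cexp (- (piC * W) * (y + n%:~R) ^+ 2) in
  [/\ summableZ F, summableZ G & sumZ F = csq W * sumZ G].
Proof.
move=> rW F G; have W0 := Re_gt0_neq0 rW.
pose y0 := y + iC / (2 * W).
pose ka := cexp (- (piC / (4 * W)) + ipi * y).
have EF n : F n = ka * cexp (- (piC / W) * n%:~R ^+ 2 + 2 * ipi * n%:~R * y0).
  rewrite /F /ka /y0 -cexpD halfintE /ipi; congr cexp; move: (n%:~R) => m.
  transitivity (- (piC / (4 * W)) + iC * piC * y +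
   (- (piC / W) * m ^+ 2 + 2 * iC * piC * m * y + (iC * iC) * piC * m / W)).
    by rewrite iC_sqr; field; rewrite W0.
  by field; rewrite W0.
have EG n : G n = ka * cexp (- (piC * W) * (y0 + n%:~R) ^+ 2).
  rewrite /G /ka /y0 -cexpD -signzN signz_ipi mulrNz -cexpD.
  congr cexp; rewrite /ipi; move: (n%:~R) => m.
  transitivity (- (piC / (4 * W)) + iC * piC * y
     - (piC * W) * (y + m) ^+ 2 - iC * piC * (y + m) - (iC * iC) * piC / (4 * W)).
    by rewrite iC_sqr; field; rewrite W0.
  by field; rewrite W0.
have sF := coef_summable y0 rW; have sG := phi_summable y0 rW.
rewrite (funext EF) (funext EG); split; [exact: summableZM|exact: summableZM|].
by rewrite !sumZ_scale// poisson_formula// mulrCA.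
Qed.

(** [vartheta] without its factor [iC]. *)
Definition thetaZ z tau : C := sumZ (fun n =>
  (-1) ^ n * e2pi ((halfint R n ^+ 2 / 2)%:C * tau) * e2pi ((halfint R n)%:C * z)).

Lemma theta_summable z tau : 0 < Im tau -> summableZ (fun n =>
  (-1) ^ n * e2pi ((halfint R n ^+ 2 / 2)%:C * tau) * e2pi ((halfint R n)%:C * z)).
Proof.
move=> it; pose V := (- (iC * tau))^-1.
have rV : 0 < Re V.
  by apply: Re_inv_gt0; rewrite cReN cReM /= mul0r mul1r sub0r opprK.
have cs n : cabs ((-1) ^ n : C) = 1 by case: n => n; rewrite ?NegzE -?exprnN ?cabsV cabsX cabsN cabs1 expr1n ?invr1.
have [[h1 h2] _ _] := poisson_half z rV.
have E n : cabs ((-1) ^ n * e2pi ((halfint R n ^+ 2 / 2)%:C * tau) * e2pi ((halfint R n)%:C * z)) =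
   cabs (cexp (- (piC / V) * (halfint R n)%:C ^+ 2 + 2 * ipi * (halfint R n)%:C * z)).
  rewrite cabsM (cabsM ((-1) ^ n)) cs mul1r -cabsM /e2pi -cexpD; congr (cabs (cexp _)).
  by rewrite /V invrK rmorphM rmorphXn fmorphV rmorph_nat /ipi; field.
by split; [move: h1|move: h2]; congr rsummable; apply/funext => n; rewrite E.
Qed.

Lemma summableZ_sum k (F : 'I_k -> int -> C) : (forall v, summableZ (F v)) ->
  summableZ (fun n => \sum_v F v n).
Proof.
have H (f : 'I_k -> nat -> C) : (forall v, csummable (f v)) -> csummable (fun n : nat => \sum_v f v n).
  elim: k f {F} => [|k IH] f hf.
    by exists 0 => N; rewrite big1// => i _; rewrite big_ord0 cabs0.
  have := csummableD (IH (fun v => f (widen_ord (leqnSn k) v)) (fun v => hf _)) (hf ord_max).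
  by congr csummable; apply/funext => n; rewrite big_ord_recr.
move=> hF; split; first exact: (H (fun v (n : nat) => F v n%:Z) (fun v => (hF v).1)).
exact: (H (fun v (n : nat) => F v (- n.+1%:Z)) (fun v => (hF v).2)).
Qed.

Lemma sumZ_sum k (F : 'I_k -> int -> C) : (forall v, summableZ (F v)) ->
  sumZ (fun n => \sum_v F v n) = \sum_v sumZ (F v).
Proof.
move=> hF; apply: ccvg_uniq (sumZ_cvg (summableZ_sum hF)) _.
have := ccvg_sum (fun v => sumZ_cvg (hF v)); congr ccvg; apply/funext => N.
by rewrite /psumZ exchange_big; apply: eq_bigr => n _; rewrite big_split.
Qed.

Lemma e2piX (n : nat) z : e2pi (n%:R * z) = e2pi z ^+ n.
Proof. by rewrite /e2pi mulrCA cexpMn. Qed.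

Lemma e2piN z : e2pi (- z) = (e2pi z)^-1.
Proof. by rewrite /e2pi mulrN cexpN. Qed.

Lemma e2pi_neq0 z : e2pi z != 0. Proof. exact: cexp_neq0. Qed.

Lemma cabs_e2pi_lt1 tau : 0 < Im tau -> cabs (e2pi tau) < 1.
Proof.
by move=> h; rewrite cabs_e2pi -expR0 ltr_expR mulNr oppr_lt0 !mulr_gt0// pi_gt0.
Qed.

(** Opposite half-integral exponents of theta pair up to the numerator of the Dirichlet kernel; this
    turns the series of [jacobi_triple] into theta. *)
Lemma dker_half (n : nat) z :
  (e2pi (z / 2) - e2pi (- (z / 2))) * dker (e2pi z) n =
  e2pi ((n%:R + 2^-1) * z) - e2pi (- ((n%:R + 2^-1) * z)).
Proof.
elim: n => [|n IH]; first by rewrite dker0 mulr1 add0r mulrC.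
have E : e2pi z = e2pi (z / 2) ^+ 2 by rewrite -e2piX; congr e2pi; field.
have E1 : e2pi ((n%:R + 2^-1) * z) = e2pi (z / 2) ^+ (2 * n).+1.
  by rewrite -e2piX; congr e2pi; rewrite -(natr1 (2 * n)) natrM; field.
have E2 : e2pi ((n.+1%:R + 2^-1) * z) = e2pi (z / 2) ^+ (2 * n).+3.
  by rewrite -e2piX; congr e2pi; rewrite -(natr1 n) -addn3 natrD natrM; field.
rewrite dkerS mulrDr IH !e2piN E1 E2 E; have := e2pi_neq0 (z / 2).
move: (e2pi (z / 2)) => v v0.
rewrite !exprVn -!exprM mulnS addnC addn2.
by rewrite (exprS v (2 * n).+2) (exprS v (2 * n).+1) (exprS v (2 * n)); field; rewrite expf_neq0.
Qed.

Lemma theta_product z tau : 0 < Im tau ->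
  thetaZ z tau = e2pi (tau / 8) * (e2pi (z / 2) - e2pi (- (z / 2))) *
    (qpoch (e2pi tau) (e2pi tau) * (qpoch (e2pi z * e2pi tau) (e2pi tau) *
       qpoch ((e2pi z)^-1 * e2pi tau) (e2pi tau))).
Proof.
move=> it; have q1 := cabs_e2pi_lt1 it; have q0 := e2pi_neq0 tau.
rewrite (jacobi_triple q1 (e2pi_neq0 z) q0) /thetaZ sumZE -cserZ; last exact: jac_summable.
apply: eq_cser => n.
have hN : halfint R (- n.+1%:Z) = - halfint R n%:Z.
  by rewrite /halfint mulrNz -!pmulrn -natr1; field.
rewrite hN sqrrN rmorphN mulNr.
have -> : (-1) ^ (- n.+1%:Z) = - (-1) ^+ n :> C.
  by rewrite signzN -exprnP exprS mulN1r.
have -> : e2pi ((halfint R n%:Z ^+ 2 / 2)%:C * tau) = e2pi (tau / 8) * e2pi tau ^+ 'C(n.+1, 2).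
  rewrite -e2piX -e2piD; congr e2pi.
  have -> : ('C(n.+1, 2)%:R : C) = n%:R * (n%:R + 1) / 2.
    have -> : n%:R * (n%:R + 1) = 2 * 'C(n.+1, 2)%:R :> C.
      rewrite -natrM natr1 -natrM; congr (_%:R).
      by rewrite bin2 /= mul2n mulnC -[LHS]odd_double_half oddM /=; case: (odd n).
    by field.
  rewrite rmorphM rmorphXn fmorphV rmorph_nat /= halfintE -pmulrn; field.
  by [].
have := dker_half n z; move=> H; rewrite -exprnP.
transitivity ((-1) ^+ n * (e2pi (tau / 8) * e2pi tau ^+ 'C(n.+1, 2)) *
  (e2pi ((n%:R + 2^-1) * z) - e2pi (- ((n%:R + 2^-1) * z)))).
  have -> : n%:R + 2^-1 = (halfint R n%:Z)%:C :> C by rewrite halfintE -pmulrn.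
  by move: (e2pi (- _)) (e2pi (_ * _)) => u v; ring.
by rewrite -H; ring.
Qed.

Lemma sumZ_group (k : nat) (H : int -> C) (G : 'I_k -> int -> C) : (0 < k)%N ->
  summableZ H -> (forall r, summableZ (G r)) ->
  (forall (r : 'I_k) (j : int), G r j = H (r%:Z + k%:Z * j)) ->
  sumZ H = \sum_r sumZ (G r).
Proof.
move=> k0 sH sG E.
have h1 := ccvg_sub (f := fun J => (k * J)%N) (fun J => leq_pmull J k0) (sumZ_cvg sH).
have h2 : ccvg (fun J => \sum_r psumZ (G r) J) (\sum_r sumZ (G r)).
  by apply: ccvg_sum => r; exact: sumZ_cvg.
apply: ccvg_uniq h1 _; move: h2; congr ccvg; apply/funext => J /=.
elim: J => [|J IH].
  by rewrite muln0 {2}/psumZ big_ord0 big1// => i _; rewrite /psumZ big_ord0.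
have S K N : psumZ H (N + K) = psumZ H N + \sum_(r < K) (H (N + r)%N%:Z + H (- (N + r).+1%:Z)).
  by rewrite /psumZ big_split_ord.
rewrite mulnS addnC S -IH.
under eq_bigr do rewrite psumZS; rewrite big_split /=; congr (_ + _).
rewrite !big_split /=; congr (_ + _).
  by apply: eq_bigr => r _; rewrite E; congr H; lia.
rewrite (reindex_inj rev_ord_inj); apply: eq_bigr => r _; rewrite E /=; congr H.
by have := ltn_ord r; lia.
Qed.

Lemma cexp_mod (a b : C) (m : int) : a = b + 2 * ipi * m%:~R -> cexp a = cexp b.
Proof. by move=> ->; rewrite cexpD -[X in _ * X]/(e2pi _) e2pi_int mulr1. Qed.

Lemma cexp_opp a : - cexp a = cexp (a + ipi) :> C.
Proof. by rewrite cexpD cexp_ipi mulrN1. Qed.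

(** The unimodular coefficients that theta acquires at the rational point [h / k]. *)
Definition gf (k h : nat) n : C := cexp (ipi * n%:~R + ipi * (h%:R / k%:R) * (halfint R n)%:C ^+ 2).

Lemma gf_neq0 k h n : gf k h n != 0.
Proof. exact: cexp_neq0. Qed.

Lemma signzD m n : (-1) ^ (m + n) = (-1) ^ m * (-1) ^ n :> C.
Proof. by rewrite expfzDr// oppr_eq0 oner_eq0. Qed.

Section Coprime.
Variables (k h : nat).
Hypotheses (k0 : (0 < k)%N) (hk : odd h || odd k).
Let kC : (k%:R : C) != 0. Proof. by rewrite pnatr_eq0 -lt0n. Qed.

Lemma gf_rec n : gf k h (n + 1) = - cexp (2 * ipi * h%:R * (n%:~R + 1) / k%:R) * gf k h n.
Proof.
rewrite /gf cexp_opp -cexpD; congr cexp; rewrite !halfintE intrD; field.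
by rewrite kC.
Qed.

Lemma gf_anti n : gf k h (n + k%:Z) = - gf k h n.
Proof.
(* The sign is that of an odd multiple of [ipi]: [k + h + h * k] is odd as soon as [h] or [k] is. *)
rewrite /gf cexp_opp; pose t := (k + h + h * k)./2.
have e : (k + h + h * k)%N = (2 * t).+1.
  rewrite -[LHS]odd_double_half -/t mul2n !oddD oddM.
  by case: (odd h) (odd k) hk => [] [].
have eC : k%:R + h%:R + h%:R * k%:R = 2 * t%:R + 1 :> C by rewrite -!natrM -!natrD e natr1.
apply: (@cexp_mod _ _ (h%:Z * n + t%:Z)).
rewrite !halfintE !intrD intrM -!pmulrn mulrDr mulrDr.
have -> : 2 * ipi * t%:R = ipi * (k%:R + h%:R + h%:R * k%:R - 1) :> C by rewrite eC; ring.
field; exact: kC.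
Qed.

Lemma gf_odd n : gf k h (- n - 1) = - gf k h n.
Proof.
rewrite /gf cexp_opp; apply: (@cexp_mod _ _ (- n - 1)).
rewrite !halfintE !intrD !mulrNz; field; exact: kC.
Qed.

Lemma gf_antiM n (j : int) : gf k h (n + k%:Z * j) = (-1) ^ j * gf k h n.
Proof.
elim/int_ind: j => [|j IH|j IH]; first by rewrite mulr0 addr0 expr0z mul1r.
  by rewrite -addn1 PoszD mulrDr mulr1 addrA gf_anti IH signzD expr1z mulrN1 mulNr.
have := gf_anti (n + k%:Z * - j.+1%:Z).
rewrite -addrA (_ : k%:Z * - j.+1%:Z + k%:Z = k%:Z * - j%:Z); last by lia.
rewrite IH => /(congr1 -%R); rewrite opprK => <-.
by rewrite -mulNr !signzN -(addn1 j) PoszD signzD expr1z mulrN1.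
Qed.

End Coprime.

Lemma sum_per (k s : nat) (P : int -> C) : (0 < k)%N -> (forall n, P (n + k%:Z) = P n) ->
  \sum_(v < k) P (v%:Z - s%:Z) = \sum_(v < k) P v%:Z.
Proof.
move=> k0 hP; elim: s => [|s <-]; first by apply: eq_bigr => v _; rewrite subr0.
case: k k0 hP => // k _ hP; rewrite big_ord_recl [RHS]big_ord_recr /= addrC.
have -> : P (0%Z - s.+1%:Z) = P (k%:Z - s%:Z) by rewrite -hP; congr P; lia.
by congr (_ + _); apply: eq_bigr => v _; congr P; rewrite /bump /=; lia.
Qed.

Section GaussFourier.
Variables (k h h' g : nat).
Hypotheses (k0 : (0 < k)%N) (E : (k * g = h * h' + 1)%N).
Let kC : (k%:R : C) != 0. Proof. by rewrite pnatr_eq0 -lt0n. Qed.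

Lemma cop_odd_l : odd h || odd k.
Proof. by have := congr1 odd E; rewrite oddD !oddM /=; case: (odd h) (odd k) => [] []. Qed.
Lemma cop_odd_r : odd h' || odd k.
Proof. by have := congr1 odd E; rewrite oddD !oddM /=; case: (odd h') (odd h) (odd k) => [] [] []. Qed.
Let hg : odd h || odd g.
Proof. by have := congr1 odd E; rewrite oddD !oddM /=; case: (odd h) (odd h') (odd g) (odd k) => [] [] [] []. Qed.

(** The additive character that pairs the half-integers of [n] and [v]. Like [gf] it changes sign
    when [v] moves by [k], so products of the two are periodic. *)
Definition chn n (v : int) : C := cexp (2 * ipi * (halfint R n)%:C * ((halfint R v)%:C / k%:R)).

Let f2 n := \sum_(v < k) gf k h' v%:Z * chn n v%:Z.

Let chn_anti n v : chn n (v + k%:Z) = - chn n v.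
Proof.
rewrite /chn cexp_opp; apply: (@cexp_mod _ _ n).
by rewrite !halfintE intrD -pmulrn; field; exact: kC.
Qed.

Let f2_rec n : f2 (n + 1) = - cexp (2 * ipi * h%:R * (n%:~R + 1) / k%:R) * f2 n.
Proof.
have [s es] : exists s : int, (1 - h%:Z) * (1 - g%:Z) = 2 * s.
  have [ho|ho] := orP hg.
    exists (- h./2%:Z * (1 - g%:Z)).
    have -> : h%:Z = 1 + 2 * h./2%:Z by have := odd_double_half h; rewrite ho; lia.
    ring.
  exists (- g./2%:Z * (1 - h%:Z)).
  have -> : g%:Z = 1 + 2 * g./2%:Z by have := odd_double_half g; rewrite ho; lia.
  ring.
have esC : 2 * s%:~R = (1 - h%:R) * (1 - g%:R) :> C.
  by have := congr1 (fun x : int => x%:~R : C) es; rewrite !intrM !intrD !mulrNz -!pmulrn => ->.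
have gE : g%:R = (h%:R * h'%:R + 1) / k%:R :> C.
  by rewrite -natrM natr1 -addn1 -E natrM mulrAC divff// mul1r.
(* Shifting [v] by [h] absorbs the increment of [n]: since [k * g = h * h' + 1], the phases differ
   by [2 * ipi] times the integer [g * v - s]. *)
have H v : gf k h' v * chn (n + 1) v = - cexp (2 * ipi * h%:R * (n%:~R + 1) / k%:R) *
    (gf k h' (v - h%:Z) * chn n (v - h%:Z)).
  rewrite /gf /chn cexp_opp -!cexpD; apply: (@cexp_mod _ _ (g%:Z * v - s)).
  rewrite !halfintE !intrD !mulrNz intrM -!pmulrn.
  have -> : 2 * ipi * (g%:R * v%:~R - s%:~R) = ipi * (2 * g%:R * v%:~R - (1 - h%:R) * (1 - g%:R)) :> C.
    by rewrite -esC; ring.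
  by rewrite gE; field; exact: kC.
rewrite /f2; under eq_bigr do rewrite H.
rewrite -mulr_sumr; congr (_ * _); apply: (@sum_per k h (fun v => gf k h' v * chn n v) k0) => v.
by rewrite (gf_anti k0 cop_odd_r) chn_anti mulrNN.
Qed.

(** The transform [f2] satisfies the first-order recurrence [gf_rec] of [gf k h], hence is a
    multiple of it. The factor is not 0, because Fourier inversion recovers [gf k h' 0] from [f2].
    No Gauss sum is evaluated. *)
Lemma gauss_fourier : exists2 c : C, c != 0 & forall n, c * gf k h n = \sum_(v < k) gf k h' v%:Z * chn n v%:Z.
Proof.
pose c := f2 0 / gf k h 0.
have H n : c * gf k h n = f2 n.
  have r0 m : - cexp (2 * ipi * h%:R * (m%:~R + 1) / k%:R) != 0 :> C by rewrite oppr_eq0 cexp_neq0.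
  elim/int_ind: n => [|n IH|n IH]; first by rewrite /c divfK// gf_neq0.
    have e : n.+1%:Z = n%:Z + 1 by lia.
    by rewrite e f2_rec -IH (gf_rec _ k0) mulrCA.
  have e : - n%:Z = - n.+1%:Z + 1 by lia.
  by apply: (mulfI (r0 (- n.+1%:Z))); rewrite -f2_rec mulrCA -(gf_rec _ k0) -e.
exists c => //; apply/eqP => c0.
have F n : f2 n = 0 by rewrite -H c0 mul0r.
have : \sum_(n < k) f2 n%:Z / chn n%:Z 0 = k%:R * gf k h' 0.
  under eq_bigr do rewrite /f2 mulr_suml; rewrite exchange_big /=.
  rewrite (bigD1 (Ordinal k0))//= addrC big1.
    rewrite add0r (eq_bigr (fun=> gf k h' 0)); last by move=> n _; rewrite mulfK// cexp_neq0.
    by rewrite sumr_const card_ord mulr_natl.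
  move=> v v0; have {}v0 : (0 < v)%N.
    by rewrite lt0n; apply: contraNneq v0 => v0; apply/eqP/val_inj.
  pose u := e2pi (v%:R / k%:R : C).
  have -> : \sum_(n < k) gf k h' v%:Z * chn n%:Z v%:Z / chn n%:Z 0 =
     gf k h' v%:Z * cexp (ipi * v%:R / k%:R) * \sum_(n < k) u ^+ n.
    rewrite mulr_sumr; apply: eq_bigr => n _; rewrite -2!(mulrA (gf k h' v%:Z)); congr (_ * _).
    rewrite /chn /u -cexpN -e2piX /e2pi -!cexpD; congr cexp.
    by rewrite !halfintE -!pmulrn; field; exact: kC.
  have u1 : u - 1 != 0.
    rewrite e2pi_sub1; apply: mulf_neq0.
      by rewrite (mulf_neq0 _ (cexp_neq0 _))// mulf_neq0 ?iC_neq0 ?pnatr_eq0.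
    have -> : (pi : R)%:C * (v%:R / k%:R) = (pi * v%:R / k%:R)%:C.
      by rewrite !rmorphM fmorphV !rmorph_nat mulrA.
    have : 0 < sin (pi * v%:R / k%:R : R).
      apply: sin_gt0_pi; rewrite !mulr_gt0 ?pi_gt0 ?invr_gt0 ?ltr0n//=.
      by rewrite ltr_pdivrMr ?ltr0n// ltr_pM2l ?pi_gt0// ltr_nat ltn_ord.
    move=> s0; rewrite -cabs_gt0 (lt_le_trans _ (csin_ge_sin _))//= normr_gt0 gt_eqF//.
  suff -> : \sum_(n < k) u ^+ n = 0 by rewrite mulr0.
  apply: (mulfI u1); rewrite -subrX1 mulr0 /u -e2piX.
  by rewrite (_ : k%:R * (v%:R / k%:R) = v%:Z%:~R) ?e2pi_int ?subrr// -pmulrn mulrC divfK.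
rewrite big1 => [/esym/eqP|n _]; last by rewrite F mul0r.
by rewrite mulf_eq0 (negbTE kC) (negbTE (gf_neq0 _ _ _)).
Qed.

(* The transformation of theta under the matrix with bottom row (k, -h). *)
Lemma theta_transf (c : C) : c != 0 ->
  (forall n, c * gf k h n = \sum_(v < k) gf k h' v%:Z * chn n v%:Z) ->
  forall Z z, 0 < Re Z ->
  c * thetaZ z ((h%:R + iC * Z) / k%:R) =
  csq (k%:R / Z) * cexp (- ((pi : R)%:C * (k%:R / Z)) * z ^+ 2) *
    thetaZ (iC * z / Z) ((h'%:R + iC / Z) / k%:R).
Proof.
move=> c0 hc Z z rZ; pose W := k%:R / Z.
have Z0 := Re_gt0_neq0 rZ.
have rW : 0 < Re W by rewrite /W -(rmorph_nat (@real_complex R)) Re_realM mulr_gt0 ?ltr0n ?Re_inv_gt0.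
pose T n := cexp (- ((pi : R)%:C / W) * (halfint R n)%:C ^+ 2 + 2 * ipi * (halfint R n)%:C * z).
have eT n : (-1) ^ n * e2pi ((halfint R n ^+ 2 / 2)%:C * ((h%:R + iC * Z) / k%:R)) *
     e2pi ((halfint R n)%:C * z) = gf k h n * T n.
  rewrite /gf /T signz_ipi /e2pi -!cexpD; congr cexp; rewrite /W rmorphM rmorphXn fmorphV rmorph_nat /=.
  move: ((halfint R n)%:C : C) => m; rewrite /ipi.
  transitivity (iC * (pi : R)%:C * n%:~R + (iC * (pi : R)%:C * h%:R + (iC * iC) * (pi : R)%:C * Z) / k%:R * m ^+ 2
    + 2 * iC * (pi : R)%:C * m * z); first by field; exact: kC.
  by rewrite iC_sqr; field; rewrite kC Z0.
have [sT _ _] := poisson_half z rW; rewrite -/T in sT.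
pose P (v : 'I_k) n := cexp (- ((pi : R)%:C / W) * (halfint R n)%:C ^+ 2 +
  2 * ipi * (halfint R n)%:C * (z + (halfint R v%:Z)%:C / k%:R)).
pose Q (v : 'I_k) n := (-1) ^ n * cexp (- ((pi : R)%:C * W) * (z + (halfint R v%:Z)%:C / k%:R + n%:~R) ^+ 2).
have hPQ v : [/\ summableZ (P v), summableZ (Q v) & sumZ (P v) = csq W * sumZ (Q v)] by exact: poisson_half.
pose t n := (-1) ^ n * e2pi ((halfint R n ^+ 2 / 2)%:C * ((h%:R + iC * Z) / k%:R)) *
     e2pi ((halfint R n)%:C * z).
have ct n : c * t n = \sum_(v < k) gf k h' v%:Z * P v n.
  rewrite /t eT mulrA hc mulr_suml; apply: eq_bigr => v _; rewrite -mulrA; congr (_ * _).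
  by rewrite /chn /T /P -cexpD; congr cexp; ring.
have gP (v : 'I_k) : summableZ (fun n => gf k h' v%:Z * P v n) by apply: summableZM; have [] := hPQ v.
have st : summableZ t.
  rewrite (_ : t = fun n => c^-1 * \sum_(v < k) gf k h' v%:Z * P v n); last first.
    by apply/funext => n; rewrite -ct mulKf.
  by apply: summableZM; exact: summableZ_sum.
rewrite /thetaZ -/t -sumZ_scale// (eq_sumZ ct) sumZ_sum//.
pose t' n := (-1) ^ n * e2pi ((halfint R n ^+ 2 / 2)%:C * ((h'%:R + iC / Z) / k%:R)) *
     e2pi ((halfint R n)%:C * (iC * z / Z)).
pose H n := cexp (- ((pi : R)%:C * W) * z ^+ 2) * t' n.
have it' : 0 < Im ((h'%:R + iC / Z) / k%:R).
  rewrite invnat mulrC cImM /= mul0r addr0 cImD -(rmorph_nat (@real_complex R)) /= add0r cImM /= mul0r add0r mul1r.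
  by rewrite mulr_gt0 ?invr_gt0 ?ltr0n ?Re_inv_gt0.
have st' : summableZ t' by exact: theta_summable.
(* The residue [v] and the summation index [j] of the dual side combine into the single index
   [v + k * j], so that [k] Poisson sums make one theta series. *)
have EH (v : 'I_k) j : gf k h' v%:Z * Q v j = H (v%:Z + k%:Z * j).
  rewrite mulrCA mulrA -(gf_antiM k0 cop_odd_r) /H /t' /gf signz_ipi /e2pi -!cexpD.
  congr cexp; rewrite rmorphM rmorphXn fmorphV rmorph_nat /= !halfintE intrD intrM -!pmulrn /W.
  move: (v%:R : C) (j%:~R : C) => v' j'; rewrite /ipi.
  transitivity (iC * (pi : R)%:C * (v' + k%:R * j') + iC * (pi : R)%:C * (h'%:R / k%:R) * (v' + k%:R * j' + 2^-1) ^+ 2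
     + (- ((pi : R)%:C * (k%:R / Z)) * z ^+ 2) + (iC * iC) * (pi : R)%:C * 2 * (v' + k%:R * j' + 2^-1) * z / Z
      + (iC * iC) * (pi : R)%:C * (v' + k%:R * j' + 2^-1) ^+ 2 / (k%:R * Z)).
    by rewrite iC_sqr; field; rewrite kC Z0.
  by field; rewrite kC Z0.
rewrite -mulrA -(sumZ_scale _ st') -/H.
rewrite (@sumZ_group k H (fun v n => gf k h' v%:Z * Q v n))//.
- rewrite mulr_sumr; apply: eq_bigr => v _; have [h1 h2 h3] := hPQ v.
  by rewrite !sumZ_scale// h3; ring.
- exact: summableZM.
- by move=> v; apply: summableZM; have [] := hPQ v.
Qed.

End GaussFourier.
End Theta.

(** * The eta function: inversion and the Euclidean step *)

Section Eta.
Variable R : realType.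
Local Notation C := R[i].
Local Notation eta := (@Defs.eta R).
Implicit Types (W y z w tau Z q p : C).

Lemma e2pi_third : let w := e2pi (3^-1 : C) in 1 + w + w ^+ 2 = 0.
Proof.
move=> w; have w3 : w ^+ 3 = 1.
  by rewrite /w -e2piX divff ?pnatr_eq0//; have := e2pi_int R 1.
have w1 : w - 1 != 0.
  rewrite /w e2pi_sub1; apply: mulf_neq0.
    by rewrite (mulf_neq0 _ (cexp_neq0 _))// mulf_neq0 ?iC_neq0 ?pnatr_eq0.
  rewrite invnat -rmorphM -cabs_gt0 (lt_le_trans _ (csin_ge_sin _))//= normr_gt0 gt_eqF// sin_gt0_pi//.
  by have := pi_gt0 R => p0; rewrite divr_gt0//=; lra.
apply: (mulfI w1); rewrite mulr0.
by transitivity (w ^+ 3 - 1); [ring|rewrite w3 subrr].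
Qed.

Lemma qpoch_shift (a q : C) : cabs q < 1 -> qpoch a q = (1 - a) * qpoch (a * q) q.
Proof.
move=> q1; have h1 := ccvg_sub (f := S) leqnSn (qpoch_cvg q1 a).
apply: ccvg_uniq h1 _; have := ccvgZ (1 - a) (qpoch_cvg q1 (a * q)).
congr ccvg; apply/funext => n /=; rewrite big_ord_recl expr0 mulr1; congr (_ * _).
by apply: eq_bigr => j _; rewrite /bump /= exprD expr1 mulrA.
Qed.

Lemma qpoch_cube q : cabs q < 1 -> let w := e2pi (3^-1 : C) in
  qpoch q q * (qpoch (w * q) q * qpoch (w^-1 * q) q) = qpoch (q ^+ 3) (q ^+ 3).
Proof.
move=> q1 w; have q3 : cabs (q ^+ 3) < 1 by rewrite cabsX exprn_ilt1// cabs_ge0.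
have := ccvgM (qpoch_cvg q1 q) (ccvgM (qpoch_cvg q1 (w * q)) (qpoch_cvg q1 (w^-1 * q))).
move=> /ccvg_uniq; apply; have := qpoch_cvg q3 (q ^+ 3); congr ccvg; apply/funext => n.
rewrite -!big_split; apply: eq_bigr => j _ /=.
have E : 1 + w + w ^+ 2 = 0 := e2pi_third.
have w0 : w != 0 := e2pi_neq0 _.
clearbody w.
have wV : w^-1 = - 1 - w.
  apply: (mulfI w0); rewrite divff//; transitivity (1 - (1 + w + w ^+ 2)); [by rewrite E subr0|ring].
have -> : q ^+ 3 * q ^+ 3 ^+ j = (q * q ^+ j) ^+ 3 by rewrite [RHS]exprMn -(exprM q 3 j) mulnC exprM.
rewrite -!mulrA wV; move: (q * q ^+ j) => x.
transitivity ((1 - x) * (1 + x + x ^+ 2 + (1 + w + w ^+ 2) * (- x ^+ 2))).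
  by rewrite E mul0r addr0; ring.
ring.
Qed.

Lemma qpoch_split3 p : cabs p < 1 ->
  qpoch p p = qpoch p (p ^+ 3) * qpoch (p ^+ 2) (p ^+ 3) * qpoch (p ^+ 3) (p ^+ 3).
Proof.
move=> p1; have p3 : cabs (p ^+ 3) < 1 by rewrite cabsX exprn_ilt1// cabs_ge0.
have h1 := ccvg_sub (f := fun n : nat => (3 * n)%N) (fun n : nat => leq_pmull n (isT : (0 < 3)%N)) (qpoch_cvg p1 p).
apply: ccvg_uniq h1 _.
have := ccvgM (ccvgM (qpoch_cvg p3 p) (qpoch_cvg p3 (p ^+ 2))) (qpoch_cvg p3 (p ^+ 3)).
congr ccvg; apply/funext => n /=; elim: n => [|n IH].
  by rewrite muln0 !big_ord0 !mulr1.
rewrite mulnS addnC addn3 !big_ord_recr /= -IH.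
have -> : p ^+ 3 ^+ n = p ^+ (3 * n) by rewrite -exprM.
rewrite (exprS p (3 * n).+1) (exprS p (3 * n)).
move: (\prod_(i < n) _) (\prod_(i < n) _) (\prod_(i < n) _) => a b c; ring.
Qed.

Lemma eta_shift tau (n : int) : eta (tau + n%:~R) = cexp (ipi * n%:~R / 12) * eta tau.
Proof.
rewrite /Defs.eta e2pi_shift mulrA; congr (_ * _); rewrite /e2pi -cexpD; congr cexp; by field.
Qed.

Lemma theta_third tau : 0 < Im tau ->
  thetaZ 3^-1 tau = (e2pi (6^-1) - e2pi (- 6^-1)) * eta (3 * tau).
Proof.
move=> it; rewrite theta_product// qpoch_cube ?cabs_e2pi_lt1// /Defs.eta e2piX.
have -> : 3^-1 / 2 = 6^-1 :> C by field.
have -> : 3 * tau / 24%:R = tau / 8 by field.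
by rewrite mulrCA mulrA.
Qed.

(** With [p = e2pi s] and nome [p ^+ 3], the three products run over the exponents of [p] congruent
    to 1, 2 and 0 modulo 3 and assemble to [(p; p)]; the elementary factor of theta supplies the
    missing [1 - p]. *)
Lemma theta_self (s : C) : 0 < Im s -> thetaZ s (3 * s) = - e2pi (- s / 6) * eta s.
Proof.
move=> is0; have p1 := cabs_e2pi_lt1 is0.
have p3 : cabs (e2pi s ^+ 3) < 1 by rewrite cabsX exprn_ilt1// cabs_ge0.
rewrite theta_product; last by rewrite -(rmorph_nat (@real_complex R)) cImM /= mul0r addr0 mulr_gt0.
rewrite /Defs.eta e2piX (qpoch_split3 p1).
have -> : (e2pi s)^-1 * e2pi s ^+ 3 = e2pi s ^+ 2 by rewrite exprS mulKf ?e2pi_neq0.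
rewrite (qpoch_shift (e2pi s) p3).
have -> : e2pi (3 * s / 8) = e2pi (- s / 6) * e2pi (s / 24%:R) * e2pi (s / 2).
  by rewrite -!e2piD; congr e2pi; field.
have e1 : e2pi s = e2pi (s / 2) ^+ 2 by rewrite -e2piX; congr e2pi; field.
have := e2pi_neq0 (s / 2); rewrite e2piN e1; move: (e2pi (s / 2)) => v v0.
move: (qpoch _ _) (qpoch _ _) (qpoch _ _) (e2pi _) (e2pi _) => a b c d e; field.
exact: v0.
Qed.

Lemma csq_inv Z : 0 < Re Z -> csq Z^-1 = (csq Z)^-1.
Proof.
move=> rZ; have Z0 := Re_gt0_neq0 rZ.
by apply: csq_unique; [exact/Re_inv_gt0/Re_csq_gt0|rewrite exprVn csq_sqr].
Qed.

(** Inversion of theta with [k = 1], at the point [1 / 3] and parameter [Z / 3]: one side is eta by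
    [theta_third], the other by [theta_self]. The constant is settled by [- i * rho = sqrt 3], which
    cancels the root of [3 / Z]. *)
Lemma eta_S Z : 0 < Re Z -> eta (iC / Z) = csq Z * eta (iC * Z).
Proof.
move=> rZ; have Z0 := Re_gt0_neq0 rZ.
have i2 := iC_sqr R.
have e1 : (1 * 1 = 0 * 0 + 1)%N by [].
have hc (n : int) : iC * gf R 1 0 n = \sum_(v < 1) gf R 1 0 v%:Z * chn R 1 n v%:Z.
  rewrite big_ord1 /gf /chn -{1}cexp_ipi_half -!cexpD; congr cexp.
  by rewrite !halfintE /= mulr0z; field.
have rZ3 : 0 < Re (Z / 3) by rewrite invnat mulrC Re_realM mulr_gt0 ?invr_gt0.
have := theta_transf (isT : (0 < 1)%N) e1 (iC_neq0 R) hc 3^-1 rZ3.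
rewrite !add0r !divr1.
have -> : iC / 3 / (Z / 3) = iC / Z by field; exact: Z0.
have -> : iC / (Z / 3) = 3 * (iC / Z) by field; exact: Z0.
have iZ : 0 < Im (iC / Z) by rewrite cImM /= mul0r add0r mul1r Re_inv_gt0.
rewrite theta_third; last by rewrite cImM /= mul0r add0r mul1r.
rewrite theta_self// (_ : 3 * (iC * (Z / 3)) = iC * Z); last by field.
pose rho : C := e2pi 6^-1 - e2pi (- 6^-1); rewrite -/rho.
have -> : cexp (- ((pi : R)%:C * (1 / (Z / 3))) * 3^-1 ^+ 2) = (e2pi (- (iC / Z) / 6))^-1.
  rewrite /e2pi -cexpN /ipi; congr cexp.
  transitivity ((iC * iC) * (pi : R)%:C / (3 * Z)); first by rewrite iC_sqr; field; exact: Z0.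
  by field; exact: Z0.
pose r := 2 * sin (pi / 3) : R.
have r0 : 0 < r by rewrite mulr_gt0// sin_gt0_pi//; have := pi_gt0 R => p0; rewrite divr_gt0//=; lra.
have rE : - (iC * rho) = r%:C.
  rewrite /rho /e2pi.
  have -> : 2 * ipi * 6^-1 = iC * (pi / 3 : R)%:C.
    by rewrite /ipi rmorphM fmorphV rmorph_nat; field.
  have -> : 2 * ipi * - 6^-1 = iC * (- (pi / 3) : R)%:C.
    by rewrite /ipi rmorphN rmorphM fmorphV rmorph_nat; field.
  rewrite !cexp_iR cosN sinN; apply: complexP; rewrite /= /r; ring.
have r3 : r%:C ^+ 2 = 3.
  have E : 1 + e2pi 3^-1 + e2pi 3^-1 ^+ 2 = 0 :> C := e2pi_third.
  rewrite -rE /rho e2piN; have e6 : e2pi 3^-1 = e2pi (6^-1) ^+ 2 :> C by rewrite -e2piX; congr e2pi; field.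
  move: E; rewrite e6; have := e2pi_neq0 (6^-1 : C); move: (e2pi _) => v v0 E.
  transitivity (3 + (iC * iC + 1) * (v - v^-1) ^+ 2 - (1 + v ^+ 2 + v ^+ 2 ^+ 2) / v ^+ 2).
    by field; exact: v0.
  by rewrite i2 E; ring.
have csE : csq (1 / (Z / 3)) = r%:C / csq Z.
  apply: csq_unique.
    by rewrite Re_realM mulr_gt0// Re_inv_gt0// Re_csq_gt0.
  by rewrite expr_div_n r3 csq_sqr//; field; exact: Z0.
rewrite csE; have := e2pi_neq0 (- (iC / Z) / 6); move: (e2pi _) => v v0 H.
have s0 := csq_neq0 Z; have rC0 : r%:C != 0 :> C by rewrite -cabs_gt0 cabs_real normr_gt0 gt_eqF.
apply: (mulfI rC0).
have {}H : iC * rho * eta (iC * Z) = - (r%:C / csq Z * eta (iC / Z)).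
  by rewrite -mulrA H; field; rewrite v0 s0.
transitivity (csq Z * - (- (r%:C / csq Z * eta (iC / Z)))); first by field.
by rewrite -H -rE; ring.
Qed.

Lemma Re_csq_gt_Im Z : 0 < Re Z -> `|Im (csq Z)| < Re (csq Z).
Proof.
move=> rZ; have Z0 := Re_gt0_neq0 rZ.
have r0 := Re_csq_gt0 rZ; rewrite -{1}(csq_sqr Z0) expr2 cReM in rZ.
rewrite -ltr_sqr ?nnegrE ?normr_ge0 ?ltW// real_normK ?num_real//; nra.
Qed.

Lemma Re_mul_gt0 (a b : C) : 0 < Re a -> `|Im a| <= Re a ->
  `|Im b| < Re b -> 0 < Re (a * b).
Proof.
move=> a0 ha hb; rewrite (cReM a b) subr_gt0.
apply: le_lt_trans (ler_norm _) _; rewrite normrM.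
apply: (@le_lt_trans _ _ (Re a * `|Im b|)); first by rewrite ler_wpM2r.
by rewrite ltr_pM2l.
Qed.

(** Roots of points in the right half-plane have [|arg| < pi / 4], so their product stays in the
    right half-plane. *)
Lemma csq_mul Z Z' : 0 < Re Z -> 0 < Re Z' -> csq (Z * Z') = csq Z * csq Z'.
Proof.
move=> rZ rZ'; have Z0 := Re_gt0_neq0 rZ.
have Z0' : Z' != 0 by apply: contraTneq rZ' => ->; rewrite ltxx.
apply: csq_unique; last by rewrite (exprMn _ (csq Z)) !csq_sqr.
by apply: Re_mul_gt0; [exact: Re_csq_gt0|exact/ltW/Re_csq_gt_Im|exact: Re_csq_gt_Im].
Qed.

(** As for [csq_mul], except that the factor [exp (+- i pi / 4)] lies on the edge of the sector; the
    other factor is strictly inside. *)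
Lemma csq_rot (e : bool) Z : 0 < Re Z ->
  csq ((-1) ^+ e * iC * Z) = cexp ((-1) ^+ e * (ipi / 4)) * csq Z.
Proof.
move=> rZ; have Z0 := Re_gt0_neq0 rZ.
have E : (-1) ^+ e * (ipi / 4) = iC * ((-1) ^+ e * (pi / 4) : R)%:C :> C.
  by rewrite 2!rmorphM fmorphV rmorph_nat rmorphXn rmorphN1 /ipi; field.
have w2 : cexp ((-1) ^+ e * (ipi / 4)) ^+ 2 = (-1) ^+ e * iC :> C.
  rewrite -cexpMn; case: e {E}; rewrite ?expr1 ?expr0 ?mulN1r ?mul1r -?cexp_ipi_half -?cexpN.
    rewrite (_ : 2 * - (ipi / 4) = - (ipi / 2)); last by field.
    rewrite cexpN cexp_ipi_half; apply: (mulfI (iC_neq0 R)); rewrite divff ?iC_neq0//.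
    by rewrite mulrN iC_sqr opprK.
  by congr cexp; field.
apply: csq_unique; last by rewrite (exprMn _ (cexp _)) w2 csq_sqr.
have r0 : 0 < Re (cexp ((-1) ^+ e * (ipi / 4)) : C).
  rewrite E cexp_iR /=; apply: cos_gt0_pihalf; have := pi_gt0 R.
  by case: e {E w2}; rewrite ?expr0 ?expr1 => p0; apply/andP; split; lra.
apply: Re_mul_gt0 => //; last exact: Re_csq_gt_Im.
rewrite -ler_sqr ?nnegrE ?normr_ge0 ?(ltW r0)// real_normK ?num_real//.
have := congr1 (@Re R) w2; rewrite expr2 (cReM (cexp _)).
have -> : Re ((-1) ^+ e * iC : C) = 0 by case: e {E w2 r0}; rewrite ?expr1 ?expr0 ?mulN1r ?mul1r //= oppr0.
move=> /eqP; rewrite subr_eq0 => /eqP h; by rewrite !expr2 h.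
Qed.

Section Multiplier.
Variables (e : bool) (u k h' g : int).
Local Notation ep := ((-1) ^+ e : int).

(* [eta_rel h h' k w]: eta transforms with factor [w] under the matrix
   (h', -(h h' + 1)/k; k, -h), written with tau = (h + i Z)/k. *)
Definition eta_rel (h h' k : int) (w : C) := forall Z, 0 < Re Z ->
  eta ((h'%:~R + iC / Z) / k%:~R) = w * csq Z * eta ((h%:~R + iC * Z) / k%:~R).

Lemma eta_rel1 (h h'' : int) : eta_rel h h'' 1 (cexp (ipi * (h'' - h)%:~R / 12)).
Proof.
move=> Z rZ; rewrite !divr1 (addrC h''%:~R) (addrC h%:~R) !eta_shift eta_S//.
rewrite intrB mulrBr mulrBl cexpB; have := cexp_neq0 (ipi * h%:~R / 12 : C).
by move: (cexp _) (cexp _) (csq _) (eta _) => a b c d b0; field.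
Qed.

(** One Euclidean step: the matrix with lower left entry [k] is composed of the inversion
    [tau -> - 1 / tau] and a matrix with lower left entry [u]. The automorphy factors satisfy
    [Z2 * (- i tau) = - ep * i * Z], so the two square roots differ from [csq Z] by an eighth root
    of unity. *)
Lemma eta_rel_S (w : C) : 0 < u -> 0 < k -> k * g = ep * u * h' + 1 ->
  eta_rel (- (ep * k)) (ep * g) u w ->
  eta_rel (ep * u) h' k (cexp (- ((-1) ^+ e * (ipi / 4))) * w).
Proof.
move=> u0 k0 E H Z rZ.
have Z0 := Re_gt0_neq0 rZ.
have kC : (k%:~R : C) != 0 by rewrite intr_eq0 gt_eqF.
have uC : (u%:~R : C) != 0 by rewrite intr_eq0 gt_eqF.
have epC : (ep%:~R : C) = (-1) ^+ e by rewrite rmorphXn rmorphN1.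
have ep2 : (-1) ^+ e * (-1) ^+ e = 1 :> C by rewrite -expr2 sqrr_sign.
have EC : (k%:~R * g%:~R = (-1) ^+ e * u%:~R * h'%:~R + 1 :> C).
  by rewrite -intrM E intrD !intrM epC.
pose D := u%:~R + (-1) ^+ e * iC * Z.
pose V := u%:~R / Z + (-1) ^+ e * iC.
pose tau := (((-1) ^+ e * u%:~R + iC * Z) / k%:~R : C).
have iR : Re ((-1) ^+ e * iC : C) = 0 by case: (e); rewrite ?expr1 ?expr0 ?mulN1r ?mul1r //= oppr0.
have kR (x : C) : Re (x / k%:~R) = Re x / k%:~R.
  by rewrite -(rmorph_int (@real_complex R)) -fmorphV mulrC Re_realM mulrC.
have rV : 0 < Re V.
  rewrite /V cReD -(rmorph_int (@real_complex R)) Re_realM.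
  by rewrite iR addr0 mulr_gt0 ?ltr0z// Re_inv_gt0.
have V0 := Re_gt0_neq0 rV.
have DV : D = V * Z by rewrite /D /V; field.
have D0 : D != 0 by rewrite DV mulf_neq0.
pose Z2 := (V / k%:~R)^-1.
have rZ2 : 0 < Re Z2 by apply: Re_inv_gt0; rewrite kR divr_gt0// ltr0z.
have rt : 0 < Re (- iC * tau).
  have -> : - iC * tau = (Z - (-1) ^+ e * iC * u%:~R) / k%:~R.
    transitivity ((- (iC * iC) * Z - (-1) ^+ e * iC * u%:~R) / k%:~R); first by rewrite /tau; field.
    by rewrite iC_sqr opprK mul1r.
  rewrite kR divr_gt0 ?ltr0z// cReD cReN -(rmorph_int (@real_complex R)).
  by rewrite mulrC Re_realM iR mulr0 subr0.
have t0 : tau != 0.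
  by apply: contraTneq rt => ->; rewrite mulr0 ltxx.
have h1 := H Z2 rZ2; have h2 := eta_S rt.
have tE : tau = (-1) ^+ e * D / k%:~R by rewrite /tau /D mulrDr !mulrA ep2 mul1r.
have s0 : (-1) ^+ e != 0 :> C by rewrite signr_eq0.
have e1 : iC / (- iC * tau) = ((- (ep * k))%:~R + iC * Z2) / u%:~R.
  rewrite mulrNz intrM epC tE /Z2 (_ : V = D / Z); last by rewrite DV mulfK.
  have eD : iC * Z = D * (-1) ^+ e - (-1) ^+ e * u%:~R
    by transitivity (((-1) ^+ e * (-1) ^+ e) * (iC * Z)); [rewrite ep2 mul1r|rewrite /D; ring].
  transitivity (- ((-1) ^+ e * k%:~R / D)).
    apply: (mulfI s0); rewrite mulrN !mulrA ep2 mul1r; move: ((-1) ^+ e) s0 ep2 => s s0 ep2.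
    by field; rewrite s0 kC D0 iC_neq0.
  transitivity ((- ((-1) ^+ e * k%:~R) + k%:~R * (iC * Z) / D) / u%:~R); last by field; rewrite uC kC D0 Z0.
  by rewrite eD; field; rewrite uC D0.
have e2 : ((ep * g)%:~R + iC / Z2) / u%:~R = (h'%:~R + iC / Z) / k%:~R.
  rewrite intrM epC /Z2 invrK /V.
  have -> : g%:~R = ((-1) ^+ e * u%:~R * h'%:~R + 1) / k%:~R :> C by rewrite -EC mulrC mulKf.
  transitivity (((((-1) ^+ e * (-1) ^+ e) * u%:~R * h'%:~R + (-1) ^+ e) / k%:~R + iC * u%:~R / Z / k%:~R + (-1) ^+ e * (iC * iC) / k%:~R) / u%:~R).
    by field; rewrite uC kC Z0.
  by rewrite ep2 iC_sqr; field; rewrite uC kC Z0.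
rewrite e2 -e1 h2 in h1; rewrite h1 intrM epC -/tau.
have -> : - ((-1) ^+ e * (ipi / 4)) = (-1) ^+ (~~ e) * (ipi / 4) :> C.
  by rewrite signrN mulNr.
have e3 : csq Z2 * csq (- iC * tau) = cexp ((-1) ^+ (~~ e) * (ipi / 4)) * csq Z.
  rewrite -(csq_mul rZ2 rt) -(csq_rot _ rZ); congr csq.
  rewrite signrN tE /Z2 (_ : V = D / Z); last by rewrite DV mulfK.
  by field; rewrite kC D0 Z0.
have e4 : iC * (- iC * tau) = tau by rewrite mulrA mulrN iC_sqr opprK mul1r.
rewrite e4; move: (cexp _) e3 => c e3; rewrite -(mulrA c) (mulrCA c) -e3; move: (csq Z2) (csq _) (eta _) => *; ring.
Qed.

End Multiplier.
End Eta.

(** * Quadratic reciprocity by Gauss sums in finite fields *)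

Lemma int3_inj (K : fieldType) (q : nat) (a b : int) : q \in [pchar K] -> odd q ->
  [|| a == 0, a == 1 | a == -1] -> [|| b == 0, b == 1 | b == -1] ->
  a%:~R = b%:~R :> K -> a = b.
Proof.
move=> qK qo ha hb /eqP; rewrite -subr_eq0 -rmorphB /= -(dvdz_pcharf qK).
have q2 : (2 < q)%N by have := pcharf_prime qK; case: q qo {qK} => [|[|[|n]]].
case/or3P: ha => /eqP ->; case/or3P: hb => /eqP -> //; rewrite dvdzE /= => /dvdn_leq; lia.
Qed.

Section Legendre.
Import fingroup cyclic finalg finfield.
Variable p : nat.
Hypotheses (pp : prime p) (po : odd p).

Definition leg (x : 'F_p) : int :=
  if x == 0 then 0 else if [exists y : 'F_p, y ^+ 2 == x] then 1 else -1.

Let p1E : (p.-1 = 2 * p./2)%N.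
Proof. by have := odd_double_half p; rewrite po => <-; rewrite /= mul2n /= add0n uphalf_double. Qed.

Lemma Fp_fermat (x : 'F_p) : x != 0 -> x ^+ p.-1 = 1.
Proof.
move=> x0; apply: (mulfI x0); rewrite -exprS prednK ?prime_gt0// mulr1.
by have := expf_card x; rewrite card_Fp.
Qed.

Lemma leg_euler (x : 'F_p) : (leg x)%:~R = x ^+ p./2 :> 'F_p.
Proof.
rewrite /leg; have [->|x0] := eqVneq x 0.
  by rewrite expr0n; case: p pp po => [|[|[|n]]].
case: ifP => [/existsP[y /eqP yx]|H].
  by rewrite -yx -exprM -p1E Fp_fermat//; apply: contraNneq x0 => y0; rewrite -yx y0 expr0n.
have : (x ^+ p./2 - 1) * (x ^+ p./2 + 1) = 0.
  rewrite -subr_sqr expr1n -exprM mulnC -p1E Fp_fermat// subrr//.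
move/eqP; rewrite mulf_eq0 subr_eq0 addr_eq0 => /orP[/eqP x1|/eqP ->//].
case/existsP: H.
have [g gE] := cyclicP (field_unit_group_cyclic [group of [set: {unit 'F_p}]]).
have og : #[g]%g = p.-1.
  by rewrite /order -gE card_finField_unit card_Fp.
pose ux := finField_unit x0.
have : ux \in <[g]>%g by rewrite -gE inE.
move=> /cycleP[i xi].
have xE : x = val g ^+ i by rewrite -FinRing.val_unitX -xi.
(* In terms of a generator [g], [x ^+ p./2 = 1] forces the exponent of [x] to be even, and half of
   it gives a square root. *)
have : (g ^+ (i * p./2) == 1)%g.
  by apply/eqP/val_inj; rewrite FinRing.val_unitX exprM -xE.
rewrite -order_dvdn og p1E dvdn_pmul2r; last by case: p pp po => [|[|[|n]]].
move=> /dvdnP[j ij]; exists (val g ^+ j).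
by rewrite -exprM -ij -xE.
Qed.

Lemma leg_val (x : 'F_p) : [|| leg x == 0, leg x == 1 | leg x == -1].
Proof. by rewrite /leg; case: ifP => // _; case: ifP. Qed.

Lemma legM (x y : 'F_p) : leg (x * y) = leg x * leg y.
Proof.
apply: (int3_inj (pchar_Fp pp) po (leg_val _)).
  by case/or3P: (leg_val x) => /eqP ->; case/or3P: (leg_val y) => /eqP ->.
by rewrite intrM !leg_euler exprMn.
Qed.

Lemma leg_neq0 (x : 'F_p) : x != 0 -> leg x * leg x = 1.
Proof. by rewrite /leg => /negbTE ->; case: ifP. Qed.

Lemma legendreE (a : int) : legendre a p = leg a%:~R.
Proof.
rewrite /legendre /leg -(dvdz_pcharf (pchar_Fp pp)); case: ifP => // _.
congr (if _ then _ else _); apply/existsP/existsP => -[x].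
  move=> H; exists (x : nat)%:R; rewrite -subr_eq0.
  have -> : (x : nat)%:R ^+ 2 - a%:~R = ((x : nat)%:Z ^+ 2 - a)%:~R :> 'F_p.
    by rewrite intrD mulrNz rmorphXn.
  by rewrite -(dvdz_pcharf (pchar_Fp pp)) -eqz_mod_dvd.
move=> /eqP xa; have lx : (x < p)%N by rewrite -[X in (_ < X)%N](Fp_cast pp).
exists (Ordinal lx); rewrite eqz_mod_dvd (dvdz_pcharf (pchar_Fp pp)).
by rewrite intrD mulrNz rmorphXn /= -xa -pmulrn natr_Zp subrr.
Qed.

(** Multiplication by a nonresidue changes the sign of the sum; a generator of the unit group is a
    nonresidue by Euler's criterion. *)
Lemma leg_sum : \sum_(x : 'F_p) leg x = 0.
Proof.
have [u u0 lu] : exists2 u : 'F_p, u != 0 & leg u = -1.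
  have [g gE] := cyclicP (field_unit_group_cyclic [group of [set: {unit 'F_p}]]).
  have og : #[g]%g = p.-1 by rewrite /order -gE card_finField_unit card_Fp.
  have g0 : val g != 0 by rewrite -unitfE; exact: valP.
  exists (val g) => //; case/or3P: (leg_val (val g)) => /eqP l //.
    by have := leg_neq0 g0; rewrite l mulr0.
  have := leg_euler (val g); rewrite l => /esym g1.
  have : (g ^+ p./2 == 1)%g by apply/eqP/val_inj; rewrite FinRing.val_unitX g1.
  rewrite -order_dvdn og p1E => /dvdn_leq.
  have : (0 < p./2)%N by case: p pp po => [|[|[|n]]].
  by move=> h /(_ h); lia.
have E : \sum_(x : 'F_p) leg x = - \sum_(x : 'F_p) leg x.
  rewrite {1}(reindex_inj (mulfI u0)) -sumrN; apply: eq_bigr => x _.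
  by rewrite legM lu mulN1r.
lia.
Qed.

End Legendre.

Section GaussSum.
Import finalg finfield.
Variables p q : nat.
Hypotheses (pp : prime p) (po : odd p) (qp : prime q) (qo : odd q) (pq : p != q).
Variables (K : finFieldType) (zeta : K).
Hypotheses (qK : q \in [pchar K]) (zp : zeta ^+ p = 1) (z1 : zeta != 1).

Let psi (x : 'F_p) : K := zeta ^+ x.

Let psi_nat (n : nat) : psi n%:R = zeta ^+ n.
Proof. by rewrite /psi val_Fp_nat// expr_mod. Qed.

Let psiD x y : psi (x + y) = psi x * psi y.
Proof. by rewrite -[x]natr_Zp -[y]natr_Zp -natrD !psi_nat exprD. Qed.

Let psi0 : psi 0 = 1. Proof. exact: (psi_nat 0). Qed.

Let psi1 : psi 1 = zeta. Proof. exact: (psi_nat 1). Qed.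

Let psi_sum : \sum_x psi x = 0.
Proof.
have z10 : zeta - 1 != 0 by rewrite subr_eq0.
apply: (mulfI z10); rewrite mulr0 mulrBl mul1r mulr_sumr.
rewrite [X in _ - X](reindex_inj (addrI 1)) -sumrB big1// => x _.
by rewrite psiD psi1 subrr.
Qed.

Let tau := \sum_(x : 'F_p) (leg x)%:~R * psi x.

Let tau_sqr : tau ^+ 2 = (leg (-1 : 'F_p) * p%:Z)%:~R.
Proof.
have S x : x != 0 -> \sum_y (leg x)%:~R * psi x * ((leg y)%:~R * psi y) =
    \sum_t (leg t)%:~R * psi (x * (1 + t)) :> K.
  move=> x0; rewrite (reindex_inj (mulfI x0)); apply: eq_bigr => t _.
  rewrite legM// mulrDr mulr1 psiD mulrACA -intrM (mulrA (leg x)) leg_neq0// mul1r; exact: erefl.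
rewrite expr2 /tau mulr_suml (bigD1 0)//= {1}/leg eqxx mul0r mul0r add0r.
rewrite (eq_bigr (fun x => \sum_t (leg t)%:~R * psi (x * (1 + t)))); last first.
  by move=> x x0; rewrite mulr_sumr; exact: S.
rewrite exchange_big /=.
rewrite (eq_bigr (fun t => (leg t)%:~R * ((p%:Z * (t == -1)%:Z)%:~R - 1))); last first.
  move=> t _; rewrite -mulr_sumr; congr (_ * _).
  have [->|t1] := eqVneq t (-1).
    rewrite mulr1 (eq_bigr (fun=> 1)); last by move=> x _; rewrite subrr mulr0 psi0.
    rewrite sumr_const; have := cardC1 (0 : 'F_p); rewrite card_Fp// => ->.
    by rewrite -pmulrn -{2}(prednK (prime_gt0 pp)) -natr1 addrK.
  have t10 : 1 + t != 0 by rewrite addrC addr_eq0.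
  rewrite mulr0 mulr0z sub0r; apply/eqP; rewrite -addr_eq0; apply/eqP.
  rewrite -[RHS]psi_sum [RHS](reindex_inj (mulIf t10)) [RHS](bigD1 0)//= mul0r psi0 addrC//.
under eq_bigr do rewrite mulrBr mulr1.
rewrite sumrB -(rmorph_sum (intmul 1 : int -> K)) /= leg_sum// mulr0z subr0.
rewrite (bigD1 (-1))//= eqxx mulr1 -intrM big1 ?addr0// => t /negbTE ->.
by rewrite mulr0 mulr0z mulr0.
Qed.

Let tau_frob : tau ^+ q = (leg (q%:R : 'F_p))%:~R * tau.
Proof.
have q0 : (q%:R : 'F_p) != 0.
  rewrite -(dvdn_pcharf (pchar_Fp pp)); apply: contra pq.
  by rewrite dvdn_prime2.
rewrite -(pFrobenius_autE qK) /tau rmorph_sum mulr_sumr /=.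
rewrite [RHS](reindex_inj (mulfI q0)); apply: eq_bigr => x _.
rewrite pFrobenius_autE exprMn legM// intrM mulrA.
have l0 := leg_neq0 q0; rewrite mulrA -intrM l0 mul1r; congr (_ * _).
  case/or3P: (leg_val x) => /eqP ->; rewrite ?mulr0z ?mulr1z ?expr1n//.
    by rewrite expr0n; case: q qp => [|n].
  by rewrite rmorphN1 -signr_odd qo expr1.
rewrite -[x in RHS]natr_Zp -natrM psi_nat /psi -exprM mulnC//.
Qed.

(** [tau ^+ q.-1] is computed twice in characteristic [q]: the Frobenius map gives the symbol of [q]
    modulo [p], while [tau ^+ 2 = +- p] and Euler's criterion give the symbol modulo [q]. *)
Lemma gauss_reciprocity : leg (q%:R : 'F_p) = leg ((leg (-1 : 'F_p) * p%:Z)%:~R : 'F_q).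
Proof.
apply: (int3_inj qK qo (leg_val _) (leg_val _)).
have t0 : tau != 0.
  have : tau ^+ 2 != 0.
    rewrite tau_sqr -(dvdz_pcharf qK); case/or3P: (leg_val (-1 : 'F_p)) => /eqP l.
    - by have := @leg_neq0 p (-1); rewrite l mulr0 oppr_eq0 oner_eq0 => /(_ isT).
    - by rewrite l mul1r dvdzE /= dvdn_prime2// eq_sym.
    - by rewrite l mulN1r dvdzE abszN /= dvdn_prime2// eq_sym.
  by rewrite expf_eq0.
have H : tau ^+ q.-1 = (leg (q%:R : 'F_p))%:~R.
  by apply: (mulIf t0); rewrite -exprSr prednK ?prime_gt0// tau_frob.
have q1E : (q.-1 = 2 * q./2)%N.
  by have := odd_double_half q; rewrite qo => <-; rewrite /= mul2n /= add0n uphalf_double.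
rewrite -H q1E exprM tau_sqr -rmorphXn; apply/eqP; rewrite -subr_eq0 -rmorphB /=.
rewrite -(dvdz_pcharf qK) (dvdz_pcharf (pchar_Fp qp)) rmorphB subr_eq0 /=.
by rewrite rmorphXn leg_euler.
Qed.

End GaussSum.

Section Reciprocity.
Import fingroup finalg finfield pgroup sylow.

(** The field with [q ^ (p - 1)] elements works: by Fermat [p] divides the order of its unit group,
    and Cauchy's theorem yields an element of order [p]. *)
Lemma ex_prime_root (p q : nat) : prime p -> prime q -> p != q ->
  exists (K : finFieldType) (zeta : K), [/\ q \in [pchar K], zeta ^+ p = 1 & zeta != 1].
Proof.
move=> pp qp pq; have p1 : (0 < p.-1)%N by case: p pp {pq} => [|[|n]].
have [K qK cK] := pPrimePowerField qp p1.
have q0 : (q%:R : 'F_p) != 0.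
  by rewrite -(dvdn_pcharf (pchar_Fp pp)) dvdn_prime2.
have dv : (p %| #|[group of [set: {unit K}]]|)%N.
  rewrite card_finField_unit cK -subn1 (dvdn_pcharf (pchar_Fp pp)) natrB ?expn_gt0 ?prime_gt0//.
  by rewrite natrX Fp_fermat// subrr.
have [u _ ou] := Cauchy pp dv.
exists K, (val u); split=> //.
  by rewrite -FinRing.val_unitX -ou expg_order.
apply/negP => /eqP u1; have : (u == 1)%g by apply/eqP/val_inj.
by rewrite -order_eq1 ou; case: p pp {pq p1 cK q0 dv ou} => [|[|n]].
Qed.

End Reciprocity.

Lemma leg_m1 (p : nat) : prime p -> odd p -> leg (-1 : 'F_p) = (-1) ^+ p./2.
Proof.
move=> pp po; apply: (int3_inj (pchar_Fp pp) po (leg_val _)).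
  by rewrite -signr_odd; case: (odd _).
by rewrite leg_euler// rmorphXn rmorphN1.
Qed.

Lemma legendre_reciprocity (p q : nat) : prime p -> odd p -> prime q -> odd q -> p != q ->
  legendre p%:Z q * legendre q%:Z p = (-1) ^+ (p./2 * q./2).
Proof.
move=> pp po qp qo pq; have [K [z [qK zp z1]]] := ex_prime_root pp qp pq.
rewrite !legendreE// -!pmulrn (gauss_reciprocity pp po qp qo pq qK zp z1).
have p0 : (p%:R : 'F_q) != 0.
  by rewrite -(dvdn_pcharf (pchar_Fp qp)) dvdn_prime2// eq_sym.
rewrite leg_m1// intrM legM// mulrCA -pmulrn leg_neq0// mulr1 rmorphXn rmorphN1.
have -> : leg ((-1) ^+ p./2 : 'F_q) = leg (-1 : 'F_q) ^+ p./2.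
  elim: (p./2) => [|n IH]; last by rewrite !exprS legM// IH.
  have := @leg_neq0 q 1 (oner_neq0 _); rewrite /leg (negbTE (oner_neq0 _)).
  by case: ifP => // /existsP[]; exists 1; rewrite expr1n.
by rewrite leg_m1// -exprM mulnC.
Qed.

(** * The Jacobi symbol and its reciprocity law *)

Section Jacobi.

Definition jac (a : int) (n : nat) : int := \prod_(l <- primes n) legendre a l ^+ logn l n.

(** A common range of primes for different moduli makes multiplicativity in the modulus a termwise
    identity. *)
Lemma jac_big (a : int) (n N : nat) : (0 < n)%N -> (n < N)%N ->
  jac a n = \prod_(l <- iota 0 N | prime l) legendre a l ^+ logn l n.
Proof.
move=> n0 nN; rewrite /jac.
rewrite (perm_big [seq l <- iota 0 N | l \in primes n]); last first.
  apply: uniq_perm; rewrite ?primes_uniq ?filter_uniq ?iota_uniq// => l.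
  rewrite mem_filter mem_iota /= add0n andb_idr// mem_primes => /and3P[_ _ ln].
  exact: leq_ltn_trans (dvdn_leq n0 ln) nN.
rewrite big_filter [LHS]big_mkcond [RHS]big_mkcond; apply: eq_bigr => l _.
rewrite mem_primes n0 /=; case: (boolP (prime l)) => //= pl.
by case: ifP => // ln; rewrite lognE pl n0 ln /= expr0.
Qed.

Lemma jacMr a n m : (0 < n)%N -> (0 < m)%N -> jac a (n * m) = jac a n * jac a m.
Proof.
move=> n0 m0; have nm0 : (0 < n * m)%N by rewrite muln_gt0 n0.
rewrite !(@jac_big a _ (n * m).+1)// ?ltnS ?leq_pmulr ?leq_pmull//.
by rewrite -big_split; apply: eq_bigr => l _ /=; rewrite lognM// exprD.
Qed.

Lemma odd_primes n l : odd n -> l \in primes n -> prime l /\ odd l.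
Proof.
move=> no; rewrite mem_primes => /and3P[pl _ ln]; split=> //.
by apply: contraLR no; rewrite -!dvdn2 => /dvdn_trans /(_ ln); rewrite !dvdn2.
Qed.

Lemma jacMl a b n : odd n -> jac (a * b) n = jac a n * jac b n.
Proof.
move=> no; rewrite /jac -big_split; apply: eq_big_seq => l ln /=.
have [pl lo] := odd_primes no ln.
by rewrite -exprMn !legendreE// intrM legM.
Qed.

Lemma jac_per a (t : int) n : odd n -> jac (a + n%:Z * t) n = jac a n.
Proof.
move=> no; rewrite /jac; apply: eq_big_seq => l ln.
have [pl lo] := odd_primes no ln.
rewrite !legendreE// intrD intrM -pmulrn; move: ln; rewrite mem_primes => /and3P[_ _ ln].
have /eqP -> : (n%:R : 'F_l) == 0 by rewrite -(dvdn_pcharf (pchar_Fp pl)).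
by rewrite mul0r addr0.
Qed.

Lemma jac1 a : jac a 1 = 1. Proof. by rewrite /jac big_nil. Qed.

Lemma jac_prime a p : prime p -> jac a p = legendre a p.
Proof. by move=> pp; rewrite /jac primes_prime// big_seq1 logn_prime// eqxx expr1. Qed.

Lemma odd_ind (P : nat -> Prop) : P 1%N ->
  (forall p n, prime p -> odd p -> odd n -> P n -> P (p * n)%N) -> forall n, odd n -> P n.
Proof.
move=> P1 PM; elim/ltn_ind => n IH no.
have [n1|n1] := leqP n 1; first by case: n n1 no IH => [|[|]].
have pp := pdiv_prime n1; have [m nE] := dvdnP (pdiv_dvd n).
have mo : odd m /\ odd (pdiv n) by move: no; rewrite {1}nE oddM => /andP[].
rewrite nE mulnC; apply: PM (IH _ _ _) => //; try by case: mo.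
have m0 : (0 < m)%N by case: (m) mo => [[]|].
by rewrite [X in (_ < X)%N]nE ltn_Pmulr// prime_gt1.
Qed.

(** Modulo 2 the map [n -> n./2] sends products of odd numbers to sums; hence the sign of the
    reciprocity law is multiplicative in both arguments. *)
Lemma half_mul n m : odd n -> odd m ->
  ((n * m)./2 = n./2 + m./2 + 2 * (n./2 * m./2))%N.
Proof.
move=> no mo; have en := odd_double_half n; have em := odd_double_half m.
rewrite no in en; rewrite mo in em.
have E : (n * m = (n./2 + m./2 + 2 * (n./2 * m./2)).*2.+1)%N.
  rewrite -{1}en -{1}em -!mul2n; lia.
by rewrite E /= uphalf_double.
Qed.

Lemma jac_m1 n : odd n -> jac (-1) n = (-1) ^+ n./2.
Proof.
move: n; apply: odd_ind => [|p n' pp po no IH]; first by rewrite jac1 expr0.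
rewrite (jacMr _ (prime_gt0 pp) (odd_gt0 no)) (jac_prime _ pp) legendreE// rmorphN1 leg_m1// IH.
by rewrite half_mul// exprD exprD exprM sqrrN !expr1n mulr1.
Qed.

Lemma sgn_mul (p n m : nat) : odd p -> odd n ->
  (-1) ^+ ((p * n)./2 * m) = (-1) ^+ (p./2 * m) * (-1) ^+ (n./2 * m) :> int.
Proof.
move=> po no; rewrite half_mul// 2!mulnDl -mulnA 2!exprD (exprM (-1) 2).
by rewrite sqrrN !expr1n mulr1.
Qed.

Lemma jac_recip n m : odd n -> odd m -> coprime n m ->
  jac n%:Z m * jac m%:Z n = (-1) ^+ (n./2 * m./2).
Proof.
have H p : prime p -> odd p -> forall m, odd m -> coprime p m ->
    jac p%:Z m * jac m%:Z p = (-1) ^+ (p./2 * m./2).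
  move=> pp po; apply: odd_ind => [|q m' qp qo mo IH].
    by rewrite jac1 mul1r jac_prime// legendreE// muln0 expr0 /leg oner_eq0;
      case: ifP => // /existsP[]; exists 1; rewrite expr1n.
  rewrite coprimeMr => /andP[c1 c2]; rewrite (jacMr _ (prime_gt0 qp) (odd_gt0 mo)).
  rewrite PoszM jacMl// mulrACA IH// (jac_prime _ qp) (jac_prime _ pp) legendre_reciprocity//.
    by rewrite !(mulnC p./2) sgn_mul.
  by apply: contraTneq c1 => ->; rewrite prime_coprime// dvdnn.
move=> no; move: n no m; apply: odd_ind => [m mo _|p n pp po no IH m mo].
  rewrite jac1 mulr1 mul0n expr0 /jac big1_seq// => l /andP[_ /(odd_primes mo)[pl lo]].
  rewrite legendreE// /leg oner_eq0; case: ifP; first by rewrite expr1n.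
  by move=> /existsP[]; exists 1; rewrite expr1n.
rewrite coprimeMl => /andP[c1 c2]; rewrite (jacMr _ (prime_gt0 pp) (odd_gt0 no)).
by rewrite PoszM jacMl// mulrACA IH// H// -sgn_mul.
Qed.

Lemma jac_recip' n m : odd n -> odd m -> coprime n m ->
  jac n%:Z m = (-1) ^+ (n./2 * m./2) * jac m%:Z n.
Proof.
move=> no mo c; have := jac_recip no mo c; move: (jac n%:Z m) (jac m%:Z n) => x y E.
rewrite -E -mulrA; have : (`|x| * `|y| = 1)%N by rewrite -abszM E abszX abszN exp1n.
move=> /eqP; rewrite muln_eq1 => /andP[_ /eqP y1].
have [->|->] : y = 1 \/ y = -1 by lia.
  by rewrite !mulr1.
by rewrite mulrNN !mulr1.
Qed.

Lemma jacobiE (a : int) (n : nat) : jacobi a n%:Z = jac a n.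
Proof. by rewrite /jacobi /= mul1r. Qed.

End Jacobi.

(** * The eta multiplier [chi] *)

Lemma cube_dvd24 (k1 : nat) : exists c : int, (2 * k1%:Z + 1) ^+ 3 - (2 * k1%:Z + 1) = 24 * c.
Proof.
elim: k1 => [|k [c IH]]; first by exists 0.
exists (c + (k%:Z + 1) ^+ 2).
have -> : (2 * k.+1%:Z + 1) ^+ 3 - (2 * k.+1%:Z + 1) =
   ((2 * k%:Z + 1) ^+ 3 - (2 * k%:Z + 1)) + 24 * (k%:Z + 1) ^+ 2.
  by rewrite -[k.+1%:Z]/(1 + k%:Z); ring.
by rewrite IH mulrDr.
Qed.

Section Chi.
Variable R : realType.
Local Notation C := R[i].

Lemma chi_odd (a b d : int) (c : nat) : odd c ->
  chi R (mx2 a b c d) = (jac d c)%:~R *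
    cexp (ipi / 12 * ((a + d) * c%:Z - b * d * (c%:Z ^+ 2 - 1) - 3 * c%:Z)%:~R).
Proof. by move=> co; rewrite /chi /mx2 !mxE /= co jacobiE. Qed.

Lemma eta_rel_shift (h h' k t : int) (w : C) : 0 < k ->
  eta_rel h h' k w -> eta_rel (h + k * t) h' k (w * cexp (- (ipi * t%:~R / 12))).
Proof.
move=> k0 H Z rZ; have kC : (k%:~R : C) != 0 by rewrite intr_eq0 gt_eqF.
have -> : ((h + k * t)%:~R + iC * Z) / k%:~R = (h%:~R + iC * Z) / k%:~R + t%:~R.
  by rewrite intrD intrM; field.
rewrite eta_shift H// cexpN; have := cexp_neq0 (ipi * t%:~R / 12 : C).
move: (cexp _) (csq _) (Defs.eta _) => a b c a0; field; exact: a0.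
Qed.

(** As [k] is odd, the residue [r] of [h] or its complement [k - r] is odd. The Euclidean algorithm
    therefore stays among odd moduli, where [chi] has a single formula. *)
Lemma odd_repr (k : nat) (h : int) : odd k -> (1 < k)%N -> coprimez k%:Z h ->
  exists (e : bool) (u : nat) (t : int), [/\ odd u, (u < k)%N & h = (-1) ^+ e * u%:Z + k%:Z * t].
Proof.
move=> ko k1 c; pose r := `|(h %% k%:Z)%Z|%N.
have k0 : k%:Z != 0 by lia.
have rE : (h %% k%:Z)%Z = r%:Z by rewrite /r gez0_abs// modz_ge0.
have rk : (r < k)%N by have := ltz_mod h k0; rewrite rE; lia.
have hE := divz_eq h k%:Z; rewrite rE in hE.
have [ro|re] := boolP (odd r).
  by exists false, r, (h %/ k%:Z)%Z; split=> //; rewrite expr0 mul1r {1}hE; ring.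
exists true, (k - r)%N, ((h %/ k%:Z)%Z + 1); split.
- by rewrite oddB ?ko ?(negbTE re)// ltnW.
- have : r != 0%N.
    apply: contraTneq c => r0; move: hE; rewrite r0 addr0 => ->.
    by rewrite /coprimez gcdzC gcdz_modl || idtac; apply/negP => /eqP; rewrite /gcdz abszM gcdnMl; lia.
  by lia.
- by rewrite expr1 mulN1r -subzn ?(ltnW rk)// {1}hE; ring.
Qed.

(** Strong induction on [k]: the multiplier known for [u < k] passes to [k] by one Euclidean step
    and a translation by [t]. It remains to match the symbols by reciprocity and the exponents of
    24th roots of unity. *)
Lemma eta_odd (k : nat) : odd k -> forall h h' g : int, k%:Z * g = h * h' + 1 ->
  eta_rel h h' k%:Z (chi R (mx2 h' (- g) k (- h)) * cexp (ipi / 4)).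
Proof.
elim/ltn_ind: k => k IH ko h h' g E.
have [k1|k1] := leqP k 1.
  have {k1 IH ko} k1 : k = 1%N by case: k k1 ko {IH E} => [|[|]].
  rewrite k1 chi_odd// jac1 mul1r -cexpD => Z rZ; rewrite (eta_rel1 h h' rZ).
  congr (cexp _ * _ * _); rewrite !(intrD, intrM, mulrNz) /=; by field.
have cop : coprimez k%:Z h.
  apply/coprimezP; exists (g, - h'); rewrite /= mulrC E; ring.
have [e [u [t [uo uk hE]]]] := odd_repr ko k1 cop.
have u0 : (0 < u)%N by case: u uo {uk hE}.
pose ep : int := (-1) ^+ e.
have ep2 : ep * ep = 1 by rewrite /ep -expr2 sqrr_sign.
pose g0 := g - t * h'.
have E0 : k%:Z * g0 = ep * u%:Z * h' + 1.
  by rewrite /g0 mulrBr E hE -/ep; ring.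
have Eu : u%:Z * - (ep * h') = - (ep * k%:Z) * (ep * g0) + 1.
  transitivity (- (ep * ep) * (k%:Z * g0) + 1); last by ring.
  by rewrite ep2 E0; ring.
have := IH u uk uo _ _ _ Eu; rewrite !opprK => H.
have {H} := @eta_rel_S R e u%:Z k%:Z h' g0 _ u0 (ltnW k1) E0 H.
move=> /(eta_rel_shift t (ltnW k1 : 0 < k%:Z)); rewrite -/ep -hE.
congr eta_rel.
(* The sign of reciprocity together with that of [jac (-1)], taken at [u] if [ep = -1] and at [k] if
   [ep = 1]. *)
pose S := if e then (u./2 + u./2 * k./2)%N else (k./2 + u./2 * k./2)%N.
have cuk : coprime u k.
  rewrite coprime_sym -[u]absz_nat -[k]absz_nat -/(coprimez k%:Z u%:Z).
  by apply/coprimezP; exists (g0, - (ep * h')); rewrite /= mulrC E0; ring.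
have JE : jac (- h) k = (-1) ^+ S * jac (ep * k%:Z) u.
  rewrite hE opprD -(mulrN k%:Z) jac_per// /S /ep; case: (e).
    rewrite !expr1 !mulN1r opprK -(mulN1r k%:Z) jacMl// jac_m1// jac_recip'// exprD.
    have := sqrr_sign (int : comPzRingType) u./2; rewrite expr2.
    move: ((-1) ^+ u./2) ((-1) ^+ (u./2 * k./2)) (jac _ _) => a b c aa.
    transitivity ((a * a) * (b * c)); [by rewrite aa mul1r|ring].
  by rewrite !expr0 !mul1r -(mulN1r u%:Z) jacMl// jac_m1// jac_recip'// mulrA -exprD.
pose E1 := (h' + - h) * k%:Z - - g * - h * (k%:Z ^+ 2 - 1) - 3 * k%:Z.
pose E2 := (ep * g0 + ep * k%:Z) * u%:Z - ep * h' * (ep * k%:Z) * (u%:Z ^+ 2 - 1) - 3 * u%:Z.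
have -> : chi R (mx2 h' (- g) k (- h)) = (jac (- h) k)%:~R * cexp (ipi / 12 * E1%:~R) by exact: chi_odd.
have -> : chi R (mx2 (ep * g0) (ep * h') u (ep * k)) = (jac (ep * k%:Z) u)%:~R * cexp (ipi / 12 * E2%:~R).
  exact: chi_odd.
(* [k ^ 3 - k] is divisible by 24 for odd [k]; the difference of the exponents contains a multiple
   of it that comes from the translation. *)
have [c3 c3E] := cube_dvd24 k./2.
have kE : k%:Z = 2 * k./2%:Z + 1 by have := odd_double_half k; rewrite ko; lia.
have uE : u%:Z = 2 * u./2%:Z + 1 by have := odd_double_half u; rewrite uo; lia.
rewrite -kE in c3E.
pose M : int := (if e then - (u./2%:Z * (k./2%:Z + 1)) else 0) + c3 * (t * (2 * g0 + t * h')).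
(* The exponents agree modulo 24, the sign [(-1) ^+ S] counting as 12; what is left over is a
   multiple of the determinant relation [E0]. *)
have EQ : - 3 * ep + E2 - t = 12 * S%:Z + E1 + 24 * M.
  have Q0 : k%:Z * g0 - ep * u%:Z * h' - 1 = 0 by rewrite E0; ring.
  pose N : int := if e then - (u./2%:Z * (k./2%:Z + 1)) else 0.
  have -> : 24 * M = 24 * N + (k%:Z ^+ 3 - k%:Z) * (t * (2 * g0 + t * h')).
    by rewrite c3E /M -/N; ring.
  apply/eqP; rewrite -subr_eq0; apply/eqP.
  transitivity (- ((k%:Z ^+ 2 - 1) * t - ep * u%:Z * k%:Z) * (k%:Z * g0 - ep * u%:Z * h' - 1)); last by rewrite Q0 mulr0.
  have gE : g = g0 + t * h' by rewrite /g0 subrK.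
  rewrite /E1 /E2 hE -/ep gE /N /S /ep; case: (e); rewrite ?expr1 ?expr0 PoszD PoszM uE kE; ring.
clearbody E1 E2 M.
have K : cexp (- ((-1) ^+ e * (ipi / 4))) * cexp (ipi / 12 * E2%:~R) * cexp (- (ipi * t%:~R / 12)) =
    (-1) ^+ S * cexp (ipi / 12 * E1%:~R) :> C.
  have -> : (-1) ^+ S = cexp (S%:R * ipi) :> C by rewrite cexpMn cexp_ipi.
  rewrite -!cexpD; apply: (@cexp_mod _ _ _ M).
  have := congr1 (fun x : int => ipi / 12 * x%:~R : C) EQ.
  rewrite !intrD !intrM !mulrNz rmorphXn rmorphN1 -[S%:Z%:~R]pmulrn => H.
  transitivity (ipi / 12 * (- 3%:~R * (-1) ^+ e + E2%:~R - t%:~R) : C); first by field.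
  by rewrite H; field.
rewrite JE intrM rmorphXn rmorphN1; move: K.
move: (cexp (ipi / 12 * E1%:~R)) (cexp (ipi / 12 * E2%:~R)) (cexp (ipi / 4)) => b1 b2 c.
move: (cexp _) (cexp _) ((-1) ^+ S : C) ((jac _ _)%:~R : C) => a d s J K.
transitivity (J * c * (d * b2 * a)); first ring.
by rewrite K; ring.
Qed.

(** A single Euclidean step leads to the odd modulus [h], so [eta_odd] applies without a further
    induction. *)
Lemma eta_even (k h : nat) (h' g : int) : ~~ odd k -> (0 < k)%N -> odd h ->
  k%:Z * g = h%:Z * h' + 1 ->
  eta_rel h%:Z h' k%:Z (chi R (mx2 h' (- g) k (- h%:Z)) * cexp (ipi / 4)).
Proof.
move=> ke k0 ho E; have h0 : (0 < h)%N := odd_gt0 ho.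
have E1 : h%:Z * - h' = - k%:Z * g + 1 by rewrite mulNr E; ring.
have := eta_odd ho E1; rewrite !opprK => H.
have E2 : k%:Z * g = (-1) ^+ false * h%:Z * h' + 1 by rewrite expr0 mul1r.
have := @eta_rel_S R false h%:Z k%:Z h' g _ h0 k0 E2.
rewrite expr0 !mul1r => /(_ _ H); congr eta_rel.
rewrite chi_odd// /chi /mx2 !mxE /= (negbTE ke).
have -> : jacobi k%:Z (- h%:Z) = jac k%:Z h by rewrite /jacobi /= andbF mul1r abszN.
set A := (g + k%:Z) * _ - _ - _; set B := h' * _ * _ + _ - _.
have AB : B = A - 3 by rewrite /A /B; ring.
clearbody A B.
have K : cexp (- (ipi / 4)) * cexp (ipi / 12 * A%:~R) = cexp (ipi / 12 * B%:~R) :> C.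
  by rewrite -cexpD AB intrD mulrNz; congr cexp; field.
rewrite -K; move: (cexp (ipi / 4)) (cexp (ipi / 12 * A%:~R)) ((jac _ _)%:~R : C) => a b c.
move: (cexp _) => d; ring.
Qed.

Lemma neg_inv_spec (h k : nat) : (0 < k)%N -> coprime h k ->
  exists g : nat, (k * g = h * neg_inv h k + 1)%N.
Proof.
move=> k0 chk.
have H : has (fun x : nat => (- h%:Z * x%:Z == 1 %[mod k])%Z) (iota 0 k).
  have [[u v]] := coprimezP _ _ (chk : coprimez h%:Z k%:Z); rewrite /= => uv.
  apply/hasP; exists `|((- u) %% k%:Z)%Z|%N.
    rewrite mem_iota /= add0n; have := ltz_mod (- u) (_ : k%:Z != 0).
    by have := modz_ge0 (- u) (_ : k%:Z != 0); lia.
  rewrite gez0_abs ?modz_ge0//; last by lia.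
  rewrite eqz_mod_dvd; have := divz_eq (- u) k%:Z.
  move: ((- u) %/ k%:Z)%Z ((- u) %% k%:Z)%Z => d m e.
  apply/dvdzP; exists (h%:Z * d - v).
  have -> : - h%:Z * m - 1 = - h%:Z * m - (u * h%:Z + v * k%:Z) by rewrite uv.
  have -> : u = - (d * k%:Z + m) by rewrite -e opprK.
  ring.
have := nth_find 0%N H; rewrite -/(neg_inv h k) => /=.
have lt : (neg_inv h k < k)%N by move: H; rewrite has_find size_iota.
rewrite nth_iota// add0n eqz_mod_dvd => /dvdzP[q qE].
move: qE; set x := neg_inv h k; case: q => q qE.
  have : (h * x + 1)%N%:Z = - (q * k)%N%:Z by rewrite PoszD !PoszM -qE; ring.
  lia.
exists q.+1; have : (h * x + 1)%N%:Z = (k * q.+1)%N%:Z.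
  by rewrite PoszD !PoszM; move: qE; rewrite NegzE => qE; transitivity (- (- h%:Z * x%:Z - 1)); [ring|rewrite qE; ring].
by case.
Qed.

Lemma eta_Mhk (h k : nat) : (0 < k)%N -> coprime h k ->
  eta_rel h%:Z (neg_inv h k)%:Z k%:Z (chi R (Mhk h k) * cexp (ipi / 4)).
Proof.
move=> k0 chk; have [g gE] := neg_inv_spec k0 chk.
have E : k%:Z * g%:Z = h%:Z * (neg_inv h k)%:Z + 1 by lia.
rewrite /Mhk -gE mulKn//.
have [ko|ke] := boolP (odd k); first exact: eta_odd.
apply: eta_even => //; have := cop_odd_l gE; by rewrite (negbTE ke) orbF.
Qed.

End Chi.

(** * Towers of derivatives and Cauchy products *)

Section Jets.
Variable R : realType.
Local Notation C := R[i].
Implicit Types (f g : C -> C) (z w h : C) (F G : nat -> C -> C) (dl : R).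

(** A function on a disc about 0 is carried together with all its derivatives. Equality of two
    functions on the disc then passes to every derivative at 0 ([tower_eq]), with no appeal to
    Cauchy's theorem. *)
Definition tower dl F := forall n z, cabs z < dl -> cdiff (F n) z (F n.+1 z).

Lemma cderiv_tower dl F f n : tower dl F -> (forall z, cabs z < dl -> f z = F 0%N z) ->
  forall z, cabs z < dl -> cderiv n f z = F n z.
Proof.
move=> tF; elim: n => [|n IH] f0 z hz; first by rewrite /cderiv derive1n0 f0.
rewrite /cderiv derive1nS /=; apply: cdiff_derive1.
have d0 : 0 < dl - cabs z by rewrite subr_gt0.
apply: (cdiff_near (f := F n) d0); last exact: tF.
move=> w hw; rewrite -IH//; have := ler_cabsB w z; lra.
Qed.

Lemma tower_eq dl F G n z : tower dl F -> tower dl G ->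
  (forall z, cabs z < dl -> F 0%N z = G 0%N z) -> cabs z < dl -> F n z = G n z.
Proof.
move=> tF tG FG hz; have h := @cderiv_tower dl F (G 0%N) n tF (fun z hz => esym (FG z hz)) z hz.
by rewrite -h (@cderiv_tower dl G).
Qed.

Definition towerM F G n z : C := \sum_(i < n.+1) 'C(n, i)%:R * (F i z * G (n - i)%N z).

Lemma tower_mul dl F G : tower dl F -> tower dl G -> tower dl (towerM F G).
Proof.
move=> tF tG n z hz.
have -> : towerM F G n.+1 z = \sum_(i < n.+1) 'C(n, i)%:R * (F i.+1 z * G (n - i)%N z + F i z * G (n - i).+1 z).
  under [RHS]eq_bigr do rewrite mulrDr; rewrite [RHS]big_split /= /towerM.
  rewrite big_ord_recl bin0 subn0 /=.
  under eq_bigr do rewrite binS natrD mulrDl /bump /= add1n subSS.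
  rewrite big_split /=; set S1 := \sum_(i < n.+1) 'C(n, i)%:R * _; set S0 := \sum_(i < n.+1) _.
  rewrite addrA addrC; congr (_ + _).
  rewrite [RHS]big_ord_recl bin0 subn0 /S0; congr (_ + _).
  rewrite big_ord_recr /= bin_small// mul0r addr0; apply: eq_bigr => i _.
  by rewrite /bump /= add1n subnSK.
rewrite /towerM; apply: cdiff_sum => i; apply: cdiffZ.
by apply: cdiffM; [exact: tF|exact: tG].
Qed.

Lemma tower_cst dl (a : C) : tower dl (fun n z => if n is 0 then a else 0).
Proof. by move=> [|n] z _; exact: cdiff_cst. Qed.

Lemma tower_shift dl F : tower dl F -> tower dl (fun n => F n.+1).
Proof. by move=> tF n; exact: tF. Qed.

Lemma tower_scale dl (a : C) F : tower dl F -> tower dl (fun n z => a * F n z).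
Proof. by move=> tF n z hz; apply: cdiffZ; exact: tF. Qed.

Lemma tower_add dl F G : tower dl F -> tower dl G -> tower dl (fun n z => F n z + G n z).
Proof. by move=> tF tG n z hz; apply: cdiffD; [exact: tF|exact: tG]. Qed.

Lemma tower_lin dl dl' (a : C) F : 0 < dl -> tower dl F -> cabs a * dl' <= dl -> tower dl' (fun n z => a ^+ n * F n (a * z)).
Proof.
move=> dl0 tF ha n z hz; have h0 : cabs (a * z) < dl.
  have [a0|a0] := eqVneq a 0.
    by rewrite a0 mul0r cabs0.
  by apply: lt_le_trans ha; rewrite cabsM ltr_pM2l// cabs_gt0.
rewrite exprSr -mulrA; apply: cdiffZ.
have d1 : cdiff (fun w => a * w + 0) z a := cdiff_lin a 0 z.
have := @cdiff_comp _ (fun w => a * w + 0) (F n) z a (F n.+1 (a * z + 0)) d1.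
rewrite !addr0 [F n.+1 _ * a]mulrC => /(_ (tF n _ h0)); congr cdiff.
by apply/funext => w; rewrite addr0.
Qed.

(* The derivatives of 1 / f are Q_n / f ^ n.+1 with Q_(n+1) = Q_n' f - (n+1) Q_n f'. *)
Fixpoint inv_num F (n : nat) : nat -> C -> C :=
  if n is n'.+1 then fun m z =>
    towerM (fun i => inv_num F n' i.+1) F m z + - n'.+1%:R * towerM (inv_num F n') (fun i => F i.+1) m z
  else fun m z => if m is 0 then 1 else 0.

Definition towerV F n z : C := inv_num F n 0 z / F 0%N z ^+ n.+1.

Lemma tower_inv dl F : tower dl F -> (forall z, cabs z < dl -> F 0%N z != 0) -> tower dl (towerV F).
Proof.
move=> tF F0 n z hz.
have tQ : tower dl (inv_num F n).
  elim: n => [|n IH]; first exact: tower_cst.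
  apply: tower_add; first by apply: tower_mul => //; exact: tower_shift.
  by apply: tower_scale; apply: tower_mul => //; exact: tower_shift.
have f0 := F0 z hz.
have d1 : cdiff (fun w => F 0%N w ^+ n.+1) z (n.+1%:R * F 0%N z ^+ n * F 1%N z).
  exact: (@cdiff_comp _ (F 0%N) (fun w => w ^+ n.+1) z (F 1%N z) _ (tF 0%N z hz) (cdiffX _ _)).
have := cdiffM (tQ 0%N z hz) (cdiffV (f := fun w => F 0%N w ^+ n.+1) (expf_neq0 n.+1 f0) d1); congr cdiff.
rewrite /towerV /= /towerM !big_ord_recl !big_ord0 bin0 subnn !addr0 !mul1r.
by rewrite !exprS; field; rewrite f0 expf_neq0.
Qed.

Lemma taylor2 (f f1 f2 : C -> C) z h (d M : R) : cabs h < d ->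
  (forall w, cabs (w - z) < d -> cdiff f w (f1 w)) ->
  (forall w, cabs (w - z) < d -> cdiff f1 w (f2 w)) ->
  (forall w, cabs (w - z) < d -> cabs (f2 w) <= M) ->
  (forall w, cabs (w - z) < d -> ccont f2 w) ->
  cabs (f (z + h) - f z - h * f1 z) <= M * cabs h ^+ 2.
Proof.
move=> hd D1 D2 hM cc.
have d0 : 0 < d by apply: le_lt_trans hd; exact: cabs_ge0.
have M0 : 0 <= M.
  by apply: le_trans (cabs_ge0 (f2 z)) _; apply: hM; rewrite subrr cabs0.
have seg (x : R) : 0 <= x <= 1 -> cabs (z + x%:C * h - z) < d.
  move=> /andP[x0 x1]; rewrite addrAC subrr add0r cabsM cabs_real ger0_norm//.
  by apply: le_lt_trans hd; rewrite ler_piMl ?cabs_ge0.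
have lin x : cdiff (fun w => z + w * h) x h.
  have := cdiff_lin h z x; congr cdiff; apply/funext => w; by rewrite addrC mulrC.
have ch (g g' : C -> C) (x : R) : (forall w, cabs (w - z) < d -> cdiff g w (g' w)) -> 0 <= x <= 1 ->
    cdiff (fun w => g (z + w * h)) x%:C (g' (z + x%:C * h) * h).
  by move=> Dg hx; apply: cdiff_comp (lin _) _; apply: Dg; exact: seg.
have cseg (g : C -> C) (x : R) : (forall w, cabs (w - z) < d -> ccont g w) -> 0 <= x <= 1 ->
    ccont (fun w => g (z + w * h)) x%:C.
  by move=> cg hx; apply: ccont_comp (cdiff_ccont (lin _)) _; apply: cg; exact: seg.
have h1 (x : R) : 0 <= x <= 1 -> cabs (f1 (z + x%:C * h) - f1 z) <= M * cabs h.
  move=> /andP[x0 x1].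
  have := @mvt_bound R 0 x (fun w => f1 (z + w * h)) (fun w => f2 (z + w * h) * h) (M * cabs h) x0.
  rewrite mul0r addr0 subr0 => H; apply: le_trans (H _ _ _) _.
  - by move=> y /andP[y0 y1]; apply: ch => //; rewrite y0 (le_trans y1).
  - move=> y /andP[y0 y1]; apply: ccontM; last exact: ccont_cst.
    by apply: cseg => //; rewrite y0 (le_trans y1).
  - move=> y /andP[y0 y1]; rewrite cabsM ler_wpM2r ?cabs_ge0// hM// seg//.
    by rewrite y0 (le_trans y1).
  - by rewrite ler_piMr// mulr_ge0 ?cabs_ge0.
have := @mvt_bound R 0 1 (fun w => f (z + w * h) - w * (h * f1 z)) (fun w => f1 (z + w * h) * h - h * f1 z)
  (M * cabs h ^+ 2) ler01.
rewrite mul0r addr0 subr0 mul1r mulr1 mul0r subr0 mul1r => H.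
rewrite addrAC; apply: H.
- move=> x hx; apply: cdiffB; first exact: ch.
  by have := cdiff_lin (h * f1 z) 0 x%:C; congr cdiff; apply/funext => w; rewrite addr0 mulrC.
- move=> x hx; apply: ccontD; last exact: ccont_cst.
  apply: ccontM; last exact: ccont_cst.
  by apply: cseg => // w hw; exact: cdiff_ccont (D2 w hw).
- move=> x hx; have -> : f1 (z + x%:C * h) * h - h * f1 z = (f1 (z + x%:C * h) - f1 z) * h by ring.
  by rewrite cabsM expr2 mulrA ler_wpM2r ?cabs_ge0// h1.
Qed.

(** Termwise differentiation: a summable bound for the second derivatives makes the sum of all
    first-order remainders [O(|h|^2)]. *)
Lemma cdiff_cser (u u1 u2 : nat -> C -> C) (M : nat -> R) z d : 0 < d ->
  (forall n w, cabs (w - z) < d -> cdiff (u n) w (u1 n w)) ->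
  (forall n w, cabs (w - z) < d -> cdiff (u1 n) w (u2 n w)) ->
  (forall n w, cabs (w - z) < d -> ccont (u2 n) w) ->
  (forall n w, cabs (w - z) < d -> cabs (u2 n w) <= M n) -> rsummable M ->
  (forall w, cabs (w - z) < d -> csummable (u^~ w)) -> csummable (u1^~ z) ->
  cdiff (fun w => cser (u^~ w)) z (cser (u1^~ z)).
Proof.
move=> d0 D1 D2 cc hM sM su su1; apply/cdiff_epsP => e e0.
have zz : cabs (z - z) < d by rewrite subrr cabs0.
have [B HB] := sM; pose B1 := B + 1.
have M0 n : 0 <= M n := le_trans (cabs_ge0 _) (hM n z zz).
have B0 : 0 < B1 by have := HB 0%N; rewrite big_ord0 /B1; lra.
exists (Num.min d (e / B1)); first by rewrite lt_min d0 divr_gt0.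
move=> h; rewrite lt_min => /andP[hd he].
have zh : cabs (z + h - z) < d by rewrite addrAC subrr add0r.
have T n := taylor2 hd (D1 n) (D2 n) (hM n) (cc n).
have sh := su _ zh; have sz := su _ zz.
have sN1 : csummable (fun n => -1 * u n z) by exact: csummableZ.
have sh1 : csummable (fun n => - h * u1 n z) by exact: csummableZ.
have E : cser (u^~ (z + h)) - cser (u^~ z) - cser (u1^~ z) * h =
    cser (fun n => u n (z + h) - u n z - h * u1 n z).
  rewrite -[- cser (u^~ z)]mulN1r -cserZ// -(mulNr (cser _)) mulNr -mulrN mulrC -cserZ// -!cserD//.
    by apply: eq_cser => n; rewrite mulN1r mulNr.
  exact: csummableD.
rewrite E; apply: (@le_trans _ _ (B * cabs h ^+ 2)).
  apply: cser_le.
    by apply: csummable_le (fun n => T n) _; have := rsummableZ (sqr_ge0 (cabs h)) sM; congr rsummable; apply/funext => n; rewrite mulrC.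
  move=> N; apply: (@le_trans _ _ (\sum_(n < N) M n * cabs h ^+ 2)); first by apply: ler_sum => n _; exact: T.
  by rewrite -mulr_suml ler_wpM2r ?sqr_ge0.
rewrite expr2 mulrA ler_wpM2r ?cabs_ge0//.
have : cabs h * B1 <= e by rewrite -ler_pdivlMr// ltW.
by have := cabs_ge0 h; rewrite /B1; nra.
Qed.

Definition conv (a b : nat -> C) n : C := \sum_(i < n.+1) a i * b (n - i)%N.

Definition cpoly N (a : nat -> C) : {poly C} := \poly_(i < N) a i.

(** Coefficients of degree below [N] are those of a product of truncated polynomials; commutativity
    and associativity of Cauchy products are inherited from there. *)
Lemma conv_poly (a b : nat -> C) (n N : nat) : (n < N)%N -> conv a b n = (cpoly N a * cpoly N b)`_n.
Proof.
move=> nN; rewrite coefM; apply: eq_bigr => i _; rewrite !coef_poly.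
have i1 : (i < N)%N by rewrite (leq_trans (ltn_ord i)).
by rewrite i1 (leq_ltn_trans (leq_subr _ _) nN).
Qed.

Lemma convC a b : conv a b = conv b a.
Proof. by apply/funext => n; rewrite !(conv_poly _ _ (ltnSn n)) mulrC. Qed.

Lemma conv_coef (x y : {poly C}) a b n : (forall i, (i <= n)%N -> x`_i = a i) ->
  (forall i, (i <= n)%N -> y`_i = b i) -> conv a b n = (x * y)`_n.
Proof.
move=> xa yb; rewrite coefM; apply: eq_bigr => i _.
by rewrite xa ?yb ?leq_subr// -ltnS.
Qed.

Lemma convA a b c : conv a (conv b c) = conv (conv a b) c.
Proof.
apply/funext => n; pose P (u : nat -> C) := cpoly n.+1 u.
have Pe (u : nat -> C) i : (i <= n)%N -> (P u)`_i = u i by move=> hi; rewrite coef_poly ltnS hi.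
have Pm (u v : nat -> C) i : (i <= n)%N -> (P u * P v)`_i = conv u v i.
  by move=> hi; rewrite -(conv_poly _ _ (hi : (i < n.+1)%N)).
rewrite (conv_coef (x := P a) (y := P b * P c)) ?mulrA; [|exact: Pe|exact: Pm].
by rewrite (conv_coef (x := P a * P b) (y := P c)); [|exact: Pm|exact: Pe].
Qed.

Lemma conv_unit a : conv (fun n => (n == 0)%:R) a = a.
Proof.
apply/funext => n; rewrite /conv big_ord_recl subn0 mul1r big1 ?addr0// => i _.
by rewrite mul0r.
Qed.

End Jets.

(** * Cotangent bounds uniform in the shift *)

Section CotBounds.
Variable R : realType.
Local Notation C := R[i].
Implicit Types (z w : C) (k : nat) (e x s : R).

Transparent ccot ccos csin.

Lemma ccot_div z : ccot z = ccos z / csin z.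
Proof. by []. Qed.

Lemma csinN z : csin (- z) = - csin z.
Proof. by rewrite /csin mulrN opprK -[RHS]mulNr opprB. Qed.

Lemma ccosN z : ccos (- z) = ccos z.
Proof. by rewrite /ccos mulrN opprK addrC. Qed.

Lemma csinB z w : csin (z - w) = csin z * ccos w - ccos z * csin w.
Proof.
rewrite /csin /ccos mulrBr opprB !cexpB !cexpN.
have := cexp_neq0 (iC * z); have := cexp_neq0 (iC * w).
move: (cexp _) (cexp _) => a b a0 b0; field.
by rewrite a0 b0 iC_neq0.
Qed.

Opaque ccot ccos csin.

Lemma cabs_csin_sqr x y : cabs (csin (x +i* y : C)) ^+ 2 = sin x ^+ 2 + ((expR y - expR (- y)) / 2) ^+ 2.
Proof.
rewrite cabs_sqr csinE /=; have := cos2Dsin2 x; have := expRN y.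
have := expR_gt0 y; move: (expR y) (expR (- y)) (cos x) (sin x) => a b c d a0 ba cd.
have ab : a * b = 1 by rewrite ba divff// gt_eqF.
have -> : (d * (a + b) / 2) ^+ 2 + (c * (a - b) / 2) ^+ 2 =
  (c ^+ 2 + d ^+ 2) * ((a - b) / 2) ^+ 2 + d ^+ 2 * (a * b) by field.
by rewrite cd ab mul1r mulr1 addrC.
Qed.

Lemma cabs_ccos_sqr x y : cabs (ccos (x +i* y : C)) ^+ 2 = cos x ^+ 2 + ((expR y - expR (- y)) / 2) ^+ 2.
Proof.
rewrite cabs_sqr ccosE /=; have := cos2Dsin2 x; have := expRN y.
have := expR_gt0 y; move: (expR y) (expR (- y)) (cos x) (sin x) => a b c d a0 ba cd.
have ab : a * b = 1 by rewrite ba divff// gt_eqF.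
have -> : (c * (a + b) / 2) ^+ 2 + (- (d * (a - b) / 2)) ^+ 2 =
  (c ^+ 2 + d ^+ 2) * ((a - b) / 2) ^+ 2 + c ^+ 2 * (a * b) by field.
by rewrite cd ab mul1r mulr1 addrC.
Qed.

Lemma sinh_ge (y : R) : (y / 2) ^+ 2 <= ((expR y - expR (- y)) / 2) ^+ 2.
Proof.
wlog y0 : y / 0 <= y.
  move=> H; have [|y0] := leP 0 y; first exact: H.
  have := H (- y); rewrite opprK oppr_ge0 => /(_ (ltW y0)).
  by rewrite -[X in _ <= X -> _]sqrrN -mulNr opprB mulNr sqrrN.
have h : y / 2 <= (expR y - expR (- y)) / 2; last first.
  have y2 : 0 <= y / 2 by rewrite divr_ge0.
  have h2 := le_trans y2 h; by rewrite ler_pXn2r ?nnegrE.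
rewrite ler_pM2r// expRN; have h1 := expR_ge1Dx y.
have h2 : (expR y)^-1 <= (1 + y)^-1 by rewrite lef_pV2 ?posrE ?expR_gt0//; lra.
have : (1 + y) * (1 + y)^-1 = 1 by rewrite divff//; apply/eqP; lra.
have := expR_gt0 y; move: (expR y) (_^-1) h1 h2 => a b h1 h2 a0.
move: ((1 + y)^-1) h2 => c h2; nra.
Qed.

Lemma ccotN z : ccot (- z) = - ccot z.
Proof. by rewrite !ccot_div ccosN csinN invrN mulrN. Qed.

(** [|cot (x + i y)|^2] is [(cos^2 x + sinh^2 y) / (sin^2 x + sinh^2 y)], which is at most
    [1 / sin^2 x] whatever [y] is. *)
Lemma ccot_bound z : sin (Re z) != 0 -> cabs (ccot z) <= `|sin (Re z)|^-1.
Proof.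
case: z => x y /= s0; have sg : 0 < `|sin x| by rewrite normr_gt0.
have c0 : csin (x +i* y) != 0.
  by rewrite -cabs_gt0; apply: lt_le_trans (csin_ge_sin _).
rewrite ccot_div cabsM cabsV ler_pdivrMr ?cabs_gt0// mulrC ler_pdivlMr//.
rewrite -(@ler_pXn2r _ 2)// ?nnegrE ?cabs_ge0 ?mulr_ge0 ?cabs_ge0//.
rewrite exprMn cabs_csin_sqr cabs_ccos_sqr real_normK ?num_real//.
have := cos2Dsin2 x; move: (cos x) (sin x) (_ / 2) => c s M h.
have := sqr_ge0 M; have := sqr_ge0 c; have := sqr_ge0 s; nra.
Qed.

Lemma csin_neq0_Im z : Im z != 0 -> csin z != 0.
Proof.
case: z => x y /= y0; rewrite -cabs_gt0 lt_neqAle cabs_ge0 andbT eq_sym.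
rewrite -sqrf_eq0 cabs_csin_sqr gt_eqF//; have := sinh_ge y; have := sqr_ge0 (sin x).
have : 0 < y ^+ 2 by rewrite exprn_even_gt0.
lra.
Qed.

Lemma csin_neq0_Re z : sin (Re z) != 0 -> csin z != 0.
Proof. by move=> h; rewrite -cabs_gt0; apply: lt_le_trans (csin_ge_sin _); rewrite normr_gt0. Qed.

(** The cotangent of period [2 * k], with poles at the multiples of [2 * k] displaced by [- i e]. *)
Definition kc k e z := ccot ((pi / (2 * k%:R) : R)%:C * (z + iC * e%:C)).

Lemma Re_kcarg (a x e : R) : Re (a%:C * (x%:C + iC * e%:C)) = a * x.
Proof. by rewrite /=; ring. Qed.

Lemma Im_kcarg (a x e : R) : Im (a%:C * (x%:C + iC * e%:C)) = a * e.
Proof. by rewrite /=; ring. Qed.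

Lemma kc_per k e z (j : nat) : (0 < k)%N -> kc k e (z + (2 * k * j)%:R) = kc k e z.
Proof.
move=> k0; elim: j => [|j IH]; first by rewrite muln0 addr0.
rewrite -IH /kc -[RHS]ccot_periodic; congr ccot.
have kk : (k%:R : C) != 0 by rewrite pnatr_eq0 -lt0n.
rewrite mulnS natrD !natrM !rmorphM fmorphV rmorphM /= !rmorph_nat.
by move: (pi%:C) => p; field.
Qed.

Lemma kcN k e z : kc k e (- z) = - kc k (- e) z.
Proof. by rewrite /kc -ccotN; congr ccot; rewrite rmorphN /=; ring. Qed.

Lemma pi_ge2 : 2 <= (pi : R).
Proof. exact: pi_ge2. Qed.

Lemma kstep k : (0 < k)%N -> 0 < (pi / (2 * k%:R) : R).
Proof. by move=> k0; rewrite divr_gt0 ?pi_gt0 ?mulr_gt0 ?ltr0n. Qed.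

Lemma sin_kstep k s : (0 < k)%N -> 0 <= s <= k%:R ->
  (pi / (2 * k%:R)) * s / 2 <= sin (pi / (2 * k%:R) * s).
Proof.
move=> k0 /andP[s0 sk]; apply: sin_ge_half; have a0 := kstep k0; have kk := natR_gt0 R k0.
rewrite mulr_ge0 ?(ltW a0)//=.
have -> : pi / 2 = (pi / (2 * k%:R)) * k%:R :> R by field; rewrite gt_eqF.
by rewrite ler_pM2l.
Qed.

Lemma kc_bound0 k e s : (0 < k)%N -> 0 < `|s| <= k%:R -> cabs (kc k e s%:C) <= 2 * k%:R / `|s|.
Proof.
wlog s0 : s e / 0 < s.
  move=> H k0 hs; have [s0|s0|s0] := ltgtP s 0.
  - have := H (- s) (- e); rewrite oppr_gt0 s0 normrN => /(_ isT k0 hs).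
    by rewrite rmorphN kcN opprK cabsN.
  - exact: H.
  - by move: hs; rewrite s0 normr0 ltxx.
rewrite gtr0_norm// => k0 hs; have /andP[_ hs2] := hs; have hs3 : 0 <= s <= k%:R by rewrite ltW.
have hsin := sin_kstep k0 hs3; have a0 := kstep k0.
have kk := natR_gt0 R k0.
have as0 : 0 < pi / (2 * k%:R) * s / 2 by rewrite divr_gt0// mulr_gt0.
have sin0 := lt_le_trans as0 hsin.
apply: le_trans (ccot_bound _) _; rewrite Re_kcarg ?gt_eqF// gtr0_norm//.
apply: (@le_trans _ _ (pi / (2 * k%:R) * s / 2)^-1); first by rewrite lef_pV2.
have -> : (pi / (2 * k%:R) * s / 2)^-1 = 2 * k%:R / s * (2 / pi).
  have := pi_gt0 R; move: (pi : R) => p p0; by field; rewrite !gt_eqF.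
rewrite ler_piMr ?divr_ge0 ?mulr_ge0 ?(ltW s0) ?ler0n// ler_pdivrMr ?pi_gt0// mul1r.
exact: pi_ge2.
Qed.

Lemma kc_bound k e x : (0 < k)%N -> 0 < x < 2 * k%:R ->
  cabs (kc k e x%:C) <= 2 * k%:R * (x^-1 + (2 * k%:R - x)^-1).
Proof.
move=> k0 /andP[x0 xk]; have kk := natR_gt0 R k0.
have v1 : 0 < x^-1 by rewrite invr_gt0.
have v2 : 0 < (2 * k%:R - x)^-1 by rewrite invr_gt0 subr_gt0.
have [h|h] := leP x k%:R.
  have := @kc_bound0 k e x k0; rewrite gtr0_norm// x0 h => /(_ isT) /le_trans; apply.
  by rewrite ler_pM2l ?mulr_gt0// lerDl ltW.
have := @kc_bound0 k e (x - 2 * k%:R) k0; rewrite ltr0_norm ?subr_lt0// opprB subr_gt0 xk /=.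
have -> : 2 * k%:R - x <= k%:R by lra.
move=> /(_ isT); rewrite -(kc_per e _ 1 k0) muln1 natrM.
have -> : (x - 2 * k%:R)%:C + 2 * k%:R = x%:C :> C by rewrite rmorphB rmorphM /= !rmorph_nat subrK.
by move=> /le_trans; apply; rewrite ler_pM2l ?mulr_gt0// lerDr ltW.
Qed.

Lemma cdiff_kc k e z : csin ((pi / (2 * k%:R) : R)%:C * (z + iC * e%:C)) != 0 ->
  cdiff (kc k e) z (- (pi / (2 * k%:R) : R)%:C * (1 + kc k e z ^+ 2)).
Proof.
move=> h; have d1 : cdiff (fun w => (pi / (2 * k%:R) : R)%:C * (w + iC * e%:C)) z (pi / (2 * k%:R) : R)%:C.
  have := cdiff_lin (pi / (2 * k%:R) : R)%:C ((pi / (2 * k%:R) : R)%:C * (iC * e%:C)) z.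
  by congr cdiff; apply/funext => w; rewrite mulrDr.
have := cdiff_comp d1 (cdiff_ccot h); congr cdiff; by rewrite /kc mulNr mulrC mulNr.
Qed.

Lemma kc_neq0_e k e x : (0 < k)%N -> e != 0 -> csin ((pi / (2 * k%:R) : R)%:C * (x%:C + iC * e%:C)) != 0.
Proof. by move=> k0 e0; apply: csin_neq0_Im; rewrite Im_kcarg mulf_neq0// gt_eqF// kstep. Qed.

Lemma kc_neq0_x k e x : (0 < k)%N -> 0 < x < 2 * k%:R -> csin ((pi / (2 * k%:R) : R)%:C * (x%:C + iC * e%:C)) != 0.
Proof.
move=> k0 /andP[x0 xk]; apply: csin_neq0_Re; rewrite Re_kcarg gt_eqF//; apply: sin_gt0_pi.
have a0 := kstep k0; rewrite mulr_gt0//=.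
have E : pi = pi / (2 * k%:R) * (2 * k%:R) :> R by field; rewrite pnatr_eq0 -lt0n.
by rewrite [ltRHS]E ltr_pM2l.
Qed.

Lemma segc_kc k e a b : (0 < k)%N -> e != 0 -> segc a b (kc k e).
Proof. by move=> k0 e0 x _; apply: cdiff_ccont (cdiff_kc _); exact: kc_neq0_e. Qed.

Lemma sinh_le (y : R) : `|(expR y - expR (- y)) / 2| <= `|y| * expR (2 * `|y|) * expR `|y|.
Proof.
have := cexp_sub1_le (2 * y)%:C; rewrite cexp_real cabs_real -rmorphB cabs_real.
have -> : expR (2 * y) = expR y * expR y by rewrite -expRD; congr expR; ring.
rewrite normrM (ger0_norm (_ : 0 <= 2))// => h.
have -> : (expR y - expR (- y)) / 2 = (expR y * expR y - 1) * expR (- y) / 2.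
  by rewrite expRN; field; rewrite gt_eqF ?expR_gt0.
rewrite !normrM (ger0_norm (expR_ge0 _)) (ger0_norm (_ : 0 <= 2^-1))//.
have h2 : expR (- y) <= expR `|y| by rewrite ler_expR -normrN ler_norm.
have := ler_pM (normr_ge0 _) (expR_ge0 _) h h2; nra.
Qed.

Lemma le_mul_sqr (q x y : R) : 0 < q -> 0 <= x -> 0 <= y -> q <= x ^+ 2 -> q <= y ^+ 2 -> q <= x * y.
Proof.
move=> q0 x0 y0 hx hy; rewrite -(@ler_pXn2r _ 2) ?nnegrE ?(ltW q0) ?mulr_ge0//.
by rewrite exprMn [leLHS]expr2 ler_pM// ltW.
Qed.

Lemma sinh_le2 (a e : R) : 0 < a -> a <= pi / 2 -> `|e| <= 1 ->
  `|(expR (2 * (a * e)) - expR (- (2 * (a * e)))) / 2| <= 2 * a * `|e| * expR (3 * pi).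
Proof.
move=> a0 a1 e1; have E : `|2 * (a * e)| = 2 * a * `|e|.
  by rewrite normrM (normrM a) (gtr0_norm a0) ger0_norm// mulrA.
apply: le_trans (sinh_le _) _; rewrite E -mulrA -expRD ler_wpM2l//.
  by rewrite mulr_ge0// mulr_ge0// ltW.
rewrite ler_expR; have e0 := normr_ge0 e; have := pi_gt0 R; nra.
Qed.

(** The constant of [kc_pair]: 2 from the numerator and 8 from the lower bound for the two sines,
    with [expR (3 * pi)] controlling the hyperbolic sine. *)
Definition pvc : R := 16 * expR (3 * pi).

(** The cancellation behind the principal value. Since [kc] is odd up to the sign of [e], the sum is
    [cot z - cot w = sin (w - z) / (sin z * sin w)], whose numerator is of order [|e|]; the integral
    of the bound over [s >= 0] does not depend on [e]. *)
Lemma kc_pair k e s : (0 < k)%N -> 0 <= s <= k%:R -> e != 0 -> `|e| <= 1 ->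
  cabs (kc k e s%:C + kc k e (- s%:C)) <= pvc * k%:R * `|e| / (s + `|e|) ^+ 2.
Proof.
move=> k0 hs e0 e1; have [s0 sk] := andP hs; have a0 := kstep k0.
have n1 := kc_neq0_e s k0 e0; have n2 := @kc_neq0_e k (- e) s k0.
rewrite oppr_eq0 in n2; have {}n2 := n2 e0.
rewrite kcN /kc; set a : R := pi / _ in a0 n1 n2 *.
set z := a%:C * (s%:C + iC * e%:C); set w := a%:C * (s%:C + iC * (- e)%:C).
have E : ccot z - ccot w = csin (w - z) / (csin z * csin w).
  rewrite !ccot_div csinB; rewrite -/z -/w in n1 n2.
  by move: (csin z) (csin w) (ccos z) (ccos w) n1 n2 => p q u v p0 q0; field; rewrite p0 q0.
rewrite E cabsM cabsV cabsM.
have wz : w - z = 0 +i* (- (2 * (a * e))).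
  by apply: complexP; rewrite /=; ring.
have L (e' : R) : `|e'| = `|e| -> a ^+ 2 / 8 * (s + `|e|) ^+ 2 <= cabs (csin (a%:C * (s%:C + iC * e'%:C))) ^+ 2.
  move=> ee; have -> : a%:C * (s%:C + iC * e'%:C) = (a * s) +i* (a * e').
    by apply: complexP; rewrite /=; ring.
  rewrite cabs_csin_sqr; have := sinh_ge (a * e'); have := sin_kstep k0 hs; rewrite -/a.
  have -> : (a * e' / 2) ^+ 2 = (a * `|e| / 2) ^+ 2.
    have F (b x : R) : (b * x / 2) ^+ 2 = b ^+ 2 / 4 * x ^+ 2 by field.
    by rewrite !F -ee real_normK ?num_real.
  have as2 : 0 <= a * s / 2 by exact: divr_ge0 (mulr_ge0 (ltW a0) s0) (ler0n _ 2).
  move=> h1 h2; have h3 : (a * s / 2) ^+ 2 <= sin (a * s) ^+ 2.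
    have h4 := le_trans as2 h1; by rewrite ler_pXn2r ?nnegrE.
  have := sqr_ge0 (a * (s - `|e|)); have := sqr_ge0 (a * `|e|); nra.
set q := a ^+ 2 / 8 * (s + `|e|) ^+ 2 in L.
have e0' : 0 < `|e| by rewrite normr_gt0.
have se : 0 < s + `|e| by rewrite ltr_wpDl.
have q0 : 0 < q by rewrite mulr_gt0 ?divr_gt0 ?exprn_gt0.
have D : q <= cabs (csin z) * cabs (csin w).
  have L1 := L e erefl; have L2 := L (- e) (normrN _); rewrite -/z in L1; rewrite -/w in L2.
  by apply: le_mul_sqr L1 L2; rewrite ?cabs_ge0.
have Nn : cabs (csin (w - z)) <= 2 * a * `|e| * expR (3 * pi).
  have <- : `|(expR (2 * (a * e)) - expR (- (2 * (a * e)))) / 2| = cabs (csin (w - z)).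
    apply/eqP; rewrite -(@eqrXn2 _ 2)// ?cabs_ge0// wz cabs_csin_sqr sin0 expr0n /= add0r real_normK ?num_real//.
    by rewrite opprK; apply/eqP; move: (expR _) (expR _) => p r; ring.
  apply: sinh_le2 => //; rewrite /a ler_pM2l ?pi_gt0// lef_pV2 ?posrE ?mulr_gt0 ?ltr0n//.
  by rewrite ler_peMr// ler1n.
have Z2 : 2 * a * `|e| * expR (3 * pi) / q <= pvc * k%:R * `|e| / (s + `|e|) ^+ 2.
  have kk := natR_gt0 R k0.
  have -> : 2 * a * `|e| * expR (3 * pi) / q = pvc * k%:R * `|e| / (s + `|e|) ^+ 2 * (2 / pi).
    rewrite /q /pvc /a; move: (expR _) => X; have := pi_gt0 R; move: (pi : R) => p p0.
    by field; rewrite !gt_eqF.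
  rewrite ler_piMr ?ler_pdivrMr ?pi_gt0// ?mul1r ?pi_ge2//.
  by rewrite divr_ge0 ?sqr_ge0// !mulr_ge0 ?expR_ge0.
have pq := lt_le_trans q0 D.
by apply: le_trans Z2; apply: ler_pM => //; rewrite ?cabs_ge0 ?invr_ge0 ?(ltW pq)// lef_pV2 ?posrE.
Qed.

End CotBounds.

(** * Principal value estimates near one pole *)

Section PrincipalValue.
Variable R : realType.
Local Notation C := R[i].
Local Notation Gkc G k e := (fun z => G z * kc k e z).
Implicit Types (z w : C) (k : nat) (e x s : R).

Lemma segcN (a b : R) (F : C -> C) : a <= b -> segc (- b) (- a) F -> segc a b (fun z => F (- z)).
Proof.
move=> ab h x /andP[ax xb]; apply: (ccont_comp (f := fun w => - w) (ccontN (ccont_id _))).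
by rewrite -rmorphN; apply: h; rewrite !lerN2 xb.
Qed.

Lemma cdiff_inv_shift (c : C) (B x : R) : 0 < x + B ->
  cdiff (fun w => - c * (w + B%:C)^-1) x%:C (c / (x%:C + B%:C) ^+ 2).
Proof.
move=> xB; have n0 : x%:C + B%:C != 0 :> C by rewrite -rmorphD -cabs_gt0 cabs_real gtr0_norm.
have d1 : cdiff (fun w => w + B%:C) x%:C 1.
  by have := cdiff_lin 1 B%:C x%:C; congr cdiff; apply/funext => w; rewrite mul1r.
have := cdiffZ (- c) (cdiffV (f := fun w => w + B%:C) n0 d1); congr cdiff.
by rewrite mulN1r mulrNN.
Qed.

Lemma integ_inv_sqr (F : C -> C) (B K a b : R) : 0 <= K -> a <= b -> 0 < a + B -> segc a b F ->
  (forall x, a <= x <= b -> cabs (F x%:C) <= K / (x + B) ^+ 2) ->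
  cabs (integ a b F) <= K / (a + B).
Proof.
move=> K0 ab aB hF hb.
have pos x : a <= x <= b -> 0 < x + B by move=> /andP[ax _]; apply: lt_le_trans aB _; rewrite lerD2r.
have dP x : a <= x <= b -> cdiff (fun w => - K%:C * (w + B%:C)^-1) x%:C (K%:C / (x%:C + B%:C) ^+ 2).
  by move=> hx; apply: cdiff_inv_shift; exact: pos.
have re x : Re (K%:C / (x%:C + B%:C) ^+ 2) = K / (x + B) ^+ 2.
  by rewrite -rmorphD -rmorphXn -fmorphV -rmorphM.
have reP x : Re (- K%:C * (x%:C + B%:C)^-1) = - (K / (x + B)).
  by rewrite -rmorphD -fmorphV -rmorphN -rmorphM /= mulNr.
have := @cint_le_primitive _ a b F (fun w => - K%:C * (w + B%:C)^-1)
   (fun w => K%:C / (w + B%:C) ^+ 2) ab hF dP.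
rewrite !reP => H; apply: le_trans (H _ _) _.
- move=> x hx; apply: ccontM; first exact: ccont_cst.
  apply: ccontV.
    by rewrite expf_neq0// -rmorphD -cabs_gt0 cabs_real gtr0_norm pos.
  apply: (@ccont_comp _ (fun w => w + B%:C) (fun w => w ^+ 2)).
    by apply: ccontD; [exact: ccont_id|exact: ccont_cst].
  exact: cdiff_ccont (cdiffX 2 _).
- by move=> x hx; rewrite re; exact: hb.
- have bb : 0 < b + B by rewrite pos// ab lexx.
  by rewrite opprK addrC gerBl divr_ge0// ltW.
Qed.

(** The segment is folded at the pole, after which [|e| / (s + |e|)^2] has integral at most 1. *)
Lemma kc_inner k e s0 : (0 < k)%N -> 0 < s0 <= k%:R -> e != 0 -> `|e| <= 1 ->
  cabs (integ (- s0) s0 (kc k e)) <= pvc R * k%:R.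
Proof.
move=> k0 /andP[s00 sk] e0 e1; have le0 := ltW s00.
have N0 : - s0 <= 0 by rewrite oppr_le0.
have ep : 0 < `|e| by rewrite normr_gt0.
rewrite (cint_cat N0 le0); last exact: segc_kc.
have := @cint_opp R 0 s0 (kc k e) le0; rewrite oppr0 => -> ; last exact: segc_kc.
have cN : segc 0 s0 (fun z => kc k e (- z)) by apply: segcN => //; exact: segc_kc.
rewrite addrC -(cintD (F := kc k e) (G := fun z => kc k e (- z))) => //; last exact: segc_kc.
apply: le_trans (integ_inv_sqr (F := fun z => kc k e z + kc k e (- z)) (B := `|e|) (K := pvc R * k%:R * `|e|) _ le0 _ _ _) _.
- by rewrite !mulr_ge0 ?expR_ge0.
- by rewrite add0r.
- by apply: segcD; [exact: segc_kc|apply: segcN => //; exact: segc_kc].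
- by move=> x /andP[x0 xs]; rewrite kc_pair// x0 (le_trans xs sk).
- by rewrite add0r mulfK ?gt_eqF.
Qed.

(** At distance at least [d] from the pole one integrates by parts with [Phi], an antiderivative of
    [G] up to [Rr]. The factor [d] in the bounds for [Phi] and [Rr] compensates [|kc| = O(k / d)]
    and the integral [O(k / d)] of the derivative of [kc]. *)
Lemma kc_outer k e a b d (G Phi Rr : C -> C) (A : R) : (0 < k)%N -> e != 0 -> 0 < d -> 1 <= 2 * k%:R / d -> a <= b ->
  (0 < a \/ b < 0) -> d <= `|a| -> d <= `|b| -> b - a <= 1 -> `|a| <= k%:R -> `|b| <= k%:R ->
  (forall x, a <= x <= b -> cdiff Phi x%:C (G x%:C - Rr x%:C)) -> segc a b G -> segc a b Rr ->
  (forall x, a <= x <= b -> cabs (Phi x%:C) <= A * d) ->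
  (forall x, a <= x <= b -> cabs (Rr x%:C) <= A * d) ->
  cabs (integ a b (Gkc G k e)) <= 26 * k%:R * A.
Proof.
move=> k0 e0 d0 d1 ab hab da db ba ak bk dPhi cG cR hP hR.
have kk := natR_gt0 R k0.
pose K' z := - (pi / (2 * k%:R) : R)%:C * (1 + kc k e z ^+ 2).
have dK x : cdiff (kc k e) x%:C (K' x%:C) by apply: cdiff_kc; exact: kc_neq0_e.
have cK : segc a b (kc k e) by exact: segc_kc.
have cK' : segc a b K'.
  apply: segcM; first exact: segc_cst.
  apply: segcD; first exact: segc_cst.
  by have := segcM cK cK; congr segc; apply/funext.
have cP : segc a b Phi by exact: segc_diff dPhi.
have xd x : a <= x <= b -> d <= `|x| <= k%:R.
  move=> /andP[ax xb]; case: hab => h.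
    have x0 : 0 < x := lt_le_trans h ax.
    by move: da bk; rewrite !gtr0_norm//; [lra|exact: lt_le_trans ab].
  have x0 : x < 0 := le_lt_trans xb h.
  by move: db ak; rewrite !ltr0_norm//; [lra|exact: le_lt_trans ab _].
have hK x : a <= x <= b -> cabs (kc k e x%:C) <= 2 * k%:R / `|x|.
  move=> hx; have /andP[h1 h2] := xd x hx; apply: kc_bound0 => //.
  by rewrite h2 (lt_le_trans d0).
have hKd x : a <= x <= b -> cabs (kc k e x%:C) <= 2 * k%:R / d.
  move=> hx; apply: le_trans (hK x hx) _; have /andP[h1 _] := xd x hx.
  rewrite ler_pM2l ?mulr_gt0// lef_pV2 ?posrE//; exact: lt_le_trans h1.
have A0 : 0 <= A.
  have := le_trans (cabs_ge0 _) (hP a _); rewrite lexx ab => /(_ isT).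
  by rewrite pmulr_lge0.
have E : integ a b (Gkc G k e) =
    Phi b%:C * kc k e b%:C - Phi a%:C * kc k e a%:C - integ a b (fun z => Phi z * K' z)
     + integ a b (fun z => Rr z * kc k e z).
  have H := @cint_parts R a b (kc k e) Phi K' (fun z => G z - Rr z) ab (fun x _ => dK x) dPhi cK'.
  have c1 : segc a b (fun z => G z - Rr z).
    by apply: segcD => //; move=> x hx; apply: ccontN; exact: cR.
  have -> : integ a b (Gkc G k e) = integ a b (fun z => kc k e z * (G z - Rr z)) + integ a b (fun z => Rr z * kc k e z).
    rewrite -(cintD (F := fun z => kc k e z * (G z - Rr z)) (G := fun z => Rr z * kc k e z));
      [|exact: segcM|exact: segcM].
    by apply: eq_cint => x _; move: (kc _ _ _) (G _) (Rr _) => p q r; ring.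
  rewrite (H c1) (mulrC (kc k e b%:C)) (mulrC (kc k e a%:C)).
  suff -> : integ a b (fun z => K' z * Phi z) = integ a b (fun z => Phi z * K' z) by [].
  by apply: eq_cint => x _; rewrite mulrC.
have lab : a <= a <= b by rewrite lexx.
have lbb : a <= b <= b by rewrite lexx andbT.
have ad0 : 0 <= A * d by rewrite mulr_ge0// ltW.
have T x : a <= x <= b -> cabs (Phi x%:C * kc k e x%:C) <= 2 * k%:R * A.
  move=> hx; rewrite cabsM; have := ler_pM (cabs_ge0 _) (cabs_ge0 _) (hP x hx) (hKd x hx).
  by move=> /le_trans; apply; rewrite [leLHS](_ : _ = 2 * k%:R * A)//; field; rewrite gt_eqF.
have T3 : cabs (integ a b (fun z => Rr z * kc k e z)) <= 2 * k%:R * A.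
  apply: le_trans (@cint_bound R a b (fun z => Rr z * kc k e z) (2 * k%:R * A) ab _ _) _.
  - exact: segcM.
  - move=> x hx; rewrite cabsM; have := ler_pM (cabs_ge0 _) (cabs_ge0 _) (hR x hx) (hKd x hx).
    by move=> /le_trans; apply; rewrite [leLHS](_ : _ = 2 * k%:R * A)//; field; rewrite gt_eqF.
  - by rewrite ler_piMr// !mulr_ge0// ltW.
have T2 : cabs (integ a b (fun z => Phi z * K' z)) <= 20 * k%:R * A.
  (* |K'| <= 10 k / s^2, integrated away from 0 *)
  have hK' x : a <= x <= b -> cabs (Phi x%:C * K' x%:C) <= A * d * (10 * k%:R) / (x + 0) ^+ 2.
    move=> hx; have /andP[h1 h2] := xd x hx; have x0 : 0 < `|x| := lt_le_trans d0 h1.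
    rewrite cabsM -mulrA; apply: ler_pM; rewrite ?cabs_ge0//; first exact: hP.
    rewrite addr0 -[x ^+ 2]real_normK ?num_real//.
    rewrite cabsM cabsN cabs_real (gtr0_norm (kstep R k0)).
    have q : cabs (1 + kc k e x%:C ^+ 2) <= 5 * k%:R ^+ 2 / `|x| ^+ 2.
      apply: le_trans (cabsD _ _) _; rewrite cabs1 cabsX.
      have := hK x hx; have := cabs_ge0 (kc k e x%:C) => c0 c1.
      have := ler_pM c0 c0 c1 c1; rewrite -!expr2 expr_div_n => c2.
      have : 1 <= k%:R ^+ 2 / `|x| ^+ 2 by rewrite ler_pdivlMr ?exprn_gt0// mul1r lerXn2r ?nnegrE// ltW.
      rewrite exprMn in c2; move: c2; rewrite -!mulrA.
      move: (k%:R * (_ / _)) (cabs _ ^+ 2) => X Q; lra.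
    have := ler_pM (ltW (kstep R k0)) (cabs_ge0 _) (lexx _) q => /le_trans; apply.
    have -> : pi / (2 * k%:R) * (5 * k%:R ^+ 2 / `|x| ^+ 2) = (5 / 2 * pi) * (k%:R / `|x| ^+ 2).
      by have := pi_gt0 R; move: (pi : R) => p p0; field; rewrite !gt_eqF.
    rewrite -[leRHS]mulrA ler_pM2r ?divr_gt0 ?exprn_gt0//.
    have := pihalf_lt2 R; lra.
  have KK : 0 <= A * d * (10 * k%:R) by rewrite mulr_ge0// mulr_ge0// ltW.
  have cF : segc a b (fun z => Phi z * K' z) by exact: segcM.
  have fin t : d <= t -> A * d * (10 * k%:R) / (t + 0) <= 20 * k%:R * A.
    move=> dt; have t0 := lt_le_trans d0 dt; rewrite addr0 ler_pdivrMr//.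
    have : 0 <= A * (10 * k%:R) by rewrite mulr_ge0// mulr_ge0// ltW.
    have -> : A * d * (10 * k%:R) = A * (10 * k%:R) * d by ring.
    have -> : 20 * k%:R * A * t = A * (10 * k%:R) * (2 * t) by ring.
    by move=> v0; apply: ler_wpM2l => //; move: dt t0; clear; lra.
  case: hab => h.
    have := integ_inv_sqr (B := 0) KK ab _ cF hK'; rewrite addr0 => /(_ h) /le_trans; apply.
    by rewrite -[X in _ / X]addr0 fin// -(gtr0_norm h).
  have nab : - b <= - a by rewrite lerN2.
  have cF' : segc (- - a) (- - b) (fun z => Phi z * K' z) by rewrite !opprK.
  have := cint_opp nab cF'; rewrite !opprK => ->.
  have := integ_inv_sqr (B := 0) KK nab _ (segcN nab cF') _; rewrite addr0 oppr_gt0 => /(_ h) H.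
  apply: le_trans (H _) _.
    move=> x /andP[x1 x2]; rewrite addr0 -sqrrN -[in leRHS](addr0 (- x)) -[in (- x%:C)]rmorphN /=.
    by apply: hK'; rewrite lerNr x2 lerNl.
  by rewrite -[X in _ / X]addr0 fin// -(ltr0_norm h).
(* Two boundary terms, the integral against the derivative of [kc], and the remainder: 2 + 2 + 20 +
   2 = 26. *)
rewrite E; have := cabsD (Phi b%:C * kc k e b%:C - Phi a%:C * kc k e a%:C - integ a b (fun z => Phi z * K' z)) (integ a b (fun z => Rr z * kc k e z)).
have := cabsD (Phi b%:C * kc k e b%:C - Phi a%:C * kc k e a%:C) (- integ a b (fun z => Phi z * K' z)).
have := cabsD (Phi b%:C * kc k e b%:C) (- (Phi a%:C * kc k e a%:C)).
rewrite !cabsN; have := T _ lab; have := T _ lbb; lra.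
Qed.

(** [pvc] comes from the principal value at the pole, 4 from the variation of the amplitude close to
    it, and [52 / d] from the two outer pieces. *)
Definition pvk (d : R) : R := pvc R + 4 + 52 / d.

(** [L] measures how fast [G] varies and is unbounded in the application, so the scale of the split
    has to follow it: within [rho / L] the function [G] is [G 0] up to [A * L * |x|], and outside
    [kc_outer] gains [1 / L]. The result depends neither on [L] nor on [e]. *)
Lemma kc_pv k e (rho L A : R) (G Gd Phi Rr : C -> C) : (0 < k)%N -> e != 0 -> `|e| <= 1 ->
  0 < rho <= 1 / 2 -> 1 <= L ->
  (forall x, - rho <= x <= rho -> cdiff G x%:C (Gd x%:C)) -> segc (- rho) rho Gd ->
  (forall x, - rho <= x <= rho -> cabs (G x%:C) <= A) ->
  (forall x, - rho <= x <= rho -> cabs (Gd x%:C) <= A * L) ->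
  (forall x, - rho <= x <= rho -> cdiff Phi x%:C (G x%:C - Rr x%:C)) -> segc (- rho) rho Rr ->
  (forall x, - rho <= x <= rho -> cabs (Phi x%:C) <= A / L) ->
  (forall x, - rho <= x <= rho -> cabs (Rr x%:C) <= A / L) ->
  cabs (integ (- rho) rho (Gkc G k e)) <= pvk rho * k%:R * A.
Proof.
move=> k0 e0 e1 /andP[r0 r1] L1 dG cGd hG hGd dPhi cR hP hR.
have L0 : 0 < L by move: L1; clear; lra.
(* The scale on which [G] is nearly constant. *)
pose d := rho / L; have d0 : 0 < d by rewrite divr_gt0.
have dr : d <= rho by rewrite ler_pdivrMr// ler_peMr// ltW.
have kk : (1 : R) <= k%:R by rewrite ler1n.
have W a b x : - rho <= a -> b <= rho -> a <= x <= b -> - rho <= x <= rho.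
  by move=> h1 h2 /andP[h3 h4]; rewrite (le_trans h1 h3) (le_trans h4 h2).
have [[n1 n2 n3 n4] n5 n6 n7 n8] : [/\ [/\ - rho <= - d, - d <= d, - d <= rho & rho <= k%:R], d <= k%:R,
    - d - - rho <= 1, rho - d <= 1 & - rho <= d].
  by move: d0 dr r0 r1 kk; clear; do 2?split; lra.
have n9 : - d < 0 by rewrite oppr_lt0.
have nr : - rho <= 0 by rewrite oppr_le0 ltW.
have ndr : - d <= rho := n3.
have rr : - rho <= 0 <= rho by rewrite nr ltW.
have A0 : 0 <= A := le_trans (cabs_ge0 _) (hG 0 rr).
have cK a b : segc a b (kc k e) by exact: segc_kc.
have cG : segc (- rho) rho G by exact: segc_diff dG.
have cI : segc (- rho) rho (Gkc G k e) by exact: segcM.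
have cI2 : segc (- d) rho (Gkc G k e) by apply: segcW cI.
rewrite (@cint_cat R _ _ _ (Gkc G k e) n1 n3 cI).
rewrite (@cint_cat R _ _ _ (Gkc G k e) n2 dr cI2).
have AL : A / L = A / rho * d by rewrite /d; field; rewrite !gt_eqF.
have d2 : 1 <= 2 * k%:R / d by rewrite ler_pdivlMr// mul1r; move: n5 kk; clear; lra.
have O1 : cabs (integ (- rho) (- d) (Gkc G k e)) <= 26 * k%:R * (A / rho).
  apply: (@kc_outer k e (- rho) (- d) d G Phi Rr (A / rho)) => //.
  - by right.
  - by rewrite normrN gtr0_norm.
  - by rewrite normrN gtr0_norm.
  - by rewrite normrN gtr0_norm.
  - by rewrite normrN gtr0_norm.
  - by move=> x hx; apply: dPhi; apply: W hx.
  - exact: segcW cG.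
  - exact: segcW cR.
  - by move=> x hx; rewrite -AL; apply: hP; apply: W hx.
  - by move=> x hx; rewrite -AL; apply: hR; apply: W hx.
have O2 : cabs (integ d rho (Gkc G k e)) <= 26 * k%:R * (A / rho).
  apply: (@kc_outer k e d rho d G Phi Rr (A / rho)) => //.
  - by left.
  - by rewrite gtr0_norm.
  - by rewrite gtr0_norm.
  - by rewrite gtr0_norm.
  - by rewrite gtr0_norm.
  - by move=> x hx; apply: dPhi; apply: W hx.
  - exact: segcW cG.
  - exact: segcW cR.
  - by move=> x hx; rewrite -AL; apply: hP; apply: W hx.
  - by move=> x hx; rewrite -AL; apply: hR; apply: W hx.
have cGm : segc (- d) d G by exact: segcW cG.
have c0 : segc (- d) d (fun z => G z - G 0) by apply: segcD => //; exact: segc_cst.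
have In : cabs (integ (- d) d (Gkc G k e)) <= 4 * k%:R * A + pvc R * k%:R * A.
  have -> : integ (- d) d (Gkc G k e) =
      integ (- d) d (fun z => (G z - G 0) * kc k e z) + G 0 * integ (- d) d (kc k e).
    rewrite -(@cintZ R _ _ (G 0) (kc k e))// -(cintD (F := fun z => (G z - G 0) * kc k e z) (G := fun z => G 0 * kc k e z)).
    - by apply: eq_cint => x _; move: (kc _ _ _) (G _) (G _) => p q r; ring.
    - exact: segcM.
    - by apply: segcM => //; exact: segc_cst.
  apply: le_trans (cabsD _ _) _; apply: lerD; last first.
    rewrite cabsM mulrC; apply: ler_pM; rewrite ?cabs_ge0//; last exact: hG.
    by apply: kc_inner => //; rewrite d0.
  apply: le_trans (@cint_bound R (- d) d (fun z => (G z - G 0) * kc k e z) (2 * k%:R * (A * L)) n2 _ _) _.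
  - exact: segcM.
  - move=> x /andP[x1 x2].
    have [->|x0] := eqVneq x 0; first by rewrite subrr mul0r cabs0 !mulr_ge0// ltW// lt_le_trans kk.
    have xp : 0 < `|x| by rewrite normr_gt0.
    have xk : `|x| <= k%:R by rewrite (le_trans _ n5)// ler_norml x1.
    have hx := @kc_bound0 R k e x k0; rewrite xp xk in hx; have {}hx := hx isT.
    have hg : cabs (G x%:C - G 0) <= A * L * `|x|.
      have [xs|xs] := leP 0 x.
        have := @mvt_bound R 0 x G Gd (A * L) xs; rewrite subr0 (ger0_norm xs) rmorph0; apply.
        - by move=> y hy; apply: dG; apply: W hy => //; exact: le_trans dr.
        - by apply: segcW cGd => //; exact: le_trans dr.
        - by move=> y hy; apply: hGd; apply: W hy => //; exact: le_trans dr.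
      have := @mvt_bound R x 0 G Gd (A * L) (ltW xs); rewrite sub0r (ltr0_norm xs) rmorph0 cabsB; apply.
      - by move=> y hy; apply: dG; apply: W hy; [exact: le_trans x1|exact: ltW].
      - by apply: segcW cGd; [exact: le_trans x1|exact: ltW].
      - by move=> y hy; apply: hGd; apply: W hy; [exact: le_trans x1|exact: ltW].
    rewrite cabsM; have := ler_pM (cabs_ge0 _) (cabs_ge0 _) hg hx.
    by move=> /le_trans; apply; rewrite [leLHS](_ : _ = 2 * k%:R * (A * L))//; field; rewrite gt_eqF.
  - by rewrite opprK /d [leLHS](_ : _ = 4 * k%:R * A * rho); [rewrite ler_piMr ?mulr_ge0//; move: r1; clear; lra|field; rewrite gt_eqF].
have := cabsD (integ (- rho) (- d) (Gkc G k e))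
  (integ (- d) d (Gkc G k e) + integ d rho (Gkc G k e)).
have := cabsD (integ (- d) d (Gkc G k e)) (integ d rho (Gkc G k e)).
have -> : pvk rho * k%:R * A = pvc R * k%:R * A + 4 * k%:R * A + 2 * (26 * k%:R * (A / rho)).
  by rewrite /pvk; move: (pvc R) => q; field; rewrite gt_eqF.
by move: O1 O2 In; clear; lra.
Qed.

End PrincipalValue.

(** * Derivatives of Gaussians *)

Section Hermite.
Variable R : realType.
Local Notation piC := ((pi : R)%:C).
Local Notation C := R[i].
Implicit Types (Y z w : C) (k : nat) (e x s y : R).

Definition gE Y z := cexp (- (piC * Y) * z ^+ 2).

(** Hermite polynomials in a complex scale: [Hp Y n] times [gE Y] is the [n]-th derivative of
    [gE Y]. *)
Fixpoint Hp Y n : {poly C} :=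
  if n is n'.+1 then (Hp Y n')^`() - (2 * (piC * Y)) *: ('X * Hp Y n') else 1.

Definition phi Y n z := (Hp Y n).[z] * gE Y z.

Lemma cdiff_gE Y z : cdiff (gE Y) z (- (2 * (piC * Y)) * z * gE Y z).
Proof.
have := cdiff_quad (- (piC * Y)) 0 z; rewrite mul0r !addr0.
have -> : cexp (- (pi%:C * Y) * z ^+ 2) * (2 * - (pi%:C * Y) * z) = - (2 * (piC * Y)) * z * gE Y z.
  by rewrite -/(gE Y z) mulrC; congr (_ * _); rewrite mulrN.
by congr cdiff; apply/funext => w; rewrite mul0r addr0.
Qed.

Lemma cdiff_phi_herm Y n z : cdiff (phi Y n) z (phi Y n.+1 z).
Proof.
have := cdiffM (cdiff_poly (Hp Y n) z) (cdiff_gE Y z); congr cdiff.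
rewrite /phi /= hornerD hornerN hornerZ hornerM hornerX.
by move: (gE Y z) (2 * _) ((Hp Y n)^`()) (Hp Y n) => E a p q; ring.
Qed.

Lemma segc_phi Y n a b : segc a b (phi Y n).
Proof. by apply: segc_diff => x _; exact: cdiff_phi_herm. Qed.

Lemma phiN Y n z : phi Y n (- z) = (-1) ^+ n * phi Y n z.
Proof.
pose dl := cabs z + 1; have dz : cabs z < dl by rewrite ltrDl.
have dl0 : 0 < dl by rewrite ltr_wpDl ?cabs_ge0.
have t1 : tower dl (phi Y) by move=> m w _; exact: cdiff_phi_herm.
have t2 : tower dl (fun m w => (-1) ^+ m * phi Y m (-1 * w)).
  by apply: tower_lin dl0 t1 _; rewrite cabsN cabs1 mul1r.
rewrite (tower_eq n t1 t2 _ dz) ?mulN1r.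
  by rewrite mulrA -exprMn mulrNN mulr1 expr1n mul1r.
by move=> w _; rewrite expr0 mul1r mulN1r /phi /gE /= !hornerC sqrrN.
Qed.

Lemma size_deriv_le (p : {poly C}) : (size p^`() <= size p)%N.
Proof. by apply: leq_trans (size_poly _ _) _; exact: leq_pred. Qed.

Lemma size_Hp Y n : (size (Hp Y n) <= n.+1)%N.
Proof.
elim: n => [|n IH] /=; first by rewrite size_poly1.
apply: leq_trans (size_polyD _ _) _; rewrite geq_max size_polyN; apply/andP; split.
  by apply: leq_trans (size_deriv_le _) (leqW IH).
apply: leq_trans (size_scale_leq _ _) _; rewrite mulrC.
by have [->|p0] := eqVneq (Hp Y n) 0; rewrite ?mul0r ?size_poly0// size_mulX.
Qed.

(** Growth of the coefficients of [Hp Y n] apart from [cabs Y ^+ n]: differentiation contributes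
    [2 * n.+1], where the 2 pays for [1 <= 2 * cabs Y], and multiplication by the variable
    contributes [2 * pi]. *)
Fixpoint Hc n : R := if n is n'.+1 then (2 * n'.+1%:R + 2 * pi) * Hc n' else 1.

Lemma Hc_gt0 n : 0 < Hc n.
Proof.
elim: n => //= n IH; have := pi_gt0 R => p0; rewrite mulr_gt0// addr_gt0 ?mulr_gt0//.
Qed.

Lemma coef_Hp Y n i : 2^-1 <= cabs Y -> cabs (Hp Y n)`_i <= Hc n * cabs Y ^+ n.
Proof.
move=> hY; elim: n i => [|n IH] i /=.
  by rewrite coef1 mulr1; case: (i == _); rewrite ?cabs1 ?cabs0.
rewrite coefB coefZ coefXM coef_deriv.
apply: le_trans (cabsD _ _) _; rewrite cabsN.
have H0 := Hc_gt0 n; have Yn : 0 <= cabs Y ^+ n by rewrite exprn_ge0 ?cabs_ge0.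
have a1 : cabs ((Hp Y n)`_i.+1 *+ i.+1) <= 2 * n.+1%:R * Hc n * cabs Y ^+ n.+1.
  have [h|h] := leqP n i.
    rewrite nth_default ?mul0rn ?cabs0 ?mulr_ge0 ?exprn_ge0 ?cabs_ge0// ?(ltW H0)//.
    by apply: leq_trans (size_Hp _ _) _.
  rewrite -[_ *+ _]mulr_natr cabsM cabs_nat.
  apply: (@le_trans _ _ (Hc n * cabs Y ^+ n * n.+1%:R)).
    by rewrite ler_pM ?cabs_ge0 ?ler_nat// ltnW.
  rewrite exprS; have n1 : (0 : R) <= n.+1%:R by []; move: (n.+1%:R) n1 (cabs Y ^+ n) Yn (Hc n) H0 hY => u u0 v v0 w w0.
  move: (cabs Y) => c hc; have : 0 <= w * v * u by rewrite !mulr_ge0// ltW.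
  have -> : 2 * u * w * (c * v) = (w * v * u) * (2 * c) by ring.
  by move=> q0; rewrite ler_peMr//; move: hc; clear; lra.
have a2 : cabs (2 * (pi%:C * Y) * (if i == 0%N then 0 else (Hp Y n)`_i.-1)) <= 2 * pi * Hc n * cabs Y ^+ n.+1.
  have p0 := pi_ge0 R; rewrite 3!cabsM cabs_nat cabs_real ger0_norm//.
  apply: (@le_trans _ _ (2 * (pi * cabs Y) * (Hc n * cabs Y ^+ n))); last first.
    by rewrite exprS; move: (cabs Y ^+ n) => v; rewrite [leRHS](_ : _ = 2 * (pi * cabs Y) * (Hc n * v))//; ring.
  rewrite ler_wpM2l ?mulr_ge0 ?cabs_ge0//; case: (i == _) => //.
  by rewrite cabs0 mulr_ge0// ltW.
by apply: le_trans (lerD a1 a2) _; rewrite -!mulrDl.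
Qed.

Lemma horner_bound (p : {poly C}) (n : nat) (B : R) z : (size p <= n.+1)%N ->
  (forall i, cabs p`_i <= B) -> cabs p.[z] <= n.+1%:R * B * (1 + cabs z) ^+ n.
Proof.
move=> sp hB; have B0 := le_trans (cabs_ge0 _) (hB 0%N).
rewrite (horner_coef_wide _ sp); apply: le_trans (cabs_sum _ _ _) _.
apply: (@le_trans _ _ (\sum_(i < n.+1) B * (1 + cabs z) ^+ n)); last first.
  by rewrite sumr_const card_ord -[_ *+ _]mulr_natl -mulrA.
apply: ler_sum => i _; rewrite cabsM cabsX ler_pM ?cabs_ge0 ?exprn_ge0 ?cabs_ge0//.
have c0 := cabs_ge0 z; apply: (@le_trans _ _ ((1 + cabs z) ^+ i)).
  by rewrite lerXn2r ?nnegrE ?addr_ge0// lerDr.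
by rewrite ler_weXn2l ?lerDl// -ltnS.
Qed.

Lemma Hp_bound Y n z : 2^-1 <= cabs Y ->
  cabs (Hp Y n).[z] <= n.+1%:R * Hc n * cabs Y ^+ n * (1 + cabs z) ^+ n.
Proof. by move=> hY; rewrite -(mulrA n.+1%:R); apply: horner_bound => [|i]; [exact: size_Hp|exact: coef_Hp]. Qed.

Lemma dHp_bound Y n z : 2^-1 <= cabs Y ->
  cabs (Hp Y n)^`().[z] <= n.+1%:R * (n.+1%:R * Hc n) * cabs Y ^+ n * (1 + cabs z) ^+ n.
Proof.
move=> hY; rewrite -(mulrA n.+1%:R); apply: horner_bound => [|i].
  by apply: leq_trans (size_deriv_le _) (size_Hp _ _).
have P : 0 <= Hc n * cabs Y ^+ n by rewrite mulr_ge0 ?exprn_ge0 ?cabs_ge0// ltW// Hc_gt0.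
rewrite coef_deriv; have [h|h] := leqP n i.
  rewrite nth_default; first by rewrite mul0rn cabs0 -mulrA (mulr_ge0 _ P).
  by apply: leq_trans (size_Hp _ _) _.
rewrite -[_ *+ _]mulr_natl cabsM cabs_nat -mulrA ler_pM ?cabs_ge0 ?ler_nat ?coef_Hp//; exact: ltnW.
Qed.

(** The end of the central segment; [beta ^+ 2 = 1 / 6] makes the Gaussian there as small as
    [e2pi (tau' / 12)]. *)
Definition beta : R := (Num.sqrt 6)^-1.

Lemma beta_sqr : beta ^+ 2 = 6^-1.
Proof. by rewrite exprVn sqr_sqrtr. Qed.

Lemma beta_gt0 : 0 < beta.
Proof. by rewrite invr_gt0 sqrtr_gt0. Qed.

(** Hence the window of radius 1/20 about the first pole 1/2 lies entirely outside the central
    segment. *)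
Lemma beta_lt : beta < 9 / 20.
Proof. have := beta_sqr; have := beta_gt0; nra. Qed.

Lemma cabs_gE Y y : cabs (gE Y y%:C) = expR (- (pi * Re Y * y ^+ 2)).
Proof.
by rewrite /gE cabs_cexp -rmorphXn mulNr mulrC cReN Re_realM Re_realM; congr expR; ring.
Qed.

(** Of [pi * Re Y * y ^+ 2], the part [pi * Re Y / 6] is set aside. The rest is at least
    [y ^+ 2 - 1 / 6], since [pi * Re Y >= 1], and yields geometric decay in the cell number
    independent of [Y]. *)
Lemma gE_bound Y (j : nat) y : 2^-1 <= Re Y -> beta <= y -> j%:R <= y ->
  cabs (gE Y y%:C) <= expR (- (pi * Re Y / 6)) * expR (- 2^-1) ^+ j.
Proof.
move=> hY hy hj; rewrite cabs_gE -expRM_natl -expRD ler_expR.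
have y2 : 6^-1 <= y ^+ 2 by rewrite -beta_sqr lerXn2r ?nnegrE ?(le_trans (ltW beta_gt0)) ?(ltW beta_gt0).
have q : 6^-1 + j%:R / 2 <= y ^+ 2.
  case: j hj => [_|j hj]; first by rewrite mul0r addr0.
  have j1 : (1 : R) <= j.+1%:R by rewrite ler1n.
  move: (j.+1%:R) j1 hj => u u1 uy; nra.
have pY : 1 <= pi * Re Y by have := pi_ge2 R; nra.
have P1 : 0 <= pi * Re Y - 1 by rewrite subr_ge0.
have j0 : (0 : R) <= j%:R by [].
have := mulr_ge0 P1 (_ : 0 <= y ^+ 2 - 6^-1); rewrite subr_ge0 => /(_ y2).
move: (pi * _) (y ^+ 2) (j%:R) {P1} q j0 => P t u q u0; rewrite mulrBl mul1r mulrBr; lra.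
Qed.

(** The weight of the cell from [j] to [j + 1]: polynomial growth against the Gaussian decay left by
    [gE_bound]. *)
Definition dec n (j : nat) : R := j.+1%:R ^+ n * expR (- 2^-1) ^+ j.

Lemma dec_ge0 n j : 0 <= dec n j.
Proof. by rewrite mulr_ge0 ?exprn_ge0 ?expR_ge0. Qed.

Lemma dec_summable n : rsummable (dec n).
Proof. by apply: natX_geom_summable; rewrite ?expR_ge0// expR_lt1 oppr_lt0. Qed.

Lemma poly_gE_bound Y n (j : nat) y (D : R) w : 0 <= D -> 2^-1 <= Re Y -> beta <= y -> j%:R <= y <= j%:R + 1 ->
  cabs w <= D * cabs Y ^+ n * (1 + cabs y%:C) ^+ n ->
  cabs (w * gE Y y%:C) <= 2 ^+ n * D * cabs Y ^+ n * dec n j * expR (- (pi * Re Y / 6)).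
Proof.
move=> D0 hY hy /andP[j1 j2] hw; rewrite cabsM; have hE := gE_bound hY hy j1.
have y0 : 0 <= y := le_trans (ltW beta_gt0) hy.
have h : (1 + cabs y%:C) ^+ n <= 2 ^+ n * j.+1%:R ^+ n.
  rewrite -exprMn cabs_real ger0_norm// lerXn2r ?nnegrE ?addr_ge0 ?mulr_ge0//.
  rewrite -(natr1 j); have : (0 : R) <= j%:R by []; move: (j%:R : R) j2 => u; lra.
have Yn : 0 <= cabs Y ^+ n by rewrite exprn_ge0 ?cabs_ge0.
have DY : 0 <= D * cabs Y ^+ n by rewrite mulr_ge0.
have := ler_pM (cabs_ge0 _) (cabs_ge0 _) (le_trans hw (ler_wpM2l DY h)) hE.
by move=> /le_trans; apply; rewrite /dec le_eqVlt; apply/orP; left; apply/eqP; ring.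
Qed.

(* Phib is an approximate antiderivative of phi, obtained from gE' = - 2 pi Y z gE. *)
Definition Phib Y n z := - (Hp Y n).[z] * gE Y z / (2 * (piC * Y) * z).
Definition Rb Y n z := ((Hp Y n)^`().[z] / (2 * (piC * Y) * z)
   - (Hp Y n).[z] / (2 * (piC * Y) * z ^+ 2)) * gE Y z.

Lemma cdiff_Phib Y n z : Y != 0 -> z != 0 -> cdiff (Phib Y n) z (phi Y n z - Rb Y n z).
Proof.
move=> Y0 z0; pose a := 2 * (piC * Y).
have a0 : a != 0.
  by rewrite mulf_neq0 ?pnatr_eq0// mulf_neq0// -cabs_gt0 cabs_real gtr0_norm ?pi_gt0.
have az : a * z != 0 by rewrite mulf_neq0.
have d1 : cdiff (fun w => a * w) z a.
  by have := cdiff_lin a 0 z; congr cdiff; apply/funext => w; rewrite addr0.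
have := cdiffM (cdiffN (cdiff_phi_herm Y n z)) (cdiffV (f := fun w => a * w) az d1).
have -> : (fun w => - phi Y n w * (a * w)^-1) = Phib Y n.
  by apply/funext => w; rewrite /Phib /phi [- _.[w] * _]mulNr.
congr cdiff; rewrite /phi /Rb -/a /= hornerD hornerN hornerZ hornerM hornerX -/a.
clearbody a; move: (gE Y z) ((Hp Y n)^`().[z]) ((Hp Y n).[z]) => E p q.
by field; rewrite z0 a0.
Qed.

Lemma segc_Rb Y n a b : Y != 0 -> 0 < a -> segc a b (Rb Y n).
Proof.
move=> Y0 a0 x /andP[ax _]; have x0 : x%:C != 0 :> C by rewrite -cabs_gt0 cabs_real gtr0_norm (lt_le_trans a0).
have p0 : 2 * (piC * Y) != 0.
  by rewrite mulf_neq0 ?pnatr_eq0// mulf_neq0// -cabs_gt0 cabs_real gtr0_norm ?pi_gt0.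
have cz (m : nat) (p : {poly C}) : ccont (fun z => p.[z] / (2 * (piC * Y) * z ^+ m)) x%:C.
  apply: ccontM; first exact: cdiff_ccont (cdiff_poly _ _).
  apply: ccontV; first by rewrite mulf_neq0// expf_neq0.
  by apply: ccontM; [exact: ccont_cst|exact: cdiff_ccont (cdiffX _ _)].
apply: ccontM; last exact: cdiff_ccont (cdiff_gE _ _).
by apply: ccontD; [exact: (cz 1%N)|apply: ccontN; exact: (cz 2%N)].
Qed.

Definition phc n : R := 2 ^+ n * (n.+1%:R * Hc n).

Lemma phc_ge0 n : 0 <= phc n.
Proof. by rewrite !mulr_ge0 ?exprn_ge0// ltW ?Hc_gt0. Qed.

Lemma cabs_ge_half Y : 2^-1 <= Re Y -> 2^-1 <= cabs Y.
Proof. by move=> h; apply: le_trans h (le_trans (ler_norm _) (ge_Re_cabs _)). Qed.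

Lemma phi_bound Y n (j : nat) y : 2^-1 <= Re Y -> beta <= y -> j%:R <= y <= j%:R + 1 ->
  cabs (phi Y n y%:C) <= phc n * cabs Y ^+ n * dec n j * expR (- (pi * Re Y / 6)).
Proof.
move=> hY hy hj; apply: poly_gE_bound => //; last by apply: Hp_bound; exact: cabs_ge_half.
by rewrite mulr_ge0 ?ler0n// ltW ?Hc_gt0.
Qed.

Lemma cabs_2piYz Y y m : 0 < y -> cabs (2 * (piC * Y) * y%:C ^+ m) = 2 * (pi * cabs Y) * y ^+ m.
Proof.
move=> y0; have p0 := pi_ge0 R.
by rewrite 3!cabsM cabsX cabs_nat !cabs_real ger0_norm// gtr0_norm.
Qed.

Lemma Phib_bound Y n (j : nat) y : 2^-1 <= Re Y -> 9 / 20 <= y -> j%:R <= y <= j%:R + 1 ->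
  cabs (Phib Y n y%:C) <= 2 * phc n * cabs Y ^+ n * dec n j * expR (- (pi * Re Y / 6)) / (2 * cabs Y).
Proof.
move=> hY hy hj; have y0 : 0 < y by apply: lt_le_trans hy; rewrite divr_gt0.
have Y0 : 0 < cabs Y by apply: lt_le_trans (cabs_ge_half hY); rewrite invr_gt0.
have -> : Phib Y n y%:C = - phi Y n y%:C / (2 * (piC * Y) * y%:C ^+ 1) by rewrite /Phib /phi mulNr.
rewrite cabsM cabsV cabsN cabs_2piYz// expr1.
have := phi_bound n hY (le_trans (ltW beta_lt) hy) hj; move: (cabs (phi _ _ _)) => P hP.
have B0 : 0 <= phc n * cabs Y ^+ n * dec n j * expR (- (pi * Re Y / 6)).
  by rewrite mulr_ge0 ?expR_ge0// mulr_ge0 ?dec_ge0// mulr_ge0 ?phc_ge0// exprn_ge0 ?cabs_ge0.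
rewrite ler_pdivrMr; last by rewrite !mulr_gt0 ?pi_gt0.
apply: le_trans hP _.
set B := (X in 0 <= X) in B0 *; rewrite -/B.
have -> : 2 * phc n * cabs Y ^+ n * dec n j * expR (- (pi * Re Y / 6)) = 2 * B.
  by rewrite /B; move: (cabs Y ^+ n) (expR _) (dec _ _) (phc n) => u v w x; ring.
rewrite [leRHS](_ : _ = B * (2 * (pi * y))); last by move: (pi : R) (B) => p b; field; rewrite gt_eqF.
rewrite ler_peMr//; have := pi_ge2 R; nra.
Qed.

Lemma Rb_bound Y n (j : nat) y : 2^-1 <= Re Y -> 9 / 20 <= y -> j%:R <= y <= j%:R + 1 ->
  cabs (Rb Y n y%:C) <= 6 * n.+1%:R * phc n * cabs Y ^+ n * dec n j * expR (- (pi * Re Y / 6)) / (2 * cabs Y).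
Proof.
move=> hY hy hj; have y0 : 0 < y by apply: lt_le_trans hy; rewrite divr_gt0.
have hYc := cabs_ge_half hY.
have Y0 : 0 < cabs Y by apply: lt_le_trans hYc; rewrite invr_gt0.
pose D : R := n.+1%:R * Hc n; have D0 : 0 <= D by rewrite mulr_ge0// ltW ?Hc_gt0.
have p2 := pi_ge2 R; have n1 : (1 : R) <= n.+1%:R by rewrite ler1n.
pose a := 2 * (pi * cabs Y); have a0 : 0 < a by rewrite !mulr_gt0 ?pi_gt0.
have iy : y^-1 <= 20 / 9 by rewrite -[leRHS]invf_div lef_pV2 ?posrE// divr_gt0.
have iy0 : 0 < y^-1 by rewrite invr_gt0.
have -> : 6 * n.+1%:R * phc n * cabs Y ^+ n * dec n j * expR (- (pi * Re Y / 6)) / (2 * cabs Y)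
   = 2 ^+ n * (6 * n.+1%:R * D / (2 * cabs Y)) * cabs Y ^+ n * dec n j * expR (- (pi * Re Y / 6)).
  by rewrite /phc -/D; move: (cabs Y ^+ n) (expR _) (dec _ _) => u v w; field; rewrite gt_eqF.
have Q0 : 0 <= 6 * n.+1%:R * D / (2 * cabs Y).
  by apply: divr_ge0; [apply: mulr_ge0 => //; apply: mulr_ge0|apply: mulr_ge0; [|exact: ltW]].
apply: (poly_gE_bound Q0 hY (le_trans (ltW beta_lt) hy) hj).
rewrite -[2 * _ * y%:C]/(2 * (pi%:C * Y) * y%:C ^+ 1); apply: le_trans (cabsD _ _) _.
rewrite cabsN 2!cabsM !cabsV !cabs_2piYz// -/a expr1.
have := Hp_bound n y%:C hYc; have := dHp_bound n y%:C hYc; rewrite -/D.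
have u0 : 0 <= cabs Y ^+ n by rewrite exprn_ge0 ?cabs_ge0.
have v0 : 0 <= (1 + cabs y%:C) ^+ n by rewrite exprn_ge0 ?addr_ge0 ?cabs_ge0.
move: (cabs (_^`()).[_]) (cabs (Hp Y n).[_]) (cabs Y ^+ n) u0 ((1 + _) ^+ n) v0 => P Q u u0 v v0 hP hQ.
pose X := n.+1%:R * D * u * v; have X0 : 0 <= X by do 3!apply: mulr_ge0 => //.
have hQ0 : Q <= X.
  apply: le_trans hQ _; rewrite ler_wpM2r// ler_wpM2r// ler_peMl//.
have i1 : 0 <= (a * y)^-1 by rewrite invr_ge0 mulr_ge0 ?ltW.
have i2 : 0 <= (a * y ^+ 2)^-1 by rewrite invr_ge0 mulr_ge0 ?sqr_ge0 ?ltW.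
apply: le_trans (lerD (ler_wpM2r i1 hP) (ler_wpM2r i2 hQ0)) _.
have -> : n.+1%:R * D * u * v / (a * y) + X / (a * y ^+ 2) = X * (2 / pi) * (y^-1 + y^-1 ^+ 2) / (4 * cabs Y).
  rewrite -/X /a; have := pi_gt0 R; move: (pi : R) => p p0.
  by field; rewrite !gt_eqF.
have -> : 6 * n.+1%:R * D / (2 * cabs Y) * u * v = X * 12 / (4 * cabs Y).
  by rewrite /X; field; rewrite gt_eqF.
rewrite ler_pM2r ?invr_gt0 ?mulr_gt0// -mulrA ler_wpM2l//.
have p1 : 2 / pi <= 1 :> R by rewrite ler_pdivrMr ?pi_gt0// mul1r.
have p3 : 0 <= 2 / pi :> R by rewrite divr_ge0// pi_ge0.
move: (2 / pi) (y^-1) p1 p3 iy iy0 => q t; nra.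
Qed.

End Hermite.

(** * The tails of the line, cell by cell *)

Section Tail.
Variable R : realType.
Local Notation C := R[i].
Implicit Types (Y z w : C) (k : nat) (e x s y : R) (g : int -> C).
Local Notation beta := (@beta R).
Local Notation errlog := (@errlog R).

Lemma ln2_ge : 2^-1 <= ln 2 :> R.
Proof.
rewrite -[leLHS]expRK ler_ln ?posrE ?expR_gt0//.
have h : 2^-1 <= expR (- 2^-1) :> R by apply: le_trans (expR_ge1Dx _); lra.
by rewrite -[2^-1]opprK expRN -[leRHS]invrK lef_pV2 ?posrE ?invr_gt0 ?expR_gt0.
Qed.

Lemma errlog_ge k : (0 < k)%N -> 2^-1 <= errlog k.
Proof.
rewrite /errlog; case: eqP => [_ _|k1 k0]; first lra.
apply: le_trans ln2_ge _; rewrite ler_ln ?posrE ?ltr0n// ler_nat.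
by case: k k1 k0 => [|[|k]].
Qed.

Lemma errlog_ge0 k : (0 < k)%N -> 0 <= errlog k.
Proof. by move=> k0; apply: le_trans (errlog_ge k0); rewrite invr_ge0. Qed.

Lemma harmonic_le n : \sum_(i < n) (i.+1%:R)^-1 <= 1 + ln n.+1%:R :> R.
Proof.
case: n => [|n]; first by rewrite big_ord0 ln1 addr0.
have H m : \sum_(i < m) (i.+2%:R)^-1 <= ln m.+1%:R :> R.
  elim: m => [|m IH]; first by rewrite big_ord0 ln1.
  rewrite big_ord_recr /=; apply: le_trans (lerD IH (lexx _)) _.
  have p1 : (0 : R) < m.+1%:R by rewrite ltr0n.
  have p2 : (0 : R) < m.+2%:R by rewrite ltr0n.
  rewrite -lerBrDl -lerN2 opprB -ln_div ?posrE//.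
  rewrite -[leRHS]expRK ler_ln ?posrE ?divr_gt0 ?expR_gt0//.
  apply: le_trans (expR_ge1Dx _); rewrite le_eqVlt; apply/orP; left; apply/eqP.
  by rewrite -(natr1 m.+1) in p2 *; move: (m.+1%:R : R) p2 => u u0; field; rewrite gt_eqF.
rewrite big_ord_recl invr1 lerD2l; apply: le_trans (H n) _.
by rewrite ler_ln ?posrE ?ltr0n// ler_nat.
Qed.

Lemma hsum_le k : (0 < k)%N -> 1 + ln (2 * k)%:R <= 4 * errlog k.
Proof.
move=> k0; rewrite natrM lnM ?posrE ?ltr0n// /errlog.
have l2 := ln2_ge; have l1 : ln 2 <= 1 :> R.
  by rewrite -[leRHS]expRK ler_ln ?posrE ?expR_gt0//; apply: le_trans (expR_ge1Dx _); lra.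
case: eqP => [->|k1]; first by rewrite ln1; lra.
have : ln 2 <= ln k%:R :> R.
  by rewrite ler_ln ?posrE ?ltr0n// ler_nat; case: k k1 k0 => [|[|k]].
lra.
Qed.

(* The terms r >= 1 of a 2k-periodic cotangent sum on a unit cell around a pole. *)
Lemma kc_sum k e s : (0 < k)%N -> `|s| <= 2^-1 ->
  \sum_(r < (2 * k).-1) cabs (kc k e (s%:C + r.+1%:R)) <= 32 * k%:R * errlog k.
Proof.
move=> k0 /ler_normlP[s1 s2]; have kk := natR_gt0 R k0.
set n := (2 * k).-1; have nE : n.+1 = (2 * k)%N by rewrite prednK// muln_gt0.
have nR : (n.+1%:R : R) = 2 * k%:R by rewrite nE natrM.
have T (r : 'I_n) : cabs (kc k e (s%:C + r.+1%:R)) <= 4 * k%:R * ((r.+1%:R)^-1 + ((n - r)%:R)^-1).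
  have r0 : (0 : R) <= r%:R by [].
  have rn : (r.+1%:R : R) + (n - r)%:R = n.+1%:R by rewrite -natrD addSn subnKC// ltnW.
  have nr1 : (1 : R) <= (n - r)%:R by rewrite ler1n subn_gt0.
  have r1 : (1 : R) <= r.+1%:R by rewrite ler1n.
  have -> : s%:C + r.+1%:R = (s + r.+1%:R)%:C :> C by rewrite rmorphD /= rmorph_nat.
  rewrite nR in rn; move: (r.+1%:R : R) ((n - r)%:R : R) rn nr1 r1 => u v uv v1 u1.
  apply: le_trans (kc_bound e k0 _) _; first by apply/andP; split; lra.
  have h1 : (s + u)^-1 <= 2 * u^-1.
    rewrite -[leRHS]invrK lef_pV2 ?posrE ?invr_gt0 ?mulr_gt0 ?invr_gt0 ?invfM ?invrK//; lra.
  have h2 : (2 * k%:R - (s + u))^-1 <= 2 * v^-1.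
    rewrite -[leRHS]invrK lef_pV2 ?posrE ?invr_gt0 ?mulr_gt0 ?invr_gt0 ?invfM ?invrK//; lra.
  have := ler_wpM2l (ltW (mulr_gt0 (ltr0Sn R 1) kk)) (lerD h1 h2) => /le_trans; apply.
  by apply: eq_ler; ring.
apply: le_trans (ler_sum _ (fun r _ => T r)) _; rewrite -mulr_sumr big_split /=.
have E : \sum_(i < n) ((n - i)%:R)^-1 = \sum_(i < n) (i.+1%:R)^-1 :> R.
  rewrite (reindex_inj rev_ord_inj); apply: eq_bigr => i _.
  by rewrite /= subKn.
rewrite E; have := harmonic_le n; rewrite nE; move: (\sum_(i < n) _) => H hH.
have h4 := hsum_le k0; have hk : 0 <= 4 * k%:R :> R by rewrite mulr_ge0.
apply: le_trans (ler_wpM2l hk (_ : H + H <= 8 * errlog k)) _; first lra.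
by apply: eq_ler; ring.
Qed.

(** The poles are all the half-integers, displaced off the line by [e], with residues given by [g]
    up to a constant. *)
Definition Kt k g e z : C := \sum_(v < 2 * k) g v%:Z * kc k e (z + v%:R + 2^-1).

Lemma kc_int_per k e z (j : int) : (0 < k)%N -> kc k e (z + (j + (2 * k)%N%:Z)%:~R) = kc k e (z + j%:~R).
Proof. by move=> k0; rewrite intrD addrA -pmulrn -[(2 * k)%N]muln1 kc_per. Qed.

(** Recentred at the pole [j + 1 / 2]: for [|s| <= 1 / 2] only the term [r = 0] comes close to a
    pole. *)
Lemma Kt_shift k g e s (j : nat) : (0 < k)%N -> (forall n, g (n + (2 * k)%N%:Z) = g n) ->
  Kt k g e (s%:C + (j%:R + 2^-1)%:C) = \sum_(r < 2 * k) g (r%:Z - j.+1%:Z) * kc k e (s%:C + r%:R).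
Proof.
move=> k0 gper; pose P (v : int) := g v * kc k e (s%:C + (v + j.+1%:Z)%:~R).
have Pper n : P (n + (2 * k)%N%:Z) = P n by rewrite /P gper addrAC kc_int_per.
transitivity (\sum_(v < 2 * k) P v%:Z).
  apply: eq_bigr => v _; rewrite /P; congr (_ * kc k e _).
  rewrite rmorphD fmorphV /= !rmorph_nat intrD -!pmulrn -[j.+1]addn1 natrD.
  by move: s%:C (v%:R : C) (j%:R : C) => x y z; field.
have k2 : (0 < 2 * k)%N by rewrite muln_gt0.
rewrite -(@sum_per R (2 * k) j.+1 P k2 Pper); apply: eq_bigr => r _.
by rewrite /P subrK.
Qed.

Definition cellc p : R := 6 * p.+1%:R * phc R p + phc R p.+1.

Lemma cellc_ge0 p : 0 <= cellc p.
Proof. have h1 := phc_ge0 R p; have h2 := phc_ge0 R p.+1; apply: addr_ge0 => //; apply: mulr_ge0 => //. Qed.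

(** A single size that bounds [phi Y p] on the cell, its derivative up to [2 * cabs Y], and [Phib]
    and [Rb] up to the inverse of [2 * cabs Y]. The weight has [p.+1] because of the derivative. *)
Definition cellA Y p j : R := cellc p * cabs Y ^+ p * dec R p.+1 j * expR (- (pi * Re Y / 6)).

Lemma cellA_ge0 Y p j : 0 <= cellA Y p j.
Proof.
by rewrite mulr_ge0 ?expR_ge0// mulr_ge0 ?dec_ge0// mulr_ge0 ?cellc_ge0// exprn_ge0 ?cabs_ge0.
Qed.

Lemma cellA_le Y p j (c : R) : 0 <= c -> c <= cellc p ->
  c * cabs Y ^+ p * dec R p j * expR (- (pi * Re Y / 6)) <= cellA Y p j.
Proof.
move=> c0 cc; rewrite ler_wpM2r ?expR_ge0//.
have Y0 : 0 <= cabs Y ^+ p by rewrite exprn_ge0 ?cabs_ge0.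
apply: ler_pM; rewrite ?mulr_ge0 ?dec_ge0 ?ler_wpM2r//.
by rewrite ler_weXn2l ?ler1n.
Qed.

Lemma segc_shift (t a b : R) F : segc (a + t) (b + t) F -> segc a b (fun z => F (z + t%:C)).
Proof.
move=> h x /andP[ax xb]; apply: (@ccont_comp _ (fun z => z + t%:C)).
  by apply: ccontD; [exact: ccont_id|exact: ccont_cst].
by rewrite -rmorphD; apply: h; rewrite !lerD2r ax.
Qed.

Lemma cint_shift (t a b : R) (F : C -> C) : a <= b -> segc (a + t) (b + t) F ->
  integ (a + t) (b + t) F = integ a b (fun z => F (z + t%:C)).
Proof.
move=> ab cF; have := @cint_affine R a b 1 t F ab ltr01; rewrite !mul1r => /(_ cF) ->.
by apply: eq_cint => x _; rewrite mul1r.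
Qed.

Lemma segc_Kt k g e a b : (0 < k)%N -> e != 0 -> segc a b (Kt k g e).
Proof.
move=> k0 e0; apply: segc_sum => v; apply: segcM; first exact: segc_cst.
rewrite (_ : (fun z => _) = fun z => kc k e (z + (v%:R + 2^-1 : R)%:C)).
  by apply: segc_shift; exact: segc_kc.
by apply/funext => z; rewrite rmorphD fmorphV /= !rmorph_nat addrA.
Qed.

(** The singular term is treated by [kc_pv] in a window of radius 1/20 and by the trivial bound in
    the rest of the cell; the other [2 * k - 1] terms have modulus O(k log k) by [kc_sum]. The free
    left end [a] lets the first cell start at [beta]. *)
Lemma cell_bound Y p k g e (j : nat) (a : R) : (0 < k)%N -> (forall n, g (n + (2 * k)%N%:Z) = g n) ->
  (forall n, cabs (g n) <= 1) -> e != 0 -> `|e| <= 1 -> 2^-1 <= Re Y ->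
  - 2^-1 <= a <= - 20^-1 -> beta <= a + (j%:R + 2^-1) ->
  cabs (integ (a + (j%:R + 2^-1)) (j%:R + 1) (fun z => phi Y p z * Kt k g e z)) <=
  (2 * pvk 20^-1 + 192) * k%:R * errlog k * cellA Y p j.
Proof.
move=> k0 gper g1 e0 e1 hY /andP[a1 a2] hb; set t := j%:R + 2^-1.
have rho0 : 0 < 20^-1 :> R by rewrite invr_gt0.
have j0 : (0 : R) <= j%:R by [].
have bl := beta_lt R.
have [W1 W2 W3] : [/\ - 20^-1 <= 20^-1 :> R, 20^-1 <= 2^-1 :> R & - 20^-1 <= 2^-1 :> R].
  by clear; split; lra.
have [ab W4 W5] : [/\ a <= 2^-1, 2^-1 - a <= 1 & j%:R + 1 = 2^-1 + t].
  by move: a1 a2; rewrite /t; clear => a1 a2; split; [lra|lra|field].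
set A := cellA Y p j; have A0 : 0 <= A := cellA_ge0 Y p j.
have hYc := cabs_ge_half hY; have Y0 : 0 < cabs Y by apply: lt_le_trans hYc; rewrite invr_gt0.
have Yn0 : Y != 0 by rewrite -cabs_gt0.
pose G z := phi Y p (z + t%:C).
have cells (s : R) : a <= s <= 2^-1 -> beta <= s + t /\ j%:R <= s + t <= j%:R + 1.
  by move=> /andP[s1 s2]; split; [apply: le_trans hb _; rewrite lerD2r|
    move: s1 s2 a1; rewrite /t; clear; move=> s1 s2 a1; apply/andP; split; lra].
have windows (s : R) : - 20^-1 <= s <= 20^-1 -> 9 / 20 <= s + t /\ j%:R <= s + t <= j%:R + 1.
  by move=> /andP[s1 s2]; move: s1 s2 j0; rewrite /t; clear => s1 s2 j0; split; [lra|apply/andP; split; lra].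
have hG s : a <= s <= 2^-1 -> cabs (G s%:C) <= A.
  move=> hs; have [h1 h2] := cells s hs; rewrite /G -rmorphD.
  apply: le_trans (phi_bound p hY h1 h2) _; apply: cellA_le; first exact: phc_ge0.
  rewrite /cellc -[leLHS]addr0 lerD ?phc_ge0// ler_peMl ?phc_ge0//.
  have : (1 : R) <= p.+1%:R by rewrite ler1n.
  lra.
have shf (F F' : C -> C) (x : R) : cdiff F (x%:C + t%:C) (F' (x%:C + t%:C)) ->
    cdiff (fun z => F (z + t%:C)) x%:C (F' (x%:C + t%:C)).
  move=> h; have d1 : cdiff (fun w => w + t%:C) x%:C 1.
    by have := cdiff_lin 1 t%:C x%:C; congr cdiff; apply/funext => w; rewrite mul1r.
  by have := cdiff_comp d1 h; rewrite mulr1.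
have cG a' b' : segc a' b' G by apply: segc_shift; exact: segc_phi.
have cK a' b' (r : nat) : segc a' b' (fun z => kc k e (z + r%:R)).
  rewrite (_ : (fun z => _) = fun z => kc k e (z + (r%:R : R)%:C)).
    by apply: segc_shift; exact: segc_kc.
  by apply/funext => z; rewrite rmorph_nat.
have PV : cabs (integ (- 20^-1) 20^-1 (fun z => G z * kc k e z)) <= pvk 20^-1 * k%:R * A.
  (* [2 * cabs Y] takes the place of [L] in [kc_pv]. *)
  have L1 : 1 <= 2 * cabs Y by move: hYc; clear; lra.
  apply: (@kc_pv R k e 20^-1 (2 * cabs Y) A G (fun z => phi Y p.+1 (z + t%:C))
     (fun z => Phib Y p (z + t%:C)) (fun z => Rb Y p (z + t%:C))) => //.
  - by rewrite rho0 div1r.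
  - by move=> x _; apply: shf; exact: cdiff_phi_herm.
  - by apply: segc_shift; exact: segc_phi.
  - by move=> x /andP[x1 x2]; apply: hG; rewrite (le_trans a2 x1) (le_trans x2).
  - move=> x hx; have [h1 h2] := windows x hx; rewrite -rmorphD.
    apply: le_trans (phi_bound _ hY (le_trans (ltW bl) h1) h2) _.
    have -> : A * (2 * cabs Y) = 2 * cellc p * cabs Y ^+ p.+1 * dec R p.+1 j * expR (- (pi * Re Y / 6)).
      by rewrite /A /cellA exprS; ring.
    rewrite ler_wpM2r ?expR_ge0// ler_wpM2r ?dec_ge0// ler_wpM2r ?exprn_ge0 ?cabs_ge0//.
    rewrite /cellc; have := phc_ge0 R p.+1; have : 0 <= 6 * p.+1%:R * phc R p by apply: mulr_ge0 (phc_ge0 R p); apply: mulr_ge0.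
    lra.
  - move=> x hx; have [h1 h2] := windows x hx; rewrite /G.
    have z0 : x%:C + t%:C != 0 by rewrite -rmorphD -cabs_gt0 cabs_real gtr0_norm; apply: lt_le_trans h1; rewrite divr_gt0.
    have := @cdiff_Phib R Y p (x%:C + t%:C) Yn0 z0.
    exact: (@shf (Phib Y p) (fun z => phi Y p z - Rb Y p z)).
  - apply: segc_shift; apply: segc_Rb => //; have [h1 _] := windows (- 20^-1) ltac:(by rewrite lexx W1).
    by apply: lt_le_trans h1; rewrite divr_gt0.
  - move=> x hx; have [h1 h2] := windows x hx; rewrite -rmorphD.
    apply: le_trans (Phib_bound _ hY h1 h2) _; rewrite ler_wpM2r ?invr_ge0 ?mulr_ge0 ?cabs_ge0//.
    apply: cellA_le; first exact: mulr_ge0 _ (phc_ge0 R p).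
    rewrite /cellc -[leLHS]addr0 lerD ?phc_ge0// ler_wpM2r ?phc_ge0//.
    have : (1 : R) <= p.+1%:R by rewrite ler1n.
    lra.
  - move=> x hx; have [h1 h2] := windows x hx; rewrite -rmorphD.
    apply: le_trans (Rb_bound _ hY h1 h2) _; rewrite ler_wpM2r ?invr_ge0 ?mulr_ge0 ?cabs_ge0//.
    apply: cellA_le; first by apply: mulr_ge0 (phc_ge0 R p); apply: mulr_ge0.
    by rewrite /cellc lerDl phc_ge0.
clearbody A; have side a' b' : a <= a' -> a' <= b' -> b' <= 2^-1 -> b' - a' <= 1 -> (20^-1 <= a' \/ b' <= - 20^-1) ->
    cabs (integ a' b' (fun z => G z * kc k e z)) <= 40 * k%:R * A.
  move=> h1 h2 h3 h4 h5; have cF : segc a' b' (fun z => G z * kc k e z) by apply: segcM => //; exact: segc_kc.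
  have kA : 0 <= 40 * k%:R * A by rewrite !mulr_ge0.
  apply: le_trans (@cint_bound R a' b' _ (40 * k%:R * A) h2 cF _) _; last by rewrite ler_piMr.
  move=> x /andP[x1 x2]; rewrite cabsM [leRHS]mulrC.
  have hx : a <= x <= 2^-1 by rewrite (le_trans h1 x1) (le_trans x2 h3).
  have xn : 20^-1 <= `|x|.
    case: h5 => h; first by rewrite (le_trans _ (ler_norm x))// (le_trans h x1).
    by rewrite -normrN (le_trans _ (ler_norm (- x)))// lerNr (le_trans x2 h).
  have x0 : 0 < `|x| := lt_le_trans rho0 xn.
  apply: ler_pM; rewrite ?cabs_ge0//; first exact: hG.
  have kk : (1 : R) <= k%:R by rewrite ler1n.
  apply: le_trans (kc_bound0 e k0 _) _.
    rewrite x0 (le_trans _ kk)// ler_norml; move: hx a1; clear => /andP[h1 h2] a1; apply/andP; split; lra.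
  rewrite ler_pdivrMr// [leLHS](_ : _ = 40 * k%:R * 20^-1); last by field.
  by rewrite ler_wpM2l// mulr_ge0.
have cI a' b' : segc a' b' (fun z => G z * kc k e z) by apply: segcM => //; exact: segc_kc.
have SING : cabs (integ a 2^-1 (fun z => G z * kc k e z)) <= (pvk 20^-1 + 80) * k%:R * A.
  rewrite (@cint_cat R _ _ _ (fun z => G z * kc k e z) a2 W3 (cI _ _)).
  rewrite (@cint_cat R _ _ _ (fun z => G z * kc k e z) W1 W2 (cI _ _)).
  have S1 := side a (- 20^-1) (lexx _) a2 W3; have S2 := side 20^-1 2^-1 _ W2 (lexx _).
  have {}S1 : cabs (integ a (- 20^-1) (fun z => G z * kc k e z)) <= 40 * k%:R * A.
    by apply: S1; [move: a1; clear; lra|right].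
  have {}S2 : cabs (integ 20^-1 2^-1 (fun z => G z * kc k e z)) <= 40 * k%:R * A.
    by apply: S2; [move: a2; clear; lra|clear; lra|left].
  have := cabsD (integ a (- 20^-1) (fun z => G z * kc k e z))
     (integ (- 20^-1) 20^-1 (fun z => G z * kc k e z) + integ 20^-1 2^-1 (fun z => G z * kc k e z)).
  have := cabsD (integ (- 20^-1) 20^-1 (fun z => G z * kc k e z)) (integ 20^-1 2^-1 (fun z => G z * kc k e z)).
  move: PV S1 S2; clear => PV S1 S2 h1 h2.
  have -> : (pvk 20^-1 + 80) * k%:R * A = pvk 20^-1 * k%:R * A + 40 * k%:R * A + 40 * k%:R * A by ring.
  lra.
set n := (2 * k).-1; have nE : (2 * k)%N = n.+1 by rewrite prednK// muln_gt0.
pose g' (r : nat) := g (r%:Z - j.+1%:Z).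
pose F2 z := G z * \sum_(r < n) g' r.+1 * kc k e (z + r.+1%:R).
have cF2 : segc a 2^-1 F2.
  by apply: segcM => //; apply: segc_sum => r; apply: segcM; [exact: segc_cst|exact: cK].
have E : integ (a + t) (j%:R + 1) (fun z => phi Y p z * Kt k g e z) =
    g' 0%N * integ a 2^-1 (fun z => G z * kc k e z) + integ a 2^-1 F2.
  rewrite W5 (@cint_shift t a 2^-1 (fun z => phi Y p z * Kt k g e z))//; last first.
    by apply: segcM; [exact: segc_phi|exact: segc_Kt].
  rewrite -(@cintZ R a 2^-1 (g' 0%N) (fun z => G z * kc k e z)); last exact: cI.
  rewrite -(@cintD R a 2^-1 (fun z => g' 0%N * (G z * kc k e z)) F2)//; last first.
    by apply: segcM; [exact: segc_cst|exact: cI].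
  apply: eq_cint => x _; rewrite Kt_shift// nE big_ord_recl /F2 addr0 -/(G x%:C) mulrDr.
  congr (_ + _); rewrite /g' /=; by move: (G _) (g _) (kc _ _ _) => u v w; ring.
rewrite E; have gg : cabs (g' 0%N * integ a 2^-1 (fun z => G z * kc k e z)) <= (pvk 20^-1 + 80) * k%:R * A.
  by rewrite cabsM; apply: le_trans SING; rewrite ler_piMl ?cabs_ge0// g1.
have NS : cabs (integ a 2^-1 F2) <= 32 * k%:R * errlog k * A.
  have el := le_trans (ltW (ltac:(by rewrite invr_gt0) : 0 < 2^-1 :> R)) (errlog_ge k0).
  have kA : 0 <= 32 * k%:R * errlog k * A by rewrite !mulr_ge0.
  apply: le_trans (@cint_bound R a 2^-1 F2 _ ab cF2 _) _; last by apply: ler_piMr W4.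
  move=> x hx; rewrite /F2 cabsM [leRHS]mulrC; apply: ler_pM; rewrite ?cabs_ge0//; first exact: hG.
  apply: le_trans (cabs_sum _ _ _) _.
  have xh : `|x| <= 2^-1.
    by move: hx a1; clear => /andP[h1 h2] a1; rewrite ler_norml; apply/andP; split; lra.
  apply: le_trans (kc_sum e k0 xh); apply: ler_sum => r _.
  by rewrite cabsM ler_piMl ?cabs_ge0// g1.
apply: le_trans (cabsD _ _) _; apply: le_trans (lerD gg NS) _.
have kA : 0 <= k%:R * A by rewrite mulr_ge0.
have el := errlog_ge k0.
have pv0 : 0 <= pvk 20^-1 + 80 :> R.
  by rewrite addr_ge0// /pvk !addr_ge0// ?mulr_ge0 ?expR_ge0.
(* As [errlog k >= 1 / 2], doubling charges the singular term to the logarithm; 2 * 80 + 32 =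
   192. *)
have : (pvk 20^-1 + 80) * (k%:R * A) <= (pvk 20^-1 + 80) * (k%:R * A) * (2 * errlog k).
  by rewrite ler_peMr ?mulr_ge0//; move: el; clear; lra.
have -> : (pvk 20^-1 + 80) * k%:R * A = (pvk 20^-1 + 80) * (k%:R * A) by ring.
have -> : 32 * k%:R * errlog k * A = 32 * errlog k * (k%:R * A) by ring.
have -> : (2 * pvk 20^-1 + 192) * k%:R * errlog k * A = (2 * pvk 20^-1 + 192) * errlog k * (k%:R * A) by ring.
rewrite -subr_ge0 => h; rewrite -subr_ge0; apply: le_trans h _.
by apply: eq_ler; ring.
Qed.

Lemma right_tail Y p k g e (J : nat) : (0 < k)%N -> (forall n, g (n + (2 * k)%N%:Z) = g n) ->
  (forall n, cabs (g n) <= 1) -> e != 0 -> `|e| <= 1 -> 2^-1 <= Re Y ->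
  cabs (integ beta J.+1%:R (fun z => phi Y p z * Kt k g e z)) <=
  (2 * pvk 20^-1 + 192) * k%:R * errlog k * \sum_(j < J.+1) cellA Y p j.
Proof.
move=> k0 gper g1 e0 e1 hY; have b0 := beta_gt0 R; have bl := beta_lt R; elim: J => [|J IH].
  rewrite big_ord_recr big_ord0 /= add0r.
  have := @cell_bound Y p k g e 0 (beta - 2^-1) k0 gper g1 e0 e1 hY.
  rewrite !add0r subrK; apply; last exact: lexx.
  by move: b0 bl; clear => b0 bl; apply/andP; split; lra.
have cI a b : segc a b (fun z => phi Y p z * Kt k g e z).
  by apply: segcM; [exact: segc_phi|exact: segc_Kt].
have b1 : beta <= J.+1%:R by apply: (@le_trans _ _ 1); [move: bl; clear; lra|rewrite ler1n].
have J1 : J.+1%:R <= J.+2%:R :> R by rewrite ler_nat.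
rewrite (@cint_cat R _ _ _ (fun z => phi Y p z * Kt k g e z) b1 J1 (cI _ _)) big_ord_recr /= mulrDr.
apply: le_trans (cabsD _ _) _; apply: lerD => //.
have := @cell_bound Y p k g e J.+1 (- 2^-1) k0 gper g1 e0 e1 hY.
have -> : - 2^-1 + (J.+1%:R + 2^-1) = J.+1%:R :> R by rewrite addrCA addNr addr0.
rewrite (natr1 J.+1); apply => //; clear; apply/andP; split; lra.
Qed.

End Tail.

(** * Partial theta coefficients as integrals against cotangents *)

Section FalseTheta.
Variable R : realType.
Local Notation C := R[i].
Implicit Types (Y z w b : C) (k : nat) (e x s y : R) (g : int -> C).
Local Notation beta := (@beta R).
Local Notation errlog := (@errlog R).

Lemma right_tail_unif p : exists2 T : R, 0 <= T & forall Y k g e (J : nat), (0 < k)%N ->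
  (forall n, g (n + (2 * k)%N%:Z) = g n) ->
  (forall n, cabs (g n) <= 1) -> e != 0 -> `|e| <= 1 -> 2^-1 <= Re Y ->
  cabs (integ beta J.+1%:R (fun z => phi Y p z * Kt k g e z)) <=
  T * k%:R * errlog k * cabs Y ^+ p * expR (- (pi * Re Y / 6)).
Proof.
have [B HB] := dec_summable R p.+1.
have B0 : 0 <= B by have := HB 0%N; rewrite big_ord0.
have c0 : 0 <= 2 * pvk 20^-1 + 192 :> R.
  by rewrite addr_ge0// mulr_ge0// /pvk !addr_ge0// ?mulr_ge0 ?expR_ge0.
exists ((2 * pvk 20^-1 + 192) * (cellc R p * B)).
  by rewrite mulr_ge0// mulr_ge0// cellc_ge0.
move=> Y k g e J k0 gper g1 e0 e1 hY; apply: le_trans (right_tail p J k0 gper g1 e0 e1 hY) _.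
have el := errlog_ge0 R k0.
have -> : \sum_(j < J.+1) cellA Y p j =
   cellc R p * (\sum_(j < J.+1) dec R p.+1 j) * (cabs Y ^+ p * expR (- (pi * Re Y / 6))).
  rewrite mulr_sumr mulr_suml; apply: eq_bigr => j _; rewrite /cellA.
  by move: (cabs Y ^+ p) (expR _) (dec _ _ _) (cellc _ _) => u v w x; ring.
have -> : (2 * pvk 20^-1 + 192) * (cellc R p * B) * k%:R * errlog k * cabs Y ^+ p * expR (- (pi * Re Y / 6))
  = (2 * pvk 20^-1 + 192) * k%:R * errlog k * (cellc R p * B * (cabs Y ^+ p * expR (- (pi * Re Y / 6)))).
  by move: (cabs Y ^+ p) (expR _) (cellc _ _) (2 * pvk _ + _) => u v w x; ring.
apply: ler_wpM2l; first by do 2!apply: mulr_ge0 => //.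
apply: ler_wpM2r; first by rewrite mulr_ge0 ?exprn_ge0 ?cabs_ge0 ?expR_ge0.
by apply: ler_wpM2l (HB _); exact: cellc_ge0.
Qed.

Lemma Kt_refl k g e z : (0 < k)%N -> (forall n, g (n + (2 * k)%N%:Z) = g n) ->
  Kt k g e (- z) = - Kt k (fun n => g (- n - 1)) (- e) z.
Proof.
move=> k0 gper; rewrite /Kt -sumrN (reindex_inj rev_ord_inj); apply: eq_bigr => v _ /=.
have vk : (v < 2 * k)%N := ltn_ord v.
rewrite -mulrN; congr (_ * _).
  by rewrite -(gper (- v%:Z - 1)); congr g; rewrite -subzn//; lia.
have -> : - z + (2 * k - v.+1)%:R + 2^-1 = - (z + v%:R + 2^-1) + (2 * k * 1)%:R :> C.
  by rewrite natrB// muln1 -natr1; field.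
by rewrite kc_per// kcN.
Qed.

(** For even [p] the Gaussian derivative is even, so the left tail is a right tail with reflected
    coefficients and opposite shift. For this reason the right tails allow any periodic [g] and
    either sign of [e]. *)
Lemma left_tail_refl Y p k g e (J : nat) : (0 < k)%N -> ~~ odd p -> e != 0 ->
  (forall n, g (n + (2 * k)%N%:Z) = g n) ->
  integ (- J.+1%:R) (- beta) (fun z => phi Y p z * Kt k g e z) =
  - integ beta J.+1%:R (fun z => phi Y p z * Kt k (fun n => g (- n - 1)) (- e) z).
Proof.
move=> k0 pe e0 gper; have bl := beta_lt R.
have b1 : beta <= J.+1%:R.
  by apply: (@le_trans _ _ 1); [move: bl; clear; lra|rewrite ler1n].
have cI (a b : R) (e' : R) g' : e' != 0 -> segc a b (fun z => phi Y p z * Kt k g' e' z).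
  by move=> e'0; apply: segcM; [exact: segc_phi|exact: segc_Kt].
rewrite (@cint_opp R _ _ (fun z => phi Y p z * Kt k g e z) b1); last exact: cI.
rewrite -[RHS]mulN1r -(@cintZ R _ _ (-1) (fun z => phi Y p z * Kt k (fun n => g (- n - 1)) (- e) z)).
  apply: eq_cint => x _; rewrite phiN -signr_odd (negPf pe) mul1r Kt_refl//.
  by rewrite mulN1r mulrN.
by apply: cI; rewrite oppr_eq0.
Qed.

Lemma cser_geom (q : C) : cabs q < 1 -> cser (fun n => q ^+ n) = (1 - q)^-1.
Proof.
move=> q1; have su : csummable (fun n => q ^+ n).
  by apply: csummable_le (geom_summable (cabs_ge0 q) q1) => n; rewrite cabsX.
have q0 : 1 - q != 0.
  by rewrite subr_eq0; apply: contraTneq q1 => <-; rewrite cabs1 ltxx.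
have E : cser (fun n => q ^+ n) = 1 + q * cser (fun n => q ^+ n).
  rewrite [LHS](cser_recl su) expr0; congr (_ + _); rewrite -cserZ//.
  by apply: eq_cser => n; rewrite exprS.
by apply: (mulfI q0); rewrite divff// mulrBl mul1r {1}E addrK.
Qed.

Lemma cser_sum (I : Type) (r : seq I) (F : I -> nat -> C) : (forall i, csummable (F i)) ->
  csummable (fun n => \sum_(i <- r) F i n) /\ cser (fun n => \sum_(i <- r) F i n) = \sum_(i <- r) cser (F i).
Proof.
move=> h; elim: r => [|i r [s1 IH]].
  have E : (fun n => \sum_(i <- [::]) F i n) = fun n : nat => 0 :> C by apply/funext => n; rewrite big_nil.
  rewrite E big_nil; split; first by exists 0 => N; rewrite big1// => i _; rewrite cabs0.
  by rewrite (@cser_fin _ _ 0)// big_ord0.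
have E : (fun n => \sum_(i <- i :: r) F i n) = fun n : nat => F i n + \sum_(i <- r) F i n.
  by apply/funext => n; rewrite big_cons.
by rewrite E big_cons -IH; split; [exact: csummableD|exact: cserD].
Qed.

Lemma cint_cser (a b : R) (u : nat -> C -> C) (U : C -> C) (M : nat -> R) : a <= b ->
  (forall n, segc a b (u n)) -> segc a b U ->
  (forall n x, a <= x <= b -> cabs (u n x%:C) <= M n) -> rsummable M ->
  (forall x, a <= x <= b -> U x%:C = cser (u^~ x%:C)) ->
  integ a b U = cser (fun n => integ a b (u n)).
Proof.
move=> ab cu cU hM sM hU; apply/esym/cser_eq => e e0.
have M0 n : 0 <= M n by apply: le_trans (cabs_ge0 _) (hM n a _); rewrite lexx ab.
have e1 : 0 < e / (b - a + 1) by rewrite divr_gt0// ltr_wpDl// subr_ge0.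
have [N HN] := rsummable_tail M0 sM e1; exists N => n Nn.
rewrite -(@cint_sum R a b n (fun i z => u i z))//.
rewrite -(@cintB R a b (fun z => \sum_(i < n) u i z) U)//; last exact: segc_sum.
have cF : segc a b (fun z => \sum_(i < n) u i z - U z).
  by apply: segcD; [exact: segc_sum|move=> x hx; apply: ccontN; exact: cU].
apply: le_trans (@cint_bound R a b _ (e / (b - a + 1)) ab cF _) _; last first.
  have d0 : 0 < b - a + 1 by rewrite ltr_wpDl// subr_ge0.
  by rewrite mulrAC ler_pdivrMr// ler_wpM2l ?(ltW e0)// lerDl.
move=> x hx; rewrite cabsB hU//.
have su : csummable (u^~ x%:C) by apply: csummable_le sM => m; exact: hM.
have cv := ccvgB (cser_cvg su) (ccvg_cst (\sum_(i < n) u i x%:C)).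
apply: ccvg_bound cv; exists n => m nm.
have -> : \sum_(i < m) u i x%:C - \sum_(i < n) u i x%:C = \sum_(n <= i < m) u i x%:C.
  rewrite -!(big_mkord xpredT (fun i => u i x%:C)).
  by rewrite (@big_cat_nat _ _ _ n 0 m)//= addrAC subrr add0r.
apply: le_trans (cabs_sum _ _ _) _; apply: le_trans (ler_sum _ (fun i _ => hM i x hx)) _.
apply: le_trans (HN m); rewrite [leRHS](big_cat_nat Nn nm)/= lerDr.
by rewrite sumr_ge0.
Qed.

Lemma phi_bound0 Y p : 2^-1 <= Re Y -> exists2 B : R, 0 <= B & forall (j : nat) y,
  j%:R <= `|y| <= j%:R + 1 -> cabs (phi Y p y%:C) <= B * dec R p j.
Proof.
move=> hY; have hYc := cabs_ge_half hY.
have H0 := ltW (Hc_gt0 R p).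
exists (2 ^+ p * (p.+1%:R * Hc R p * cabs Y ^+ p)) => [|j y].
  by rewrite mulr_ge0// ?exprn_ge0// mulr_ge0 ?exprn_ge0 ?cabs_ge0// mulr_ge0.
wlog y0 : y / 0 <= y.
  move=> H; have [h|h] := leP 0 y; first exact: H.
  have := H (- y); rewrite oppr_ge0 (ltW h) normrN rmorphN phiN cabsM cabsX cabsN cabs1 expr1n mul1r.
  exact.
rewrite ger0_norm// => /andP[j1 j2]; rewrite /phi cabsM.
have hE : cabs (gE Y y%:C) <= expR (- 2^-1) ^+ j.
  rewrite cabs_gE -expRM_natl ler_expR mulrN lerN2.
  have pY : 1 <= pi * Re Y by have := pi_ge2 R; move: hY; nra.
  have yj : j%:R / 2 <= y ^+ 2.
    case: j j1 {j2} => [_|j h]; first by rewrite mul0r sqr_ge0.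
    have h1 : (1 : R) <= j.+1%:R by rewrite ler1n.
    by move: (j.+1%:R : R) h h1 => u; nra.
  by apply: le_trans yj _; rewrite ler_peMl ?sqr_ge0.
have hH := Hp_bound p y%:C hYc; rewrite cabs_real ger0_norm// in hH.
have hH2 : cabs (Hp Y p).[y%:C] <= p.+1%:R * Hc R p * cabs Y ^+ p * (2 ^+ p * j.+1%:R ^+ p).
  apply: le_trans hH _; apply: ler_wpM2l.
    by rewrite mulr_ge0 ?exprn_ge0 ?cabs_ge0// mulr_ge0.
  rewrite -exprMn lerXn2r ?nnegrE ?addr_ge0 ?mulr_ge0//.
  rewrite -(natr1 j); have : (0 : R) <= j%:R by []; move: (j%:R : R) j2 => u; lra.
have := ler_pM (cabs_ge0 _) (cabs_ge0 _) hH2 hE => /le_trans; apply; rewrite /dec.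
by apply: eq_ler; move: (expR _ ^+ j) (cabs Y ^+ p) (Hc _ _) => u v w; ring.
Qed.

Lemma dec_cvg0 p e : 0 < e -> exists N, forall n, (N <= n)%N -> dec R p n <= e.
Proof.
move=> e0; have [N HN] := rsummable_tail (@dec_ge0 R p) (dec_summable R p) e0.
exists N => n Nn; apply: le_trans (HN n.+1); rewrite big_nat_recr//= lerDr.
by rewrite sumr_ge0// => i _; exact: dec_ge0.
Qed.

Lemma cabsM_le (a b : C) (A B : R) : cabs a <= A -> cabs b <= B -> cabs (a * b) <= A * B.
Proof. by move=> ha hb; rewrite cabsM ler_pM ?cabs_ge0. Qed.

Lemma cabs_unit2_le (q a b e1 e2 : C) (B : R) : cabs a <= B -> cabs b <= B -> cabs e1 = 1 -> cabs e2 = 1 ->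
  cabs (q * (a * e1 - b * e2)) <= cabs q * (2 * B).
Proof.
move=> ha hb h1 h2; rewrite cabsM ler_wpM2l ?cabs_ge0//; apply: le_trans (cabsD _ _) _.
by rewrite cabsN 2!cabsM h1 h2 !mulr1 mulrDl mul1r lerD.
Qed.

Lemma phi_ft Y p b : 2^-1 <= Re Y -> Re b = 0 ->
  ccvg (fun J : nat => csq Y * integ (- J.+1%:R) J.+1%:R (fun z => phi Y p z * cexp (b * z)))
    ((- b) ^+ p * cexp (b ^+ 2 / (4 * ((pi : R)%:C * Y)))).
Proof.
move=> hY hb; have Y0 : 0 < Re Y by apply: lt_le_trans hY; rewrite invr_gt0.
elim: p => [|p IH].
  rewrite expr0 mul1r => e e0; have [L0 HL] := gauss_ft b Y0 e0.
  have [N HN] : exists N : nat, L0 <= N%:R.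
    by exists (Num.bound `|L0|); rewrite (le_trans (ler_norm _))// ltW// archi_boundP.
  exists N => n nL; have hL : L0 <= n.+1%:R by rewrite (le_trans HN)// ler_nat leqW.
  apply: le_trans (HL n.+1%:R hL).
  have -> // : integ (- n.+1%:R) n.+1%:R (fun z => phi Y 0 z * cexp (b * z)) =
     integ (- n.+1%:R) n.+1%:R (fun z => cexp (- ((pi : R)%:C * Y) * z ^+ 2 + b * z)).
  by apply: eq_cint => x _; rewrite /phi /= hornerC mul1r cexpD.
have [B B0 HB] := phi_bound0 p hY.
have ce x : cabs (cexp (b * x%:C)) = 1.
  by rewrite cabs_cexp mulrC Re_realM hb mulr0 expR0.
have E (J : nat) : csq Y * integ (- J.+1%:R) J.+1%:R (fun z => phi Y p.+1 z * cexp (b * z)) =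
   csq Y * (phi Y p J.+1%:R%:C * cexp (b * J.+1%:R%:C) - phi Y p (- J.+1%:R)%:C * cexp (b * (- J.+1%:R)%:C))
   + - b * (csq Y * integ (- J.+1%:R) J.+1%:R (fun z => phi Y p z * cexp (b * z))).
  have J0 : - J.+1%:R <= J.+1%:R :> R by rewrite ge0_cp.
  have H := @cint_parts R (- J.+1%:R) J.+1%:R (fun z => cexp (b * z)) (phi Y p)
    (fun z => cexp (b * z) * b) (phi Y p.+1) J0 (fun x _ => cdiff_cexpZ b x%:C) (fun x _ => cdiff_phi_herm Y p x%:C).
  have c1 : segc (- J.+1%:R) J.+1%:R (fun z => cexp (b * z)).
    by apply: segc_diff => x _; exact: cdiff_cexpZ.
  have := H (segcM c1 (@segc_cst R _ _ b)) (@segc_phi R _ _ _ _) => {}H.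
  have -> : integ (- J.+1%:R) J.+1%:R (fun z => phi Y p.+1 z * cexp (b * z)) =
     integ (- J.+1%:R) J.+1%:R (fun z => cexp (b * z) * phi Y p.+1 z).
    by apply: eq_cint => x _; rewrite mulrC.
  rewrite H; have -> : integ (- J.+1%:R) J.+1%:R (fun z => cexp (b * z) * b * phi Y p z) =
     b * integ (- J.+1%:R) J.+1%:R (fun z => phi Y p z * cexp (b * z)).
    rewrite -(@cintZ R _ _ b (fun z => phi Y p z * cexp (b * z))); last exact: segcM (@segc_phi R _ _ _ _) c1.
    by apply: eq_cint => x _; move: (cexp _) (phi _ _ _) => u v; ring.
  by move: (cexp _) (cexp _) (csq _) (phi _ _ _) (phi _ _ _) (cint _ _ _) => q1 q2 q3 q4 q5 q6; ring.
apply: (ccvg_near (ex_intro _ 0%N (fun J _ => esym (E J)))).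
rewrite exprS -mulrA -[X in ccvg _ X]add0r; apply: ccvgD; last exact: ccvgZ.
apply: (@ccvg_le _ _ _ (fun J => dec R p J.+1) (cabs (csq Y) * (2 * B) + 1)).
- by rewrite ltr_wpDl// mulr_ge0 ?cabs_ge0// mulr_ge0.
- by move=> e e0; have [N HN] := dec_cvg0 p e0; exists N => n Nn; apply: HN; exact: leqW.
move=> J; rewrite subr0; have d0 := dec_ge0 R p J.+1.
have h1 := HB J.+1 J.+1%:R; have h2 := HB J.+1 (- J.+1%:R).
rewrite normrN in h2; rewrite ger0_norm// lexx lerDl ler01 /= in h1 h2.
apply: le_trans (cabs_unit2_le (csq Y) (h1 isT) (h2 isT) (ce _) (ce _)) _.
move: d0; move: (cabs (csq Y)) (dec R p J.+1) => q d d0; have -> : (q * (2 * B) + 1) * d = q * (2 * (B * d)) + d by ring.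
by rewrite lerDl.
Qed.

Lemma ccot_exp w : csin w != 0 -> ccot w = iC * (cexp (2 * iC * w) + 1) / (cexp (2 * iC * w) - 1).
Proof.
have E : cexp (2 * iC * w) = cexp (iC * w) ^+ 2 by rewrite -mulrA cexpMn.
rewrite E ccot_div csin2E => s0; have -> : ccos w = (cexp (iC * w) + cexp (- (iC * w))) / 2 by [].
move: s0; rewrite cexpN; have := cexp_neq0 (iC * w); move: (cexp _) => a a0 s0.
have n0 : a ^+ 2 - 1 != 0.
  apply: contraNneq s0 => h; have -> : a - a^-1 = (a ^+ 2 - 1) / a by field.
  by rewrite h !mul0r.
by field; rewrite a0 n0 iC_neq0.
Qed.

Definition tn k (n : nat) : R := 2 * pi * (n%:R + 2^-1) / k%:R.
(** The finite Fourier transform of [g]; for [g = gf R k h'] it is [c * gf R k h] by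
    [gauss_fourier]. *)
Definition av k g (n : nat) : C := \sum_(v < k) g v%:Z * chn R k n%:Z v%:Z.

(** Coefficients that change sign under [k] pair the cotangents half a period apart. The difference
    [u / (1 - u ^+ 2)] expands in odd powers of [u] only, which are the half-integral frequencies of
    theta. *)
Lemma kc_halfper k e x : (0 < k)%N -> 0 < e ->
  let u := cexp (ipi * (x%:C + iC * e%:C) / k%:R) in
  [/\ cabs u < 1 & iC / 4 * (kc k e x%:C - kc k e (x%:C + k%:R)) = u / (1 - u ^+ 2)].
Proof.
move=> k0 e0 u; have kR := natR_gt0 R k0.
have kC := natC_neq0 R k0.
have uE : u = cexp (2 * iC * ((pi / (2 * k%:R) : R)%:C * (x%:C + iC * e%:C))).
  rewrite /u; congr cexp; rewrite rmorphM fmorphV rmorphM /= !rmorph_nat /ipi.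
  by move: (pi%:C) => p; field.
have u1 : cabs u < 1.
  rewrite /u cabs_cexp -mulrA Re_ipi.
  have -> : Im ((x%:C + iC * e%:C) / k%:R) = e / k%:R.
    by rewrite invnat /=; ring.
  by rewrite expR_lt1 mulNr oppr_lt0 mulr_gt0 ?pi_gt0// divr_gt0.
split=> //; have e1 : e != 0 by rewrite gt_eqF.
have kx : x%:C + k%:R = (x + k%:R)%:C :> C by rewrite rmorphD /= rmorph_nat.
have n1 := kc_neq0_e x k0 e1; have n2 := kc_neq0_e (x + k%:R) k0 e1.
rewrite /kc (ccot_exp n1) kx (ccot_exp n2) -uE.
have -> : cexp (2 * iC * ((pi / (2 * k%:R) : R)%:C * ((x + k%:R)%:C + iC * e%:C))) = - u.
  rewrite uE cexp_opp; congr cexp; rewrite -kx rmorphM fmorphV rmorphM /= !rmorph_nat /ipi.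
  by move: (pi%:C) => p; field.
have d1 : u - 1 != 0 by rewrite subr_eq0; apply: contraTneq u1 => ->; rewrite cabs1 ltxx.
have d2 : - u - 1 != 0.
  by rewrite subr_eq0 eqr_oppLR; apply: contraTneq u1 => ->; rewrite cabsN cabs1 ltxx.
have i2 := iC_sqr R; clearbody u; move: (iC : C) i2 => i i2.
have -> : i / 4 * (i * (u + 1) / (u - 1) - i * (- u + 1) / (- u - 1)) =
  (i * i) * ((u + 1) / (u - 1) - (- u + 1) / (- u - 1)) / 4 by field; rewrite d1 d2.
rewrite i2; have -> : 1 - u ^+ 2 = (u - 1) * (- u - 1) by ring.
by field; rewrite d1 d2.
Qed.

Lemma Kt_series k g e x : (0 < k)%N -> 0 < e -> (forall n, g (n + k%:Z) = - g n) ->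
  iC / 4 * Kt k g e x%:C =
  cser (fun n => av k g n * cexp (iC * (tn k n)%:C * (iC * e%:C)) * cexp (iC * (tn k n)%:C * x%:C)).
Proof.
move=> k0 e0 ganti; pose u (v : nat) := cexp (ipi * ((x + (v%:R + 2^-1))%:C + iC * e%:C) / k%:R).
have kC := natC_neq0 R k0.
have xv (v : nat) : x%:C + v%:R + 2^-1 = (x + (v%:R + 2^-1))%:C :> C.
  by rewrite !rmorphD fmorphV /= !rmorph_nat addrA.
have L : iC / 4 * Kt k g e x%:C = \sum_(v < k) g v%:Z * (u v / (1 - u v ^+ 2)).
  rewrite /Kt mul2n -addnn big_split_ord /= -big_split mulr_sumr; apply: eq_bigr => v _ /=.
  have -> : g (k + v)%N%:Z = - g v%:Z by rewrite -ganti addnC PoszD.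
  rewrite mulNr -mulrBr mulrCA; congr (_ * _).
  have -> : x%:C + (k + v)%:R + 2^-1 = (x + (v%:R + 2^-1))%:C + k%:R :> C.
    by rewrite -xv natrD; move: (k%:R : C) (v%:R : C) => p q; ring.
  by rewrite xv; have [_ ->] := @kc_halfper k e (x + (v%:R + 2^-1)) k0 e0.
have u1 v : cabs (u v) < 1 by have [] := @kc_halfper k e (x + (v%:R + 2^-1)) k0 e0.
have u2 v : cabs (u v ^+ 2) < 1 by rewrite cabsX expr2 mulr_ilt1 ?cabs_ge0.
have su v : csummable (fun n => g v%:Z * (u v * (u v ^+ 2) ^+ n)).
  do 2!apply: csummableZ; apply: csummable_le (geom_summable (cabs_ge0 _) (u2 v)) => n.
  by rewrite cabsX.
have su' v : csummable (fun n => u v * (u v ^+ 2) ^+ n).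
  by apply: csummableZ; apply: csummable_le (geom_summable (cabs_ge0 _) (u2 v)) => n; rewrite cabsX.
have su'' v : csummable (fun n => (u v ^+ 2) ^+ n).
  by apply: csummable_le (geom_summable (cabs_ge0 _) (u2 v)) => n; rewrite cabsX.
have [_ E] := cser_sum (index_enum 'I_k) (fun v : 'I_k => su v).
rewrite L; transitivity (\sum_(v < k) cser (fun n => g v%:Z * (u v * (u v ^+ 2) ^+ n))).
  by apply: eq_bigr => v _; rewrite cserZ// cserZ// cser_geom.
rewrite -E; apply: eq_cser => n; rewrite /av !mulr_suml; apply: eq_bigr => v _.
have X : u v ^+ (2 * n).+1 = chn R k n%:Z v%:Z * cexp (iC * (tn k n)%:C * (iC * e%:C)) * cexp (iC * (tn k n)%:C * x%:C).
  rewrite /u -cexpMn /chn -!cexpD; congr cexp.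
  rewrite !halfintE -!pmulrn /tn rmorphM fmorphV rmorphM !rmorphD fmorphV rmorphM /= !rmorph_nat /ipi.
  rewrite -(natr1 (2 * n)) natrM.
  move: (pi%:C) (n%:R : C) ((nat_of_ord v)%:R : C) x%:C e%:C => p q w y h.
  by field.
have -> : u v * (u v ^+ 2) ^+ n = u v ^+ (2 * n).+1 by rewrite [RHS]exprS exprM.
rewrite X; move: (g _) (chn _ _ _ _) (cexp _) (cexp _) => p q w h; ring.
Qed.

Lemma integ_cells_le Y p (F : C -> C) (B : R) (J : nat) : segc (- J%:R) J%:R F ->
  (forall (j : nat) y, j%:R <= `|y| <= j%:R + 1 -> cabs (F y%:C) <= B * dec R p j) ->
  cabs (integ (- J%:R) J%:R F) <= \sum_(j < J) 2 * (B * dec R p j).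
Proof.
move=> cF hF; elim: J cF => [|J IH] cF; first by rewrite oppr0 cintxx cabs0 big_ord0.
have h1 : - J.+1%:R <= - J%:R :> R by rewrite lerN2 ler_nat.
have h2 : - J%:R <= J%:R :> R by rewrite ge0_cp.
have h3 : J%:R <= J.+1%:R :> R by rewrite ler_nat.
rewrite (@cint_cat R _ _ _ F h1 (le_trans h2 h3) cF) (@cint_cat R _ _ _ F h2 h3); last exact: segcW cF.
rewrite big_ord_recr /=; have d1 : J.+1%:R = J%:R + 1 :> R by rewrite natr1.
have L : cabs (integ (- J.+1%:R) (- J%:R) F) <= B * dec R p J.
  have := @cint_bound R (- J.+1%:R) (- J%:R) F (B * dec R p J) h1 (segcW (lexx _) (le_trans h2 h3) cF).
  have -> : - J%:R - - J.+1%:R = 1 :> R by rewrite d1; ring.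
  rewrite mulr1; apply=> x /andP[x1 x2]; apply: hF; rewrite d1 in x1.
  have x0 : x <= 0 by apply: le_trans x2 _; rewrite oppr_le0.
  by rewrite (ler0_norm x0) lerNr x2 lerNl x1.
have Rr : cabs (integ J%:R J.+1%:R F) <= B * dec R p J.
  have := @cint_bound R J%:R J.+1%:R F (B * dec R p J) h3 (segcW (le_trans h1 h2) (lexx _) cF).
  rewrite d1 addrAC subrr add0r mulr1; apply=> x /andP[x1 x2]; apply: hF.
  by rewrite ger0_norm ?x1// (le_trans _ x1).
have := IH (segcW h1 h3 cF); have := cabsD (integ (- J%:R) J%:R F) (integ J%:R J.+1%:R F).
have := cabsD (integ (- J.+1%:R) (- J%:R) F) (integ (- J%:R) J%:R F + integ J%:R J.+1%:R F).
move: L Rr; clear; lra.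
Qed.

Lemma nat_floor (x : R) : 0 <= x -> exists j : nat, j%:R <= x <= j%:R + 1.
Proof.
move=> x0; exists (Num.truncn x); have /andP[h1 h2] := truncn_itv x0.
by rewrite h1 natr1 ltW.
Qed.

Lemma tn_ge k n : (0 < k)%N -> 2 * n%:R / k%:R <= tn k n.
Proof.
move=> k0; have kR := natR_gt0 R k0.
rewrite /tn ler_pM2r ?invr_gt0//; have := pi_ge2 R; have : (0 : R) <= n%:R by [].
move: (pi : R) (n%:R : R) => p x; nra.
Qed.

Lemma cabs_ex (t x : R) : cabs (cexp (iC * t%:C * x%:C) : C) = 1.
Proof. by rewrite cabs_cexp (_ : Re _ = 0) ?expR0//=; ring. Qed.

Lemma cabs_ee (t e : R) : cabs (cexp (iC * t%:C * (iC * e%:C)) : C) = expR (- (t * e)).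
Proof.
have -> : iC * t%:C * (iC * e%:C) = (- (t * e))%:C :> C.
  rewrite rmorphN rmorphM /=; have := iC_sqr R; move: (iC : C) t%:C e%:C => i a b i2.
  by rewrite -mulN1r -i2; ring.
by rewrite cexp_real cabs_real ger0_norm ?expR_ge0.
Qed.

Lemma av_bound k g n : (forall n, cabs (g n) <= 1) -> cabs (av k g n) <= k%:R.
Proof.
move=> g1; apply: le_trans (cabs_sum _ _ _) _.
rewrite -[k in leRHS]card_ord -sumr_const; apply: ler_sum => v _.
rewrite cabsM -[leRHS]mulr1 ler_pM ?cabs_ge0// /chn cabs_cexp.
have -> : 2 * ipi * (halfint R n%:Z)%:C * ((halfint R v%:Z)%:C / k%:R) =
   ipi * (2 * halfint R n%:Z * (halfint R v%:Z / k%:R))%:C :> C.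
  by rewrite !rmorphM fmorphV /= !rmorph_nat; ring.
by rewrite Re_ipi /= mulr0 expR0.
Qed.

(** The [n]-th term of the [p]-th Taylor coefficient of the partial theta function, up to
    normalization, damped by [exp (- e * tn k n)]. *)
Definition Seps Y p k g e (n : nat) : C := av k g n * cexp (iC * (tn k n)%:C * (iC * e%:C)) *
  ((iC * (tn k n)%:C) ^+ p * cexp ((iC * (tn k n)%:C) ^+ 2 / (4 * ((pi : R)%:C * Y)))).

(** [Kt_series] is integrated term by term on each segment, [phi_ft] gives the limit of each term,
    and [tannery] exchanges limit and sum. *)
Lemma false_theta_int Y p k g e : (0 < k)%N -> 0 < e -> ~~ odd p -> 2^-1 <= Re Y ->
  (forall n, g (n + k%:Z) = - g n) -> (forall n, cabs (g n) <= 1) ->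
  ccvg (fun J : nat => csq Y * integ (- J.+1%:R) J.+1%:R (fun z => phi Y p z * (iC / 4 * Kt k g e z)))
    (cser (Seps Y p k g e)).
Proof.
move=> k0 e0 pe hY ganti g1; have kR := natR_gt0 R k0.
have e1 : e != 0 by rewrite gt_eqF.
pose c n := av k g n * cexp (iC * (tn k n)%:C * (iC * e%:C)).
(* Since [tn k n >= 2 * n / k], the shift damps the [n]-th term by [r ^+ n]; [e > 0] gives [r < 1]
   and hence the domination. *)
pose r := expR (- (2 / k%:R * e)).
have r1 : r < 1 by rewrite expR_lt1 oppr_lt0 mulr_gt0// divr_gt0.
have r0 : 0 <= r := expR_ge0 _.
have hc n : cabs (c n) <= k%:R * r ^+ n.
  rewrite /c cabsM cabs_ee; apply: ler_pM; rewrite ?cabs_ge0 ?expR_ge0 ?av_bound//.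
  rewrite -expRM_natl ler_expR mulrN lerN2 mulrA; apply: ler_wpM2r; first exact: ltW.
  by apply: le_trans (tn_ge n k0); rewrite mulrCA mulrA.
have cex (a b t : R) : segc a b (fun z => cexp (iC * t%:C * z)).
  by apply: segc_diff => x _; exact: cdiff_cexpZ.
have [B B0 HB] := phi_bound0 p hY; have [S HS] := dec_summable R p.
have S0 : 0 <= S by have := HS 0%N; rewrite big_ord0.
pose u (J n : nat) : C := csq Y * integ (- J.+1%:R) J.+1%:R (fun z => phi Y p z * cexp (iC * (tn k n)%:C * z)).
have cu (J n : nat) : segc (- J%:R) J%:R (fun z => phi Y p z * cexp (iC * (tn k n)%:C * z)).
  by apply: segcM; [exact: segc_phi|exact: cex].
have hu (J n : nat) : cabs (u J n) <= cabs (csq Y) * (2 * B * S).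
  rewrite /u cabsM; apply: ler_wpM2l; first exact: cabs_ge0.
  apply: le_trans (@integ_cells_le Y p (fun z => phi Y p z * cexp (iC * (tn k n)%:C * z)) B J.+1 (cu _ n) _) _.
    move=> j y hj; have := cabsM_le (HB j y hj) (lexx (cabs (cexp (iC * (tn k n)%:C * y%:C)))).
    by rewrite cabs_ex [X in _ <= X -> _]mulr1.
  under eq_bigr do rewrite mulrA; rewrite -mulr_sumr; apply: ler_wpM2l (HS _).
  by rewrite mulr_ge0.
pose w (J n : nat) : C := c n * u J n.
have E (J : nat) : csq Y * integ (- J.+1%:R) J.+1%:R (fun z => phi Y p z * (iC / 4 * Kt k g e z)) = cser (w J).
  have J0 : - J.+1%:R <= J.+1%:R :> R by rewrite ge0_cp.
  pose v (n : nat) z := c n * (phi Y p z * cexp (iC * (tn k n)%:C * z)).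
  have [D D0 HD] : exists2 D : R, 0 <= D & forall x, - J.+1%:R <= x <= J.+1%:R -> cabs (phi Y p x%:C) <= D.
    exists (B * S); first exact: mulr_ge0.
    move=> x _; have [j hj] := nat_floor (normr_ge0 x).
    apply: le_trans (HB j x hj) (ler_wpM2l B0 (le_trans _ (HS j.+1))).
    by rewrite big_ord_recr /= lerDr sumr_ge0// => i _; exact: dec_ge0.
  have bv n x : - J.+1%:R <= x <= J.+1%:R -> cabs (v n x%:C) <= D * k%:R * r ^+ n.
    move=> hx; have ex1 : cabs (cexp (iC * (tn k n)%:C * x%:C) : C) <= 1 by rewrite cabs_ex.
    have := cabsM_le (hc n) (cabsM_le (HD x hx) ex1) => /le_trans; apply.
    by apply: eq_ler; move: (r ^+ n) => q; ring.
  have sM : rsummable (fun n => D * k%:R * r ^+ n).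
    by apply: rsummableZ; [rewrite mulr_ge0|exact: geom_summable].
  have H := @cint_cser (- J.+1%:R) J.+1%:R v (fun z => phi Y p z * (iC / 4 * Kt k g e z)) _ J0 _ _ bv sM _.
  rewrite H.
  - rewrite -cserZ.
      apply: eq_cser => n; rewrite /v /w /u (@cintZ R _ _ (c n) (fun z => phi Y p z * cexp (iC * (tn k n)%:C * z)))//.
      by rewrite mulrCA.
    apply: csummable_le (rsummableZ (_ : 0 <= 2 * J.+1%:R) sM); last by rewrite mulr_ge0.
    move=> n; have cv : segc (- J.+1%:R) J.+1%:R (v n) by apply: segcM => //; exact: segc_cst.
    have := @cint_bound R _ _ (v n) _ J0 cv (bv n); congr (_ <= _); ring.
  - by move=> n; apply: segcM => //; exact: segc_cst.
  - apply: segcM; first exact: segc_phi.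
    by apply: segcM; [exact: segc_cst|exact: segc_Kt].
  - move=> x hx; rewrite Kt_series// -cserZ.
      by apply: eq_cser => n; rewrite /v /c; move: (phi _ _ _) (av _ _ _) (cexp _) (cexp _) => a b d f; ring.
    have sk : rsummable (fun n => k%:R * r ^+ n) by apply: rsummableZ; [exact: ltW|exact: geom_summable].
    apply: csummable_le sk => n; have ex1 : cabs (cexp (iC * (tn k n)%:C * x%:C) : C) <= 1 by rewrite cabs_ex.
    by have := cabsM_le (hc n) ex1; rewrite mulr1.
apply: (ccvg_near (ex_intro _ 0%N (fun J _ => esym (E J)))).
apply: (@tannery _ w (Seps Y p k g e) (fun n => cabs (csq Y) * (2 * B * S) * k%:R * r ^+ n)).
- move=> J n; have := cabsM_le (hc n) (hu J n) => /le_trans; apply.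
  by apply: eq_ler; move: (r ^+ n) (cabs (csq Y)) => q q'; ring.
- apply: rsummableZ; last exact: geom_summable.
  by rewrite mulr_ge0 ?(ltW kR)// mulr_ge0 ?cabs_ge0// mulr_ge0// mulr_ge0.
move=> n; rewrite /w /Seps -/(c n); apply: ccvgZ.
have re0 : Re (iC * (tn k n)%:C : C) = 0 by rewrite /= mul0r mul1r sub0r oppr0.
have := phi_ft p hY re0.
by rewrite [(- _) ^+ p]exprNn -signr_odd (negPf pe) mul1r.
Qed.

End FalseTheta.

(** * The central segment *)

Section MainSegment.
Variable R : realType.
Local Notation C := R[i].
Implicit Types (Y z w b : C) (k : nat) (e x s y : R) (g : int -> C).
Local Notation beta := (@beta R).
Local Notation errlog := (@errlog R).

(* The n-th derivative of cot is a polynomial in cot. *)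
Fixpoint Pc (n : nat) : {poly C} := if n is n'.+1 then - ((Pc n')^`() * (1 + 'X^2)) else 'X.

(** The [i]-th derivative of [Kt] in [z]. *)
Definition Kd k g i e z : C :=
  \sum_(v < 2 * k) g v%:Z * ((pi / (2 * k%:R) : R)%:C ^+ i * (Pc i).[kc k e (z + v%:R + 2^-1)]).

Lemma Kd0 k g e z : Kd k g 0 e z = Kt k g e z.
Proof. by apply: eq_bigr => v _; rewrite expr0 mul1r hornerX. Qed.

Lemma kc_trans k e z : kc k e z = kc k 0 (z + iC * e%:C).
Proof. by rewrite /kc rmorph0 mulr0 addr0. Qed.

Lemma Kd_trans k g i e z : Kd k g i e z = Kd k g i 0 (z + iC * e%:C).
Proof.
apply: eq_bigr => v _; congr (_ * (_ * _)); rewrite kc_trans; congr (_.[kc _ _ _]).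
by rewrite addrAC -addrA addrC addrACA addrC !addrA; ring.
Qed.

(** Since [beta < 9 / 20], at least 1/20 separates the central segment from the poles 1/2 and -1/2;
    the distances to the further poles grow linearly, and their inverses sum to a logarithm. *)
Lemma seg_range k v y : (v < 2 * k)%N -> `|y| <= beta ->
  (v.+1%:R / 20 <= y + (v%:R + 2^-1)) /\ ((2 * k - v)%:R / 20 <= 2 * k%:R - (y + (v%:R + 2^-1))).
Proof.
move=> vk /ler_normlP[y1 y2]; have bl := beta_lt R.
have v0 : (0 : R) <= v%:R by [].
have E : ((2 * k - v)%:R : R) = 2 * k%:R - v%:R by rewrite natrB ?natrM// ltnW.
have k1 : (1 : R) <= (2 * k - v)%:R by rewrite ler1n subn_gt0.
rewrite -(natr1 v) E in k1 *; move: (v%:R : R) (k%:R : R) v0 k1 => a c a0 c1.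
by split; lra.
Qed.

Lemma seg_range2 k v y : (v < 2 * k)%N -> `|y| <= beta -> 0 < y + (v%:R + 2^-1) < 2 * k%:R.
Proof.
move=> vk hy; have [h1 h2] := seg_range vk hy; apply/andP; split.
  by apply: lt_le_trans h1; rewrite divr_gt0 ?ltr0n.
by rewrite -subr_gt0; apply: lt_le_trans h2; rewrite divr_gt0 ?ltr0n ?subn_gt0.
Qed.

Lemma xv_real y (v : nat) : y%:C + v%:R + 2^-1 = (y + (v%:R + 2^-1))%:C :> C.
Proof. by rewrite !rmorphD fmorphV /= !rmorph_nat addrA. Qed.

Lemma cdiff_Kd k g i e y : (0 < k)%N -> `|y| <= beta -> cdiff (Kd k g i e) y%:C (Kd k g i.+1 e y%:C).
Proof.
move=> k0 hy; apply: cdiff_sum => v; apply: cdiffZ; rewrite exprSr -mulrA; apply: cdiffZ.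
have n0 := kc_neq0_x e k0 (seg_range2 (ltn_ord v) hy); rewrite -xv_real in n0.
have d1 : cdiff (fun w => w + v%:R + 2^-1) y%:C 1.
  by have := cdiff_lin 1 (v%:R + 2^-1) y%:C; congr cdiff; apply/funext => w; rewrite mul1r addrA.
have := cdiff_comp (cdiff_comp d1 (cdiff_kc n0)) (cdiff_poly (Pc i) _); congr cdiff.
by rewrite /= hornerN hornerM hornerD hornerXn hornerC mulr1; move: (_^`()) (kc _ _ _) => p c; ring.
Qed.

Lemma segc_Kd k g i e : (0 < k)%N -> segc (- beta) beta (Kd k g i e).
Proof.
move=> k0; apply: segc_diff => x hx; apply: cdiff_Kd => //.
by rewrite ler_norml.
Qed.

Lemma size_Pc n : (size (Pc n) <= n.+2)%N.
Proof.
elim: n => [|n IH] /=; first by rewrite size_polyX.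
rewrite size_polyN; apply: leq_trans (size_mul_leq _ _) _.
have s2 : (size (1 + 'X^2 : {poly C})%R <= 3)%N.
  by apply: leq_trans (size_polyD _ _) _; rewrite size_poly1 size_polyXn.
have s1 : (size (Pc n)^`() <= n.+1)%N.
  apply: leq_trans (size_poly _ _) _; by case: (size _) IH.
by have := leq_add s1 s2; rewrite -subn1 leq_subLR => /leq_trans; apply; lia.
Qed.

Lemma Pc_bound n : exists2 D : R, 0 <= D & forall w : C, cabs (Pc n).[w] <= D * (1 + cabs w) ^+ n.+1.
Proof.
pose B := \sum_(i < size (Pc n)) cabs (Pc n)`_i.
have B0 : 0 <= B by apply: sumr_ge0 => i _; exact: cabs_ge0.
exists (n.+2%:R * B) => [|w]; first by rewrite mulr_ge0.
apply: horner_bound (size_Pc n) _ => i; have [h|h] := leqP (size (Pc n)) i.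
  by rewrite nth_default// cabs0.
by rewrite /B (bigD1 (Ordinal h))//= lerDl sumr_ge0// => j _; exact: cabs_ge0.
Qed.

Lemma kc_seg_sum k e y : (0 < k)%N -> `|y| <= beta ->
  \sum_(v < 2 * k) (1 + cabs (kc k e (y%:C + v%:R + 2^-1))) <= 500 * k%:R * errlog k.
Proof.
move=> k0 hy; have kR := natR_gt0 R k0.
set n := (2 * k)%N.
have T (v : 'I_n) : 1 + cabs (kc k e (y%:C + v%:R + 2^-1)) <=
    1 + 40 * k%:R * ((v.+1%:R)^-1 + ((n - v)%:R)^-1).
  rewrite lerD2l xv_real; have vn : (v < n)%N := ltn_ord v.
  have [h1 h2] := seg_range vn hy.
  apply: le_trans (kc_bound e k0 (seg_range2 vn hy)) _.
  have p1 : (0 : R) < v.+1%:R by rewrite ltr0n.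
  have p2 : (0 : R) < (n - v)%:R by rewrite ltr0n subn_gt0.
  have q1 : (y + (v%:R + 2^-1))^-1 <= 20 * (v.+1%:R)^-1.
    rewrite -[leRHS]invrK lef_pV2 ?posrE ?invr_gt0 ?mulr_gt0 ?invr_gt0//; last first.
      by apply: lt_le_trans h1; rewrite divr_gt0.
    by rewrite invfM invrK mulrC.
  have q2 : (2 * k%:R - (y + (v%:R + 2^-1)))^-1 <= 20 * ((n - v)%:R)^-1.
    rewrite -[leRHS]invrK lef_pV2 ?posrE ?invr_gt0 ?mulr_gt0 ?invr_gt0//; last first.
      by apply: lt_le_trans h2; rewrite divr_gt0.
    by rewrite invfM invrK mulrC.
  apply: le_trans (ler_wpM2l _ (lerD q1 q2)) _; first by rewrite mulr_ge0.
  by apply: eq_ler; ring.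
apply: le_trans (ler_sum _ (fun v _ => T v)) _.
rewrite big_split /= sumr_const card_ord -mulr_sumr big_split /=.
have E : \sum_(i < n) ((n - i)%:R)^-1 = \sum_(i < n) (i.+1%:R)^-1 :> R.
  rewrite (reindex_inj rev_ord_inj); apply: eq_bigr => i _.
  by rewrite /= subKn.
rewrite E; have := harmonic_le R n; move: (\sum_(i < n) _) => H hH.
have el := errlog_ge R k0; have hs := hsum_le R k0; rewrite -/n in hs.
have l2 : ln n.+1%:R <= ln n%:R + ln 2 :> R.
  rewrite -lnM ?posrE ?ltr0n ?muln_gt0// ler_ln ?posrE ?mulr_gt0 ?ltr0n ?muln_gt0//.
  by rewrite -natrM ler_nat /n; lia.
have l1 : ln 2 <= 1 :> R.
  by rewrite -[leRHS]expRK ler_ln ?posrE ?expR_gt0//; apply: le_trans (expR_ge1Dx _); lra.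
have hH2 : H <= 6 * errlog k by move: hH hs l2 l1 el; clear; lra.
have -> : (1 : R) *+ n = 2 * k%:R by rewrite /n -natrM.
have := ler_wpM2l (ltW kR) el; have := ler_wpM2l (ltW kR) hH2.
have -> : 40 * k%:R * (H + H) = 80 * (k%:R * H) by ring.
have -> : k%:R * (6 * errlog k) = 6 * (k%:R * errlog k) by ring.
have -> : 500 * k%:R * errlog k = 500 * (k%:R * errlog k) by ring.
by move: kR; move: (k%:R * H) (k%:R * errlog k) (k%:R : R) => kH u v; lra.
Qed.

(** Higher derivatives cost only a constant: on the segment [|kc| <= 80 k], hence
    [pi / (2 k) * (1 + |kc|) <= 162]. One factor [1 + |kc|] is kept and summed to O(k log k). *)
Lemma Kd_bound i : exists2 D : R, 0 <= D & forall k g e y, (0 < k)%N -> (forall n, cabs (g n) <= 1) ->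
  `|y| <= beta -> cabs (Kd k g i e y%:C) <= D * k%:R * errlog k.
Proof.
have [D D0 HD] := Pc_bound i; exists (D * 162 ^+ i * 500).
  by apply: mulr_ge0 (ler0n _ _); apply: mulr_ge0 D0 _; exact: exprn_ge0 (ler0n _ _).
move=> k g e y k0 g1 hy; have kR : (1 : R) <= k%:R by rewrite ler1n.
have k00 := natR_gt0 R k0.
have T (v : 'I_(2 * k)) : cabs (g v%:Z * ((pi / (2 * k%:R) : R)%:C ^+ i * (Pc i).[kc k e (y%:C + v%:R + 2^-1)]))
    <= D * 162 ^+ i * (1 + cabs (kc k e (y%:C + v%:R + 2^-1))).
  have vn : (v < 2 * k)%N := ltn_ord v; have [h1 h2] := seg_range vn hy.
  have hk := kc_bound e k0 (seg_range2 vn hy); rewrite -xv_real in hk.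
  have q1 : (y + (v%:R + 2^-1))^-1 <= 20.
    rewrite -[leRHS]invrK lef_pV2 ?posrE ?invr_gt0//; last by have /andP[] := seg_range2 vn hy.
    by apply: le_trans h1; rewrite ler_peMl ?invr_ge0// ler1n.
  have q2 : (2 * k%:R - (y + (v%:R + 2^-1)))^-1 <= 20.
    rewrite -[leRHS]invrK lef_pV2 ?posrE ?invr_gt0 ?subr_gt0//; last by have /andP[] := seg_range2 vn hy.
    by apply: le_trans h2; rewrite ler_peMl ?invr_ge0// ler1n subn_gt0.
  have hk2 : cabs (kc k e (y%:C + v%:R + 2^-1)) <= 80 * k%:R.
    apply: le_trans hk (le_trans (ler_wpM2l _ (lerD q1 q2)) _); first by rewrite mulr_ge0.
    by apply: eq_ler; ring.
  have c0 := cabs_ge0 (kc k e (y%:C + v%:R + 2^-1)).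
  rewrite cabsM; apply: le_trans (ler_piMl (cabs_ge0 _) (g1 _)) _.
  rewrite cabsM cabsX cabs_real gtr0_norm ?kstep//.
  have hP := HD (kc k e (y%:C + v%:R + 2^-1)).
  move: (cabs (_.[_])) (cabs (kc _ _ _)) c0 hk2 hP => P c c0 hc hP.
  have a0 := kstep R k0.
  apply: le_trans (ler_wpM2l (exprn_ge0 _ (ltW a0)) hP) _.
  have -> : (pi / (2 * k%:R)) ^+ i * (D * (1 + c) ^+ i.+1) = D * (1 + c) * ((pi / (2 * k%:R)) * (1 + c)) ^+ i :> R.
    by rewrite [(_ * (1 + c)) ^+ i]exprMn [(1 + c) ^+ i.+1]exprS; move: (_ ^+ i) (_ ^+ i) => p q; ring.
  have -> : D * 162 ^+ i * (1 + c) = D * (1 + c) * 162 ^+ i by ring.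
  apply: ler_wpM2l; first by rewrite mulr_ge0// addr_ge0.
  apply: lerXn2r; rewrite ?nnegrE//; first by rewrite mulr_ge0 ?(ltW a0)// addr_ge0.
  rewrite mulrAC ler_pdivrMr ?mulr_gt0//; have := pihalf_lt2 R; have := pi_gt0 R.
  move: (pi : R) (k%:R : R) kR hc => p q q1' hc' p0 p4.
  have hp : p <= 4 by move: p4; clear; lra.
  have hq : 1 + c <= 81 * q by move: q1' hc'; clear; lra.
  have c1 : 0 <= 1 + c by move: c0; clear; lra.
  by apply: le_trans (ler_pM (ltW p0) c1 hp hq) _; move: q1'; clear; lra.
apply: le_trans (cabs_sum _ _ _) _; apply: le_trans (ler_sum _ (fun v _ => T v)) _.
rewrite -mulr_sumr.
have -> : D * 162 ^+ i * 500 * k%:R * errlog k = D * 162 ^+ i * (500 * k%:R * errlog k).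
  by move: (162 ^+ i) => q; ring.
apply: ler_wpM2l; last exact: kc_seg_sum.
by apply: mulr_ge0 D0 _; exact: exprn_ge0 (ler0n _ _).
Qed.

Lemma boundary_le (X1 X2 I J s : C) (T D : R) : cabs X1 <= T -> cabs X2 <= T -> cabs (I - s * J) <= D ->
  cabs (X1 - X2 - I - -1 * s * J) <= 2 * T + D.
Proof.
move=> h1 h2 h3; have -> : X1 - X2 - I - -1 * s * J = X1 - X2 - (I - s * J) by ring.
apply: le_trans (cabsD _ _) _; rewrite cabsN; apply: lerD => //.
by apply: le_trans (cabsD _ _) _; rewrite cabsN mulrDl mul1r lerD.
Qed.

(** Integration by parts [m] times moves the derivatives from the Gaussian to the cotangents. The
    boundary terms sit at [y^2 = 1 / 6], where the Gaussian has just the size allowed in the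
    error. *)
Lemma seg_parts m r : exists2 D : R, 0 <= D & forall Y k g e, (0 < k)%N -> (forall n, cabs (g n) <= 1) ->
  2^-1 <= Re Y ->
  cabs (integ (- beta) beta (fun z => phi Y m z * Kd k g r e z)
    - (-1) ^+ m * integ (- beta) beta (fun z => phi Y 0 z * Kd k g (r + m) e z)) <=
  D * k%:R * errlog k * cabs Y ^+ m * expR (- (pi * Re Y / 6)).
Proof.
elim: m r => [|m IH] r.
  by exists 0 => // Y k g e _ _ _; rewrite expr0 mul1r addn0 subrr cabs0 !mul0r.
have [D D0 HD] := IH r.+1; have [B B0 HB] := Kd_bound r.
have ph0 := phc_ge0 R m; exists (2 * D + 4 * phc R m * B).
  by apply: addr_ge0; [exact: mulr_ge0|apply: mulr_ge0 B0; exact: mulr_ge0].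
move=> Y k g e k0 g1 hY; have b0 := ltW (beta_gt0 R).
have bb : - beta <= beta by rewrite ge0_cp.
have IN x : - beta <= x <= beta -> `|x| <= beta by rewrite ler_norml.
have H := @cint_parts R (- beta) beta (Kd k g r e) (phi Y m) (Kd k g r.+1 e) (phi Y m.+1) bb
  (fun x hx => cdiff_Kd g r e k0 (IN x hx)) (fun x _ => cdiff_phi_herm Y m x%:C) (segc_Kd g r.+1 e k0) (@segc_phi R _ _ _ _).
have E1 : integ (- beta) beta (fun z => phi Y m.+1 z * Kd k g r e z) =
    integ (- beta) beta (fun z => Kd k g r e z * phi Y m.+1 z).
  by apply: eq_cint => x _; rewrite mulrC.
have E2 : integ (- beta) beta (fun z => Kd k g r.+1 e z * phi Y m z) =
    integ (- beta) beta (fun z => phi Y m z * Kd k g r.+1 e z).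
  by apply: eq_cint => x _; rewrite mulrC.
have := HD Y k g e k0 g1 hY; rewrite E1 H E2 addSnnS (exprS (-1)) (exprS (cabs Y)).
have el := errlog_ge0 R k0.
set EE := expR _; have EE0 : 0 <= EE := expR_ge0 _.
have bt : beta <= 1 by apply: ltW; apply: lt_trans (beta_lt R) _; rewrite ltr_pdivrMr// mul1r ltr_nat.
have P1 : cabs (phi Y m beta%:C) <= phc R m * cabs Y ^+ m * EE.
  have := @phi_bound R Y m 0 beta hY (lexx _); rewrite add0r b0 bt => /(_ isT).
  by rewrite /dec expr1n expr0 !mulr1.
have P2 : cabs (phi Y m (- beta)%:C) <= phc R m * cabs Y ^+ m * EE.
  by rewrite rmorphN phiN cabsM cabsX cabsN cabs1 expr1n mul1r.
have K1 := HB k g e beta k0 g1 (IN beta ltac:(by rewrite bb lexx)).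
have K2 := HB k g e (- beta) k0 g1 (IN (- beta) ltac:(by rewrite bb lexx)).
have T1 := cabsM_le K1 P1; have T2 := cabsM_le K2 P2.
move=> hD; apply: le_trans (boundary_le T1 T2 hD) _.
have hYc := cabs_ge_half hY; have Yn : 0 <= cabs Y ^+ m by rewrite exprn_ge0 ?cabs_ge0.
pose Q := k%:R * errlog k * cabs Y ^+ m * EE.
have Q0 : 0 <= Q by apply: mulr_ge0 => //; apply: mulr_ge0 => //; exact: mulr_ge0.
have -> : 2 * (B * k%:R * errlog k * (phc R m * cabs Y ^+ m * EE)) + D * k%:R * errlog k * cabs Y ^+ m * EE =
  (2 * D + 4 * phc R m * B) * (Q / 2).
  by rewrite /Q; clearbody EE; move: (cabs Y ^+ m) (phc R m) => u v; field.
have -> : (2 * D + 4 * phc R m * B) * k%:R * errlog k * (cabs Y * cabs Y ^+ m) * EE =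
  (2 * D + 4 * phc R m * B) * (Q * cabs Y).
  by rewrite /Q; clearbody EE; move: (cabs Y ^+ m) (phc R m) => u v; ring.
apply: ler_wpM2l; last by apply: ler_wpM2l.
by apply: addr_ge0; [exact: mulr_ge0|apply: mulr_ge0 B0; exact: mulr_ge0].
Qed.

(** The segment avoids the poles, so the shift enters smoothly: the derivative in [e] is [iC] times
    the next [Kd], bounded uniformly, and the convergence has rate [e]. *)
Lemma main_cvg p Y k g : (0 < k)%N -> (forall n, cabs (g n) <= 1) -> 2^-1 <= Re Y ->
  ccvg (fun N => integ (- beta) beta (fun z => phi Y 0 z * Kd k g p N.+1%:R^-1 z))
    (integ (- beta) beta (fun z => phi Y 0 z * Kd k g p 0 z)).
Proof.
move=> k0 g1 hY; have [B B0 HB] := Kd_bound p.+1; have b0 := ltW (beta_gt0 R).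
have bb : - beta <= beta by rewrite ge0_cp.
have el := errlog_ge0 R k0.
have IN x : - beta <= x <= beta -> `|x| <= beta by rewrite ler_norml.
have cI (e : R) : segc (- beta) beta (fun z => phi Y 0 z * Kd k g p e z).
  by apply: segcM; [exact: segc_phi|exact: segc_Kd].
pose M := B * k%:R * errlog k; have M0 : 0 <= M by rewrite mulr_ge0// mulr_ge0.
apply: (@ccvg_le _ _ _ (fun N => N.+1%:R^-1) (M * (beta - - beta) + 1)).
- by rewrite ltr_wpDl// mulr_ge0// subr_ge0.
- exact: invn_cvg0.
move=> N; set e := N.+1%:R^-1; have e0 : 0 <= e by rewrite invr_ge0.
rewrite -(@cintB R _ _ (fun z => phi Y 0 z * Kd k g p e z) (fun z => phi Y 0 z * Kd k g p 0 z))//.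
have cF : segc (- beta) beta (fun z => phi Y 0 z * Kd k g p e z - phi Y 0 z * Kd k g p 0 z).
  by apply: segcD => //; move=> x hx; apply: ccontN; exact: cI.
apply: le_trans (@cint_bound R _ _ _ (M * e) bb cF _) _; last first.
  by rewrite mulrAC; apply: ler_wpM2r => //; rewrite lerDl.
move=> x hx; rewrite -mulrBr -[leRHS]mul1r; apply: cabsM_le.
  rewrite /phi /= hornerC mul1r cabs_gE expR_le1 oppr_le0 mulr_ge0 ?sqr_ge0// mulr_ge0 ?pi_ge0//.
  by apply: le_trans hY; rewrite invr_ge0.
have D q (t : R) : cdiff (fun w => Kd k g q 0 (x%:C + iC * w)) t%:C (Kd k g q.+1 t x%:C * iC).
  have E : iC * t%:C + (x%:C - iC * t%:C) = x%:C :> C by rewrite addrC subrK.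
  have := cdiff_Kd g q t k0 (IN x hx); rewrite -[in cdiff _ _ _]E => h.
  have := cdiff_comp (cdiff_lin iC (x%:C - iC * t%:C) t%:C) h; rewrite E; congr cdiff.
  by apply/funext => w; rewrite Kd_trans; congr (Kd _ _ _ _ _); ring.
have := @mvt_bound R 0 e (fun w => Kd k g p 0 (x%:C + iC * w)) (fun w => Kd k g p.+1 0 (x%:C + iC * w) * iC) M e0.
rewrite rmorph0 mulr0 addr0 -Kd_trans subr0; apply.
- by move=> t _; rewrite -Kd_trans; exact: D.
- by move=> t _; apply: ccontM (ccont_cst _ _); exact: cdiff_ccont (D p.+1 t).
- by move=> t _; rewrite -Kd_trans cabsM cabs_iC mulr1; apply: HB => //; exact: IN.
Qed.

End MainSegment.

(** * Asymptotics of the partial theta coefficients *)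

Section Asymptotics.
Variable R : realType.
Local Notation C := R[i].
Implicit Types (Y z w b : C) (k : nat) (e x s y : R) (g : int -> C).
Local Notation beta := (@beta R).
Local Notation errlog := (@errlog R).

Lemma gauss_exponent (t : R) Y : Y != 0 ->
  (iC * t%:C) ^+ 2 / (4 * ((pi : R)%:C * Y)) = (- (t ^+ 2 / (4 * pi)))%:C * Y^-1.
Proof.
move=> y0; have pc : ((pi : R)%:C : C) != 0 by rewrite -cabs_gt0 cabs_real gtr0_norm ?pi_gt0.
rewrite exprMn (expr2 iC) iC_sqr rmorphN rmorphM rmorphXn fmorphV rmorphM /= rmorph_nat.
by move: (pi%:C) pc t%:C => q q0 u; field; rewrite q0 y0.
Qed.

(** Here the domination comes from the Gaussian factor alone, thanks to [Re Y^-1 > 0], and is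
    uniform in the shift. *)
Lemma Seps_cvg p Y k g : (0 < k)%N -> (forall n, cabs (g n) <= 1) -> 2^-1 <= Re Y ->
  ccvg (fun N => cser (Seps Y p k g N.+1%:R^-1)) (cser (Seps Y p k g 0)).
Proof.
move=> k0 g1 hY; have kR := natR_gt0 R k0.
have rY : 0 < Re Y by apply: lt_le_trans hY; rewrite invr_gt0.
have rV := Re_inv_gt0 rY; set c := pi * Re Y^-1 / k%:R ^+ 2.
have c0 : 0 < c by rewrite divr_gt0 ?exprn_gt0// mulr_gt0 ?pi_gt0.
pose M (n : nat) : R := k%:R * ((2 * pi / k%:R) ^+ p * (n.+1%:R ^+ p * expR (0 * n%:R - c * n%:R ^+ 2))).
have sM : rsummable M.
  apply: rsummableZ; first exact: ltW.
  apply: rsummableZ; last exact: gauss_summable.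
  by rewrite exprn_ge0// divr_ge0// mulr_ge0// pi_ge0.
apply: (tannery (M := M)) => // [N n|n].
  have e0 : 0 <= N.+1%:R^-1 :> R by rewrite invr_ge0.
  have t0 : 0 <= tn R k n by apply: le_trans (tn_ge R n k0); rewrite divr_ge0 ?mulr_ge0.
  have a1 : cabs (av k g n * cexp (iC * (tn R k n)%:C * (iC * (N.+1%:R^-1)%:C))) <= k%:R * 1.
    apply: cabsM_le; first exact: av_bound.
    by rewrite cabs_ee expR_le1 oppr_le0 mulr_ge0.
  rewrite mulr1 in a1; rewrite /Seps /M [X in _ <= _ * X]mulrA; apply: cabsM_le => //; apply: cabsM_le.
    rewrite cabsX cabsM cabs_iC mul1r cabs_real ger0_norm//.
    rewrite -exprMn lerXn2r ?nnegrE ?mulr_ge0 ?divr_ge0 ?mulr_ge0 ?pi_ge0//.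
    rewrite /tn mulrAC ler_wpM2l ?divr_ge0 ?mulr_ge0 ?pi_ge0// -(natr1 n) lerD2l.
    by rewrite invf_le1// ler1n.
  rewrite cabs_cexp ler_expR mul0r add0r.
  have y0 := Re_gt0_neq0 rY.
  rewrite (gauss_exponent (tn R k n) y0).
  rewrite Re_realM mulNr lerN2 /c.
  have -> : pi * Re Y^-1 / k%:R ^+ 2 * n%:R ^+ 2 = pi * (n%:R / k%:R) ^+ 2 * Re Y^-1.
    by move: (Re _) (pi : R) => u q; field; rewrite gt_eqF.
  rewrite ler_wpM2r ?(ltW rV)//.
  have -> : tn R k n ^+ 2 / (4 * pi) = pi * ((n%:R + 2^-1) / k%:R) ^+ 2.
    by rewrite /tn; have := pi_gt0 R; move: (pi : R) => q q0; field; rewrite !gt_eqF.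
  rewrite ler_wpM2l ?pi_ge0// lerXn2r ?nnegrE ?divr_ge0 ?addr_ge0 ?invr_ge0//.
  by rewrite ler_wpM2r ?invr_ge0 ?(ltW kR)// lerDl invr_ge0.
have cv : ccvg (fun N : nat => (N.+1%:R^-1)%:C) (0 : C).
  apply: (@ccvg_le _ _ _ (fun N => N.+1%:R^-1) 1) => //; first exact: invn_cvg0.
  by move=> N; rewrite subr0 cabs_real ger0_norm ?mul1r// invr_ge0.
have cc : ccont (fun w => av k g n * cexp (iC * (tn R k n)%:C * (iC * w)) *
  ((iC * (tn R k n)%:C) ^+ p * cexp ((iC * (tn R k n)%:C) ^+ 2 / (4 * ((pi : R)%:C * Y))))) 0.
  apply: ccontM (ccont_cst _ _); apply: ccontM; first exact: ccont_cst.
  have := cdiff_ccont (cdiff_cexpZ (iC * (tn R k n)%:C * iC) 0); congr ccont.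
  by apply/funext => w; rewrite mulrA.
exact: ccvg_cont cc cv.
Qed.

Lemma three_terms_le (q i I1 I2 I3 I4 : C) (t d : R) : cabs i <= 1 -> cabs I1 <= t -> cabs I3 <= t ->
  cabs (I2 - I4) <= d -> cabs (q * (i * (- I1 + I3 + (I2 - I4)))) <= cabs q * (2 * t + d).
Proof.
move=> hi h1 h3 hd; rewrite cabsM; apply: ler_wpM2l; first exact: cabs_ge0.
rewrite cabsM; apply: le_trans (ler_piMl (cabs_ge0 _) hi) _; apply: le_trans (cabsD _ _) _.
by apply: lerD => //; apply: le_trans (cabsD _ _) _; rewrite cabsN mulrDl mul1r lerD.
Qed.

(** For [0 < e <= 1] the line splits into two tails and the segment, with bounds that do not involve
    [e]; then [e = 1 / (N + 1)] tends to 0 in the series and in the main integral. *)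
Lemma false_theta_asymp p : ~~ odd p -> exists2 D : R, 0 <= D & forall Y k g, (0 < k)%N ->
  (forall n, g (n + k%:Z) = - g n) -> (forall n, cabs (g n) <= 1) -> 2^-1 <= Re Y ->
  cabs (cser (Seps Y p k g 0) - csq Y * (iC / 4 * integ (- beta) beta (fun z => phi Y 0 z * Kd k g p 0 z)))
  <= D * (cabs (csq Y) * (k%:R * errlog k * cabs Y ^+ p * expR (- (pi * Re Y / 6)))).
Proof.
move=> pe; have [T T0 HT] := right_tail_unif R p; have [D D0 HD] := seg_parts R p 0.
exists (2 * T + D) => [|Y k g k0 ganti g1 hY]; first by rewrite addr_ge0// mulr_ge0.
have b0 := ltW (beta_gt0 R); have bb : - beta <= beta by rewrite ge0_cp.
have bt : beta <= 1 by apply: ltW; apply: lt_trans (beta_lt R) _; rewrite ltr_pdivrMr// mul1r ltr_nat.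
have gper n : g (n + (2 * k)%N%:Z) = g n.
  by rewrite mul2n -addnn PoszD addrA !ganti opprK.
set EE := expR _ in HT HD *.
have q4 : cabs (iC / 4 : C) <= 1.
  by rewrite cabsM cabs_iC cabsV cabs_nat mul1r invf_le1// ler1n.
have fin (e : R) : 0 < e -> e <= 1 ->
   cabs (cser (Seps Y p k g e) - csq Y * (iC / 4 * integ (- beta) beta (fun z => phi Y 0 z * Kd k g p e z)))
   <= (2 * T + D) * (cabs (csq Y) * (k%:R * errlog k * cabs Y ^+ p * expR (- (pi * Re Y / 6)))).
  move=> e0 e1; have en : e != 0 by rewrite gt_eqF.
  have cv := ccvgB (false_theta_int k0 e0 pe hY ganti g1)
     (ccvg_cst (csq Y * (iC / 4 * integ (- beta) beta (fun z => phi Y 0 z * Kd k g p e z)))).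
  apply: ccvg_bound cv; exists 0%N => J _.
  have cI (a b e' : R) g' : e' != 0 -> segc a b (fun z => phi Y p z * Kt k g' e' z).
    by move=> e'0; apply: segcM; [exact: segc_phi|exact: segc_Kt].
  have J1 : beta <= J.+1%:R by apply: le_trans bt _; rewrite ler1n.
  have J2 : - J.+1%:R <= - beta by rewrite lerN2.
  have -> : integ (- J.+1%:R) J.+1%:R (fun z => phi Y p z * (iC / 4 * Kt k g e z)) =
     iC / 4 * integ (- J.+1%:R) J.+1%:R (fun z => phi Y p z * Kt k g e z).
    rewrite -(@cintZ R _ _ (iC / 4) (fun z => phi Y p z * Kt k g e z)); last exact: cI.
    by apply: eq_cint => x _; rewrite mulrCA.
  rewrite (@cint_cat R _ _ _ (fun z => phi Y p z * Kt k g e z) J2 (le_trans bb J1) (cI _ _ _ _ en)).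
  rewrite (@cint_cat R _ _ _ (fun z => phi Y p z * Kt k g e z) bb J1 (cI _ _ _ _ en)).
  rewrite left_tail_refl//.
  have eN : - e != 0 by rewrite oppr_eq0.
  have e1' : `|e| <= 1 by rewrite gtr0_norm.
  have eN1 : `|- e| <= 1 by rewrite normrN.
  have gN n : (fun n => g (- n - 1)) (n + (2 * k)%N%:Z) = (fun n => g (- n - 1)) n.
    by rewrite /= -[LHS]gper; congr g; ring.
  have L := HT Y k (fun n => g (- n - 1)) (- e) J k0 gN (fun n => g1 _) eN eN1 hY.
  have Rr := HT Y k g e J k0 gper g1 en e1' hY.
  have Md := HD Y k g e k0 g1 hY.
  rewrite -signr_odd (negPf pe) mul1r add0n in Md.
  have E0 : integ (- beta) beta (fun z => phi Y p z * Kd k g 0 e z) = integ (- beta) beta (fun z => phi Y p z * Kt k g e z).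
    by apply: eq_cint => x _; rewrite Kd0.
  rewrite E0 in Md.
  move: (cint _ _ _) (cint _ _ _) (cint _ _ _) (cint _ _ _) L Rr Md => I4 I2 I3 I1 L Rr Md.
  have -> : csq Y * (iC / 4 * (- I1 + (I2 + I3))) - csq Y * (iC / 4 * I4) =
     csq Y * (iC / 4 * (- I1 + I3 + (I2 - I4))).
    by move: (csq Y) (iC / 4) => a b; ring.
  apply: le_trans (three_terms_le _ q4 L Rr Md) _; rewrite -/EE.
  apply: eq_ler; move: (cabs (csq Y)) (cabs Y ^+ p) (EE) => q u v; ring.
have cv := ccvgB (Seps_cvg p k0 g1 hY) (ccvgZ (csq Y) (ccvgZ (iC / 4) (main_cvg p k0 g1 hY))).
apply: ccvg_bound cv; exists 0%N => N _; apply: fin; first by rewrite invr_gt0.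
by rewrite invf_le1// ler1n.
Qed.

End Asymptotics.

(** * Towers for exponential series and for the triple product *)

Section Towers.
Variable R : realType.
Local Notation C := R[i].
Implicit Types (z w q : C) (dl : R).

Lemma cabs_cexp_le (b z : C) dl : cabs z <= dl -> cabs (cexp (b * z)) <= expR (cabs b * dl).
Proof.
move=> hz; rewrite cabs_cexp ler_expR.
apply: le_trans (le_trans (ler_norm _) (ge_Re_cabs _)) _.
by rewrite cabsM ler_wpM2l ?cabs_ge0.
Qed.

Lemma exp_series_tower (a b : nat -> C) dl :
  (forall p : nat, rsummable (fun n => cabs (a n) * cabs (b n) ^+ p * expR (cabs (b n) * dl))) ->
  tower dl (fun p z => cser (fun n => a n * b n ^+ p * cexp (b n * z))).
Proof.
move=> hs p z hz; have d0 : 0 < dl - cabs z by rewrite subr_gt0.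
have ball w : cabs (w - z) < dl - cabs z -> cabs w <= dl.
  by move=> h; have := ler_cabsB w z; lra.
have bd r n w : cabs w <= dl ->
    cabs (a n * b n ^+ r * cexp (b n * w)) <= cabs (a n) * cabs (b n) ^+ r * expR (cabs (b n) * dl).
  by move=> hw; apply: cabsM_le (cabs_cexp_le _ hw); rewrite cabsM cabsX.
have D r n w : cdiff (fun w => a n * b n ^+ r * cexp (b n * w)) w (a n * b n ^+ r.+1 * cexp (b n * w)).
  have := cdiffZ (a n * b n ^+ r) (cdiff_cexpZ (b n) w); congr cdiff.
  by rewrite exprSr; move: (cexp _) => e; ring.
apply: (@cdiff_cser _ (fun n w => a n * b n ^+ p * cexp (b n * w)) (fun n w => a n * b n ^+ p.+1 * cexp (b n * w))
   (fun n w => a n * b n ^+ p.+2 * cexp (b n * w)) _ z _ d0 _ _ _ _ (hs p.+2)).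
- by move=> n w _; exact: D.
- by move=> n w _; exact: D.
- by move=> n w _; exact: cdiff_ccont (D _ _ _).
- by move=> n w hw; apply: bd; exact: ball.
- by move=> w hw; apply: csummable_le (hs p) => n; apply: bd; exact: ball.
- by apply: csummable_le (hs p.+1) => n; apply: bd; exact: ltW.
Qed.

(** The [p]-th derivative in [z] of the Dirichlet kernel [dker (e2pi z) n]. *)
Definition Dk (p n : nat) z : C := (p == 0%N)%:R + \sum_(i < n)
  ((2 * ipi * i.+1%:R) ^+ p * cexp (2 * ipi * i.+1%:R * z)
   + (- (2 * ipi * i.+1%:R)) ^+ p * cexp (- (2 * ipi * i.+1%:R) * z)).

Lemma Dk0 n z : Dk 0 n z = dker (e2pi z) n.
Proof.
rewrite /Dk /dker eqxx; congr (_ + _); apply: eq_bigr => i _; rewrite !expr0 !mul1r.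
rewrite -e2piN -!e2piX /e2pi; congr (cexp _ + cexp _); ring.
Qed.

Lemma cdiff_Dk p n z : cdiff (Dk p n) z (Dk p.+1 n z).
Proof.
apply: cdiffD; first by exact: cdiff_cst.
apply: cdiff_sum => i; rewrite !exprSr.
have E (b : C) : cdiff (fun w => b ^+ p * cexp (b * w)) z (b ^+ p * b * cexp (b * z)).
  by have := cdiffZ (b ^+ p) (cdiff_cexpZ b z); congr cdiff; move: (cexp _) => e; ring.
by apply: cdiffD; exact: E.
Qed.

Lemma Dk_bound p n z (M : R) : expR (2 * pi * cabs z) <= M ->
  cabs (Dk p n z) <= 2 * n.+1%:R * ((2 * pi * n.+1%:R) ^+ p * M ^+ n).
Proof.
move=> hM; have M1 : 1 <= M.
  by apply: le_trans hM; rewrite -[leLHS]expR0 ler_expR !mulr_ge0 ?pi_ge0 ?cabs_ge0.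
have n1 : (1 : R) <= n.+1%:R by rewrite ler1n.
have pn : 1 <= 2 * pi * n.+1%:R :> R by have := pi_ge2 R; nra.
set X := (2 * pi * n.+1%:R) ^+ p * M ^+ n.
have X1 : 1 <= X by rewrite -[leLHS]mulr1 ler_pM ?exprn_ege1.
have T (e : bool) (i : 'I_n) : cabs ((if e then 2 * ipi * i.+1%:R else - (2 * ipi * i.+1%:R)) ^+ p *
   cexp ((if e then 2 * ipi * i.+1%:R else - (2 * ipi * i.+1%:R)) * z)) <= X.
  have cb : cabs (if e then 2 * ipi * i.+1%:R else - (2 * ipi * i.+1%:R) : C) = 2 * pi * i.+1%:R.
    by case: e; rewrite ?cabsN 2!cabsM cabsM cabs_iC !cabs_nat cabs_real ger0_norm ?pi_ge0// mul1r.
  have i1 : i.+1%:R <= n.+1%:R :> R by rewrite ler_nat ltnS ltnW.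
  apply: cabsM_le.
    rewrite cabsX cb lerXn2r ?nnegrE ?mulr_ge0 ?pi_ge0// ler_wpM2l// mulr_ge0 ?pi_ge0//.
  apply: le_trans (cabs_cexp_le _ (lexx _)) _; rewrite cb.
  have -> : 2 * pi * i.+1%:R * cabs z = i.+1%:R * (2 * pi * cabs z) by ring.
  rewrite expRM_natl; apply: (@le_trans _ _ (M ^+ i.+1)).
    by rewrite lerXn2r ?nnegrE ?expR_ge0// (le_trans _ M1).
  by rewrite ler_weXn2l.
rewrite /Dk; apply: le_trans (cabsD _ _) _.
have b0 : cabs ((p == 0%N)%:R : C) <= 2 * X.
  by rewrite cabs_nat; apply: (@le_trans _ _ 1); [case: (p == _); rewrite ?ler01|lra].
apply: le_trans (lerD b0 (cabs_sum _ _ _)) _.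
apply: (@le_trans _ _ (2 * X + \sum_(i < n) 2 * X)).
  rewrite lerD2l; apply: ler_sum => i _; apply: le_trans (cabsD _ _) _.
  by have := lerD (T true i) (T false i); rewrite -[X + X]mulr2n -[X *+ 2]mulr_natl.
rewrite sumr_const card_ord -[_ *+ n]mulr_natl -(natr1 n) le_eqVlt; apply/orP; left; apply/eqP; ring.
Qed.

Lemma binomial2_ge n : (n * n <= 2 * 'C(n.+1, 2))%N.
Proof. by have := bin_ffact n.+1 2; rewrite !ffactnS ffactn0 (_ : 2`! = 2)%N //= => hb; nia. Qed.

(** The [p]-th derivative of the triple product without its factor vanishing at [z = 0], as a
    q-series that is regular there. *)
Definition Bq q p z : C := cser (fun n => (-1) ^+ n * q ^+ 'C(n.+1, 2) * Dk p n z).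

Lemma Bq_summable q (M : R) p : cabs q < 1 -> 0 <= M ->
  rsummable (fun n => cabs q ^+ 'C(n.+1, 2) * (2 * n.+1%:R * ((2 * pi * n.+1%:R) ^+ p * M ^+ n))).
Proof.
move=> q1 M0; pose r := Num.sqrt (cabs q).
have r0 : 0 <= r := sqrtr_ge0 _.
have r1 : r < 1 by rewrite -sqrtr1 ltr_sqrt.
have sr : r ^+ 2 = cabs q by rewrite sqr_sqrtr ?cabs_ge0.
have c0 : 0 <= 2 * (2 * pi) ^+ p :> R by rewrite mulr_ge0// exprn_ge0// mulr_ge0// pi_ge0.
apply: rsummable_le (rsummableZ c0 (quad_summable p.+1 r0 r1 M0)) => n.
have h : cabs q ^+ 'C(n.+1, 2) <= r ^+ (n * n).
  rewrite -sr -exprM; apply: ler_wiXn2l => //; [exact: ltW|exact: binomial2_ge].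
apply: le_trans (ler_wpM2r _ h) _.
  by rewrite !mulr_ge0 ?exprn_ge0 ?mulr_ge0 ?pi_ge0.
apply: eq_ler; rewrite exprMn exprS.
by move: (r ^+ _) (M ^+ n) (_ ^+ p) (_ ^+ p) => x y u v; ring.
Qed.

Lemma tower_Bq q : cabs q < 1 -> tower 1 (Bq q).
Proof.
move=> q1 p z hz; have d0 : 0 < 1 - cabs z by rewrite subr_gt0.
pose M := expR (2 * pi : R); have M0 : 0 <= M := expR_ge0 _.
have bd r n w : cabs w <= 1 -> cabs ((-1) ^+ n * q ^+ 'C(n.+1, 2) * Dk r n w) <=
    cabs q ^+ 'C(n.+1, 2) * (2 * n.+1%:R * ((2 * pi * n.+1%:R) ^+ r * M ^+ n)).
  move=> hw; apply: cabsM_le.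
    by rewrite cabsM !cabsX cabsN cabs1 expr1n mul1r.
  by apply: Dk_bound; rewrite ler_expR ler_piMr// mulr_ge0 ?pi_ge0.
have ball w : cabs (w - z) < 1 - cabs z -> cabs w <= 1.
  by move=> h; have := ler_cabsB w z; lra.
have D r n w : cdiff (fun w => (-1) ^+ n * q ^+ 'C(n.+1, 2) * Dk r n w) w ((-1) ^+ n * q ^+ 'C(n.+1, 2) * Dk r.+1 n w).
  by apply: cdiffZ; exact: cdiff_Dk.
apply: (@cdiff_cser _ (fun n w => (-1) ^+ n * q ^+ 'C(n.+1, 2) * Dk p n w)
   (fun n w => (-1) ^+ n * q ^+ 'C(n.+1, 2) * Dk p.+1 n w)
   (fun n w => (-1) ^+ n * q ^+ 'C(n.+1, 2) * Dk p.+2 n w) _ z _ d0 _ _ _ _ (Bq_summable p.+2 q1 M0)).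
- by move=> n w _; exact: D.
- by move=> n w _; exact: D.
- by move=> n w _; exact: cdiff_ccont (D _ _ _).
- by move=> n w hw; apply: bd; exact: ball.
- by move=> w hw; apply: csummable_le (Bq_summable p q1 M0) => n; apply: bd; exact: ball.
- by apply: csummable_le (Bq_summable p.+1 q1 M0) => n; apply: bd; exact: ltW.
Qed.

Lemma Bq0E q z : q != 0 -> cabs q < 1 ->
  Bq q 0 z = qpoch q q * (qpoch (e2pi z * q) q * qpoch ((e2pi z)^-1 * q) q).
Proof.
move=> q0 q1; rewrite (jacobi_triple q1 (e2pi_neq0 z) q0); apply: eq_cser => n.
by rewrite Dk0.
Qed.

Lemma Bq_odd q p : odd p -> Bq q p 0 = 0.
Proof.
move=> op; rewrite /Bq (@eq_cser _ _ (fun=> 0)) => [|n]; first by rewrite (@cser_fin _ _ 0)// big_ord0.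
rewrite /Dk; case: p op => // p op; rewrite add0r big1 ?mulr0// => i _.
by rewrite !mulr0 !cexp0 !mulr1 exprNn -signr_odd op expr1 mulN1r subrr.
Qed.

(* Away from the constant term of B_0 only the terms n >= 1 contribute, and they carry a factor q. *)
Lemma Bq_bound p : exists2 D : R, 0 <= D & forall q, cabs q <= 5^-1 ->
  cabs (Bq q p 0 - (p == 0%N)%:R) <= D * cabs q.
Proof.
have r0 : 0 <= 5^-1 :> R by [].
have r1 : 5^-1 < 1 :> R by rewrite invf_lt1// ltr1n.
have [S HS] := natX_geom_summable p.+1 r0 r1.
have S0 : 0 <= S by have := HS 0%N; rewrite big_ord0.
have c0 : 0 <= 2 * (2 * pi) ^+ p :> R by rewrite mulr_ge0// exprn_ge0// mulr_ge0// pi_ge0.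
exists (2 * (2 * pi) ^+ p * (2 ^+ p.+1 * S)); first by rewrite !mulr_ge0 ?exprn_ge0 ?mulr_ge0 ?pi_ge0.
move=> q hq; have q1 : cabs q < 1 := le_lt_trans hq r1.
have su : csummable (fun n => (-1) ^+ n * q ^+ 'C(n.+1, 2) * Dk p n 0).
  apply: csummable_le (Bq_summable p q1 (ler01 : 0 <= 1 :> R)) => n; apply: cabsM_le.
    by rewrite cabsM !cabsX cabsN cabs1 expr1n mul1r.
  by apply: Dk_bound; rewrite cabs0 mulr0 expR0.
have E0 : (-1) ^+ 0 * q ^+ 'C(1, 2) * Dk p 0 0 = (p == 0%N)%:R.
  by rewrite /Dk big_ord0 addr0 bin_small// !expr0 !mul1r.
rewrite /Bq (cser_recl su) E0 addrAC subrr add0r.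
pose M (n : nat) : R := cabs q * (2 * (2 * pi) ^+ p * (2 ^+ p.+1 * (n.+1%:R ^+ p.+1 * 5^-1 ^+ n))).
have hM n : cabs ((-1) ^+ n.+1 * q ^+ 'C(n.+2, 2) * Dk p n.+1 0) <= M n.
  have hD : cabs (Dk p n.+1 0) <= 2 * n.+2%:R * ((2 * pi * n.+2%:R) ^+ p * 1 ^+ n.+1).
    by apply: Dk_bound; rewrite cabs0 mulr0 expR0.
  have hq2 : cabs ((-1) ^+ n.+1 * q ^+ 'C(n.+2, 2)) <= cabs q * 5^-1 ^+ n.
    rewrite cabsM !cabsX cabsN cabs1 expr1n mul1r.
    apply: (@le_trans _ _ (cabs q ^+ n.+1)).
      rewrite ler_wiXn2l ?cabs_ge0 ?(ltW q1)//.
      by have := binomial2_ge n.+1; nia.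
    by rewrite exprS ler_wpM2l ?cabs_ge0// lerXn2r ?nnegrE ?cabs_ge0.
  apply: le_trans (cabsM_le hq2 hD) _; rewrite expr1n mulr1 /M.
  have h2 : n.+2%:R ^+ p.+1 <= 2 ^+ p.+1 * n.+1%:R ^+ p.+1 :> R.
    by rewrite -exprMn lerXn2r ?nnegrE ?mulr_ge0// -natrM ler_nat; lia.
  have -> : cabs q * 5^-1 ^+ n * (2 * n.+2%:R * (2 * pi * n.+2%:R) ^+ p) =
     cabs q * (2 * (2 * pi) ^+ p * (n.+2%:R ^+ p.+1 * 5^-1 ^+ n)) :> R.
    by rewrite [(2 * pi * _) ^+ p]exprMn exprS; move: (_ ^+ p) (_ ^+ p) (_ ^+ n) => u v w; ring.
  rewrite ler_wpM2l ?cabs_ge0// ler_wpM2l// mulrA ler_wpM2r ?exprn_ge0//.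
have bM N : \sum_(n < N) M n <= cabs q * (2 * (2 * pi) ^+ p * (2 ^+ p.+1 * S)).
  by rewrite -!mulr_sumr !ler_wpM2l ?exprn_ge0 ?cabs_ge0.
have su1 : csummable (fun n => (-1) ^+ n.+1 * q ^+ 'C(n.+2, 2) * Dk p n.+1 0).
  by apply: (csummable_le hM); exists (cabs q * (2 * (2 * pi) ^+ p * (2 ^+ p.+1 * S))).
rewrite [leRHS]mulrC; apply: cser_le su1 _ => N; apply: le_trans (bM N).
by apply: ler_sum => n _; exact: hM.
Qed.

Lemma qpoch_sub1 q : cabs q <= 5^-1 -> cabs (qpoch q q - 1) <= 2 * cabs q /\ 2^-1 <= cabs (qpoch q q).
Proof.
move=> hq; have q0 := cabs_ge0 q; have q1 : cabs q < 1 by apply: le_lt_trans hq _; rewrite invf_lt1// ltr1n.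
have r0 : 0 < 1 - cabs q by rewrite subr_gt0.
have gs n : \sum_(j < n) cabs q ^+ j.+1 <= 5 / 4 * cabs q.
  have -> : \sum_(j < n) cabs q ^+ j.+1 = cabs q * \sum_(j < n) cabs q ^+ j.
    by rewrite mulr_sumr; apply: eq_bigr => j _; rewrite exprS.
  have := subrX1 (cabs q) n; have := exprn_ge0 n q0.
  move: (\sum_(j < n) _) (cabs q ^+ n) => S x x0; move: (cabs q) hq q0 r0 => r hr r00 r1 E; nra.
have pr n : cabs (\prod_(j < n) (1 - q * q ^+ j) - 1) <= \prod_(j < n) (1 + cabs q ^+ j.+1) - 1.
  elim: n => [|n IH]; first by rewrite !big_ord0 !subrr cabs0.
  rewrite !big_ord_recr /=; move: (\prod_(j < n) _) (\prod_(j < n) _) IH => Q P IH.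
  have -> : P * (1 - q * q ^+ n) - 1 = (P - 1) * (1 - q * q ^+ n) - q * q ^+ n by ring.
  have cq : cabs (q * q ^+ n) = cabs q ^+ n.+1 by rewrite -exprS cabsX.
  apply: le_trans (cabsD _ _) _; rewrite cabsN cq.
  have h1 : cabs (1 - q * q ^+ n) <= 1 + cabs q ^+ n.+1.
    by apply: le_trans (cabsD _ _) _; rewrite cabsN cq cabs1.
  have := cabsM_le IH h1; move: (cabs q ^+ _) => x; nra.
have bd n : cabs (\prod_(j < n) (1 - q * q ^+ j) - 1) <= 5 / 3 * cabs q.
  apply: le_trans (pr n) _; have := prod_1D_le n (fun j => exprn_ge0 j.+1 q0).
  set P := \prod_(j < n) _; set S := \sum_(j < n) _ => hP; have hS := gs n; rewrite -/S in hS.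
  have S0 : 0 <= S by apply: sumr_ge0 => j _; rewrite exprn_ge0.
  have hE : expR S <= (1 - S)^-1.
    have S4 : S <= 1 / 4 by move: hS hq; clear; lra.
    have h := expR_ge1Dx (- S); rewrite -[S]opprK expRN lef_pV2 ?posrE ?expR_gt0 ?opprK//; move: S4; clear; lra.
  have S4 : S <= 1 / 4 by move: hS hq; clear; lra.
  have : (1 - S)^-1 <= 1 + 4 / 3 * S.
    by rewrite -div1r ler_pdivrMr; [nra|move: S4; clear; lra].
  move: hS hE hP; clear; lra.
have cv := ccvgB (qpoch_cvg q1 q) (ccvg_cst 1).
have L : cabs (qpoch q q - 1) <= 5 / 3 * cabs q by apply: ccvg_bound cv; exists 0%N => n _; exact: bd.
split; first by move: L q0; clear; lra.
have := ler_cabsB 1 (1 - qpoch q q); have -> : 1 - (1 - qpoch q q) = qpoch q q by ring.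
by rewrite cabs1 (cabsB 1 (qpoch q q)); move: L hq; clear; lra.
Qed.

End Towers.

(** * The relation for [U1] near [z = 0] *)

Section Relation.
Variable R : realType.
Local Notation C := R[i].
Implicit Types (z w q Z : C) (dl : R).

(** The partial theta function at [2 z] has terms [fta n * cexp (ftb n * z)]; its nome is split into
    the rational phase [gf] and a Gaussian in [W = k / Z]. *)
Definition fta k h W (n : nat) : C := gf R k h n%:Z * cexp (- ((pi : R)%:C / W) * (halfint R n%:Z)%:C ^+ 2).
Definition ftb (n : nat) : C := 4 * ipi * (halfint R n%:Z)%:C.
Definition FT k h W p z : C := cser (fun n => fta k h W n * ftb n ^+ p * cexp (ftb n * z)).

Lemma cabs_gf k h (n : int) : cabs (gf R k h n) = 1.
Proof.
rewrite /gf cabs_cexp.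
have -> : ipi * n%:~R + ipi * (h%:R / k%:R) * (halfint R n)%:C ^+ 2 =
   ipi * (n%:~R + (h%:R / k%:R) * halfint R n ^+ 2)%:C :> C.
  have -> : (n%:~R + (h%:R / k%:R) * halfint R n ^+ 2)%:C = n%:~R + (h%:R / k%:R) * (halfint R n)%:C ^+ 2 :> C.
    by move: (halfint R n) => a; rewrite rmorphD rmorph_int !rmorphM fmorphV /= !rmorph_nat.
  by move: (halfint R n)%:C (h%:R / k%:R : C) => a b; ring.
by rewrite Re_ipi /= mulr0 expR0.
Qed.

Lemma halfint_nat (n : nat) : halfint R n%:Z = n%:R + 2^-1.
Proof. by rewrite /halfint -pmulrn. Qed.

Lemma fta_summable k h W p dl : 0 < Re W -> 0 <= dl ->
  rsummable (fun n => cabs (fta k h W n) * cabs (ftb n) ^+ p * expR (cabs (ftb n) * dl)).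
Proof.
move=> rW dl0; have rV := Re_inv_gt0 rW; set c := pi * Re W^-1.
have c0 : 0 < c by rewrite mulr_gt0 ?pi_gt0.
have p0 := pi_ge0 R; pose K : R := (4 * pi) ^+ p * expR (4 * pi * dl).
have K0 : 0 <= K by rewrite mulr_ge0 ?expR_ge0// exprn_ge0// mulr_ge0.
apply: rsummable_le (rsummableZ K0 (gauss_summable (4 * pi * dl) p c0)) => n.
have a1 : cabs (fta k h W n) <= expR (- (c * n%:R ^+ 2)).
  rewrite cabsM cabs_gf mul1r cabs_cexp ler_expR.
  have -> : - ((pi : R)%:C / W) * (halfint R n)%:C ^+ 2 = (- (pi * halfint R n ^+ 2))%:C * W^-1 :> C.
    by rewrite rmorphN rmorphM rmorphXn /=; ring.
  rewrite Re_realM mulNr lerN2 /c mulrAC ler_wpM2r ?(ltW rV)// ler_wpM2l// halfint_nat.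
  by rewrite lerXn2r ?nnegrE ?addr_ge0 ?invr_ge0// lerDl invr_ge0.
have b1 : cabs (ftb n) <= 4 * pi * n.+1%:R.
  rewrite 3!cabsM cabs_iC cabs_nat !cabs_real ger0_norm// mul1r halfint_nat.
  rewrite ger0_norm ?addr_ge0 ?invr_ge0// ler_wpM2l ?mulr_ge0// -(natr1 n) lerD2l invf_le1 ?ler1n//.
have b2 : cabs (ftb n) ^+ p <= (4 * pi) ^+ p * n.+1%:R ^+ p.
  by rewrite -exprMn lerXn2r ?nnegrE ?cabs_ge0 ?mulr_ge0.
have b3 : expR (cabs (ftb n) * dl) <= expR (4 * pi * dl) * expR (4 * pi * dl * n%:R).
  rewrite -expRD ler_expR; apply: le_trans (ler_wpM2r dl0 b1) _.
  by rewrite -(natr1 n) le_eqVlt; apply/orP; left; apply/eqP; ring.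
have s1 := ler_pM (cabs_ge0 _) (exprn_ge0 p (cabs_ge0 (ftb n))) a1 b2.
have s2 := ler_pM (mulr_ge0 (cabs_ge0 _) (exprn_ge0 p (cabs_ge0 (ftb n)))) (expR_ge0 _) s1 b3.
apply: le_trans s2 _; rewrite expRD expRN /K; move: (expR _) (expR _) (expR _)^-1 (_ ^+ p) (_ ^+ p) => x1 x2 x3 x4 x5.
by apply: eq_ler; ring.
Qed.

Lemma tower_FT k h W dl : 0 < Re W -> 0 <= dl -> tower dl (FT k h W).
Proof. by move=> rW dl0; apply: exp_series_tower => p; exact: fta_summable. Qed.

Lemma sgz_half (n : int) (x : R) : `|x| < 2^-1 -> Num.sg (halfint R n + x) = if (0 <= n) then 1 else -1.
Proof.
move=> /ltr_normlP[x1 x2]; rewrite /halfint; case: n => n /=.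
  rewrite gtr0_sg// -pmulrn; have : (0 : R) <= n%:R by []; move: (n%:R : R) => u; lra.
rewrite ltr0_sg// NegzE mulrNz -pmulrn -(natr1 n); have : (0 : R) <= n%:R by []; move: (n%:R : R) => u; lra.
Qed.

Section Fix.
Variables (k h : nat) (Z : C).
Hypotheses (k0 : (0 < k)%N) (rZ : 0 < Re Z).
Let tau : C := (h%:R + iC * Z) / k%:R.
Let q : C := e2pi tau.
Let W : C := k%:R / Z.

Let kR : (0 : R) < k%:R. Proof. by rewrite ltr0n. Qed.
Let kC : (k%:R : C) != 0. Proof. by rewrite pnatr_eq0 -lt0n. Qed.
Let Z0 : Z != 0. Proof. by apply: contraTneq rZ => ->; rewrite ltxx. Qed.

Lemma Im_tau : Im tau = Re Z / k%:R.
Proof.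
rewrite /tau invnat mulrC cImM /= mul0r addr0 cImD -(rmorph_nat (@real_complex R)) /= add0r cImM /= mul0r add0r mul1r.
by rewrite mulrC.
Qed.

Let rW : 0 < Re W.
Proof. by rewrite /W -(rmorph_nat (@real_complex R)) Re_realM mulr_gt0// Re_inv_gt0. Qed.

Let tau0 : 0 < Im tau. Proof. by rewrite Im_tau divr_gt0. Qed.
Let q1 : cabs q < 1. Proof. exact: cabs_e2pi_lt1. Qed.

(** The hypothesis makes [|Im (2 z) / Im tau| < 1 / 2], less than every [|m|] with [m]
    half-integral. The sign in [psi] is then that of [m]: terms with [m < 0] cancel and those with
    [m > 0] double. *)
Lemma theta_psi_FT z : 4 * `|Im z| < Re Z / k%:R ->
  vartheta (2 * z) tau + psi (2 * z) tau = 2 * iC * FT k h W 0 z.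
Proof.
move=> hz; rewrite /vartheta /psi -mulrDr -mulrA mulrCA; congr (_ * _).
pose A (n : int) := (-1) ^ n * e2pi ((halfint R n ^+ 2 / 2)%:C * tau) * e2pi ((halfint R n)%:C * (2 * z)).
pose sg (n : int) : C := (Num.sg (halfint R n + Im (2 * z) / Im tau))%:C.
have sgE n : sg n = if 0 <= n then 1 else -1.
  rewrite /sg sgz_half; first by case: (0 <= n) => //; rewrite rmorphN.
  rewrite Im_tau normrM normfV [`|_ / _|]gtr0_norm ?divr_gt0// ltr_pdivrMr ?divr_gt0//.
  have -> : Im (2 * z) = 2 * Im z by rewrite cImM /=; ring.
  by rewrite normrM gtr0_norm//; move: hz; lra.
have [s1 s2] := theta_summable (2 * z) tau0.
have E1 : sumZ A = cser (fun n : nat => A n%:Z + A (- n.+1%:Z)) by rewrite sumZE.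
have E2 : sumZ (fun n => sg n * (-1) ^ n * e2pi ((halfint R n ^+ 2 / 2)%:C * tau) * e2pi ((halfint R n)%:C * (2 * z)))
   = cser (fun n : nat => A n%:Z + -1 * A (- n.+1%:Z)).
  rewrite sumZE; apply: eq_cser => n; rewrite !sgE /= mul1r; congr (_ + _).
  by rewrite /A -!mulrA.
rewrite -/A E1 E2 -cserD; last 2 first.
- exact: csummableD.
- by apply: csummableD => //; exact: csummableZ.
rewrite -cserZ.
  apply: eq_cser => n; rewrite mulN1r addrACA subrr addr0 -mulr2n -[A _ *+ 2]mulr_natl; congr (_ * _).
  rewrite /A /fta /ftb /gf expr0 mulr1 signz_ipi /e2pi -!cexpD; congr cexp.
  rewrite /tau /W rmorphM rmorphXn fmorphV rmorph_nat /=.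
  move: ((halfint R n)%:C : C) => m; rewrite /ipi.
  transitivity (iC * (pi : R)%:C * n%:Z%:~R + (iC * (pi : R)%:C * h%:R + (iC * iC) * (pi : R)%:C * Z) / k%:R * m ^+ 2
    + 4 * iC * (pi : R)%:C * m * z); first by field; exact: kC.
  by rewrite iC_sqr; field; rewrite kC Z0.
have s0 := fta_summable k h 0 rW (cabs_ge0 z).
apply: csummable_le s0 => n; apply: cabsM_le (cabs_cexp_le _ (lexx _)).
by rewrite cabsM cabsX.
Qed.

Lemma U1_Bq z : 4 * `|Im z| < Re Z / k%:R -> Bq q 0 z != 0 ->
  U1 z tau * Bq q 0 z = e2pi (- (tau / 12)) * qpoch q q * FT k h W 0 z.
Proof.
move=> hz; rewrite /U1 theta_psi_FT// (Bq0E _ (e2pi_neq0 _) q1) => nz.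
rewrite /Defs.Cstar /Defs.eta -/q.
have := qq_neq0 q1; move: nz; move: (qpoch q q) (qpoch (_ * q) q * _) => a b ab a0.
have b0 : b != 0 by apply: contraNneq ab => ->; rewrite mulr0.
have -> : e2pi (- (tau / 12)) = e2pi (- (tau / 24%:R)) / e2pi (tau / 24%:R).
  by rewrite -e2piN -e2piD; congr e2pi; field.
have := e2pi_neq0 (tau / 24%:R); move: (e2pi _) (e2pi (tau / _)) (FT _ _ _ _ _) => x y F y0.
have i2 := iC_sqr R; move: (iC : C) i2 => i i2.
transitivity (- (i * i) * (x / y * a * F)); first by field; rewrite a0 b0 y0.
by rewrite i2 opprK mul1r.
Qed.

(** [2 i sin (pi z)], the elementary factor through which theta vanishes at 0. *)
Definition sth z : C := cexp (ipi * z) - cexp (- ipi * z).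

Lemma sth_e2pi z : e2pi (z / 2) - e2pi (- (z / 2)) = sth z.
Proof. by rewrite /sth /e2pi; congr (cexp _ - cexp _); field. Qed.

Lemma U1_relation (h' g : nat) (w c : C) z : (k * g = h * h' + 1)%N ->
  eta_rel h%:Z h'%:Z k%:Z w -> c != 0 ->
  (forall n, c * gf R k h n = \sum_(v < k) gf R k h' v%:Z * chn R k n v%:Z) ->
  4 * `|Im z| < Re Z / k%:R -> Bq q 0 z != 0 ->
  let tau' := (h'%:R + iC / Z) / k%:R in let q' := e2pi tau' in
  U1 z tau * (csq k%:R * w * e2pi (tau' / 12)) * (sth (iC / Z * z) * Bq q' 0 (iC / Z * z)) =
  qpoch q' q' * (c * FT k h W 0 z) * (sth z * gE (- W) z).
Proof.
move=> E er c0 hc hz nz tau' q'.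
have rV := Re_inv_gt0 rZ.
have it' : 0 < Im tau'.
  rewrite /tau' invnat mulrC cImM /= mul0r addr0 cImD -(rmorph_nat (@real_complex R)) /= add0r cImM /= mul0r add0r mul1r.
  by rewrite mulr_gt0 ?invr_gt0.
have q1' : cabs q' < 1 := cabs_e2pi_lt1 it'.
have := U1_Bq hz nz; have := theta_transf k0 E c0 hc z rZ.
have -> : iC * z / Z = iC / Z * z by rewrite mulrAC.
have B1 := Bq0E z (e2pi_neq0 tau : q != 0) q1.
have B2 := Bq0E (iC / Z * z) (e2pi_neq0 tau' : q' != 0) q1'.
have T1 : thetaZ z tau = e2pi (tau / 8) * sth z * Bq q 0 z by rewrite B1 -sth_e2pi; exact: theta_product.
have T2 : thetaZ (iC / Z * z) tau' = e2pi (tau' / 8) * sth (iC / Z * z) * Bq q' 0 (iC / Z * z).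
  by rewrite B2 -sth_e2pi; exact: theta_product.
rewrite -/tau -/tau' T1 T2 {B1 B2 T1 T2}.
have kW : csq k%:R = csq W * csq Z.
  by rewrite -(csq_mul rW rZ) /W divfK.
have := er Z rZ; rewrite -!pmulrn -/tau -/tau' /Defs.eta -/q -/q'.
have e1 : e2pi (tau' / 12) = e2pi (tau' / 8) / e2pi (tau' / 24%:R).
  by rewrite -e2piN -e2piD; congr e2pi; field.
have e2 : e2pi (- (tau / 12)) = e2pi (tau / 24%:R) / e2pi (tau / 8).
  by rewrite -e2piN -e2piD; congr e2pi; field.
have g1 : cexp (- (pi%:C * (k%:R / Z)) * z ^+ 2) * gE (- W) z = 1.
  by rewrite /gE -cexpD -[RHS]cexp0; congr cexp; rewrite /W; ring.
rewrite kW e1 e2 -/W.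
have x0 := e2pi_neq0 (tau' / 24%:R); have y0 := e2pi_neq0 (tau / 8).
move: g1 x0 y0; move: (cexp _) (gE _ _) (e2pi (tau' / 24%:R)) (e2pi (tau / 8)) => Em Ep x y g1 x0 y0.
move: (e2pi (tau' / 8)) (e2pi (tau / 24%:R)) (qpoch q q) (qpoch q' q') (sth z) (sth (iC / Z * z)) (Bq q 0 z) (Bq q' 0 _) => x8 y24 a a' s s' B B'.
move: (csq W) (csq Z) (FT _ _ _ _ _) (U1 _ _) => r t F U he ht hu.
have hs : U * (c * (y * s * B)) = c * s * (y24 * a * F).
  transitivity (c * s * y * (U * B)); first ring.
  by rewrite hu; field.
rewrite ht in hs.
transitivity (U * (r * Em * (x8 * s' * B')) * (w * t) / x * Ep).
  by rewrite -[LHS]mulr1 -g1; field.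
rewrite hs; transitivity (c * s * F * (w * t * (y24 * a)) / x * Ep); first by field.
by rewrite -he; field.
Qed.

End Fix.
End Relation.

(** * Taylor coefficients as formal power series *)

Section FormalSeries.
Variable R : realType.
Local Notation piC := ((pi : R)%:C).
Local Notation C := R[i].
Implicit Types (a b u v : nat -> C) (x y t w Y : C) (F G : nat -> C -> C).

Definition jet F n : C := F n 0 / n`!%:R.
Definition ex x n : C := x ^+ n / n`!%:R.
(** Drops the constant term and divides by the variable. *)
Definition sh a n : C := a n.+1.
(** The coefficients of [2 sinh (x z)]. *)
Definition sg x n : C := ex x n - ex (- x) n.
Definition dlt n : C := (n == 0%N)%:R.

Lemma factC_neq0 n : (n`!%:R : C) != 0.
Proof. by rewrite pnatr_eq0 -lt0n fact_gt0. Qed.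

Lemma bin_factC n i : (i <= n)%N -> 'C(n, i)%:R / n`!%:R = (i`!%:R)^-1 / (n - i)`!%:R :> C.
Proof.
move=> h; have := factC_neq0 n; have := factC_neq0 i; have := factC_neq0 (n - i).
rewrite -[in n`!](bin_fact h) !natrM.
move: ('C(n, i)%:R) (i`!%:R) ((n - i)`!%:R) => p q r r0 q0 s0.
have p0 : p != 0 by apply: contraNneq s0 => ->; rewrite mul0r.
by field; rewrite p0 q0 r0.
Qed.

Lemma jet_mul F G n : jet (towerM F G) n = conv (jet F) (jet G) n.
Proof.
rewrite /jet /towerM /conv mulr_suml; apply: eq_bigr => i _.
have hi : (i <= n)%N by rewrite -ltnS.
by rewrite mulrAC bin_factC// /jet; move: (_^-1) (_^-1) (F _ _) (G _ _) => p q f g; ring.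
Qed.

Lemma conv_exp x y : conv (ex x) (ex y) = ex (x + y).
Proof.
apply/funext => n; rewrite /conv /ex addrC exprDn mulr_suml; apply: eq_bigr => i _.
have hi : (i <= n)%N by rewrite -ltnS.
rewrite -[_ *+ 'C(n, i)]mulr_natr -[RHS]mulrA bin_factC//.
by move: (_^-1) (_^-1) (_ ^+ _) (_ ^+ _) => p q f g; ring.
Qed.

Lemma ex0 : ex 0 = dlt.
Proof. by apply/funext => -[|n]; rewrite /ex /dlt ?expr0 ?fact0 ?divr1// exprS !mul0r. Qed.

Lemma conv_dlt a : conv a dlt = a.
Proof. by rewrite convC; exact: conv_unit. Qed.

Lemma conv_scale a (c : C) b : conv a (fun n => c * b n) = fun n => c * conv a b n.
Proof.
apply/funext => n; rewrite /conv mulr_sumr; apply: eq_bigr => i _; ring.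
Qed.

Lemma conv_add a b u : conv a (fun n => b n + u n) = fun n => conv a b n + conv a u n.
Proof. by apply/funext => n; rewrite /conv -big_split; apply: eq_bigr => i _; rewrite mulrDr. Qed.

Lemma conv_sh a b n : b 0%N = 0 -> conv a b n.+1 = conv a (sh b) n.
Proof.
move=> b0; rewrite /conv big_ord_recr /= subnn b0 mulr0 addr0; apply: eq_bigr => i _.
by rewrite /sh subSn// -ltnS.
Qed.

Lemma sg0 x : sg x 0 = 0.
Proof. by rewrite /sg /ex !expr0 subrr. Qed.

(** The coefficients of [t z / (2 sinh (t z / 2))], the generating function of the Bernoulli
    polynomials at 1/2. *)
Definition bs t n : C := ((bernoulli_poly R n).[2^-1])%:C * t ^+ n / n`!%:R.

Lemma bernoulli_conv t : conv (bs t) (sh (ex t)) = fun n => t * ex (t / 2) n.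
Proof.
apply/funext => n.
have := congr1 (fun p => (p.[2^-1])%:C : C) (bernoulli_polyE R n).
rewrite /= hornerZ hornerXn horner_sum rmorphM rmorphXn fmorphV /= !rmorph_nat rmorph_sum /= => E.
have -> : t * ex (t / 2) n = (n.+1%:R * 2^-1 ^+ n) * (t ^+ n.+1 / n.+1`!%:R).
  rewrite /ex factS natrM exprMn exprS; have := factC_neq0 n.
  have n0 : (n.+1%:R : C) != 0 by rewrite pnatr_eq0.
  by move: (t ^+ n) (_^-1 ^+ n) (n`!%:R) (n.+1%:R : C) n0 => p q r m m0 r0; field; rewrite r0 m0.
rewrite -E mulr_suml; apply: eq_bigr => i _.
have hi : (i <= n)%N by rewrite -ltnS.
rewrite hornerZ rmorphM /= rmorph_nat /bs /sh /ex -subSn//.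
have -> : t ^+ n.+1 = t ^+ i * t ^+ (n.+1 - i) by rewrite -exprD subnKC// leqW.
have := @bin_factC n.+1 i (leqW hi); move: ('C(_, _)%:R) (_^-1) (_^-1) (_^-1) (_ ^+ _) (_ ^+ _) _%:C => p q r s T1 T2 B H.
transitivity ((q * r) * (B * T1 * T2)); first by ring.
by transitivity ((p * s) * (B * T1 * T2)); [rewrite H; ring|ring].
Qed.

(** [e^(t z) - 1] is [e^(t z / 2)] times [2 sinh (t z / 2)]; cancelling the exponential in
    [bernoulli_conv] leaves the inverse of the hyperbolic sine. *)
Lemma ber_conv t : conv (bs t) (sh (sg (t / 2))) = fun n => t * dlt n.
Proof.
have E1 : sh (ex t) = conv (ex (t / 2)) (sh (sg (t / 2))).
  apply/funext => n; rewrite -conv_sh ?sg0//.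
  have -> : sg (t / 2) = fun n => ex (t / 2) n + -1 * ex (- (t / 2)) n.
    by apply/funext => m; rewrite /sg mulN1r.
  rewrite conv_add conv_scale !conv_exp subrr ex0 /dlt /= mulr0 addr0 /sh.
  by congr (ex _ _); field.
have := bernoulli_conv t; rewrite E1 convA (convC (bs t)) -convA => H.
have := congr1 (fun a => conv (ex (- (t / 2))) a) H.
rewrite convA conv_scale !conv_exp addNr ex0.
by rewrite (_ : conv dlt _ = conv (bs t) (sh (sg (t / 2))))//; exact: conv_unit.
Qed.

(** The Appell property of Hermite polynomials. At 0 it yields a two-step recursion for the
    derivatives of the Gaussian, from which [jet_gE] follows. *)
Lemma deriv_Hp Y n : (Hp Y n.+1)^`() = (- (2 * (piC * Y)) * n.+1%:R) *: Hp Y n.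
Proof.
elim: n => [|n IH].
  by rewrite /= -polyC1 derivB !derivC derivZ derivM derivX derivC mulr0 addr0 mul1r sub0r mulr1 -scaleNr.
have Hs m : Hp Y m.+1 = (Hp Y m)^`() - (2 * (piC * Y)) *: ('X * Hp Y m) by [].
have E : (Hp Y n)^`() = Hp Y n.+1 + (2 * (piC * Y)) *: ('X * Hp Y n) by rewrite Hs subrK.
rewrite (Hs n.+1) derivB derivZ (derivM 'X) derivX mul1r IH derivZ E.
move: (2 * _) (Hp Y n.+1) (Hp Y n) => c P Q.
rewrite -!mul_polyC -(natr1 n.+1) !rmorphM rmorphD rmorphN /= rmorph1.
by move: (c%:P) ((n.+1)%:R%:P) => c' m; ring.
Qed.

Lemma deriv_H0 Y : Hp Y 1 = (- (2 * (piC * Y))) *: 'X.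
Proof. by rewrite /= -polyC1 derivC sub0r polyC1 mulr1 -scaleNr. Qed.

(* Taylor coefficients of exp (w z ^ 2). *)
Definition ge w n : C := if odd n then 0 else w ^+ n./2 / (n./2)`!%:R.

Lemma jet_gE w n : jet (phi (- w)) n = ge (piC * w) n.
Proof.
have E0 m : phi (- w) m 0 = (Hp (- w) m).[0].
  by rewrite /phi /gE expr0n mulr0 cexp0 mulr1.
have S m : phi (- w) m.+2 0 = 2 * (piC * w) * m.+1%:R * phi (- w) m 0.
  rewrite !E0 [Hp _ m.+2]/= hornerD hornerN !hornerZ hornerM hornerX mul0r mulr0 subr0.
  by rewrite -/(Hp _ m.+1) deriv_Hp hornerZ; move: (_.[_]) => p; ring.
have [m ->] : exists m, n = (odd n + m.*2)%N by exists n./2; rewrite odd_double_half.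
case: (odd n); rewrite /jet /ge ?add0n ?add1n /= odd_double /=.
  elim: m => [|m IH]; first by rewrite E0 deriv_H0 !hornerE ?mulr0 ?mul0r.
  rewrite doubleS S; move/eqP: IH; rewrite mulf_eq0 invr_eq0 (negPf (factC_neq0 _)) orbF => /eqP ->.
  by rewrite mulr0 mul0r.
elim: m => [|m IH]; first by rewrite E0 /= !hornerE.
rewrite doubleK in IH; rewrite doubleS S.
have -> : m.*2.+2./2 = m.+1 by rewrite -doubleS doubleK.
have n1 : ((m.*2.+1)%:R : C) != 0 by rewrite pnatr_eq0.
have n2 : ((m.*2.+2)%:R : C) != 0 by rewrite pnatr_eq0.
have n3 : ((m.+1)%:R : C) != 0 by rewrite pnatr_eq0.
have E3 : (m.*2.+2)%:R = 2 * m.+1%:R :> C by rewrite -natrM mul2n doubleS.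
rewrite !factS !natrM E3 exprS.
transitivity (piC * w / m.+1%:R * (phi (- w) m.*2 0 / (m.*2)`!%:R)).
  have := factC_neq0 m.*2; move: (phi _ _ _) ((m.*2)`!%:R) (m.*2.+1%:R) n1 => P q r r0 q0.
  by move: (m.+1%:R : C) n3 => s s0; field; rewrite r0 q0 s0.
rewrite IH; have := factC_neq0 m; move: (_ ^+ m) (m`!%:R) => P q q0.
by move: (m.+1%:R : C) n3 => s s0; field; rewrite q0 s0.
Qed.

Definition evn a n : C := if odd n then 0 else a n.
Definition evs a := forall n, odd n -> a n = 0.

Lemma conv_evn a b : evs b -> conv (evn a) b = evn (conv a b).
Proof.
move=> eb; apply/funext => n; rewrite /evn /conv; case: ifP => on.
  apply: big1 => i _; case: ifP => oi; first by rewrite mul0r.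
  by rewrite eb ?mulr0// oddB ?on ?oi// -ltnS.
apply: eq_bigr => i _; case: ifP => // oi.
by rewrite eb ?mulr0 ?mul0r// oddB ?on ?oi// -ltnS.
Qed.

Lemma evs_conv a b : evs a -> evs b -> evs (conv a b).
Proof.
move=> ea eb n on; have := conv_evn a eb => /(congr1 (fun f => f n)); rewrite /evn on => <-.
by apply: eq_bigr => i _; case: ifP => // /ea ->.
Qed.

Lemma sum_even (F : nat -> C) j : (forall n, odd n -> F n = 0) ->
  \sum_(i < (2 * j).+1) F i = \sum_(i < j.+1) F (2 * i)%N.
Proof.
move=> F0; elim: j => [|j IH]; first by rewrite !big_ord1.
rewrite mulnS big_ord_recr big_ord_recr /= IH [in RHS]big_ord_recr /= -addrA mulnS; congr (_ + _).
by rewrite (F0 (2 * j).+1) ?add0r//= oddM.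
Qed.

Lemma conv_double a b j : evs a -> conv a b (2 * j) = \sum_(i < j.+1) a (2 * i)%N * b (2 * (j - i))%N.
Proof.
move=> ea; rewrite /conv (@sum_even (fun i => a i * b (2 * j - i)%N)) => [|n on]; last by rewrite ea// mul0r.
by apply: eq_bigr => i _; rewrite mulnBr.
Qed.

(** The summation indices come in the order of [kappa]: first the Gaussian [v], then the sine
    quotient [u], then the Bernoulli series. *)
Lemma conv3_double u v a j : evs u -> evs v -> conv u (conv v a) (2 * j) =
  \sum_(p < j.+1) \sum_(r < j.+1) \sum_(s < j.+1 | (p + r + s == j)%N) v (2 * p)%N * u (2 * r)%N * a (2 * s)%N.
Proof.
move=> eu ev; rewrite conv_double// exchange_big /=; apply: eq_bigr => r _.
have rj : (r <= j)%N by rewrite -ltnS.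
rewrite conv_double// mulr_sumr.
transitivity (\sum_(p < j.+1 | (p < (j - r).+1)%N) u (2 * r)%N * (v (2 * p)%N * a (2 * (j - r - p))%N)).
  by rewrite (big_ord_widen j.+1 (fun p => u (2 * r)%N * (v (2 * p)%N * a (2 * (j - r - p))%N))) ?ltnS ?leq_subr.
rewrite big_mkcond; apply: eq_bigr => p _; case: ifP => h.
  have hs : (j - r - p < j.+1)%N by lia.
  rewrite (bigD1 (Ordinal hs)) /=; last by apply/eqP; lia.
  rewrite big1 ?addr0 => [|s /andP[/eqP h1 /eqP h2]]; first by ring.
  by case: h2; apply: val_inj => /=; lia.
rewrite big1// => s /eqP h1; move/negP: h; case; rewrite ltnS.
by move: h1; clear; lia.
Qed.

Lemma evs_sh_sg x : evs (sh (sg x)).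
Proof. by move=> n on; rewrite /sh /sg /ex [(- x) ^+ _]exprNn -signr_odd /= on expr0 mul1r subrr. Qed.

Lemma sh_sg_even x n : ~~ odd n -> sh (sg x) n = 2 * x ^+ n.+1 / n.+1`!%:R.
Proof.
move=> on; rewrite /sh /sg /ex [(- x) ^+ _]exprNn -signr_odd /= on expr1.
by move: (x ^+ _) (_^-1) => p q; ring.
Qed.

Lemma evs_ge w : evs (ge w).
Proof. by move=> n; rewrite /ge => ->. Qed.

(** An inverse of an even series is even: the even part of [bs t] solves the same equation, and
    solutions are unique by associativity. *)
Lemma evs_bs t : t != 0 -> evs (bs t).
Proof.
move=> t0; have H := ber_conv t; set S := sh _ in H.
have eS : evs S := evs_sh_sg _.
have H2 : conv (evn (bs t)) S = fun n => t * dlt n.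
  rewrite conv_evn// H; apply/funext => n; rewrite /evn /dlt; case: n => //= n.
  by rewrite mulr0; case: ifP.
have E : (fun n => t * evn (bs t) n) = fun n => t * bs t n.
  have := congr1 (fun f => conv (bs t) f) H2; rewrite /= conv_scale conv_dlt => <-.
  by rewrite (convC (evn _)) convA H convC conv_scale conv_dlt.
move=> n on; have := congr1 (fun f => f n) E; rewrite /= /evn on mulr0 => /esym /eqP.
by rewrite mulf_eq0 (negPf t0) => /eqP.
Qed.

End FormalSeries.

(** * Power series equations close to the identity *)

Section Perturbation.
Variable R : realType.
Local Notation C := R[i].
Implicit Types (u v b : nat -> C) (B V : nat -> R) (T X th : R).

(** The equation [u * b = v] with [b = 1 + O(th)]. Here [X] is the cost of one degree, [T] the size
    of the right-hand side, and [B], [V] are constants independent of all parameters. *)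
Definition pert_hyp B V u v b th T X := [/\ [/\ conv u b =1 v, 0 <= th <= 1, 0 <= T & 0 <= X],
  4^-1 <= cabs (b 0%N), (forall n, cabs (b n - dlt R n) <= B n * th * X ^+ n) &
  (forall n, cabs (v n) <= V n * T * X ^+ n)].

Lemma conv_perturb_bound B V : (forall n, 0 <= B n) -> (forall n, 0 <= V n) -> forall n, exists2 U : R, 0 <= U &
  forall u v b th T X, pert_hyp B V u v b th T X -> forall i, (i <= n)%N -> cabs (u i) <= U * T * X ^+ i.
Proof.
move=> B0 V0.
have step u b n : conv u b n = u n * b 0%N + \sum_(i < n) u i * b (n - i)%N.
  by rewrite /conv big_ord_recr /= subnn addrC.
elim=> [|n [U U0 IH]].
  exists (4 * V 0%N) => [|u v b th T X [[E _ T0 X0] b0 _ hv] i]; first by rewrite mulr_ge0.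
  rewrite leqn0 => /eqP ->; have := hv 0%N; rewrite -E step// big_ord0 addr0 cabsM !expr0 !mulr1.
  have u0 := cabs_ge0 (u 0%N); move: (cabs (b _)) b0 => c c4 h.
  rewrite -mulrA; have : cabs (u 0%N) * 4^-1 <= V 0%N * T by apply: le_trans h; rewrite ler_wpM2l.
  lra.
pose S := \sum_(i < n.+1) B (n.+1 - i)%N; have S0 : 0 <= S by apply: sumr_ge0.
exists (U + 4 * (V n.+1 + U * S)) => [|u v b th T X H i]; first by rewrite addr_ge0// mulr_ge0// addr_ge0// mulr_ge0.
have hi := IH u v b th T X H; have [[E /andP[th0 th1] T0 X0] b0 hb hv] := H.
rewrite leq_eqVlt ltnS => /predU1P[->|ilt]; last first.
  apply: le_trans (hi i ilt) _; rewrite ler_wpM2r ?exprn_ge0// ler_wpM2r// lerDl.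
  by rewrite mulr_ge0// addr_ge0// mulr_ge0.
have hS : cabs (\sum_(i < n.+1) u i * b (n.+1 - i)%N) <= U * S * (T * X ^+ n.+1).
  apply: le_trans (cabs_sum _ _ _) _; rewrite /S mulr_sumr mulr_suml; apply: ler_sum => j _.
  have jn : (j <= n)%N by rewrite -ltnS.
  have bj : cabs (b (n.+1 - j)%N) <= B (n.+1 - j)%N * X ^+ (n.+1 - j).
    have := hb (n.+1 - j)%N; rewrite /dlt subn_eq0 leqNgt ltn_ord /= subr0 => /le_trans; apply.
    by rewrite ler_wpM2r ?exprn_ge0// ler_piMr.
  apply: le_trans (cabsM_le (hi j jn) bj) _; rewrite le_eqVlt; apply/orP; left; apply/eqP.
  have -> : X ^+ n.+1 = X ^+ j * X ^+ (n.+1 - j) by rewrite -exprD subnKC// leqW.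
  by move: (X ^+ j) (X ^+ _) => p q; ring.
have h : u n.+1 * b 0%N = v n.+1 - \sum_(i < n.+1) u i * b (n.+1 - i)%N by rewrite -E step addrK.
have : cabs (u n.+1) * cabs (b 0%N) <= (V n.+1 + U * S) * (T * X ^+ n.+1).
  rewrite -cabsM h mulrDl; apply: le_trans (cabsD _ _) _; rewrite cabsN; apply: lerD => //.
  by rewrite mulrA.
have u0 := cabs_ge0 (u n.+1); move: (cabs (b _)) b0 => c c4 hh.
have h4 : cabs (u n.+1) * 4^-1 <= (V n.+1 + U * S) * (T * X ^+ n.+1).
  by apply: le_trans hh; rewrite ler_wpM2l.
have TX : 0 <= T * X ^+ n.+1 by rewrite mulr_ge0 ?exprn_ge0.
have UT := mulr_ge0 U0 TX.
have -> : (U + 4 * (V n.+1 + U * S)) * T * X ^+ n.+1 = U * (T * X ^+ n.+1) + 4 * ((V n.+1 + U * S) * (T * X ^+ n.+1)).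
  by move: (X ^+ _) => p; ring.
move: UT h4; move: (U * _) (_ * (T * _)) (cabs _) => p q r; clear; lra.
Qed.

(** [u - v] is the Cauchy product of [- u] with [b - 1], so it suffices to bound [u] like [v];
    [conv_perturb_bound] does this by solving the triangular system, dividing by [b 0] at each
    degree. *)
Lemma conv_perturb B V : (forall n, 0 <= B n) -> (forall n, 0 <= V n) -> forall n, exists2 D : R, 0 <= D &
  forall u v b th T X, pert_hyp B V u v b th T X -> cabs (u n - v n) <= D * th * T * X ^+ n.
Proof.
move=> B0 V0 n; have [U U0 HU] := conv_perturb_bound B0 V0 n.
exists (\sum_(i < n.+1) U * B (n - i)%N) => [|u v b th T X H].
  by apply: sumr_ge0 => i _; rewrite mulr_ge0.
have hi := HU u v b th T X H; have [[E /andP[th0 th1] T0 X0] b0 hb hv] := H.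
have -> : u n - v n = - \sum_(i < n.+1) u i * (b (n - i)%N - dlt R (n - i)%N).
  have E1 : u n = conv u (dlt R) n by rewrite conv_dlt.
  rewrite [in LHS]E1 -E /conv -sumrB -sumrN; apply: eq_bigr => i _; ring.
rewrite cabsN; apply: le_trans (cabs_sum _ _ _) _; rewrite !mulr_suml; apply: ler_sum => i _.
have jn : (i <= n)%N by rewrite -ltnS.
apply: le_trans (cabsM_le (hi i jn) (hb _)) _; rewrite le_eqVlt; apply/orP; left; apply/eqP.
have -> : X ^+ n = X ^+ i * X ^+ (n - i) by rewrite -exprD subnKC.
by move: (X ^+ i) (X ^+ _) => p q; ring.
Qed.

Lemma conv_bound (u v : nat -> C) (U V : nat -> R) (s t X : R) n : 0 <= X ->
  (forall i, cabs (u i) <= U i * s * X ^+ i) -> (forall i, cabs (v i) <= V i * t * X ^+ i) ->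
  cabs (conv u v n) <= (\sum_(i < n.+1) U i * V (n - i)%N) * (s * t) * X ^+ n.
Proof.
move=> X0 hu hv; apply: le_trans (cabs_sum _ _ _) _; rewrite !mulr_suml; apply: ler_sum => i _.
have jn : (i <= n)%N by rewrite -ltnS.
apply: le_trans (cabsM_le (hu _) (hv _)) _; rewrite le_eqVlt; apply/orP; left; apply/eqP.
have -> : X ^+ n = X ^+ i * X ^+ (n - i) by rewrite -exprD subnKC.
by move: (X ^+ i) (X ^+ _) => p q; ring.
Qed.

End Perturbation.

(** * The main integral and the coefficients [kappa] *)

Section MainTerm.
Variable R : realType.
Local Notation piC := ((pi : R)%:C).
Local Notation C := R[i].
Implicit Types (z w Y Z : C) (k p : nat) (x y : R) (g : int -> C).
Local Notation beta := (@beta R).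

Lemma cdiff_mulpi w : cdiff (fun v => piC * v) w (piC : C).
Proof. by have := cdiff_lin (piC : C) 0 w; congr cdiff; apply/funext => v; rewrite addr0. Qed.

(** The closed form holds off the poles only, so the induction differentiates it on a disc around
    [w] that is free of poles. *)
Lemma CcotE p w : csin (piC * w) != 0 ->
  Ccot p w = (piC / (2 * ipi)) ^+ p * (Pc R p).[ccot (piC * w)].
Proof.
elim: p w => [|p IH] w w0; first by rewrite expr0 mul1r hornerX.
rewrite /Ccot iterS -/(Ccot p) exprS.
have cs : ccont (fun v => csin (piC * v)) w.
  exact: cdiff_ccont (cdiff_comp (cdiff_mulpi w) (cdiff_csin _)).
have c0 : 0 < cabs (csin (piC * w)) / 2 by rewrite divr_gt0// cabs_gt0.
have [d d0 Hd] := cs _ c0.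
have near v : cabs (v - w) < d -> csin (piC * v) != 0.
  move=> /Hd; apply: contraTneq => ->; rewrite sub0r cabsN -ltNge.
  by move: c0; move: (cabs _) => t; lra.
have D := cdiff_comp (cdiff_comp (cdiff_mulpi w) (cdiff_ccot w0)) (cdiff_poly (Pc R p) _).
have D2 := cdiffZ ((piC / (2 * ipi)) ^+ p) D.
have D3 : cdiff (Ccot p) w ((piC / (2 * ipi)) ^+ p *
    ((Pc R p)^`().[ccot (piC * w)] * (- (1 + ccot (piC * w) ^+ 2) * piC))).
  by apply: (cdiff_near d0 _ D2) => v hv; rewrite IH//; exact: near.
rewrite (cdiff_derive1 D3) /= hornerN hornerM hornerD hornerXn hornerC.
move: ((piC / (2 * ipi)) ^+ p) ((2 * ipi)^-1 : C) ((Pc R p)^`()) (ccot (piC * w)) (piC : C) => a b P c e; ring.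
Qed.

(** The oddness of [g] under [n -> - n - 1] replaces [z + v + 1 / 2] by [z - v - 1 / 2], the form of
    the argument in the theorem. *)
Lemma Kd_reflect k g p z : (0 < k)%N -> (forall n, g (n + (2 * k)%N%:Z) = g n) ->
  (forall n, g (- n - 1) = - g n) ->
  Kd k g p 0 z = - \sum_(v < 2 * k) g v%:Z * ((pi / (2 * k%:R) : R)%:C ^+ p *
    (Pc R p).[kc k 0 (z - v%:R - 2^-1)]).
Proof.
move=> k0 gper godd; rewrite /Kd -sumrN (reindex_inj rev_ord_inj); apply: eq_bigr => v _ /=.
have vk : (v < 2 * k)%N := ltn_ord v.
rewrite -mulNr -godd; congr (_ * (_ * _.[_])).
  by rewrite -(gper (- v%:Z - 1)); congr g; rewrite -subzn//; lia.
have -> : z + (2 * k - v.+1)%:R + 2^-1 = (z - v%:R - 2^-1) + (2 * k * 1)%:R :> C.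
  by rewrite natrB// muln1 -(natr1 v); field.
by rewrite kc_per.
Qed.

Lemma kc_neg_neq0 k (v : nat) y : (0 < k)%N -> (v < 2 * k)%N -> `|y| <= beta ->
  csin ((pi / (2 * k%:R) : R)%:C * (y%:C - v%:R - 2^-1)) != 0.
Proof.
move=> k0 vk hy; have hy' : `|- y| <= beta by rewrite normrN.
have := kc_neq0_x 0 k0 (seg_range2 vk hy'); rewrite rmorph0 mulr0 addr0.
have -> : ((- y + (v%:R + 2^-1))%:C : C) = - (y%:C - v%:R - 2^-1).
  by rewrite !rmorphD rmorphN fmorphV /= !rmorph_nat; ring.
by rewrite mulrN csinN oppr_eq0.
Qed.

Definition mainI k Y p (v : nat) : C := cint (-1) 1 (fun x : R =>
  Ccot p ((2 * k%:R)^-1 * ((x / Num.sqrt 6)%:C - v%:R - 2^-1)) * gE Y (x / Num.sqrt 6)%:C).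

Lemma segc_Pc_kc k p (v : nat) : (0 < k)%N -> (v < 2 * k)%N ->
  segc (- beta) beta (fun z => (Pc R p).[kc k 0 (z - v%:R - 2^-1)]).
Proof.
move=> k0 vk x hx; have hy : `|x| <= beta by rewrite ler_norml.
have n0 := kc_neg_neq0 k0 vk hy.
have d1 : cdiff (fun z => z - v%:R - 2^-1) x%:C 1.
  by have := cdiff_lin 1 (- v%:R - 2^-1) x%:C; congr cdiff; apply/funext => w; rewrite mul1r addrA.
have d2 : cdiff (kc k 0) (x%:C - v%:R - 2^-1) (- (pi / (2 * k%:R) : R)%:C * (1 + kc k 0 (x%:C - v%:R - 2^-1) ^+ 2)).
  by apply: cdiff_kc; rewrite rmorph0 mulr0 addr0.
exact: cdiff_ccont (cdiff_comp (cdiff_comp d1 d2) (cdiff_poly _ _)).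
Qed.

Lemma mainI_scaled k Y p (v : nat) (e : C) : (0 < k)%N -> (v < 2 * k)%N ->
  cint (-1) 1 (fun x : R => Ccot p ((2 * k%:R)^-1 * ((x / Num.sqrt 6)%:C - v%:R - 2^-1)) *
    (e * gE Y (x / Num.sqrt 6)%:C)) =
  e * (piC / (2 * ipi)) ^+ p *
  integ (-1) 1 (fun z => gE Y (beta%:C * z + 0) * (Pc R p).[kc k 0 (beta%:C * z + 0 - v%:R - 2^-1)]).
Proof.
move=> k0 vk; have kC := natC_neq0 R k0.
have b0 := beta_gt0 R.
transitivity (integ (-1) 1 (fun z => (e * (piC / (2 * ipi)) ^+ p) *
     (gE Y (beta%:C * z + 0) * (Pc R p).[kc k 0 (beta%:C * z + 0 - v%:R - 2^-1)]))).
  apply: eq_cint => x /andP[x1 x2].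
  have xb : (x / Num.sqrt 6)%:C = beta%:C * x%:C + 0 :> C by rewrite addr0 -rmorphM mulrC.
  have arg : piC * ((2 * k%:R)^-1 * ((x / Num.sqrt 6)%:C - v%:R - 2^-1)) =
     (pi / (2 * k%:R) : R)%:C * ((x / Num.sqrt 6)%:C - v%:R - 2^-1) :> C.
    have -> : (pi / (2 * k%:R) : R)%:C = piC / (2 * k%:R) :> C by rewrite rmorphM fmorphV rmorphM /= !rmorph_nat.
    by rewrite mulrA.
  have hx : `|x / Num.sqrt 6| <= beta.
    by rewrite normrM (gtr0_norm b0) ler_piMl ?(ltW b0)// ler_norml x1.
  rewrite CcotE arg; last exact: kc_neg_neq0.
  rewrite -xb /kc rmorph0 mulr0 addr0; move: (gE _ _) (_ ^+ p) (_.[_]) => a b c; ring.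
rewrite (@cintZ R _ _ (e * (piC / (2 * ipi)) ^+ p) (fun z => gE Y (beta%:C * z + 0) * (Pc R p).[kc k 0 (beta%:C * z + 0 - v%:R - 2^-1)]))//.
move=> x /andP[x1 x2]; apply: (@ccont_comp _ (fun z => beta%:C * z + 0) (fun z => gE Y z * (Pc R p).[kc k 0 (z - v%:R - 2^-1)])).
  exact: cdiff_ccont (cdiff_lin _ _ _).
have cF : segc (- beta) beta (fun z => gE Y z * (Pc R p).[kc k 0 (z - v%:R - 2^-1)]).
  by apply: segcM; [apply: segc_diff => y _; exact: cdiff_gE|exact: segc_Pc_kc].
rewrite addr0 -rmorphM; apply: cF; apply/andP; split.
  by rewrite -mulrN1 ler_pM2l.
by rewrite -[leRHS]mulr1 ler_pM2l.
Qed.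

Lemma mainI_exp k Z p (v : nat) : (0 < k)%N -> Z != 0 -> (v < 2 * k)%N ->
  cint (-1) 1 (fun x : R => Ccot p ((2 * k%:R)^-1 * ((x / Num.sqrt 6)%:C - v%:R - 2^-1)) *
    cexp (piC / (6 * k%:R * Z) * (1 - x ^+ 2)%:C)) =
  cexp (piC / (6 * k%:R * Z)) * mainI k (k%:R * Z)^-1 p v.
Proof.
move=> k0 Z0 vk; have kC := natC_neq0 R k0.
have -> : mainI k (k%:R * Z)^-1 p v = 1 * (piC / (2 * ipi)) ^+ p *
    integ (-1) 1 (fun z => gE (k%:R * Z)^-1 (beta%:C * z + 0) * (Pc R p).[kc k 0 (beta%:C * z + 0 - v%:R - 2^-1)]).
  by rewrite -mainI_scaled//; apply: eq_cint => x _; rewrite mul1r.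
rewrite mul1r mulrA -mainI_scaled//; apply: eq_cint => x _; congr (_ * _).
rewrite /gE -cexpD; congr cexp.
have -> : (x / Num.sqrt 6)%:C ^+ 2 = (x ^+ 2)%:C / 6 :> C.
  by rewrite -rmorphXn exprMn exprVn sqr_sqrtr// rmorphM fmorphV rmorph_nat.
have -> : (1 - x ^+ 2)%:C = 1 - (x ^+ 2)%:C :> C by rewrite rmorphB.
move: ((x ^+ 2)%:C : C) (piC : C) (k%:R : C) kC => a P κ kC; field.
by rewrite kC Z0.
Qed.

Lemma main_integral k g p Y : (0 < k)%N -> (forall n, g (n + (2 * k)%N%:Z) = g n) ->
  (forall n, g (- n - 1) = - g n) ->
  integ (- beta) beta (fun z => phi Y 0 z * Kd k g p 0 z) =
  - (ipi / k%:R) ^+ p * (Num.sqrt 6)^-1%:C * \sum_(v < 2 * k) g v%:Z * mainI k Y p v.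
Proof.
move=> k0 gper godd; have kC := natC_neq0 R k0.
have kR := natR_gt0 R k0.
have b0 := beta_gt0 R; have m1 : -1 <= 1 :> R by rewrite ge0_cp.
pose F (v : 'I_(2 * k)) z := (- g v%:Z * (pi / (2 * k%:R) : R)%:C ^+ p) * (gE Y z * (Pc R p).[kc k 0 (z - v%:R - 2^-1)]).
have cg a b : segc a b (gE Y) by apply: segc_diff => x _; exact: cdiff_gE.
have cF0 (v : 'I_(2 * k)) : segc (- beta) beta (fun z => gE Y z * (Pc R p).[kc k 0 (z - v%:R - 2^-1)]).
  by apply: segcM => //; exact: segc_Pc_kc.
have cF v : segc (- beta) beta (F v) by apply: segcM => //; exact: segc_cst.
transitivity (integ (- beta) beta (fun z => \sum_v F v z)).
  apply: eq_cint => x _; rewrite Kd_reflect// mulrN mulr_sumr -sumrN; apply: eq_bigr => v _.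
  rewrite /F /phi /= hornerC mul1r; move: (gE _ _) (g _) (_ ^+ p) (_.[_]) => a b c d; ring.
rewrite cint_sum// mulr_sumr; apply: eq_bigr => v _.
rewrite (@cintZ R _ _ (- g v%:Z * (pi / (2 * k%:R) : R)%:C ^+ p) (fun z => gE Y z * (Pc R p).[kc k 0 (z - v%:R - 2^-1)]))//.
have := @cint_affine R (-1) 1 beta 0 (fun z => gE Y z * (Pc R p).[kc k 0 (z - v%:R - 2^-1)]) m1 b0.
rewrite !addr0 mulrN1 mulr1 => /(_ (cF0 v)) ->.
have p0 := piC_neq0 R.
have E : (ipi / k%:R) ^+ p * mainI k Y p v = (pi / (2 * k%:R) : R)%:C ^+ p *
   integ (-1) 1 (fun z => gE Y (beta%:C * z + 0) * (Pc R p).[kc k 0 (beta%:C * z + 0 - v%:R - 2^-1)]).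
  have hI : mainI k Y p v = 1 * (piC / (2 * ipi)) ^+ p *
    integ (-1) 1 (fun z => gE Y (beta%:C * z + 0) * (Pc R p).[kc k 0 (beta%:C * z + 0 - v%:R - 2^-1)]).
    by rewrite -mainI_scaled//; apply: eq_cint => x _; rewrite mul1r.
  rewrite hI mul1r mulrA -exprMn; congr (_ ^+ p * _).
  rewrite rmorphM fmorphV rmorphM /= !rmorph_nat /ipi.
  by move: (pi%:C) p0 (iC : C) (iC_neq0 R) => q q0 i i0; field; rewrite kC i0 q0.
set J := (X in _ * (_ * X)) in E *.
transitivity (- g v%:Z * beta%:C * ((pi / (2 * k%:R) : R)%:C ^+ p * J)); first by move: (_ ^+ p) => a; ring.
rewrite -E -/beta; move: (_ ^+ p) (mainI _ _ _ _) => a b; ring.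
Qed.

Lemma m_even_alg (F : fieldType) (i p Z N B pa pb pc ka za zc fa fb fc sa sb sc qa qb qc : F) :
  sa * sa = 1 -> sc * sc = 1 -> 2 != 0 :> F -> p != 0 -> Z != 0 -> pa != 0 -> za != 0 -> zc != 0 ->
  fa != 0 -> fb != 0 -> fc != 0 -> qa != 0 -> qb != 0 ->
  N * (pa * ka / za / fa * (2 * (i * p * sb * pb * pb) / fb) *
     ((- (2 * p) / Z)^-1 * (B * (qc * pc ^+ 2 / zc ^+ 2) / fc))) =
  - i * Z * (sa * sb * sc * (qa * qb * qc) * (pa * pb * pc) ^+ 2) *
    (ka * (N * (sa * sc) * B / (fa * fb * fc * pa * (qa * qb))) / (za * zc ^+ 2)).
Proof.
move=> ea ec n2 *; rewrite -[LHS]mul1r -[X in X * _]mulr1 -{1}ea -ec; field.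
by do !(apply/andP; split) => //; rewrite ec mul1r oppr_eq0 mulf_neq0.
Qed.

(** Here [kappa] arises: [a] counts the Gaussian [exp (pi k z^2 / Z)], [b] the quotient
    [2 i sin (pi z) / z], and [c] the inverse of [2 sinh (t z / 2)], whose coefficients are
    Bernoulli values. *)
Lemma m_even k Z j : (0 < k)%N -> Z != 0 ->
  let t := - (2 * piC) / Z in
  (2 * j)`!%:R * conv (sh (sg ipi)) (conv (ge (piC * (k%:R / Z))) (fun n => t^-1 * bs t n)) (2 * j) =
  - iC * Z * (2 * ipi) ^+ (2 * j) *
    \sum_(a < j.+1) \sum_(b < j.+1) \sum_(c < j.+1 | (a + b + c == j)%N)
       k%:R ^+ a * (kappa R a b c)%:C / Z ^+ (a + 2 * c).
Proof.
move=> k0 Z0 t; have kC := natC_neq0 R k0.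
have p0 := piC_neq0 R.
rewrite conv3_double; [|exact: evs_sh_sg|exact: evs_ge].
rewrite !mulr_sumr; apply: eq_bigr => a _; rewrite !mulr_sumr; apply: eq_bigr => b _.
rewrite !mulr_sumr; apply: eq_bigr => c /eqP abc.
have o2 n : odd (2 * n) = false by rewrite oddM.
have d2 n : (2 * n)./2 = n by rewrite mul2n doubleK.
move: (nat_of_ord a) (nat_of_ord b) (nat_of_ord c) abc => {}a {}b {}c abc.
rewrite sh_sg_even ?o2// /ge o2 d2 /bs -abc.
have -> : ipi ^+ (2 * b).+1 = ipi * (-1) ^+ b * piC ^+ b * piC ^+ b :> C.
  by rewrite exprS exprM [ipi ^+ 2]exprMn expr2 iC_sqr exprMn expr2 exprMn; ring.
have -> : (2 * ipi) ^+ (2 * (a + b + c)) = (-1) ^+ a * (-1) ^+ b * (-1) ^+ c *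
   (4 ^+ a * 4 ^+ b * 4 ^+ c) * (piC ^+ a * piC ^+ b * piC ^+ c) ^+ 2 :> C.
  have -> : (2 * ipi) ^+ (2 * (a + b + c)) = ((-1) * 4 * piC * piC) ^+ (a + b + c) :> C.
    rewrite exprM; congr (_ ^+ _); rewrite /ipi.
    transitivity (4 * (iC * iC) * piC * piC); first ring.
    by rewrite iC_sqr; ring.
  by rewrite !exprD !exprMn; move: (_ ^+ a) (_ ^+ b) (_ ^+ c) => x y z; ring.
have -> : t ^+ (2 * c) = 4 ^+ c * (piC ^+ c) ^+ 2 / (Z ^+ c) ^+ 2.
  have -> : t ^+ (2 * c) = (4 * (piC * piC) / (Z * Z)) ^+ c.
    by rewrite exprM; congr (_ ^+ c); rewrite /t; field.
  by rewrite exprMn exprVn 3!exprMn.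
have -> : Z ^+ (a + 2 * c) = Z ^+ a * (Z ^+ c) ^+ 2 by rewrite exprD -exprM (mulnC c 2).
have -> : (piC * (k%:R / Z)) ^+ a = piC ^+ a * k%:R ^+ a / Z ^+ a by rewrite !exprMn exprVn mulrA.
have -> : (kappa R a b c)%:C = (2 * (a + b + c))`!%:R * ((-1) ^+ a * (-1) ^+ c) * ((bernoulli_poly R (2 * c)).[2^-1])%:C /
    (a`!%:R * (2 * b).+1`!%:R * (2 * c)`!%:R * piC ^+ a * (4 ^+ a * 4 ^+ b)) :> C.
  rewrite /kappa addn1 rmorphM fmorphV !rmorphM !rmorphXn /= rmorphN rmorph1 !rmorph_nat !exprD.
  by [].
have n2 : 2 != 0 :> C by rewrite pnatr_eq0.
have n4 n : (4 : C) ^+ n != 0 by rewrite expf_neq0// pnatr_eq0.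
have s2 n : (-1 : C) ^+ n * (-1) ^+ n = 1 by rewrite -expr2 sqrr_sign.
apply: m_even_alg => //; by [rewrite expf_neq0|exact: factC_neq0].
Qed.

End MainTerm.

(** * Comparison of Taylor coefficients *)

Section TaylorRelation.
Variable R : realType.
Local Notation C := R[i].
Implicit Types (u ph B : nat -> C) (z w : C).

Lemma scale_conv (a : C) u B : conv (fun n => a * u n) B = fun n => a * conv u B n.
Proof. by rewrite convC conv_scale convC. Qed.

Lemma evn_scale (a : C) u : evn (fun n => a * u n) = fun n => a * evn u n.
Proof. by apply/funext => n; rewrite /evn; case: ifP => _ //; rewrite mulr0. Qed.

(** Both sides vanish at 0; once a factor [z] is removed, the hyperbolic sine on the left is
    invertible with inverse [rho]. The remaining factors [B] and [m] are even, so the even parts of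
    [u] and [ph] satisfy the relation by themselves. *)
Lemma jets_relation u ph B w (K0 qp t : C) : K0 != 0 -> qp != 0 -> t != 0 -> evs B ->
  conv (fun n => K0 * u n) (conv (sg (t / 2)) B) =1 conv (fun n => qp * ph n) (conv (sg ipi) (ge w)) ->
  conv (evn u) (fun n => qp^-1 * B n) =1
  fun n => K0^-1 * conv (evn ph) (conv (sh (sg ipi)) (conv (ge w) (fun n => t^-1 * bs t n))) n.
Proof.
move=> K00 qp0 t0 eB E.
set rho := fun n => t^-1 * bs t n; set m := conv (sh _) _.
have H0 : conv (conv (fun n => K0 * u n) B) (sh (sg (t / 2))) = conv (conv (fun n => qp * ph n) (ge w)) (sh (sg ipi)).
  by apply/funext => n; rewrite -!conv_sh ?sg0// -!convA [conv B _]convC [conv (ge w) _]convC E.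
have Hr : conv (sh (sg (t / 2))) rho = @dlt R.
  rewrite convC scale_conv ber_conv; apply/funext => n; rewrite mulrA mulVf// mul1r//.
have H1 : conv (fun n => K0 * u n) B = conv (fun n => qp * ph n) m.
  have := congr1 (fun f : nat -> C => conv f rho) H0; rewrite /= -!convA Hr conv_dlt => ->.
  by congr conv; rewrite /m !convA [conv (ge w) _]convC.
have er : evs rho by move=> n on; rewrite /rho evs_bs// mulr0.
have em : evs m by apply: evs_conv; [exact: evs_sh_sg|apply: evs_conv; [exact: evs_ge|]].
have := congr1 (@evn R) H1; rewrite -!conv_evn// !evn_scale !scale_conv => H2 n.
rewrite convC scale_conv convC; have := congr1 (fun f => f n) H2; rewrite /=.
by move: (conv (evn u) B n) (conv (evn ph) m n) => a b hab; rewrite -[a](mulKf K00) hab mulrCA mulKf.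
Qed.

Lemma tower_le dl dl' (F : nat -> C -> C) : dl' <= dl -> tower dl F -> tower dl' F.
Proof. by move=> le tF n z hz; apply: tF; exact: lt_le_trans le. Qed.

Definition sthT n z : C := ipi ^+ n * cexp (ipi * z) + (-1) * ((- ipi) ^+ n * cexp (- ipi * z)).

Lemma tower_sthT dl : tower dl sthT.
Proof.
have E (b : C) : tower dl (fun n z => b ^+ n * cexp (b * z)).
  move=> n z _; have := cdiffZ (b ^+ n) (cdiff_cexpZ b z); congr cdiff.
  by rewrite exprSr; move: (b ^+ n) (cexp _) => p q; ring.
by apply: tower_add (E _) _; apply: tower_scale; exact: E.
Qed.

Lemma jet_sthT (a : C) n : a ^+ n * sthT n 0 / n`!%:R = sg (a * ipi) n.
Proof.
rewrite /sthT /sg /ex !mulr0 cexp0 !mulr1 -(mulrN a ipi) (exprMn n a ipi) (exprMn n a (- ipi)).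
move: (a ^+ n) (ipi ^+ n) ((- ipi) ^+ n) (_^-1) => p q r s; ring.
Qed.

Lemma tower_phi (Y : C) dl : tower dl (phi Y).
Proof. by move=> n z _; exact: cdiff_phi_herm. Qed.

Lemma Bq00 (q : C) : q != 0 -> cabs q < 1 -> Bq q 0 0 = qpoch q q ^+ 3.
Proof.
move=> q0 q1; rewrite Bq0E// (_ : e2pi 0 = 1) ?invr1 ?mul1r; last by rewrite /e2pi mulr0 cexp0.
by rewrite exprS expr2.
Qed.

(** The coefficients of [Bq q' 0 (i z / Z) / (q'; q')], a perturbation of the constant 1 of order
    [|q'|]. *)
Definition bt (Z : C) (h' k : nat) n : C := let q := e2pi ((h'%:R + iC / Z) / k%:R) in
  (qpoch q q)^-1 * ((iC / Z) ^+ n * Bq q n 0 / n`!%:R).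
(** The elementary part of the relation, which contains no q-product: sine quotient, Gaussian and
    inverse hyperbolic sine. *)
Definition mt (Z : C) (k : nat) : nat -> C := let t := - (2 * (pi : R)%:C) / Z in
  conv (sh (sg ipi)) (conv (ge ((pi : R)%:C * (k%:R / Z))) (fun n => t^-1 * bs t n)).

Lemma U1_jets (k h h' g : nat) (Z w c : C) : (0 < k)%N -> 0 < Re Z -> (k * g)%N = (h * h' + 1)%N ->
  eta_rel h%:Z h'%:Z k%:Z w -> w != 0 -> c != 0 ->
  (forall n, c * gf R k h n = \sum_(v < k) gf R k h' v%:Z * chn R k n v%:Z) ->
  let u n := cderiv n (fun z => U1 z (h%:R / k%:R + iC * Z / k%:R)) 0 / n`!%:R in
  let K0 := csq k%:R * w * e2pi ((h'%:R + iC / Z) / k%:R / 12) in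
  conv (evn u) (bt Z h' k) =1 fun n => K0^-1 * conv (evn (fun n => c * FT k h (k%:R / Z) n 0 / n`!%:R)) (mt Z k) n.
Proof.
move=> k0 rZ kg er w0 c0 hc u K0.
have Z0 := Re_gt0_neq0 rZ.
have kR := natR_gt0 R k0.
have kC := natC_neq0 R k0.
set tau := (h%:R + iC * Z) / k%:R.
have tauE : h%:R / k%:R + iC * Z / k%:R = tau by rewrite -mulrDl.
set q := e2pi tau; pose q' := e2pi ((h'%:R + iC / Z) / k%:R).
have K00 : K0 != 0 by rewrite mulf_neq0 ?e2pi_neq0// mulf_neq0// csq_neq0.
have rW : 0 < Re (k%:R / Z : C).
  by rewrite -[k%:R](rmorph_nat (real_complex R)) cReM /= mul0r subr0 mulr_gt0// Re_inv_gt0.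
have q1 : cabs q < 1 by apply: cabs_e2pi_lt1; rewrite Im_tau divr_gt0.
have q'1 : cabs q' < 1.
  apply: cabs_e2pi_lt1; rewrite -[iC / Z]/(iC * Z^-1) Im_tau divr_gt0// Re_inv_gt0//.
have Bc : ccont (Bq q 0) 0 by apply: cdiff_ccont (tower_Bq q1 _ _); rewrite cabs0.
have B0 : Bq q 0 0 != 0 by rewrite Bq00 ?e2pi_neq0// expf_neq0// qq_neq0.
have e0 : 0 < cabs (Bq q 0 0) / 2 by rewrite divr_gt0// cabs_gt0.
have [d1 d10 Hd1] := Bc _ e0.
(* The disc has to avoid the zeros of [Bq q 0], keep the sign in [psi] constant (1/5 is below the
   1/4 needed), and be mapped into the unit disc by [z -> lam * z]. *)
pose lam : C := iC / Z; pose d2 := Num.min d1 (Num.min 1 (Re Z / k%:R / 5)).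
pose dl := Num.min d2 (1 + cabs lam)^-1.
have l1 : 0 < 1 + cabs lam by rewrite ltr_wpDr// cabs_ge0.
have dl0 : 0 < dl by rewrite /dl /d2 !lt_min d10 ltr01 invr_gt0 l1 divr_gt0// divr_gt0.
have dld1 : dl <= d1 by rewrite /dl /d2 !ge_min lexx.
have dl1 : dl <= 1 by rewrite /dl /d2 !ge_min lexx !orbT.
have dlZ : dl <= Re Z / k%:R / 5 by rewrite /dl /d2 !ge_min lexx !orbT.
have dllam : cabs lam * dl <= 1.
  have : dl <= (1 + cabs lam)^-1 by rewrite /dl ge_min lexx orbT.
  by rewrite -[_^-1]mul1r ler_pdivlMr//; move: dl0; clear; move: dl (cabs lam) => a b; nra.
have Bnz z : cabs z < dl -> Bq q 0 z != 0.
  move=> hz; have := Hd1 z; rewrite subr0 => /(_ (lt_le_trans hz dld1)); apply: contraTneq => ->.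
  by rewrite sub0r cabsN -ltNge; move: e0; move: (cabs _) => a; clear; lra.
have hz4 z : cabs z < dl -> 4 * `|Im z| < Re Z / k%:R.
  move=> hz; have h1 := ge_Im_cabs z; have h2 := normr_ge0 (Im z).
  by move: h1 h2 hz dlZ; clear; clearbody dl; move: (Re Z / _) `|_| (cabs z) dl => a b x y; lra.
pose U := towerM (fun n z => e2pi (- (tau / 12)) * qpoch q q * FT k h (k%:R / Z) n z) (towerV (Bq q)).
have tU : tower dl U.
  apply: tower_mul; first by apply: tower_scale; apply: tower_FT => //; exact: ltW.
  by apply: tower_inv => //; apply: tower_le (tower_Bq q1).
have U0 z : cabs z < dl -> U1 z tau = U 0%N z.
  move=> hz; have := U1_Bq k0 rZ (hz4 z hz) (Bnz z hz).
  rewrite /U /towerM big_ord1 bin0 mul1r /towerV /= expr1 mul1r => H.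
  by move: H; rewrite -/tau -/q => <-; rewrite mulfK ?Bnz.
have uE n : u n = jet U n.
  rewrite /u /jet tauE (@cderiv_tower _ dl U) ?cabs0//; exact: U0.
pose S' n z := lam ^+ n * sthT n (lam * z); pose B' n z := lam ^+ n * Bq q' n (lam * z).
have tS : tower dl S' by apply: (@tower_lin _ 1) => //; exact: tower_sthT.
have tB : tower dl B' by apply: (@tower_lin _ 1) => //; exact: tower_Bq.
pose L := towerM (fun n z => K0 * U n z) (towerM S' B').
pose Rr := towerM (fun n z => qpoch q' q' * (c * FT k h (k%:R / Z) n z)) (towerM sthT (phi (- (k%:R / Z)))).
have tL : tower dl L by apply: tower_mul; [exact: tower_scale|exact: tower_mul].
have tR : tower dl Rr.
  apply: tower_mul; last by apply: tower_mul; [exact: tower_sthT|exact: tower_phi].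
  by do 2 apply: tower_scale; apply: tower_FT => //; exact: ltW.
have LR z : cabs z < dl -> L 0%N z = Rr 0%N z.
  move=> hz; have := U1_relation k0 rZ kg er c0 hc (hz4 z hz) (Bnz z hz).
  rewrite /= -/tau -/q' -/lam (U0 z hz) => E.
  have s0 y : sthT 0 y = sth y by rewrite /sthT /sth !expr0 !mul1r mulN1r.
  rewrite /L /Rr /towerM !big_ord1 !bin0 !mul1r /S' /B' !expr0 !mul1r !s0 /phi /= hornerC mul1r.
  by move: E; rewrite -/K0; move: (gE _ _) => G; rewrite (mulrC K0).
have J n : jet L n = jet Rr n by rewrite /jet (@tower_eq _ dl L Rr n 0 tL tR LR)// cabs0.
have eB : evs (fun n => lam ^+ n * Bq q' n 0 / n`!%:R).
  by move=> n on; rewrite Bq_odd// mulr0 mul0r.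
pose t : C := - (2 * (pi : R)%:C) / Z.
have p0 := piC_neq0 R.
have t0 : t != 0 by rewrite mulf_neq0 ?invr_eq0// oppr_eq0 mulf_neq0// pnatr_eq0.
apply: jets_relation K00 (qq_neq0 q'1) t0 eB _ => n.
have jS : jet S' = sg (t / 2).
  apply/funext => m; rewrite /jet /S' mulr0 jet_sthT; congr sg.
  by rewrite /lam /t /ipi mulrA; transitivity ((iC * iC) * (pi : R)%:C / Z); [field|rewrite iC_sqr; field].
have jB : jet B' = fun n => lam ^+ n * Bq q' n 0 / n`!%:R by apply/funext => m; rewrite /jet /B' mulr0.
have js : jet sthT = sg ipi.
  by apply/funext => m; have := jet_sthT 1 m; rewrite expr1n !mul1r.
have jp : jet (phi (- (k%:R / Z))) = ge ((pi : R)%:C * (k%:R / Z)) by apply/funext => m; exact: jet_gE.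
have jm F G : jet (towerM F G) = conv (jet F) (jet G) by apply/funext => m; exact: jet_mul.
have jz (a : C) F : jet (fun n z => a * F n z) = fun n => a * jet F n.
  by apply/funext => m; rewrite /jet mulrA.
have uE' : u = jet U by apply/funext.
have EL : jet L = conv (fun n => K0 * u n) (conv (sg (t / 2)) (fun n => lam ^+ n * Bq q' n 0 / n`!%:R)).
  by rewrite uE' -jS -jB -jm -jz -jm.
have ER : jet Rr = conv (fun n => qpoch q' q' * (c * FT k h (k%:R / Z) n 0 / n`!%:R))
    (conv (sg ipi) (ge ((pi : R)%:C * (k%:R / Z)))).
  by rewrite -js -jp -jm /Rr jm jz.
have := J n; rewrite EL ER; apply.
Qed.

End TaylorRelation.

(** * Bounds for the factors of the relation *)

Section AssemblyBounds.
Variable R : realType.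
Local Notation C := R[i].
Local Notation beta := (@beta R).
Local Notation errlog := (@errlog R).
Implicit Types (z w Z Y c : C) (k h p n : nat).

Lemma Re_kinv k Z : (0 < k)%N -> Re (k%:R * Z)^-1 = Re Z^-1 / k%:R.
Proof.
by move=> k0; rewrite invfM -(rmorph_nat (real_complex R)) -fmorphV cReM /= mul0r subr0 mulrC.
Qed.

(** [gauss_fourier] turns [c * gf R k h] into the transform [av] of [gf R k h'], and [ftb n] is
    [2 * k] times the frequency [iC * tn k n]; hence the factor [(2 * k) ^ p]. *)
Lemma FT_Seps k h h' Z c p : (0 < k)%N -> 0 < Re Z ->
  (forall n : int, c * gf R k h n = \sum_(v < k) gf R k h' v%:Z * chn R k n v%:Z) ->
  c * FT k h (k%:R / Z) p 0 = (2 * k)%:R ^+ p * cser (Seps (k%:R * Z)^-1 p k (gf R k h') 0).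
Proof.
move=> k0 rZ hc; have Z0 := Re_gt0_neq0 rZ.
have kC := natC_neq0 R k0.
have k2 : ((2 * k)%:R ^+ p : C) != 0 by rewrite expf_neq0// pnatr_eq0 muln_eq0 negb_or /= -lt0n.
have p0 := piC_neq0 R.
have rW : 0 < Re (k%:R / Z : C).
  by rewrite -[k%:R](rmorph_nat (real_complex R)) cReM /= mul0r subr0 mulr_gt0 ?ltr0n// Re_inv_gt0.
pose a n := fta k h (k%:R / Z) n * ftb R n ^+ p * cexp (ftb R n * 0).
have sa : csummable a.
  apply: csummable_le (fta_summable k h p rW (lexx 0)) => n.
  by rewrite /a !mulr0 cexp0 mulr1 expR0 mulr1 cabsM cabsX.
have -> : cser (Seps (k%:R * Z)^-1 p k (gf R k h') 0) = cser (fun n => c / (2 * k)%:R ^+ p * a n).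
  apply: eq_cser => n; rewrite /Seps /a !mulr0 cexp0 !mulr1 /av -hc /fta.
  have -> : ftb R n = (2 * k)%:R * (iC * (tn R k n)%:C).
    rewrite /ftb /tn halfint_nat !rmorphM fmorphV /= !rmorph_nat natrM /ipi.
    by move: ((n%:R + 2^-1)%:C) => m; field.
  have -> : (iC * (tn R k n)%:C) ^+ 2 / (4 * ((pi : R)%:C * (k%:R * Z)^-1)) =
     - ((pi : R)%:C / (k%:R / Z)) * (halfint R n%:Z)%:C ^+ 2 :> C.
    rewrite /tn halfint_nat !rmorphM fmorphV /= !rmorph_nat.
    move: ((n%:R + 2^-1)%:C) p0 kC => m; move: ((pi : R)%:C : C) (k%:R : C) => P κ p0 kC.
    transitivity ((iC * iC) * (P / (κ / Z)) * m ^+ 2); last by rewrite iC_sqr; ring.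
    by field; do ?(apply/andP; split).
  rewrite (exprMn p (2 * k)%:R (iC * (tn R k n)%:C)).
  by move: ((2 * k)%:R ^+ p) k2 ((iC * _) ^+ p) (gf _ _ _ _) (cexp _) => x x0 y g e; field.
by rewrite cserZ// /FT mulrA mulrCA mulfV// mulr1.
Qed.

Lemma chi_ge1 (M : 'M[int]_2) : chi R M != 0 -> 1 <= cabs (chi R M).
Proof.
have E (j i : int) : (j%:~R : C) * cexp (ipi / 12 * i%:~R) != 0 -> 1 <= cabs ((j%:~R : C) * cexp (ipi / 12 * i%:~R)).
  rewrite mulf_eq0 negb_or intr_eq0 => /andP[j0 _]; rewrite cabsM cabs_cexp.
  have -> : ipi / 12 * i%:~R = iC * (pi / 12 * i%:~R)%:C :> C.
    by rewrite !rmorphM fmorphV /= rmorph_int rmorph_nat /ipi !mulrA.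
  rewrite cReM /= mul0r mul1r subrr expR0 mulr1 -(rmorph_int (real_complex R)) cabs_real -intr_norm ler1z.
  by rewrite -gtz0_ge1 normr_gt0.
by rewrite /chi; case: ifP => _; exact: E.
Qed.

(** Read off from the transformation of eta at [Z = 1], since eta has no zeros; no symbol is
    computed. *)
Lemma chi_neq0 k h : (0 < k)%N -> coprime h k -> chi R (Mhk h k) != 0.
Proof.
move=> k0 hk; have := @eta_Mhk R _ _ k0 hk 1; rewrite /= ltr01 => /(_ isT); apply: contra_eq_neq => ->.
rewrite !mul0r /Defs.eta mulf_neq0 ?e2pi_neq0// qq_neq0// cabs_e2pi_lt1//.
have := @Im_tau R k (neg_inv h k) 1^-1; rewrite -pmulrn => ->.
by rewrite invr1 /= divr_gt0// ltr0n.
Qed.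

(** [expR (pi / 4) >= 3 / 2], and the fourth power of 3/2 is 81/16, above 5. *)
Lemma expRN_pi : expR (- pi) <= 5^-1 :> R.
Proof.
have p4 : 3 / 2 <= expR (pi / 4) :> R by have := expR_ge1Dx (pi / 4 : R); have := pi_ge2 R; lra.
have E : expR pi = expR (pi / 4) ^+ 4 :> R by rewrite -expRM_natl; congr expR; field.
rewrite expRN lef_pV2 ?posrE ?expR_gt0// E.
by apply: le_trans (lerXn2r 4 _ _ p4); rewrite ?nnegrE ?expR_ge0//; lra.
Qed.

Lemma cabs_q' k h' Z : (0 < k)%N -> k%:R / 2 <= Re Z^-1 ->
  let q := e2pi ((h'%:R + iC / Z) / k%:R) in
  cabs q = expR (- (2 * pi * Re (k%:R * Z)^-1)) /\ cabs q <= 5^-1.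
Proof.
move=> k0 hZ q; have kR := natR_gt0 R k0.
have E : cabs q = expR (- (2 * pi * Re (k%:R * Z)^-1)).
  by rewrite /q cabs_e2pi -[iC / Z]/(iC * Z^-1) Im_tau Re_kinv// mulNr.
split=> //; rewrite E; apply: le_trans expRN_pi; rewrite ler_expR lerN2 Re_kinv//.
have h2 : 2^-1 <= Re Z^-1 / k%:R by rewrite ler_pdivlMr// mulrC.
by move: (_ / _) h2 (pi_ge0 R) => y; move: (pi) => p; clear; nra.
Qed.

(** [Bq_bound] compares the series in [q'] with the constant 1 and [qpoch_sub1] handles the
    normalization; each degree carries a factor [i / Z] from the argument [i z / Z]. *)
Lemma bt_bound : exists2 B : nat -> R, (forall n, 0 <= B n) &
  forall k h' Z, (0 < k)%N -> k%:R / 2 <= Re Z^-1 ->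
  4^-1 <= cabs (bt Z h' k 0) /\
  forall n, cabs (bt Z h' k n - dlt R n) <= B n * cabs (e2pi ((h'%:R + iC / Z) / k%:R)) * cabs Z^-1 ^+ n.
Proof.
have /choice[D HD] : forall p, exists D : R, 0 <= D /\ forall q : C, cabs q <= 5^-1 ->
   cabs (Bq q p 0 - (p == 0%N)%:R) <= D * cabs q.
  by move=> p; have [D D0 H] := @Bq_bound R p; exists D.
exists (fun n => 2 * (D n + 2)) => [n|k h' Z k0 hZ]; first by rewrite mulr_ge0// addr_ge0//; case: (HD n).
have [_ q5] := cabs_q' h' k0 hZ; set q := e2pi _ in q5 *.
have [hq hq2] := qpoch_sub1 q5; set P := qpoch q q in hq hq2.
have q1 : cabs q < 1 by apply: le_lt_trans q5 _; rewrite invf_lt1// ltr1n.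
have P0 : P != 0 by rewrite -cabs_gt0; apply: lt_le_trans hq2; rewrite invr_gt0.
have iP : cabs P^-1 <= 2 by rewrite cabsV -[2]invrK lef_pV2// posrE// cabs_gt0.
split.
  rewrite /bt -/q -/P expr0 fact0 divr1 mul1r Bq00 ?e2pi_neq0// -/P exprS mulKf// cabsX.
  by move: (cabs P) hq2; clear => x; nra.
move=> n; have [D0 H] := HD n; have {H} := H q q5.
have -> : bt Z h' k n - dlt R n = (P^-1 * ((iC / Z) ^+ n / n`!%:R)) * (Bq q n 0 - (n == 0%N)%:R * P).
  rewrite /bt -/q -/P /dlt mulrBr; congr (_ - _).
    by move: (_ ^+ _) (P^-1) (_^-1) => x y t; ring.
  case: n {D0} => [|n]; last by rewrite mul0r mulr0.
  by rewrite expr0 fact0 eqxx !mul1r invr1 mulr1 mulVf.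
move=> H; have h1 : cabs (Bq q n 0 - (n == 0%N)%:R * P) <= (D n + 2) * cabs q.
  have -> : Bq q n 0 - (n == 0%N)%:R * P = (Bq q n 0 - (n == 0%N)%:R) - (n == 0%N)%:R * (P - 1).
    by move: (_%:R) => b; ring.
  apply: le_trans (cabsD _ _) _; rewrite cabsN mulrDl; apply: lerD => //.
  case: (n == 0%N); first by rewrite mul1r.
  by rewrite mul0r cabs0 mulr_ge0 ?cabs_ge0.
have h2 : cabs (P^-1 * ((iC / Z) ^+ n / n`!%:R)) <= 2 * cabs Z^-1 ^+ n.
  apply: cabsM_le iP _; rewrite cabsM cabsX cabsM cabs_iC mul1r -[leRHS]mulr1.
  apply: ler_wpM2l; first by rewrite exprn_ge0 ?cabs_ge0.
  by rewrite cabsV cabs_nat invf_le1 ?ltr0n ?fact_gt0// ler1n fact_gt0.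
have := cabsM_le h2 h1; move: (cabs (_ * _)) (cabs Z^-1 ^+ n) (D n) (cabs q) => a b d e.
by have -> : 2 * b * ((d + 2) * e) = 2 * (d + 2) * e * b by ring.
Qed.

(** Powers of [k] can thus be charged to powers of [1 / |Z|], and [1 / |Z|] is bounded below. *)
Lemma cabs_Zinv_ge k Z : (0 < k)%N -> k%:R / 2 <= Re Z^-1 ->
  k%:R <= 2 * cabs Z^-1 /\ 1 <= 2 * cabs Z^-1.
Proof.
move=> k0 hZ; have h := le_trans (ler_norm _) (ge_Re_cabs Z^-1).
have k1 : (1 : R) <= k%:R by rewrite ler1n.
by move: hZ h k1; move: (Re _) (cabs _) (k%:R) => a b c; clear; split; lra.
Qed.

(** [t^-1] is of size [|Z|], which is the factor [(cabs Z^-1)^-1]. The Gaussian coefficient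
    [pi k / Z] is of order [|Z|^(-2)] and comes with [z^2], so every degree costs one [1 / |Z|]. *)
Lemma mt_bound : exists2 M : nat -> R, (forall n, 0 <= M n) & forall k Z, (0 < k)%N ->
  k%:R / 2 <= Re Z^-1 -> forall n, cabs (mt Z k n) <= M n * (cabs Z^-1)^-1 * cabs Z^-1 ^+ n.
Proof.
have p0 := pi_ge0 R.
pose U1 n : R := 2 * pi ^+ n.+1 * 2 ^+ n.
pose U2 n : R := (2 * pi) ^+ n./2.
pose U3 n : R := (2 * pi)^-1 * `|(bernoulli_poly R n).[2^-1]| * (2 * pi) ^+ n / n`!%:R.
have U10 n : 0 <= U1 n by rewrite /U1 !mulr_ge0 ?exprn_ge0.
have U20 n : 0 <= U2 n by rewrite exprn_ge0// mulr_ge0.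
have U30 n : 0 <= U3 n by rewrite /U3 !mulr_ge0 ?invr_ge0 ?exprn_ge0// mulr_ge0.
pose U4 n := \sum_(i < n.+1) U2 i * U3 (n - i)%N.
exists (fun n => \sum_(i < n.+1) U1 i * U4 (n - i)%N) => [n|k Z k0 hZ n].
  by apply: sumr_ge0 => i _; rewrite mulr_ge0//; apply: sumr_ge0 => j _; rewrite mulr_ge0.
have [kX X1] := cabs_Zinv_ge k0 hZ; set X := cabs Z^-1 in kX X1 *.
have X0 : 0 < X by move: X1; clear; lra.
have i0 m : 0 <= (m`!%:R)^-1 :> R by rewrite invr_ge0.
have i1 m : (m`!%:R)^-1 <= 1 :> R by rewrite invf_le1 ?ltr0n ?fact_gt0// ler1n fact_gt0.
have cf m : cabs ((m`!%:R)^-1 : C) = (m`!%:R)^-1 by rewrite cabsV cabs_nat.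
have cpi : cabs (ipi : C) = pi by rewrite /ipi cabsM cabs_iC mul1r cabs_real ger0_norm.
have h1 m : cabs (sh (sg (ipi : C)) m) <= U1 m * 1 * X ^+ m.
  have [om|em] := boolP (odd m).
    by rewrite evs_sh_sg// cabs0 mulr1 mulr_ge0// exprn_ge0// ltW.
  rewrite sh_sg_even// 2!cabsM cf cabs_nat cabsX cpi mulr1 /U1 -[leRHS]mulrA -exprMn.
  apply: ler_pM => //; [by rewrite mulr_ge0 ?exprn_ge0|].
  by apply: le_trans (i1 _) _; apply: exprn_ege1.
have h2 m : cabs (ge ((pi : R)%:C * (k%:R / Z)) m) <= U2 m * 1 * X ^+ m.
  rewrite /ge; case: ifP => om; first by rewrite cabs0 mulr1 mulr_ge0// exprn_ge0// ltW.
  have XE : X ^+ m = (X * X) ^+ m./2 by rewrite -expr2 -exprM mul2n -{1}(odd_double_half m) om.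
  rewrite cabsM cf cabsX 2!cabsM cabs_real ger0_norm// cabs_nat -/X mulr1 XE /U2 -exprMn.
  rewrite -[leRHS]mulr1; apply: ler_pM => //; first by rewrite exprn_ge0// !mulr_ge0// ltW.
  apply: lerXn2r; rewrite ?nnegrE ?mulr_ge0 ?(ltW X0)//.
  have : 0 <= pi * X * (2 * X - k%:R) by rewrite mulr_ge0 ?subr_ge0// mulr_ge0// ltW.
  by clear; move: (k%:R) X pi => a x p; lra.
pose t : C := - (2 * (pi : R)%:C) / Z.
have ct : cabs t = 2 * pi * X by rewrite /t cabsM cabsN cabsM cabs_nat cabs_real ger0_norm.
have h3 m : cabs (t^-1 * bs t m) <= U3 m * X^-1 * X ^+ m.
  rewrite /bs cabsM 2!cabsM cf cabsV cabsX cabs_real ct /U3 exprMn invfM.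
  move: (_^-1) (X^-1) `|_| (_ ^+ m) (X ^+ m) (_^-1) => a b d e f g.
  by apply: eq_ler; ring.
have h4 m : cabs (conv (ge ((pi : R)%:C * (k%:R / Z))) (fun n => t^-1 * bs t n) m) <= U4 m * X^-1 * X ^+ m.
  by have := conv_bound m (ltW X0) h2 h3; rewrite mul1r.
by have := conv_bound n (ltW X0) h1 h4; rewrite mul1r.
Qed.

Lemma main_integral_bound p : exists2 D : R, 0 <= D & forall k (g : int -> C) Y, (0 < k)%N ->
  (forall n : int, cabs (g n) <= 1) -> 2^-1 <= Re Y ->
  cabs (integ (- beta) beta (fun z => phi Y 0 z * Kd k g p 0 z)) <= D * (k%:R * errlog k).
Proof.
have [D D0 HD] := @Kd_bound R p; exists D => // k g Y k0 g1 hY.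
have b0 := ltW (beta_gt0 R); have bb : - beta <= beta by rewrite ge0_cp.
have el := errlog_ge0 R k0.
have cF : segc (- beta) beta (fun z => phi Y 0 z * Kd k g p 0 z).
  by apply: segcM; [exact: segc_phi|exact: segc_Kd].
apply: le_trans (@cint_bound R _ _ _ (D * k%:R * errlog k) bb cF _) _.
  move=> x hx; have nx : `|x| <= beta by rewrite ler_norml.
  rewrite -[leRHS]mul1r; apply: cabsM_le; last exact: HD k g 0 x k0 g1 nx.
  rewrite /phi /= hornerC mul1r cabs_gE expR_le1 oppr_le0 mulr_ge0 ?sqr_ge0// mulr_ge0 ?pi_ge0//.
  by apply: le_trans hY; rewrite invr_ge0.
rewrite mulrA -[leRHS]mulr1; apply: ler_wpM2l; first by rewrite mulr_ge0// mulr_ge0.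
by have := beta_lt R; lra.
Qed.

Lemma Seps_bound p : ~~ odd p -> exists2 D : R, 0 <= D & forall k (g : int -> C) Y, (0 < k)%N ->
  (forall n : int, g (n + k%:Z) = - g n) -> (forall n : int, cabs (g n) <= 1) -> 2^-1 <= Re Y ->
  cabs (cser (Seps Y p k g 0)) <= D * (cabs (csq Y) * (k%:R * errlog k) * cabs Y ^+ p).
Proof.
move=> ep; have [D D0 HD] := @false_theta_asymp R p ep; have [E E0 HE] := main_integral_bound p.
exists (D + E * 2 ^+ p) => [|k g Y k0 ga g1 hY]; first by rewrite addr_ge0// mulr_ge0// exprn_ge0.
have := HD Y k g k0 ga g1 hY; have := HE k g Y k0 g1 hY; move: (cint _ _ _) (cser _) => I S hI hS.
have el := errlog_ge0 R k0.
have kel : 0 <= k%:R * errlog k by rewrite mulr_ge0.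
have Y2 : 1 <= (2 * cabs Y) ^+ p.
  by apply: exprn_ege1; have := cabs_ge_half hY; move: (cabs Y) => y; clear; lra.
have s0 := cabs_ge0 (csq Y); have y0 : 0 <= cabs Y ^+ p by rewrite exprn_ge0// cabs_ge0.
have e1 : expR (- (pi * Re Y / 6)) <= 1.
  by rewrite expR_le1 oppr_le0 divr_ge0// mulr_ge0 ?pi_ge0// (le_trans _ hY)// invr_ge0.
have -> : S = S - csq Y * (iC / 4 * I) + csq Y * (iC / 4 * I) by rewrite subrK.
apply: le_trans (cabsD _ _) _; rewrite mulrDl; apply: lerD.
  apply: le_trans hS _; apply: ler_wpM2l => //; rewrite -[leRHS]mulrA; apply: ler_wpM2l => //.
  by rewrite -[leRHS]mulr1; apply: ler_wpM2l => //; exact: mulr_ge0.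
have h4 : cabs (iC / 4 * I) <= 1 * (E * (k%:R * errlog k)).
  apply: cabsM_le hI; rewrite cabsM cabs_iC cabsV cabs_nat mul1r invf_le1//.
  by rewrite ler1n.
rewrite cabsM; apply: le_trans (ler_wpM2l s0 h4) _; rewrite mul1r exprMn in Y2 *.
move: Y2 y0 s0 E0 kel; move: (cabs (csq Y)) (k%:R * errlog k) (2 ^+ p) (cabs Y ^+ p) => a b d e Y2 y0 a0 E0 b0.
have -> : E * d * (a * b * e) = a * (E * b) * (d * e) by ring.
by rewrite -[leLHS]mulr1; apply: ler_wpM2l => //; apply: mulr_ge0 => //; exact: mulr_ge0.
Qed.

End AssemblyBounds.

(** * The main term of the theorem in terms of the central integral *)

Section Assembly.
Variable R : realType.
Local Notation C := R[i].
Local Notation beta := (@beta R).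
Local Notation errlog := (@errlog R).
Implicit Types (z w Z Y c : C) (k h p n l : nat).

(** The scalar identity left once sums and integrals agree: [x] is the multiplier, [ck] and [s] the
    roots of [k] and [Z], [e] the eighth root of unity of [eta_Mhk], [T] the factor
    [e(- tau' / 12)], and [w] the root of 6. *)
Lemma main_scalar (F : fieldType) (i P x ck s T e w : F) : i * i = -1 -> 2 != 0 :> F -> x != 0 -> ck != 0 ->
  s != 0 -> e != 0 -> w != 0 ->
  P * - e^-1 / (4 * w * (ck * ck)) * x^-1 * (T * s) =
  (ck * (x * e) * T^-1)^-1 * (- i * (s * s)) * ((ck * s)^-1 * (i / 4 * (- P * w^-1))).
Proof.
move=> ii n2 x0 ck0 s0 e0 w0; have n4 : 4 != 0 :> F.
  by rewrite (_ : 4 = 2 * 2) ?mulf_neq0// -natrM.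
have [->|T0] := eqVneq T 0; first by rewrite invr0 !mulr0 invr0 !mul0r mulr0.
transitivity ((i * i) * ((ck * (x * e) * T^-1)^-1 * (s * s) * ((ck * s)^-1 * (4^-1 * (P * w^-1))))).
  by rewrite ii; field; rewrite ?T0 ?n4 ?w0 ?ck0 ?x0 ?s0 ?e0.
by field; rewrite ?T0 ?n4 ?w0 ?ck0 ?x0 ?s0 ?e0.
Qed.

Lemma double_le_even l j : ~~ odd l -> (j < l./2.+1)%N -> (2 * j <= l)%N.
Proof. by move=> el; rewrite ltnS => h; rewrite -(odd_double_half l) (negbTE el) add0n -mul2n leq_mul2l. Qed.

Definition mainJ k h p : C -> C := fun Z =>
  integ (- beta) beta (fun z => phi (k%:R * Z)^-1 0 z * Kd k (gf R k h) p 0 z).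
Definition K0 k h h' Z : C :=
  csq k%:R * (chi R (Mhk h k) * cexp (ipi / 4)) * e2pi ((h'%:R + iC / Z) / k%:R / 12).

Lemma main_term l k h Z : ~~ odd l -> (0 < k)%N -> coprime h k -> 0 < Re Z ->
  let h' := neg_inv h k in
  (2 * ipi) ^+ l * cpow iC (3 / 2) / (4 * (Num.sqrt 6)%:C * k%:R) * (chi R (Mhk h k))^-1 *
  \sum_(nu < 2 * k)
    (-1) ^+ nu * cexp (ipi * h'%:R / (12 * k%:R) * (12 * nu%:R * (nu%:R + 1) + 1)) *
    \sum_(j < l./2.+1) ('C(l, 2 * j))%:R *
      (\sum_(a < j.+1) \sum_(b < j.+1) \sum_(c < j.+1 | (a + b + c == j)%N)
         k%:R ^+ a * (kappa R a b c)%:C * cpow Z (2^-1 - a%:R - 2 * c%:R)) *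
      cint (-1) 1 (fun x : R => Ccot (l - 2 * j) ((2 * k%:R)^-1 * ((x / Num.sqrt 6)%:C - nu%:R - 2^-1)) *
        cexp ((pi : R)%:C / (6 * k%:R * Z) * (1 - x ^+ 2)%:C)) =
  (K0 k h h' Z)^-1 * \sum_(j < l./2.+1) ('C(l, 2 * j) * (2 * j)`!)%:R * mt Z k (2 * j) *
    ((2 * k)%:R ^+ (l - 2 * j) * (csq (k%:R * Z)^-1 * (iC / 4 * mainJ k h' (l - 2 * j) Z))).
Proof.
move=> el k0 hk rZ h'; have Z0 := Re_gt0_neq0 rZ.
have kC := natC_neq0 R k0.
have [g kg] := neg_inv_spec k0 hk.
have ga := gf_anti R k0 (cop_odd_r kg); rewrite -/h' in ga.
have gp (n : int) : gf R k h' (n + (2 * k)%N%:Z) = gf R k h' n.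
  by rewrite mul2n -addnn PoszD addrA !ga opprK.
have go := gf_odd R h' k0.
pose E := cexp ((pi : R)%:C / (6 * k%:R * Z)); pose G0 := cexp (- (ipi * h'%:R / (6 * k%:R))) : C.
pose s := csq Z; pose I p := \sum_(v < 2 * k) gf R k h' v%:Z * mainI k (k%:R * Z)^-1 p v.
pose Sz j := \sum_(a < j.+1) \sum_(b < j.+1) \sum_(c < j.+1 | (a + b + c == j)%N)
   k%:R ^+ a * (kappa R a b c)%:C / Z ^+ (a + 2 * c).
have EJ p : mainJ k h' p Z = - (ipi / k%:R) ^+ p * (Num.sqrt 6)^-1%:C * I p by exact: main_integral.
have Em j : (2 * j)`!%:R * mt Z k (2 * j) = - iC * Z * (2 * ipi) ^+ (2 * j) * Sz j by exact: m_even.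
have ES j : \sum_(a < j.+1) \sum_(b < j.+1) \sum_(c < j.+1 | (a + b + c == j)%N)
         k%:R ^+ a * (kappa R a b c)%:C * cpow Z (2^-1 - a%:R - 2 * c%:R) = s * Sz j.
  rewrite /Sz mulr_sumr; apply: eq_bigr => a _; rewrite mulr_sumr; apply: eq_bigr => b _.
  rewrite mulr_sumr; apply: eq_bigr => c _.
  have -> : 2^-1 - a%:R - 2 * c%:R = 2^-1 - (a + 2 * c)%:R :> C by rewrite natrD natrM opprD addrA.
  by rewrite cpow_half_sub// -/s mulrCA.
have EG (v : nat) : (-1) ^+ v * cexp (ipi * h'%:R / (12 * k%:R) * (12 * v%:R * (v%:R + 1) + 1)) = G0 * gf R k h' v%:Z.
  have -> : (-1) ^+ v = cexp (ipi * v%:R) :> C.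
    elim: v => [|v IH]; first by rewrite mulr0 cexp0.
    by rewrite exprSr -natr1 mulrDr cexpD IH mulr1 cexp_ipi.
  rewrite /G0 /gf -!cexpD halfint_nat -pmulrn; congr cexp.
  rewrite rmorphD fmorphV /= !rmorph_nat; move: (v%:R : C) (h'%:R : C) (ipi : C) (k%:R : C) kC => V H P K Kn; field.
  exact: Kn.
(* The constant [exp (pi / (6 k Z))] of the main integral and the phase left from completing the
   square in [nu] are together [e(- tau' / 12)], the factor contributed by eta. *)
have ET : E * G0 = e2pi (- ((h'%:R + iC / Z) / k%:R / 12)).
  rewrite /E /G0 /e2pi -cexpD; congr cexp; rewrite /ipi.
  move: (h'%:R : C) ((pi : R)%:C : C) (k%:R : C) kC => H P K Kn.
  transitivity (- (iC * iC) * P / (6 * K * Z) - iC * P * H / (6 * K)); first by rewrite iC_sqr opprK mul1r.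
  by field; rewrite Kn Z0.
have cp : cpow iC (3 / 2) = - (cexp (ipi / 4))^-1 :> C.
  rewrite /cpow clog_iC -cexpN -[RHS]mulN1r -cexp_ipi -cexpD; congr cexp; by field.
have sk : csq (k%:R * Z)^-1 = (csq k%:R * s)^-1.
  have rk : 0 < Re (k%:R : C) by rewrite -(rmorph_nat (real_complex R)) ltr0n.
  by rewrite csq_inv ?csq_mul// -(rmorph_nat (real_complex R)) cReM /= mul0r subr0 mulr_gt0// ltr0n.
have ks : csq k%:R * csq k%:R = k%:R :> C by rewrite -expr2 csq_sqr.
have ss : s * s = Z by rewrite -expr2 csq_sqr.
have w6 : (Num.sqrt 6)%:C != 0 :> C by rewrite -cabs_gt0 cabs_real normr_gt0 sqrtr_eq0 -ltNge.
set P := (2 * ipi) ^+ l * _ / _ / _; set S := (X in P * X = _).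
have -> : S = E * G0 * s * \sum_(j < l./2.+1) ('C(l, 2 * j))%:R * Sz j * I (l - 2 * j)%N.
  rewrite /S mulr_sumr; under eq_bigr => v _ do rewrite EG mulr_sumr.
  rewrite exchange_big /=; apply: eq_bigr => j _; rewrite /I [RHS]mulrA [RHS]mulr_sumr; apply: eq_bigr => v _.
  rewrite ES mainI_exp// -/E; clearbody E G0 s.
  move: (mainI _ _ _ _) (gf _ _ _ _) (Sz j) ('C(_, _)%:R) => a b c d; ring.
rewrite ET mulrA mulr_sumr mulr_sumr; apply: eq_bigr => j _; rewrite {S}/P.
have jl : (2 * j <= l)%N.
  exact: double_le_even el (ltn_ord j).
rewrite EJ natrM -[X in _ = _ * (X * _)]mulrA Em sk cp e2piN /K0.
have -> : (2 * ipi) ^+ l = (2 * ipi) ^+ (2 * j) * ((2 * k)%:R ^+ (l - 2 * j) * (ipi / k%:R) ^+ (l - 2 * j)) :> C.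
  rewrite -exprMn natrM (_ : 2 * k%:R * (ipi / k%:R) = 2 * ipi); first by rewrite -exprD subnKC.
  by move: (ipi : C) => P; field.
have := @main_scalar _ iC ((2 * ipi) ^+ (2 * j) * ((2 * k)%:R ^+ (l - 2 * j) * (ipi / k%:R) ^+ (l - 2 * j)))
   (chi R (Mhk h k)) (csq k%:R) s (e2pi ((h'%:R + iC / Z) / k%:R / 12))^-1 (cexp (ipi / 4)) (Num.sqrt 6)%:C
   (iC_sqr R) _ (chi_neq0 R k0 hk) (csq_neq0 _) (csq_neq0 _) (cexp_neq0 _) w6.
rewrite invrK ks ss pnatr_eq0 => /(_ isT) ->.
rewrite fmorphV; move: ((_)^-1) ((csq k%:R * s)^-1) ((Num.sqrt 6)%:C^-1) ((2 * ipi) ^+ _) ((2 * k)%:R ^+ _) ((ipi / _) ^+ _) => A B D U V W.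
move: (Sz j) (I _) ('C(_, _)%:R) => a b c; ring.
Qed.

End Assembly.

(** * The error terms *)

Section Estimates.
Variable R : realType.
Local Notation C := R[i].
Local Notation errlog := (@errlog R).
Implicit Types (z w Z Y c : C) (k h p n l : nat).

(** The coefficients that [U1] would have with every q-product in [q'] replaced by 1. *)
Definition vt k h Z c n : C :=
  (K0 k h (neg_inv h k) Z)^-1 * conv (evn (fun n => c * FT k h (k%:R / Z) n 0 / n`!%:R)) (mt Z k) n.

(** The price of the eta factor, [exp (pi * Re Y / 6)] with [Y = 1 / (k Z)]. The multiplier does no
    harm: when nonzero it is a nonzero integer times a root of unity. *)
Lemma K0_inv_le k h Z : (0 < k)%N -> coprime h k -> k%:R / 2 <= Re Z^-1 ->
  cabs (K0 k h (neg_inv h k) Z)^-1 <= (Num.sqrt k%:R)^-1 * expR (pi * Re (k%:R * Z)^-1 / 6).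
Proof.
move=> k0 hk hZ; have kR := natR_gt0 R k0.
have kC := natC_neq0 R k0.
have cw : cabs (cexp (ipi / 4) : C) = 1.
  have -> : ipi / 4 = iC * (pi / 4)%:C :> C by rewrite rmorphM fmorphV rmorph_nat /ipi mulrA.
  by rewrite cabs_cexp cReM /= mul0r mul1r subrr expR0.
have ct : cabs (e2pi ((((neg_inv h k)%:R + iC / Z) / k%:R) / 12))^-1 = expR (pi * Re (k%:R * Z)^-1 / 6).
  rewrite cabsV cabs_e2pi -expRN; congr expR.
  have -> z : Im (z / 12) = Im z / 12.
    by rewrite -(rmorph_nat (real_complex R) 12) -fmorphV mulrC cImM /= mul0r addr0 mulrC.
  rewrite -[iC / Z]/(iC * Z^-1) Im_tau Re_kinv//.
  by move: (Re Z^-1 / k%:R) (pi : R) => x p; field.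
rewrite /K0 invfM cabsM ct invfM cabsM; apply: ler_wpM2r; first exact: expR_ge0.
rewrite cabsV cabs_csq// cabs_nat -[leRHS]mulr1; apply: ler_wpM2l; first by rewrite invr_ge0.
by rewrite cabsV cabsM cw mulr1 invf_le1 ?cabs_gt0 ?chi_neq0// chi_ge1// chi_neq0.
Qed.

(** How the powers of [k] cancel: [k^(-1/2)] from [K0], [k * |Y|^(1/2)] from the partial theta
    coefficients and [|Z|] from [mt] leave [|Z|^(1/2)]. *)
Lemma scale_identity k (X : R) : (0 < k)%N -> 0 < X ->
  (Num.sqrt k%:R)^-1 * (Num.sqrt (X / k%:R) * k%:R) * X^-1 = Num.sqrt X^-1.
Proof.
move=> k0 X0; have kR := natR_gt0 R k0.
rewrite sqrtrM ?ltW// !sqrtrV ?ltW//.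
have a0 : 0 < Num.sqrt k%:R :> R by rewrite sqrtr_gt0.
have b0 : 0 < Num.sqrt X by rewrite sqrtr_gt0.
have := sqr_sqrtr (ltW kR); have := sqr_sqrtr (ltW X0); move: (Num.sqrt k%:R) (Num.sqrt X) a0 b0 => a b a0 b0 <- <-.
by field; rewrite !gt_eqF.
Qed.

Lemma fact_div l j : (2 * j <= l)%N -> ('C(l, 2 * j) * (2 * j)`! * (l - 2 * j)`! = l`!)%N.
Proof. by move=> jl; rewrite -mulnA bin_fact. Qed.

Lemma cabs_kinv k Z : cabs (k%:R * Z)^-1 = cabs Z^-1 / k%:R.
Proof. by rewrite cabsV cabsM cabs_nat invfM cabsV mulrC. Qed.

Definition mt_bounded (M : nat -> R) := forall k Z, (0 < k)%N -> k%:R / 2 <= Re Z^-1 ->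
  forall n, cabs (mt Z k n) <= M n * (cabs Z^-1)^-1 * cabs Z^-1 ^+ n.

(** A coarse bound that keeps the full exponential growth of [K0^-1]; it serves only for the
    perturbation in [q'], where a factor [|q'|] is gained. *)
Lemma v_bound (M : nat -> R) : (forall n, 0 <= M n) ->
  mt_bounded M ->
  exists2 V : nat -> R, (forall n, 0 <= V n) & forall k h Z c, (0 < k)%N -> coprime h k ->
    k%:R / 2 <= Re Z^-1 -> 0 < Re Z ->
    (forall n : int, c * gf R k h n = \sum_(v < k) gf R k (neg_inv h k) v%:Z * chn R k n v%:Z) ->
    forall n, cabs (vt k h Z c n)
      <= V n * (errlog k * (Num.sqrt (cabs Z) * expR (pi * Re (k%:R * Z)^-1 / 6))) * cabs Z^-1 ^+ n.
Proof.
move=> M0 HM.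
have /choice[P HP] : forall p, exists D : R, 0 <= D /\ (~~ odd p -> forall k (g : int -> C) Y, (0 < k)%N ->
  (forall n : int, g (n + k%:Z) = - g n) -> (forall n : int, cabs (g n) <= 1) -> 2^-1 <= Re Y ->
  cabs (cser (Seps Y p k g 0)) <= D * (cabs (csq Y) * (k%:R * errlog k) * cabs Y ^+ p)).
  move=> p; have [op|ep] := boolP (odd p); first by exists 0.
  by have [D D0 HD] := Seps_bound R ep; exists D.
exists (fun n => \sum_(i < n.+1) (2 ^+ i * P i) * M (n - i)%N) => [n|k h Z c k0 hk hZ rZ hc n].
  by apply: sumr_ge0 => i _; rewrite mulr_ge0// mulr_ge0 ?exprn_ge0//; case: (HP i).
have [kX X1] := cabs_Zinv_ge k0 hZ; set X := cabs Z^-1 in kX X1 *.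
have X0 : 0 < X by move: X1; clear; lra.
have kR := natR_gt0 R k0.
have kC := natC_neq0 R k0.
have Z0 := Re_gt0_neq0 rZ.
have Y0 : (k%:R * Z)^-1 != 0 by rewrite invr_eq0 mulf_neq0.
have [g kg] := neg_inv_spec k0 hk.
have ga := gf_anti R k0 (cop_odd_r kg).
have g1 (m : int) : cabs (gf R k (neg_inv h k) m) <= 1 by rewrite cabs_gf.
have hY : 2^-1 <= Re (k%:R * Z)^-1 by rewrite Re_kinv// ler_pdivlMr// mulrC.
have el := errlog_ge0 R k0.
have sY : cabs (csq (k%:R * Z)^-1) = Num.sqrt (X / k%:R) by rewrite cabs_csq// cabs_kinv.
pose s0 := Num.sqrt (X / k%:R) * (k%:R * errlog k).
have s00 : 0 <= s0 by rewrite mulr_ge0// mulr_ge0.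
have h1 m : cabs (evn (fun n => c * FT k h (k%:R / Z) n 0 / n`!%:R) m) <= 2 ^+ m * P m * s0 * X ^+ m.
  have [Pm Hm] := HP m; rewrite /evn; case: ifP => om.
    by rewrite cabs0 !mulr_ge0 ?exprn_ge0// ltW.
  have := Hm (negbT om) k _ _ k0 ga g1 hY; rewrite sY cabs_kinv -/X -/s0 => hS.
  rewrite (FT_Seps _ k0 rZ hc) cabsM cabsV cabs_nat -[leRHS]mulr1.
  apply: ler_pM; rewrite ?cabs_ge0 ?invr_ge0//; last first.
    by rewrite invf_le1 ?ltr0n ?fact_gt0// ler1n fact_gt0.
  rewrite cabsM cabsX cabs_nat; apply: le_trans (ler_wpM2l _ hS) _; first exact: exprn_ge0.
  rewrite natrM (exprMn _ 2 k%:R) (exprMn _ X k%:R^-1) exprVn.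
  clearbody s0.
  have := expf_neq0 m (lt0r_neq0 kR); move: (k%:R ^+ m) (2 ^+ m) (X ^+ m) (P m) => a b d f a0.
  by apply: eq_ler; field.
have h2 := HM k Z k0 hZ; rewrite -/X in h2.
have := conv_bound n (ltW X0) h1 h2; have := K0_inv_le k0 hk hZ; rewrite -/X.
rewrite /vt; set S := \sum_(i < n.+1) _ => hK hC; have := cabsM_le hK hC.
set L := cabs _; set E := expR _ => hL; apply: le_trans hL _.
have rX : Num.sqrt (cabs Z) = (Num.sqrt k%:R)^-1 * (Num.sqrt (X / k%:R) * k%:R) * X^-1.
  by rewrite scale_identity// /X cabsV invrK.
rewrite rX /s0; move: ((Num.sqrt (k%:R : R))^-1) (Num.sqrt (X / k%:R)) (X^-1) (X ^+ n) (errlog k) => a b d e f.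
by apply: eq_ler; ring.
Qed.

(** Here the Gaussian at [beta] cancels the growth of [K0^-1] exactly: the errors of
    [false_theta_asymp] carry [exp (- pi * Re Y / 6)]. *)
Lemma main_error l (M : nat -> R) : ~~ odd l -> (forall n, 0 <= M n) ->
  mt_bounded M ->
  exists2 D : R, 0 <= D & forall k h Z c, (0 < k)%N -> coprime h k ->
    k%:R / 2 <= Re Z^-1 -> 0 < Re Z ->
    (forall n : int, c * gf R k h n = \sum_(v < k) gf R k (neg_inv h k) v%:Z * chn R k n v%:Z) ->
    cabs (l`!%:R * vt k h Z c l
     - (K0 k h (neg_inv h k) Z)^-1 * \sum_(j < l./2.+1) ('C(l, 2 * j) * (2 * j)`!)%:R * mt Z k (2 * j) *
    ((2 * k)%:R ^+ (l - 2 * j) * (csq (k%:R * Z)^-1 * (iC / 4 * mainJ k (neg_inv h k) (l - 2 * j) Z))))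
    <= D * (errlog k * Num.sqrt (cabs Z) * cabs Z^-1 ^+ l).
Proof.
move=> el M0 HM.
have /choice[F HF] : forall p, exists D : R, 0 <= D /\ (~~ odd p -> forall Y k (g : int -> C), (0 < k)%N ->
  (forall n : int, g (n + k%:Z) = - g n) -> (forall n : int, cabs (g n) <= 1) -> 2^-1 <= Re Y ->
  cabs (cser (Seps Y p k g 0) - csq Y * (iC / 4 * integ (- @beta R) (@beta R) (fun z => phi Y 0 z * Kd k g p 0 z))) <=
   D * (cabs (csq Y) * (k%:R * errlog k * cabs Y ^+ p * expR (- (pi * Re Y / 6))))).
  move=> p; have [op|ep] := boolP (odd p); first by exists 0.
  by have [D D0 HD] := @false_theta_asymp R p ep; exists D.
exists (\sum_(j < l./2.+1) ('C(l, 2 * j) * (2 * j)`!)%:R * M (2 * j)%N * (2 ^+ (l - 2 * j) * F (l - 2 * j)%N)).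
  by apply: sumr_ge0 => j _; rewrite !mulr_ge0 ?exprn_ge0//; case: (HF (l - 2 * j)%N).
move=> k h Z c k0 hk hZ rZ hc.
have [kX X1] := cabs_Zinv_ge k0 hZ; set X := cabs Z^-1 in kX X1 *.
have X0 : 0 < X by move: X1; clear; lra.
have kR := natR_gt0 R k0.
have kC := natC_neq0 R k0.
have Z0 := Re_gt0_neq0 rZ.
have Y0 : (k%:R * Z)^-1 != 0 by rewrite invr_eq0 mulf_neq0.
have [g kg] := neg_inv_spec k0 hk.
have ga := gf_anti R k0 (cop_odd_r kg).
have g1 (m : int) : cabs (gf R k (neg_inv h k) m) <= 1 by rewrite cabs_gf.
have hY : 2^-1 <= Re (k%:R * Z)^-1 by rewrite Re_kinv// ler_pdivlMr// mulrC.
have eg := errlog_ge0 R k0.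
have sY : cabs (csq (k%:R * Z)^-1) = Num.sqrt (X / k%:R) by rewrite cabs_csq// cabs_kinv.
have p0 := piC_neq0 R.
have em : evs (mt Z k).
  apply: evs_conv; first exact: evs_sh_sg.
  apply: evs_conv; first exact: evs_ge.
  move=> n on; rewrite evs_bs ?mulr0//.
  by rewrite mulf_neq0 ?invr_eq0// oppr_eq0 mulf_neq0// pnatr_eq0.
pose S p := cser (Seps (k%:R * Z)^-1 p k (gf R k (neg_inv h k)) 0).
have vE : l`!%:R * vt k h Z c l =
  (K0 k h (neg_inv h k) Z)^-1 * \sum_(j < l./2.+1) ('C(l, 2 * j) * (2 * j)`!)%:R * mt Z k (2 * j) *
    ((2 * k)%:R ^+ (l - 2 * j) * S (l - 2 * j)%N).
  rewrite /vt mulrCA; congr (_ * _).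
  have l2 : l = (2 * l./2)%N by rewrite -{1}(odd_double_half l) (negbTE el) add0n mul2n.
  rewrite convC {2}l2 conv_double// mulr_sumr; apply: eq_bigr => j _.
  have jl := double_le_even el (ltn_ord j).
  rewrite mulnBr -l2 /evn oddB// (negbTE el) oddM /= (FT_Seps _ k0 rZ hc) -/(S _).
  rewrite -(fact_div jl) !natrM; have := factC_neq0 R (l - 2 * j).
  move: ((l - 2 * j)`!%:R) ('C(_, _)%:R) ((2 * j)`!%:R) (mt _ _ _) ((2 * k%:R) ^+ _) (S _) => a b d e f s a0; by field.
rewrite vE -mulrBr -sumrB; have hK := K0_inv_le k0 hk hZ.
set I := mainJ k (neg_inv h k).
have hS : cabs (\sum_(j < l./2.+1) (('C(l, 2 * j) * (2 * j)`!)%:R * mt Z k (2 * j) * ((2 * k)%:R ^+ (l - 2 * j) * S (l - 2 * j)%N)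
   - ('C(l, 2 * j) * (2 * j)`!)%:R * mt Z k (2 * j) * ((2 * k)%:R ^+ (l - 2 * j) * (csq (k%:R * Z)^-1 * (iC / 4 * I (l - 2 * j)%N Z)))))
  <= (\sum_(j < l./2.+1) ('C(l, 2 * j) * (2 * j)`!)%:R * M (2 * j)%N * (2 ^+ (l - 2 * j) * F (l - 2 * j)%N)) *
     (X^-1 * X ^+ l * (Num.sqrt (X / k%:R) * k%:R * errlog k * expR (- (pi * Re (k%:R * Z)^-1 / 6)))).
  apply: le_trans (cabs_sum _ _ _) _; rewrite mulr_suml; apply: ler_sum => j _.
  have jl := double_le_even el (ltn_ord j).
  have ep : ~~ odd (l - 2 * j) by rewrite oddB// (negbTE el) oddM.
  have [_ Hp] := HF (l - 2 * j)%N; have := Hp ep _ _ _ k0 ga g1 hY; rewrite sY cabs_kinv -/X => hp.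
  have hm := HM k Z k0 hZ (2 * j)%N; rewrite -/X in hm.
  rewrite -mulrBr -mulrBr.
  have h1 : cabs (('C(l, 2 * j) * (2 * j)`!)%:R * mt Z k (2 * j)) <= ('C(l, 2 * j) * (2 * j)`!)%:R * (M (2 * j)%N * X^-1 * X ^+ (2 * j)).
    by apply: cabsM_le hm; rewrite cabs_nat.
  have h2 := @cabsM_le _ _ _ ((2 * k)%:R ^+ (l - 2 * j)) _ _ hp.
  have {}h2 := cabsM_le h1 (h2 ((2 * k)%:R ^+ (l - 2 * j)) _).
  apply: le_trans (h2 _) _; first by rewrite cabsX cabs_nat.
  have XE : X ^+ l = X ^+ (2 * j) * X ^+ (l - 2 * j) by rewrite -exprD subnKC.
  rewrite XE (natrM _ 2 k) (exprMn _ 2 k%:R) (exprMn _ X k%:R^-1) exprVn.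
  have := expf_neq0 (l - 2 * j)%N (lt0r_neq0 kR).
  move: (k%:R ^+ (l - 2 * j)) (X ^+ (l - 2 * j)) (X ^+ (2 * j)) (Num.sqrt _) (expR _) (2 ^+ _) (X^-1) => a b d e f u x a0.
  by apply: eq_ler; field.
apply: le_trans (cabsM_le hK hS) _.
set D := \sum_(j < _) _.
have rX : Num.sqrt (cabs Z) = (Num.sqrt k%:R)^-1 * (Num.sqrt (X / k%:R) * k%:R) * X^-1.
  by rewrite scale_identity// /X cabsV invrK.
have eE : expR (- (pi * Re (k%:R * Z)^-1 / 6)) = (expR (pi * Re (k%:R * Z)^-1 / 6))^-1 :> R by rewrite expRN.
rewrite rX eE; have := lt0r_neq0 (expR_gt0 (pi * Re (k%:R * Z)^-1 / 6)).
clearbody D.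
move: (expR (pi * Re (k%:R * Z)^-1 / 6)) ((Num.sqrt (k%:R : R))^-1) (Num.sqrt (X / k%:R)) (X^-1) (X ^+ l) (errlog k) D => E a b d e f D E0.
by apply: eq_ler; field.
Qed.

End Estimates.

Theorem theorem5p1 (R : realType) (l : nat) (l_even : ~~ odd l)
    (A : R) (A_gt0 : 0 < A) :
  exists K : R, forall (k h : nat) (Z : R[i]),
    (1 <= k)%N -> (h < k)%N -> coprime h k ->
    k%:R / 2%:R <= complex.Re (Z^-1) ->
    cabs Z <= A / k%:R ->
    cabs
      (cderiv l (fun z : R[i] => U1 z (h%:R / k%:R + iC * Z / k%:R)) 0
       - (2%:R * ipi) ^+ l * cpow iC (3%:R / 2%:R)
           / (4%:R * (Num.sqrt 6%:R)%:C * k%:R)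
         * (chi R (Mhk h k))^-1
         * \sum_(nu < 2 * k)
             (-1) ^+ nu
             * cexp (ipi * (neg_inv h k)%:R / (12%:R * k%:R)
                     * (12%:R * nu%:R * (nu%:R + 1) + 1))
             * \sum_(j < l./2.+1)
                 ('C(l, 2 * j))%:R
                 * (\sum_(a < j.+1) \sum_(b < j.+1)
                      \sum_(c < j.+1 | (a + b + c == j)%N)
                        k%:R ^+ a * (kappa R a b c)%:C
                        * cpow Z (2%:R^-1 - a%:R - 2%:R * c%:R))
                 * cint (-1) 1 (fun x : R =>
                     Ccot (l - 2 * j)
                       ((2%:R * k%:R)^-1
                        * ((x / Num.sqrt 6%:R)%:C - nu%:R - 2%:R^-1))
                     * cexp ((pi : R)%:C / (6%:R * k%:R * Z) * (1 - x ^+ 2)%:C)))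
      <= K * errlog R k * (cabs Z `^ (2%:R^-1 - l%:R)).
Proof.
have [B B0 HB] := bt_bound R; have [M M0 HM] := mt_bound R.
have [V V0 HV] := v_bound M0 HM; have [D D0 HD] := conv_perturb B0 V0 l.
have [G G0 HG] := main_error l_even M0 HM.
(* [D] accounts for the factors in [q'], [G] for the tails and the boundary terms of the
   integrals. *)
exists (l`!%:R * D + G) => k h Z k0 _ hk hZ _.
have kR := natR_gt0 R k0.
have rZ : 0 < Re Z.
  by rewrite -[Z]invrK; apply: Re_inv_gt0; apply: lt_le_trans hZ; rewrite divr_gt0.
have Z0 := Re_gt0_neq0 rZ.
have [g kg] := neg_inv_spec k0 hk; have [c c0 hc] := gauss_fourier R k0 kg.
have er := @eta_Mhk R _ _ k0 hk.
have w0 : chi R (Mhk h k) * cexp (ipi / 4) != 0 :> R[i] by rewrite mulf_neq0 ?cexp_neq0// chi_neq0.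
have := U1_jets k0 rZ kg er w0 c0 hc; rewrite /= -/(K0 k h (neg_inv h k) Z).
set u := fun n => cderiv n _ 0 / _ => Eu.
rewrite main_term//.
(* As [l] is even, passing to even parts keeps the coefficient in question. *)
have -> : cderiv l (fun z : R[i] => U1 z (h%:R / k%:R + iC * Z / k%:R)) 0 = l`!%:R * evn u l.
  by rewrite /evn (negbTE l_even) /u [RHS]mulrC divfK// factC_neq0.
have hv := HV k h Z c k0 hk hZ rZ hc; have {HB}[hb0 hb] := HB k (neg_inv h k) Z k0 hZ.
have [q1 q2] := @cabs_q' R k (neg_inv h k) Z k0 hZ.
set q := e2pi _ in hb q1 q2.
have el := errlog_ge0 R k0.
have ry : 0 <= Re (k%:R * Z)^-1.
  by rewrite Re_kinv// divr_ge0// ltW// Re_inv_gt0.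
pose v := vt k h Z c; set T := errlog R k * _ in hv.
have T0 : 0 <= T by rewrite mulr_ge0// mulr_ge0 ?expR_ge0.
have H1 : cabs (evn u l - v l) <= D * cabs q * T * cabs Z^-1 ^+ l.
  have q3 : 0 <= cabs q <= 1 by rewrite cabs_ge0 (le_trans q2)// invf_le1// ler1n.
  apply: (HD _ v (bt Z (neg_inv h k) k) (cabs q) T (cabs Z^-1)).
  by split; [split; [exact: Eu|exact: q3|exact: T0|exact: cabs_ge0]|exact: hb0|exact: hb|exact: hv].
(* [|q'| = exp (- 2 pi * Re Y)] outweighs the growth [exp (pi * Re Y / 6)] contained in [T]. *)
have qT : cabs q * T <= errlog R k * Num.sqrt (cabs Z).
  rewrite q1 /T mulrCA; apply: ler_wpM2l => //; rewrite mulrCA -[leRHS]mulr1; apply: ler_wpM2l => //.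
  rewrite -expRD expR_le1; have := mulr_ge0 (pi_ge0 R) ry; rewrite -mulrA.
  by move: (pi * _) => x; clear; lra.
have XE : cabs Z `^ (2^-1 - l%:R) = Num.sqrt (cabs Z) * cabs Z^-1 ^+ l.
  rewrite powRB; last by rewrite (lt0r_neq0 (_ : 0 < cabs Z)) ?cabs_gt0// implybT.
  by rewrite powR12_sqrt ?cabs_ge0// powR_mulrn ?cabs_ge0// cabsV exprVn.
have X0 : 0 <= cabs Z^-1 ^+ l by rewrite exprn_ge0 ?cabs_ge0.
have H2 := HG k h Z c k0 hk hZ rZ hc; rewrite -/(v l) in H2.
rewrite XE -(subrK (l`!%:R * v l) (l`!%:R * evn u l)) -addrA -mulrBr.
apply: le_trans (cabsD _ _) _.
rewrite -[leRHS]mulrA [errlog R k * _]mulrA mulrDl; apply: lerD H2.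
rewrite cabsM cabs_nat -[leRHS]mulrA; apply: ler_wpM2l => //; apply: le_trans H1 _.
rewrite -[D * _ * T]mulrA -[leLHS]mulrA; apply: ler_wpM2l => //; exact: ler_wpM2r.
Qed.
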